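(* Let $\alpha\in(1,2)$, $x_0\in\mathbb{R}$, and let $\mu\in K_\eta^f$ with $\eta\in(0,\alpha-1)$. Then there exists a unique strong solution to $$X_t=x_0+L_t+\int_0^t\mu(X_s)\,ds,\qquad t\ge0,$$ where $L$ is a one-dimensional symmetric $\alpha$-stable process.
   Context: Symmetric $\alpha$-stable process: a one-dimensional Lévy process $L$ with $L_0=0$ and $\mathbb{E}[e^{i\xi L_t}]=e^{-t|\xi|^\alpha}$. Kato class: for a signed measure $\nu$ on $\mathbb{R}$ with total variation measure $|\nu|$ and $\eta\in(0,1)$ put $M_\nu^\eta(r)=\sup_{x\in\mathbb{R}}\int_{B(x,r)}\frac{|\nu|(dy)}{|x-y|^{1-\eta}}$. $K_\eta$ is the set of signed measures $\nu$ with $\lim_{r\downarrow0}M_\nu^\eta(r)=0$, and $K_\eta^f$ is the set of finite measures in $K_\eta$. Mollification: fix a non-negative, radial (even) $\varphi\in\mathcal{C}^\infty(\mathbb{R})$ with $\mathrm{supp}(\varphi)=[-1,1]$, $\int\varphi=1$; put $\varphi_n(x)=2^n\varphi(2^nx)$ and $\mu_n(x)=\int_{\mathbb{R}}\varphi_n(x-y)\mu(dy)$. Solution (for a signed measure $\mu\in K_{\alpha-1}$): a càdlàg process $X$ is a solution with initial condition $x_0$ if there is a continuous process $(A_t)_{t\ge0}$ such that a.s. $X_t=x_0+L_t+A_t$ for all $t\ge0$, where (1) $\int_0^t\mu_n(X_s)ds$ converges to $A_t$ in probability, uniformly in $t$ over finite intervals; (2) there is a subsequence $\{n_k\}$ such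 that $\sup_k\int_0^t|\mu_{n_k}(X_s)|ds<\infty$ a.s. for each $t>0$; (3) under $\mathbb{P}$, $L_0=0$ and $L$ is a symmetric $\alpha$-stable process on $(\Omega,(\mathcal{F}_t)_{t\ge0})$. A strong solution with respect to a given symmetric $\alpha$-stable process $L$ is a solution adapted to the filtration generated by $L$. Strong uniqueness: any two strong solutions $X,\tilde X$ relative to a common $L$ and initial condition are indistinguishable. *)

(* Defs.v *)
From HB Require Import structures.
From mathcomp Require Import all_boot all_order all_algebra.
From mathcomp Require Import complex.
From mathcomp Require Import all_classical all_reals all_analysis.

Set Implicit Arguments.
Unset Strict Implicit.
Unset Printing Implicit Defensive.

Import Order.TTheory GRing.Theory Num.Theory.
Import numFieldNormedType.Exports.

Local Open Scope classical_set_scope.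
Local Open Scope ring_scope.

(* A charge is finite-valued, so [charge R] is the type of finite signed Borel
   measures on the real line. *)
Notation finite_signed_measure R := (charge (measurableTypeR R) R).

Section signed_measures.
Context {R : realType}.
Implicit Types (nu : finite_signed_measure R) (eta : R).

(* The choice of the Hahn decomposition is immaterial, see
   [Hahn_decomposition_uniq]. *)
Definition hahn_pos nu : set (measurableTypeR R) :=
  sval (cid (Hahn_decomposition nu)).

Definition hahn_neg nu : set (measurableTypeR R) :=
  sval (cid (svalP (cid (Hahn_decomposition nu)))).

Lemma hahn_posnegP nu : hahn_decomposition nu (hahn_pos nu) (hahn_neg nu).
Proof. exact: (svalP (cid (svalP (cid (Hahn_decomposition nu))))). Qed.

Definition total_variation nu := charge_variation (hahn_posnegP nu).

HB.instance Definition _ nu := Measure.on (total_variation nu).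

Definition signed_integral nu (f : R -> R) : R :=
  \int[jordan_pos (hahn_posnegP nu)]_y f y
  - \int[jordan_neg (hahn_posnegP nu)]_y f y.

(* The inverse is that of the extended reals, so that the kernel is +oo on the
   diagonal (whereas [0 `^ (eta - 1)] would be 0). *)
Definition kato_modulus eta nu (r : R) : \bar R :=
  ereal_sup [set (\int[total_variation nu]_(y in (ball x r : set R))
                    (((`|x - y| `^ (1 - eta))%:E)^-1))%E | x in [set: R]].

Definition kato_class_finite eta : set (finite_signed_measure R) :=
  [set nu | kato_modulus eta nu r @[r --> 0^'+] --> 0%E].

End signed_measures.

Section mollification.
Context {R : realType}.
Implicit Types phi : R -> R.

Definition smooth phi : Prop :=
  forall (n : nat) (x : R), derivable (derive1n n phi) x 1.

Definition mollifier phi : Prop :=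
  [/\ forall x, 0 <= phi x,
      forall x, phi (- x) = phi x,
      smooth phi,
      closure [set x | phi x != 0] = `[-1, 1]%classic &
      (\int[@lebesgue_measure R]_x (phi x)%:E = 1)%E].

Definition mollifier_seq phi (n : nat) (x : R) : R :=
  2 ^+ n * phi (2 ^+ n * x).

Definition mollify phi (mu : finite_signed_measure R) (n : nat) (x : R) : R :=
  signed_integral mu (fun y => mollifier_seq phi n (x - y)).

End mollification.

(* Processes are indexed by all of R; only their restriction to times [0 <= t]
   is ever used. *)
Section processes.
Context {R : realType} d (T : measurableType d) (P : probability T R).
Implicit Types (X L A : R -> T -> R) (F : R -> set (set T)).

Definition process X : Prop :=
  forall t, 0 <= t -> measurable_fun [set: T] (X t).

Definition cadlag (x : R -> R) : Prop :=
  (forall t, 0 <= t -> x s @[s --> t^'+] --> x t) /\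
  (forall t, 0 < t -> cvg (x s @[s --> t^'-])).

Definition cadlag_process X : Prop := process X /\ forall w, cadlag (X ^~ w).

Definition continuous_process A : Prop :=
  process A /\ forall w, {within `[0, +oo[, continuous (A ^~ w)}.

Definition filtration F : Prop :=
  [/\ forall t, 0 <= t -> sigma_algebra [set: T] (F t),
      forall t, 0 <= t -> F t `<=` measurable &
      forall s t, 0 <= s -> s <= t -> F s `<=` F t].

Definition adapted F X : Prop :=
  forall t, 0 <= t -> forall B : set R, measurable B -> F t (X t @^-1` B).

(* The filtration generated by L, completed by the P-null events. *)
Definition generated_filtration L (t : R) : set (set T) :=
  <<s [set B | exists2 s, 0 <= s <= t &
         exists2 C : set R, measurable C & B = L s @^-1` C]
      `|` [set N | measurable N /\ P N = 0%E] >>.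

(* E[exp(i xi Y)], taken componentwise: the library integrates real functions
   only. *)
Definition char_fun (Y : T -> R) (xi : R) : R[i] :=
  ((\int[P]_w cos (xi * Y w)) +i* (\int[P]_w sin (xi * Y w)))%C.

Definition increment L (s t : R) (w : T) : R := L t w - L s w.

(* Stochastic continuity follows from the regularity of the paths. *)
Definition levy_process F L : Prop :=
  [/\ filtration F /\ adapted F L,
      {ae P, forall w, L 0 w = 0},
      {ae P, forall w, cadlag (L ^~ w)},
      forall s t, 0 <= s -> s <= t ->
        forall (B : set T) (C : set R), F s B -> measurable C ->
          P (B `&` increment L s t @^-1` C) =
            (P B * P (increment L s t @^-1` C))%E &
      forall s t, 0 <= s -> s <= t -> forall C : set R, measurable C ->
        P (increment L s t @^-1` C) = P (L (t - s) @^-1` C)].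

Definition symmetric_stable_process alpha F L : Prop :=
  levy_process F L /\
  forall t xi, 0 <= t ->
    char_fun (L t) xi = (expR (- (t * `|xi| `^ alpha)))%:C%C.

Definition time_integral (f : R -> R) X (t : R) (w : T) : R :=
  \int[@lebesgue_measure R]_(s in `[0, t]) f (X s w).

Definition running_sup X (t : R) (w : T) : \bar R :=
  ereal_sup [set `|X s w|%:E | s in `[0, t]%classic].

(* Convergence in probability, uniformly over bounded time intervals. *)
Definition ucp_cvg (Y : nat -> R -> T -> R) A : Prop :=
  forall t eps : R, 0 <= t -> 0 < eps ->
    P [set w | (eps%:E < running_sup (fun s w => (Y n s w - A s w)%R) t w)%E]
      @[n --> \oo] --> 0%E.

Definition solution alpha phi (mu : finite_signed_measure R) (x0 : R) F L X :
    Prop :=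
  cadlag_process X /\
  exists A, [/\ continuous_process A,
    {ae P, forall w, forall t, 0 <= t -> X t w = x0 + L t w + A t w},
    ucp_cvg (fun n => time_integral (mollify phi mu n) X) A,
    exists2 nk : nat -> nat, {homo nk : i j / (i < j)%N} &
      forall t, 0 < t -> {ae P, forall w,
        (ereal_sup (range (fun k => \int[@lebesgue_measure R]_(s in `[0%R, t])
           `|mollify phi mu (nk k) (X s w)|%:E)) < +oo)%E} &
    symmetric_stable_process alpha F L].

(* For a strong solution the driving filtration is the one generated by L. *)
Definition strong_solution alpha phi (mu : finite_signed_measure R) (x0 : R)
    L X : Prop :=
  solution alpha phi mu x0 (generated_filtration L) L X /\
  adapted (generated_filtration L) X.

Definition indistinguishable X X' : Prop :=
  {ae P, forall w, forall t, 0 <= t -> X t w = X' t w}.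

End processes.

(* Main.v *)
(* Write [mu = h kap] with [kap] the total variation and [|h| = 1], and let [r]
   be the resolvent kernel of [lam + (-Delta)^(alpha/2)].  Since
   [|r'(z)| <= q |z|^(eta-1)] with [q] small for large [lam], and the Kato
   condition bounds the potentials of [|z|^(eta-1)], the equation
   [v = r' * ((1 + v) mu)] is a contraction in the sup norm.  With
   [u = r * ((1 + v) mu)] one has [u' = v], and Ito's formula for [u] turns the
   singular drift [(1 + v(X)) mu(X) dt] into the Lipschitz term [u(X)].
   Everything is done for mollified kernels, with bounds uniform in the
   mollification.

   Ito's formula is only needed in expectation, against adapted absolutely
   continuous weights.  For [u x = cos (xi x)] it is the independence of the
   increments together with the characteristic function; the general case is a
   superposition of cosines.

   For two approximate solutions driven by the same noise, the difference [D] of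
   the two drift parts is tested against the weight [chi(D)], where [chi] is a
   ramp on a logarithmic scale, for which [x chi'(x)] is uniformly small, and
   the weight is killed at a high rate once [D >= eta]; the outcome bounds
   [P (sup D >= 2 eta)].  Applied to the solutions for the mollified drifts, it
   shows that these are Cauchy uniformly in probability; applied to two
   solutions, with weights killed in addition by the accumulated
   [|mu_n(X)|], it gives uniqueness. *)
Require Import Defs.
From HB Require Import structures.
From mathcomp Require Import all_boot all_order all_algebra.
From mathcomp Require Import complex.
From mathcomp Require Import all_classical all_reals all_analysis.
From mathcomp Require Import measurable_realfun ring lra.

Set Implicit Arguments.
Unset Strict Implicit.
Unset Printing Implicit Defensive.

Import Order.TTheory GRing.Theory Num.Theory.
Import numFieldNormedType.Exports.

Local Open Scope classical_set_scope.
Local Open Scope ring_scope.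

(** The drift [mu_n(X)] is controlled in time integral only, never pointwise, which rules out a
    Gronwall argument for the difference [D] of two drift parts. In the product rule for
    [chi(D) (D + u(X) - u(X'))] the drifts cancel, but the term [chi'(D) D' (D + u(X) - u(X'))]
    remains. Since [u] is Lipschitz with constant 1/2, the last factor is at most [3/2 |D|] up to a
    small error, so that smallness of [x chi'(x)] together with an integral bound on [|D'|]
    suffices. For approximate solutions this bound holds in expectation: Ito's formula for the
    potential of the total variation returns one quarter of the drift, which is absorbed. An
    arbitrary solution offers no moment bound, only the almost sure bound along a subsequence that
    belongs to the notion of solution; this is the reason for killing the weights in the uniqueness
    proof. Approximation takes place on the given noise and in its filtration, so that the limit is
    adapted by construction and existence of a strong solution does not pass through weak
    solutions. *)

Notation itg mu D f := (integrable mu D (EFin \o f)).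

(** * Integrals of real functions under a dominating function *)

Section integral_toolkit.
Context d (T : measurableType d) (R : realType) (mu : {measure set T -> \bar R}).
Context (D : set T) (mD : measurable D).
Implicit Types f g : T -> R.

Lemma itg_meas f : itg mu D f -> measurable_fun D f.
Proof. by move=> /measurable_int /measurable_EFinP. Qed.

Lemma itg_dom f g : measurable_fun D f -> itg mu D g ->
  (forall x, D x -> `|f x| <= g x) -> itg mu D f.
Proof.
move=> mf ig fg; apply: (le_integrable mD _ _ ig); first exact/measurable_EFinP.
by move=> x Dx; rewrite /= lee_fin (le_trans (fg _ Dx))// ler_norm.
Qed.

Lemma itg_cst (c : R) : (mu D < +oo)%E -> itg mu D (fun=> c).
Proof.
move=> fD; apply: measurable_bounded_integrable => //.
exact: bounded_cst.
Qed.

Lemma itg_bnd f (M : R) : (mu D < +oo)%E -> measurable_fun D f ->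
  (forall x, D x -> `|f x| <= M) -> itg mu D f.
Proof. by move=> fD mf fM; apply: (itg_dom mf (itg_cst M fD)). Qed.

Lemma itgD f g : itg mu D f -> itg mu D g -> itg mu D (fun x => f x + g x).
Proof.
move=> hf hg; have := integrableD mD hf hg.
by apply: eq_integrable => // x _; rewrite /= EFinD.
Qed.

Lemma itgB f g : itg mu D f -> itg mu D g -> itg mu D (fun x => f x - g x).
Proof.
move=> hf hg; have := integrableB mD hf hg.
by apply: eq_integrable => // x _; rewrite /= EFinB.
Qed.

Lemma itgZ c f : itg mu D f -> itg mu D (fun x => c * f x).
Proof.
move=> hf; have := integrableZl mD c hf.
by apply: eq_integrable => // x _; rewrite /= EFinM.
Qed.

Lemma itgZr c f : itg mu D f -> itg mu D (fun x => f x * c).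
Proof. by move=> hf; under eq_fun do rewrite mulrC; exact: itgZ. Qed.

Lemma itg_norm f : itg mu D f -> itg mu D (fun x => `|f x|).
Proof. by move=> hf; exact: integrable_norm hf. Qed.

Lemma itg_M f g (M : R) : itg mu D f -> measurable_fun D g ->
  (forall x, D x -> `|g x| <= M) -> itg mu D (fun x => g x * f x).
Proof.
move=> hf mg gM; apply: (@itg_dom _ (fun x => M * `|f x|)).
- by apply: measurable_funM => //; exact: itg_meas.
- exact/itgZ/itg_norm.
- by move=> x Dx; rewrite normrM ler_wpM2r// gM.
Qed.

Lemma int_eq f g : (forall x, D x -> f x = g x) ->
  \int[mu]_(x in D) f x = \int[mu]_(x in D) g x.
Proof. by move=> fg; apply: eq_Rintegral => x /set_mem /fg. Qed.

Lemma int_dom f g : measurable_fun D f -> itg mu D g ->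
  (forall x, D x -> `|f x| <= g x) ->
  `|\int[mu]_(x in D) f x| <= \int[mu]_(x in D) g x.
Proof.
move=> mf ig fg; have hf := itg_dom mf ig fg.
apply: le_trans (le_normr_Rintegral mD hf) _.
by apply: le_Rintegral => //; exact: itg_norm.
Qed.

Lemma int_bnd f (M : R) : (mu D < +oo)%E -> measurable_fun D f ->
  (forall x, D x -> `|f x| <= M) ->
  `|\int[mu]_(x in D) f x| <= M * fine (mu D).
Proof.
by move=> fD mf fM; rewrite -Rintegral_cst//; apply: int_dom => //; exact: itg_cst.
Qed.

Lemma int_cvg (f_ : nat -> T -> R) f g :
  (forall n, measurable_fun D (f_ n)) -> itg mu D g ->
  (forall n x, D x -> `|f_ n x| <= g x) ->
  (forall x, D x -> f_ n x @[n --> \oo] --> f x) ->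
  \int[mu]_(x in D) f_ n x @[n --> \oo] --> \int[mu]_(x in D) f x.
Proof.
move=> mf ig fg cf.
have mlim : measurable_fun D f by apply: (measurable_fun_cvg mf).
have hf : itg mu D f.
  apply: (itg_dom mlim ig) => x Dx.
  have cn : `|f_ n x| @[n --> \oo] --> `|f x| by apply: cvg_norm; exact: cf.
  rewrite -(cvg_lim _ cn)//; apply: limr_le; first by apply/cvg_ex; eexists; exact: cn.
  by apply: nearW => n; exact: fg.
have /fineK h : (\int[mu]_(x in D) (f x)%:E)%E \is a fin_num by exact: integrable_fin_num.
rewrite /Rintegral; apply: fine_cvg; rewrite h.
apply: (@dominated_cvg _ _ _ mu D mD (fun n x => (f_ n x)%:E) (fun x => (f x)%:E)
  (fun x => (g x)%:E)) => //.
- by move=> n; exact/measurable_EFinP.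
- by move=> x Dx; apply: cvg_EFin; [exact: nearW|exact: cf].
Qed.

End integral_toolkit.

Section fubini_toolkit.
Context d1 d2 (T1 : measurableType d1) (T2 : measurableType d2) (R : realType).
Context (m1 : {sigma_finite_measure set T1 -> \bar R}).
Context (m2 : {sigma_finite_measure set T2 -> \bar R}).
Context (D1 : set T1) (D2 : set T2) (mD1 : measurable D1) (mD2 : measurable D2).
Context (f : T1 -> T2 -> R) (B1 : T1 -> R) (B2 : T2 -> R).
Hypothesis mf : measurable_fun setT (fun p : T1 * T2 => f p.1 p.2).
Hypothesis iB1 : itg m1 D1 B1.
Hypothesis iB2 : itg m2 D2 B2.
Hypothesis fB : forall x y, D1 x -> D2 y -> `|f x y| <= B1 x * B2 y.

Lemma itg_sec x : D1 x -> itg m2 D2 (f x).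
Proof.
move=> Dx; apply: (@itg_dom _ _ _ _ _ _ _ (fun y => B1 x * B2 y)) => //.
- apply: measurable_funTS.
  exact: (measurableT_comp mf (pair1_measurable x)).
- exact: itgZ.
- by move=> y Dy; exact: fB.
Qed.

Lemma itg_sec2 y : D2 y -> itg m1 D1 (fun x => f x y).
Proof.
move=> Dy; apply: (@itg_dom _ _ _ _ _ _ _ (fun x => B2 y * B1 x)) => //.
- apply: measurable_funTS.
  exact: (measurableT_comp mf (pair2_measurable y)).
- exact: itgZ.
- by move=> x Dx; rewrite mulrC; exact: fB.
Qed.

Let F (p : T1 * T2) : R := ((fun p : T1 * T2 => f p.1 p.2) \_ (D1 `*` D2)) p.

Let mFr : measurable_fun setT F.
Proof.
apply/(measurable_restrictT _ _).1 => //.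
- exact: measurableX.
- exact: measurable_funTS.
Qed.

Let mF : measurable_fun setT (fun p => (F p)%:E).
Proof. exact/measurable_EFinP. Qed.

Let FE x y : F (x, y) = ((fun x => (f x \_ D2) y) \_ D1) x.
Proof. by rewrite /F !patchE in_setX /=; case: (x \in D1); case: (y \in D2). Qed.

Let FE2 x y : F (x, y) = ((fun y => ((fun x => f x y) \_ D1) x) \_ D2) y.
Proof. by rewrite /F !patchE in_setX /=; case: (x \in D1); case: (y \in D2). Qed.

Let iF : (m1 \x m2)%E.-integrable setT (fun p => (F p)%:E).
Proof.
apply/integrable12ltyP => //=.
apply: (@le_lt_trans _ _ (\int[m1]_x (((fun x => (\int[m2]_(y in D2) `|B2 y|%:E) * `|B1 x|%:E)
     \_ D1) x))%E).
  apply: ge0_le_integral => //.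
  - by move=> x _; exact: integral_ge0.
  - apply: (measurable_fun_fubini_tonelli_F (fun p => `|(F p)%:E|%E)) => //.
    exact: measurableT_comp.
  - apply/(measurable_restrictT _ _).1 => //; apply: emeasurable_funM => //.
    apply/measurable_EFinP/measurableT_comp => //; exact: itg_meas iB1.
  move=> x _; rewrite patchE; case: ifPn => xD.
    rewrite -ge0_integralZr//; last first.
      apply/measurable_EFinP/measurableT_comp => //; exact: itg_meas iB2.
    rewrite [leRHS]integral_mkcond; apply: ge0_le_integral => //.
    - apply/measurable_EFinP/measurableT_comp => //.
      exact: (measurableT_comp mFr (pair1_measurable x)).
    - apply/(measurable_restrictT _ _).1 => //; apply: emeasurable_funM => //.
      apply/measurable_EFinP/measurableT_comp => //; exact: itg_meas iB2.
    - move=> y _; rewrite FE !patchE xD; case: ifPn => yD.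
        rewrite -EFinM lee_fin (le_trans (fB _ _))//; try exact: set_mem.
        by rewrite mulrC (le_trans (ler_norm _))// normrM.
      by rewrite normr0.
  rewrite integral0_eq// => y _; by rewrite FE patchE (negbTE xD) normr0.
rewrite -integral_mkcond.
rewrite ge0_integralZl//.
- have /integrableP[_ h1] := iB1; have /integrableP[_ h2] := iB2.
  by rewrite lte_mul_pinfty// ?ge0_fin_numE// ?integral_ge0.
- apply/measurable_EFinP/measurableT_comp => //; exact: itg_meas iB1.
- by apply: integral_ge0 => y _; rewrite lee_fin.
Qed.

Let EF x : D1 x -> (\int[m2]_y (F (x, y))%:E)%E = (\int[m2]_(y in D2) f x y)%:E.
Proof.
move=> D1x; rewrite /Rintegral fineK; last first.
  by apply: integrable_fin_num => //; exact: itg_sec.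
rewrite [RHS]integral_mkcond; apply: eq_integral => y _.
by rewrite FE patchE mem_set// !patchE; case: ifP.
Qed.

Let EF2 y : D2 y -> (\int[m1]_x (F (x, y))%:E)%E = (\int[m1]_(x in D1) f x y)%:E.
Proof.
move=> D2y; rewrite /Rintegral fineK; last first.
  by apply: integrable_fin_num => //; exact: itg_sec2.
rewrite [RHS]integral_mkcond; apply: eq_integral => x _.
by rewrite FE2 patchE mem_set// !patchE; case: ifP.
Qed.

Lemma itg_fub2 : itg m2 D2 (fun y => \int[m1]_(x in D1) f x y).
Proof.
have h : m2.-integrable setT (fubini_G m1 (fun p => (F p)%:E)).
  apply/integrableP; split; first exact: (measurable_fubini_G iF).
  apply: (@le_lt_trans _ _ (\int[m2]_y \int[m1]_x `|(F (x, y))%:E|)%E); last first.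
    exact: (iffLR (integrable21ltyP m1 m2 mF) iF).
  apply: ge0_le_integral => //.
  - by apply: measurableT_comp => //; exact: (measurable_fubini_G iF).
  - apply: (measurable_fun_fubini_tonelli_G (fun p => `|(F p)%:E|%E)) => //.
    exact: measurableT_comp.
  - move=> y _; apply: le_abse_integral => //.
    exact: (measurableT_comp mF (pair2_measurable y)).
have {}h : m2.-integrable D2 (fubini_G m1 (fun p => (F p)%:E)).
  by apply: integrableS h.
by apply: eq_integrable h => // x /set_mem xD; rewrite /= -EF2.
Qed.

Let Rint_F : (\int[m1]_(x in D1) (\int[m2]_(y in D2) f x y)%:E)%E =
  (\int[m1]_x \int[m2]_y (F (x, y))%:E)%E.
Proof.
rewrite integral_mkcond; apply: eq_integral => x _; rewrite patchE.
case: ifPn => xD; first by rewrite EF//; exact: set_mem.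
by rewrite integral0_eq// => y _; rewrite FE patchE (negbTE xD).
Qed.

Lemma Rfubini : \int[m1]_(x in D1) \int[m2]_(y in D2) f x y =
  \int[m2]_(y in D2) \int[m1]_(x in D1) f x y.
Proof.
rewrite /Rintegral; congr fine.
rewrite Rint_F (Fubini iF).
rewrite [RHS]integral_mkcond; apply: eq_integral => y _; rewrite patchE.
case: ifPn => yD; first by rewrite EF2//; exact: set_mem.
by rewrite integral0_eq// => x _; rewrite FE2 patchE (negbTE yD).
Qed.

Lemma Rint_prod : \int[(m1 \x m2)%E]_(p in D1 `*` D2) f p.1 p.2 =
  \int[m1]_(x in D1) \int[m2]_(y in D2) f x y.
Proof.
rewrite /Rintegral; congr fine.
rewrite [RHS](_ : _ = (\int[m1]_x \int[m2]_y (F (x, y))%:E)%E); last exact: Rint_F.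
by rewrite (integral12_prod_meas1 iF) [LHS]integral_mkcond restrict_EFin.
Qed.

End fubini_toolkit.

(** * Calculus of absolutely continuous paths *)

Section primitives.
Context {R : realType}.
Notation leb := (@lebesgue_measure R).
Implicit Types (y dy z dz f : R -> R) (s t T : R).

Lemma leb_cc_fin s t : (leb `[s, t]%classic < +oo)%E.
Proof. by rewrite lebesgue_measure_itv/=; case: ifP => _; rewrite ?ltry// -EFinB ltry. Qed.

Lemma leb_oc_fin s t : (leb `]s, t]%classic < +oo)%E.
Proof. by rewrite lebesgue_measure_itv/=; case: ifP => _; rewrite ?ltry// -EFinB ltry. Qed.

Lemma leb_ccE s t : s <= t -> fine (leb `[s, t]%classic) = t - s.
Proof.
rewrite lebesgue_measure_itv/= lte_fin le_eqVlt => /predU1P[->|->//].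
by rewrite ltxx/= subrr.
Qed.

Lemma leb_ocE s t : s <= t -> fine (leb `]s, t]%classic) = t - s.
Proof.
rewrite lebesgue_measure_itv/= lte_fin le_eqVlt => /predU1P[->|->//].
by rewrite ltxx/= subrr.
Qed.

Lemma int_ccB f s t T : itg leb `[0, T]%classic f -> 0 <= s -> s <= t -> t <= T ->
  \int[leb]_(r in `[0, t]) f r - \int[leb]_(r in `[0, s]) f r =
  \int[leb]_(r in `]s, t]) f r.
Proof.
move=> hf s0 st tT; apply: Rintegral_itvB; rewrite ?bnd_simp//.
apply: integrableS hf => //; apply: subset_itvl; by rewrite bnd_simp.
Qed.

(** Telescoping over [n] equal steps leaves a bound of order [1 / n]. This replaces the
    differentiation of integrals in the chain rule below. *)
Lemma quadratic_const (zeta : R -> R) (C T : R) :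
  (forall s t, 0 <= s -> s <= t -> t <= T -> `|zeta t - zeta s| <= C * (t - s) ^+ 2) ->
  forall t, 0 <= t <= T -> zeta t = zeta 0.
Proof.
move=> H t /andP[t0 tT]; apply/eqP; rewrite -subr_eq0 -normr_le0.
have C0 : 0 <= C * t ^+ 2.
  by have := H 0 t (lexx 0) t0 tT; rewrite subr0; apply: le_trans.
apply/ler_addgt0Pr => e e0; rewrite add0r.
pose n := (Num.truncn (C * t ^+ 2 / e)).+1.
have n0 : 0 < n%:R :> R by rewrite ltr0n.
have hn : C * t ^+ 2 / e < n%:R by rewrite truncnS_gt.
pose p i := t * (i%:R / n%:R).
have key i : (i <= n)%N -> `|zeta (p i) - zeta 0| <= i%:R * (C * (t / n%:R) ^+ 2).
  elim: i => [|i IH] ilt; first by rewrite /p mul0r mulr0 subrr normr0 mul0r.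
  rewrite -(subrK (zeta (p i)) (zeta (p i.+1))) -addrA (le_trans (ler_normD _ _))//.
  rewrite [leRHS](_ : _ = C * (t / n%:R) ^+ 2 + i%:R * (C * (t / n%:R) ^+ 2)); last first.
    by rewrite -[i.+1]addn1 natrD; ring.
  rewrite lerD//; last exact/IH/ltnW.
  have pE : p i.+1 - p i = t / n%:R.
    by rewrite /p -mulrBr -mulrBl -natr1 addrAC subrr add0r mul1r.
  rewrite -pE H//.
  - by rewrite /p !mulr_ge0// invr_ge0 ltW.
  - by rewrite -subr_ge0 pE divr_ge0// ltW.
  - rewrite /p (le_trans _ tT)// ler_piMr// ler_pdivrMr// mul1r ler_nat//.
have := key n (leqnn _); rewrite /p divff ?mulr1 ?gt_eqF// => /le_trans; apply.
rewrite (_ : n%:R * _ = C * t ^+ 2 / n%:R); last by field; rewrite gt_eqF.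
by rewrite ler_pdivrMr// [e * _]mulrC -ler_pdivrMr// ltW.
Qed.

(** A Lipschitz path with its density kept as data, so that the calculus rules never mention almost
    everywhere derivatives. *)
Definition prim T y dy := [/\ measurable_fun setT y, measurable_fun setT dy,
  (exists M, forall r, 0 <= r <= T -> `|dy r| <= M) &
  forall t, 0 <= t <= T -> y t = y 0 + \int[leb]_(r in `[0, t]) dy r].

Lemma prim_itg T y dy t : prim T y dy -> t <= T -> itg leb `[0, t]%classic dy.
Proof.
move=> [_ mdy [M hM] _] tT; apply: (@itg_bnd _ _ _ _ _ _ _ M) => //.
- exact: leb_cc_fin.
- exact: measurable_funTS.
- by move=> x /=; rewrite in_itv/= => /andP[x0 xt]; rewrite hM// x0 (le_trans xt).
Qed.

Lemma prim_incr T y dy s t : prim T y dy -> 0 <= s -> s <= t -> t <= T ->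
  y t - y s = \int[leb]_(r in `]s, t]) dy r.
Proof.
move=> py s0 st tT; have [_ _ _ e] := py.
rewrite e ?tT ?(le_trans s0)// (e s) ?s0 ?(le_trans st)//.
by rewrite opprD addrACA subrr add0r (@int_ccB _ _ _ T)//; exact: prim_itg py _.
Qed.

Lemma prim_ext T y dy dy' : prim T y dy -> (forall r, dy r = dy' r) -> prim T y dy'.
Proof. by move=> h /funext <-. Qed.

Lemma prim_cst T (c : R) : prim T (fun=> c) (fun=> 0).
Proof.
split => //; first by exists 0 => r _; rewrite normr0.
by move=> t _; rewrite Rintegral_cst// mul0r addr0.
Qed.

Lemma prim_id T : prim T id (fun=> 1).
Proof.
split => //; first by exists 1 => r _; rewrite normr1.
by move=> t /andP[t0 _]; rewrite Rintegral_cst// mul1r leb_ccE// subr0 add0r.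
Qed.

Lemma primD T y dy z dz : prim T y dy -> prim T z dz ->
  prim T (fun r => y r + z r) (fun r => dy r + dz r).
Proof.
move=> py pz; have [my mdy [M hM] ey] := py; have [mz mdz [N hN] ez] := pz.
split; try exact: measurable_funD.
  by exists (M + N) => r hr; rewrite (le_trans (ler_normD _ _))// lerD ?hM ?hN.
move=> t /[dup] ht /andP[t0 tT].
rewrite ey// ez// RintegralD//; first by rewrite addrACA.
- exact: prim_itg py _.
- exact: prim_itg pz _.
Qed.

Lemma primZ T y dy (c : R) : prim T y dy -> prim T (fun r => c * y r) (fun r => c * dy r).
Proof.
move=> py; have [my mdy [M hM] ey] := py.
split; try exact: measurable_funM.
  by exists (`|c| * M) => r hr; rewrite normrM ler_wpM2l// hM.
move=> t /[dup] ht /andP[t0 tT].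
by rewrite ey// RintegralZl// ?mulrDr//; exact: prim_itg py _.
Qed.

(** The order-convex set [S] allows half-lines, on which exponentials have a Lipschitz
    derivative. *)
Lemma taylor1 (f f' : R -> R) (S : set R) (K : R) :
  (forall u v w, S u -> S v -> u <= w <= v -> S w) ->
  (forall x, S x -> is_derive x 1 f (f' x)) ->
  (forall u v, S u -> S v -> `|f' u - f' v| <= K * `|u - v|) ->
  forall u v, S u -> S v -> `|f v - f u - f' u * (v - u)| <= K * (v - u) ^+ 2.
Proof.
move=> Scvx df lipf u v Su Sv.
have [c [Sc ec hc]] : exists c, [/\ S c, f v - f u = f' c * (v - u) & `|c - u| <= `|v - u|].
  have [uv|vu|->] := ltgtP u v; last by exists v; rewrite !subrr mulr0.
  - have [||c cin ->] := @MVT _ f f' u v uv.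
      move=> x; rewrite in_itv/= => /andP[/ltW ux /ltW xv]; apply: df.
      by apply: (Scvx u v) => //; rewrite ux.
      apply: derivable_within_continuous => x; rewrite in_itv/= => /andP[ux xv].
      by have -[] := df x (Scvx u v x Su Sv _) => //; rewrite ux.
    move: cin; rewrite in_itv/= => /andP[uc cv]; exists c; split => //.
      by apply: (Scvx u v) => //; rewrite !ltW.
    by rewrite !ger0_norm ?subr_ge0 ?lerD2r ltW.
  - have [||c cin e] := @MVT _ f f' v u vu.
      move=> x; rewrite in_itv/= => /andP[/ltW ux /ltW xv]; apply: df.
      by apply: (Scvx v u) => //; rewrite ux.
      apply: derivable_within_continuous => x; rewrite in_itv/= => /andP[ux xv].
      by have -[] := df x (Scvx v u x Sv Su _) => //; rewrite ux.
    move: cin; rewrite in_itv/= => /andP[vc cu]; exists c; split => //.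
    + by apply: (Scvx v u) => //; rewrite !ltW.
    + by rewrite -opprB e -mulrN opprB.
    + by rewrite !(distrC _ u) !ger0_norm ?subr_ge0 ?lerD2l ?lerN2 ltW.
rewrite ec -mulrBl normrM.
have K0 : 0 <= K * `|c - u| by rewrite (le_trans _ (lipf _ _ Sc Su)).
rewrite (le_trans (ler_wpM2r _ (lipf _ _ Sc Su)))//.
rewrite -(real_normK (num_real (v - u))) expr2 mulrA ler_wpM2r//.
have [->|cu] := eqVneq c u; first by move: K0; rewrite subrr normr0 mulr0 => _;
  have [->|uv] := eqVneq v u; rewrite ?subrr ?normr0 ?mulr0//;
  rewrite mulr_ge0//; have := lipf _ _ Sv Su; rewrite -(pmulr_lge0 K (x := `|v - u|))
   ?normr_gt0 ?subr_eq0//; apply: le_trans.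
by rewrite ler_wpM2l//; move: K0; rewrite pmulr_lge0// normr_gt0 subr_eq0.
Qed.

(** Over a short interval the two sides change by the same amount up to a multiple of
    [(t - s) ^+ 2]: once from the Taylor expansion of [f], once from freezing [f' (y r)] at the left
    endpoint. Their difference is then constant by [quadratic_const]. *)
Lemma prim_comp T y dy (f f' : R -> R) (S : set R) (K : R) :
  prim T y dy -> measurable_fun setT f -> measurable_fun setT f' ->
  (forall u v w, S u -> S v -> u <= w <= v -> S w) ->
  (forall t, 0 <= t <= T -> S (y t)) ->
  (forall x, S x -> is_derive x 1 f (f' x)) ->
  (forall u v, S u -> S v -> `|f' u - f' v| <= K * `|u - v|) ->
  prim T (fun r => f (y r)) (fun r => f' (y r) * dy r).
Proof.
move=> py mf mf' Scvx Sy df lipf; have [my mdy [M0 hM0] ey] := py.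
have mfy : measurable_fun setT (fun r => f' (y r) * dy r).
  by apply: measurable_funM => //; exact: measurableT_comp.
pose M := Num.max M0 0; have M_ge0 : 0 <= M by rewrite le_max lexx orbT.
have hM r : 0 <= r <= T -> `|dy r| <= M.
  by move=> hr; rewrite (le_trans (hM0 _ hr))// le_max lexx.
pose K1 := Num.max K 0; have K1_ge0 : 0 <= K1 by rewrite le_max lexx orbT.
have lipf1 u v : S u -> S v -> `|f' u - f' v| <= K1 * `|u - v|.
  by move=> Su Sv; rewrite (le_trans (lipf _ _ Su Sv))// ler_wpM2r// le_max lexx.
have lipy s t : 0 <= s -> s <= t -> t <= T -> `|y t - y s| <= M * (t - s).
  move=> s0 st tT; rewrite (prim_incr py)// -leb_ocE//.
  apply: int_bnd => //; [exact: leb_oc_fin|exact: measurable_funTS|].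
  move=> r /=; rewrite in_itv/= => /andP[sr rt].
  by rewrite hM// (le_trans rt)// andbT ltW// (le_lt_trans s0).
have bd : forall r, 0 <= r <= T -> `|f' (y r) * dy r| <= (`|f' (y 0)| + K1 * (M * T)) * M.
  move=> r /[dup] hr /andP[r0 rT].
  have S0 : S (y 0) by apply: Sy; rewrite lexx (le_trans r0).
  rewrite normrM ler_pM ?hM// -(subrK (f' (y 0)) (f' (y r))) addrC.
  rewrite (le_trans (ler_normD _ _))// lerD2l (le_trans (lipf1 _ _ (Sy _ hr) S0))//.
  rewrite ler_wpM2l// (le_trans (lipy _ _ _ _ _))// subr0 ler_wpM2l//.
split => //; [exact: measurableT_comp|by eexists; exact: bd|].
have ig t : t <= T -> itg leb `[0, t]%classic (fun r => f' (y r) * dy r).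
  move=> tT; apply: (itg_bnd _ (leb_cc_fin _ _)) => //; first exact: measurable_funTS.
  by move=> x /=; rewrite in_itv/= => /andP[x0 xt]; apply: bd; rewrite x0 (le_trans xt).
move=> t ht.
pose zeta t := f (y t) - \int[leb]_(r in `[0, t]) (f' (y r) * dy r).
suff : zeta t = zeta 0.
  by rewrite /zeta set_itv1 Rintegral_set1 subr0 => <-; rewrite subrK.
apply: (@quadratic_const _ (K1 * M ^+ 2 + K1 * M * M) T) ht => {}s {}t s0 st tT.
have hs : 0 <= s <= T by rewrite s0 (le_trans st).
have ht : 0 <= t <= T by rewrite (le_trans s0).
have hoc r : `]s, t]%classic r -> 0 <= r <= T /\ s <= r <= t.
  rewrite /= in_itv/= => /andP[sr rt]; rewrite (ltW sr) rt (le_trans rt) ?andbT//.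
  by rewrite ltW// (le_lt_trans s0).
have mfin := leb_oc_fin s t.
have igoc : itg leb `]s, t]%classic (fun r => f' (y r) * dy r).
  apply: (itg_bnd _ mfin) => //; first exact: measurable_funTS.
  by move=> r /hoc[hr _]; exact: bd.
have igdy : itg leb `]s, t]%classic dy.
  apply: (itg_bnd _ mfin) => //; first exact: measurable_funTS.
  by move=> r /hoc[hr _]; exact: hM.
have -> : zeta t - zeta s = (f (y t) - f (y s) - f' (y s) * (y t - y s)) +
    \int[leb]_(r in `]s, t]) ((f' (y s) - f' (y r)) * dy r).
  rewrite (_ : \int[leb]_(r in `]s, t]) ((f' (y s) - f' (y r)) * dy r) =
      \int[leb]_(r in `]s, t]) (f' (y s) * dy r - f' (y r) * dy r)); last first.
    by apply: int_eq => r _; rewrite mulrBl.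
  rewrite RintegralB//; last exact: itgZ.
  rewrite RintegralZl// -(prim_incr py)// /zeta.
  rewrite -(@int_ccB _ s t T)//; last exact: ig.
  by ring.
rewrite (le_trans (ler_normD _ _))// mulrDl lerD//.
  rewrite (le_trans (taylor1 Scvx df lipf1 (Sy _ hs) (Sy _ ht)))// -mulrA ler_wpM2l//.
  by rewrite -exprMn -[leLHS]real_normK ?num_real// lerXn2r ?nnegrE// ?mulr_ge0 ?subr_ge0// lipy.
have -> : K1 * M * M * (t - s) ^+ 2 = (K1 * (M * (t - s)) * M) * fine (leb `]s, t]%classic).
  by rewrite leb_ocE//; ring.
apply: int_bnd => //.
  apply: measurable_funTS; apply: measurable_funM => //; apply: measurable_funB => //.
  exact: measurableT_comp.
move=> r /hoc[/[dup] hr /andP[r0 rT] /andP[sr rt]]; rewrite normrM ler_pM ?hM//.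
rewrite distrC (le_trans (lipf1 _ _ (Sy _ hr) (Sy _ hs)))// ler_wpM2l//.
by rewrite (le_trans (lipy _ _ _ _ _))// ler_wpM2l// lerD2r.
Qed.

Lemma prim_sqr T y dy : prim T y dy ->
  prim T (fun r => y r ^+ 2) (fun r => 2 * y r * dy r).
Proof.
move=> py; apply: (@prim_comp T y dy (fun x => x ^+ 2) (fun x => 2 * x) setT 2) => //.
- exact: measurable_funM.
- move=> x _; apply: is_derive_eq (is_deriveX 2 (is_derive_id x 1)) _.
  by rewrite /= expr1 [_ *: _]mulr1.
- by move=> u v _ _; rewrite -mulrBr normrM ger0_norm.
Qed.

(** Polarisation reduces the product rule to the chain rule for squares. *)
Lemma primM T y dy z dz : prim T y dy -> prim T z dz ->
  prim T (fun r => y r * z r) (fun r => y r * dz r + z r * dy r).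
Proof.
move=> py pz.
have h := primD (primZ 2^-1 (prim_sqr (primD py pz)))
  (primD (primZ (- 2^-1) (prim_sqr py)) (primZ (- 2^-1) (prim_sqr pz))).
rewrite (_ : (fun r => y r * z r) = (fun r => 2^-1 * (y r + z r) ^+ 2 +
   (- 2^-1 * y r ^+ 2 + - 2^-1 * z r ^+ 2))); last by apply/funext => r; field.
by apply: prim_ext h _ => r; field.
Qed.

End primitives.

Section measurable_rules.
Context d (T : measurableType d) (R : realType) (D : set T).
Implicit Types f g : T -> R.

Lemma mrD f g : measurable_fun D f -> measurable_fun D g ->
  measurable_fun D (fun x => f x + g x).
Proof. exact: measurable_funD. Qed.

Lemma mrB f g : measurable_fun D f -> measurable_fun D g ->
  measurable_fun D (fun x => f x - g x).
Proof. exact: measurable_funB. Qed.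

Lemma mrM f g : measurable_fun D f -> measurable_fun D g ->
  measurable_fun D (fun x => f x * g x).
Proof. exact: measurable_funM. Qed.

Lemma mrN f : measurable_fun D f -> measurable_fun D (fun x => - f x).
Proof. by move=> mf; apply: measurableT_comp. Qed.

Lemma mrcst (c : R) : measurable_fun D (fun=> c).
Proof. exact: measurable_cst. Qed.

Lemma mrcont (h : R -> R) f : continuous h -> measurable_fun D f ->
  measurable_fun D (fun x => h (f x)).
Proof. by move=> ch mf; apply: measurableT_comp => //; exact: continuous_measurable_fun. Qed.

Lemma mrcomp (h : R -> R) f : measurable_fun setT h -> measurable_fun D f ->
  measurable_fun D (fun x => h (f x)).
Proof. by move=> ch mf; apply: measurableT_comp. Qed.

Lemma mrcos f : measurable_fun D f -> measurable_fun D (fun x => cos (f x)).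
Proof. exact/mrcont/continuous_cos. Qed.

Lemma mrsin f : measurable_fun D f -> measurable_fun D (fun x => sin (f x)).
Proof. exact/mrcont/continuous_sin. Qed.

Lemma mrexp f : measurable_fun D f -> measurable_fun D (fun x => expR (f x)).
Proof. exact/mrcont/continuous_expR. Qed.

Lemma mrnorm f : measurable_fun D f -> measurable_fun D (fun x => `|f x|).
Proof. by move=> mf; apply: measurableT_comp. Qed.

Lemma mrmax f g : measurable_fun D f -> measurable_fun D g ->
  measurable_fun D (fun x => Num.max (f x) (g x)).
Proof. exact: measurable_maxr. Qed.

Lemma mrmin f g : measurable_fun D f -> measurable_fun D g ->
  measurable_fun D (fun x => Num.min (f x) (g x)).
Proof. exact: measurable_minr. Qed.

End measurable_rules.

Ltac mr := repeat first
  [ assumption | apply: mrcst | apply: mrM | apply: mrB | apply: mrD | apply: mrN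
  | apply: mrcos | apply: mrsin | apply: mrexp | apply: mrnorm | apply: mrmax | apply: mrmin
  | exact: measurable_fst | exact: measurable_snd | exact: measurable_id].

Section pushforward_finite.
Context (R : realType) d (T : measurableType d) d' (T' : measurableType d').
Context (P : {finite_measure set T -> \bar R}) (f : T -> T').

Definition pushm (mf : measurable_fun setT f) : set T' -> \bar R := pushforward P f.

Context (mf : measurable_fun setT f).

Let pushm0 : pushm mf set0 = 0%E.
Proof. by rewrite /pushm /pushforward preimage_set0 measure0. Qed.

Let pushm_ge0 A : (0 <= pushm mf A)%E.
Proof. exact: measure_ge0. Qed.

Let pushm_sa : semi_sigma_additive (pushm mf).
Proof. exact: (@measure_semi_sigma_additive _ _ _ (pushforward P f)). Qed.

HB.instance Definition _ := isMeasure.Build _ _ _ (pushm mf) pushm0 pushm_ge0 pushm_sa.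

Let pushm_fin : fin_num_fun (pushm mf).
Proof.
move=> U mU; rewrite /pushm /pushforward fin_num_measure// -[X in measurable X]setTI.
exact: mf.
Qed.

HB.instance Definition _ := Measure_isFinite.Build _ _ _ (pushm mf) pushm_fin.

Lemma int_pushm (g : T' -> R) : measurable_fun setT g -> itg P setT (g \o f) ->
  \int[pushm mf]_y g y = \int[P]_x g (f x).
Proof.
move=> mg ig; rewrite /Rintegral; congr fine.
have := @integral_pushforward _ _ T T' R f mf P setT (EFin \o g).
rewrite preimage_setT => <- //; exact/measurable_EFinP.
Qed.

End pushforward_finite.

(** * Progressive measurability *)

Section filtered_space.
Context (R : realType) d (T : measurableType d) (P : probability T R).
Context (F : R -> set (set T)).
Implicit Types (X Y a c : R -> T -> R) (s t r : R).

Notation Ft t := (g_sigma_algebraType (F t)).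

Definition Fmeas t (Y : T -> R) := @measurable_fun _ _ (Ft t) R setT Y.

(** Progressive measurability, with the restriction to [[0, t]] replaced by freezing time at [t];
    the domain then stays a product of full types. Negative times are included. *)
Definition prog X := forall t, 0 <= t ->
  measurable_fun setT (fun p : R * Ft t => X (Num.min p.1 t) p.2).

Hypothesis hF : filtration F.

Lemma Ft_measE t (A : set T) : 0 <= t -> measurable (A : set (Ft t)) = F t A.
Proof.
move=> t0; have [h _ _] := hF.
by have -> : (measurable : set (set (Ft t))) = F t by exact/sigma_algebra_id/h.
Qed.

Lemma Fmeas_sub s t (Y : T -> R) : 0 <= s -> s <= t -> Fmeas s Y -> Fmeas t Y.
Proof.
move=> s0 st h mD B mB; have [_ _ hm] := hF.
have t0 : 0 <= t by exact: le_trans st.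
rewrite Ft_measE//; apply: (hm s) => //; rewrite -Ft_measE//.
by apply: h => //; rewrite Ft_measE// -(Ft_measE setT s0).
Qed.

Lemma measurable_Ft_id t : 0 <= t -> measurable_fun setT (id : T -> Ft t).
Proof.
move=> t0 _ B mB; rewrite setTI; have [_ h _] := hF.
by apply: (h t) => //; rewrite -Ft_measE.
Qed.

Lemma Fmeas_meas t (Y : T -> R) : 0 <= t -> Fmeas t Y -> measurable_fun setT Y.
Proof. by move=> t0 h; exact: (measurableT_comp h (measurable_Ft_id t0)). Qed.

Lemma prog_Fmeas X t : prog X -> 0 <= t -> Fmeas t (X t).
Proof.
move=> pX t0.
have h : measurable_fun setT (fun w : Ft t => (t, w) : R * Ft t).
  exact: measurable_fun_pair.
by have := measurableT_comp (pX t t0) h; rewrite /comp /= /Fmeas minxx.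
Qed.

Lemma prog_meas X t : prog X -> 0 <= t -> measurable_fun setT (X t).
Proof. by move=> pX t0; exact: (Fmeas_meas t0 (prog_Fmeas pX t0)). Qed.

Lemma prog_joint X : prog X -> measurable_fun setT (fun p : R * T => X p.1 p.2).
Proof.
move=> pX.
have m1 (n : nat) : measurable_fun setT (fun p : R * T => X (Num.min p.1 n%:R) p.2).
  have h : measurable_fun setT (fun p : R * T => (p.1, p.2) : R * Ft n%:R).
    apply: measurable_fun_pair => //.
    exact: (measurableT_comp (measurable_Ft_id (ler0n _ n)) measurable_snd).
  exact: (measurableT_comp (pX n%:R (ler0n _ _)) h).
apply: (measurable_fun_cvg m1) => p _.
apply: cvg_near_cst; near=> n.
rewrite (min_idPl _)//; near: n; exact: nbhs_infty_ger.
Unshelve. all: end_near. Qed.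

Lemma prog_cst (c : R) : prog (fun _ _ => c).
Proof. by move=> t t0; exact: measurable_cst. Qed.

Lemma prog_comp (h : R -> R) X : measurable_fun setT h -> prog X ->
  prog (fun r w => h (X r w)).
Proof. by move=> mh pX t t0; apply: mrcomp => //; exact: pX. Qed.

Lemma progD X Y : prog X -> prog Y -> prog (fun r w => X r w + Y r w).
Proof. by move=> pX pY t t0; apply: mrD; [exact: pX|exact: pY]. Qed.

Lemma progB X Y : prog X -> prog Y -> prog (fun r w => X r w - Y r w).
Proof. by move=> pX pY t t0; apply: mrB; [exact: pX|exact: pY]. Qed.

Lemma progM X Y : prog X -> prog Y -> prog (fun r w => X r w * Y r w).
Proof. by move=> pX pY t t0; apply: mrM; [exact: pX|exact: pY]. Qed.

Lemma measurable_truncn_cell (n k : nat) (t : R) :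
  measurable [set r : R | Num.truncn (Num.max (Num.min r t) 0 * n.+1%:R) = k].
Proof.
have -> : [set r : R | Num.truncn (Num.max (Num.min r t) 0 * n.+1%:R) = k] =
  (fun r => Num.max (Num.min r t) 0 * n.+1%:R) @^-1` `[k%:R, k.+1%:R[.
  apply/seteqP; split => r /=; rewrite in_itv/=.
    by move=> <-; rewrite truncn_itv// mulr_ge0// le_max lexx orbT.
  by move=> h; exact: truncn_def.
have mh : measurable_fun setT (fun r : R => Num.max (Num.min r t) 0 * n.+1%:R) by mr.
by rewrite -[X in measurable X]setTI; apply: mh; [exact: measurableT|exact: measurable_itv].
Qed.

(** By right-continuity the value at [r] is a limit of values at the next point of a grid of mesh
    [1 / n.+1], capped at [t], so that only countably many [F t]-measurable variables enter. The
    first hypothesis settles the values at negative times. *)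
Lemma prog_rc X : (forall r w, X r w = X (Num.max r 0) w) ->
  (forall t, 0 <= t -> Fmeas t (X t)) ->
  (forall w t, 0 <= t -> X s w @[s --> t^'+] --> X t w) ->
  prog X.
Proof.
move=> X0 mX rcX t t0.
pose q (n k : nat) : R := Num.min (k.+1%:R / n.+1%:R) t.
pose kap n (r : R) := Num.truncn (Num.max (Num.min r t) 0 * n.+1%:R).
have q0 n k : 0 <= q n k by rewrite le_min t0 andbT divr_ge0.
have mXn n : measurable_fun setT (fun p : R * Ft t => X (q n (kap n p.1)) p.2).
  move=> _ B mB; rewrite setTI.
  have -> : (fun p : R * Ft t => X (q n (kap n p.1)) p.2) @^-1` B =
    \bigcup_k ([set r | kap n r = k] `*` (X (q n k) @^-1` B)).
    apply/seteqP; split => [[r w]/= h|[r w] [k _ [/= <- //]]].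
    by exists (kap n r).
  apply: bigcupT_measurable => k; apply: measurableX.
    exact: measurable_truncn_cell.
  have : Fmeas t (X (q n k)).
    apply: (@Fmeas_sub (q n k)) => //; first by rewrite ge_min lexx orbT.
    exact: mX.
  by move=> /(_ measurableT B mB); rewrite setTI.
apply: (measurable_fun_cvg mXn) => -[r w] _ /=.
have [tr|rt] := leP t r.
  apply: cvg_near_cst; near=> n.
  congr (X _ w); apply/min_idPr; rewrite /kap (min_idPr tr) (max_idPl t0).
  by rewrite ler_pdivlMr ?ltr0n// ltW// truncnS_gt.
have [t_eq0|tn0] := eqVneq t 0.
  have rn : r < 0 by rewrite -t_eq0.
  apply: cvg_near_cst; near=> n; rewrite X0 [RHS]X0; congr (X _ w).
  rewrite (max_idPr (ltW rn)) (max_idPl (q0 _ _)) /q t_eq0; apply/min_idPr.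
  by rewrite divr_ge0.
have tpos : 0 < t by rewrite lt_neqAle eq_sym tn0.
set r0 := Num.max r 0; have r00 : 0 <= r0 by rewrite le_max lexx orbT.
have r0t : r0 < t by rewrite gt_max rt.
rewrite X0 -/r0.
have kapE n : kap n r = Num.truncn (r0 * n.+1%:R) by rewrite /kap (min_idPl (ltW rt)).
have cq : q n (kap n r) @[n --> \oo] --> r0.
  apply: (@squeeze_cvgr _ _ _ _ (fun=> r0) (fun n => r0 + n.+1%:R^-1)).
  - near=> n; rewrite le_min (ltW r0t) ge_min andbT kapE; apply/andP; split.
      by rewrite ler_pdivlMr ?ltr0n// ltW// truncnS_gt.
    apply/orP; left; rewrite ler_pdivrMr ?ltr0n// mulrDl mulVf// -natr1 lerD2r.
    by rewrite truncn_le// mulr_ge0.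
  - exact: cvg_cst.
  - rewrite -[X in _ --> X]addr0; apply: cvgD; first exact: cvg_cst.
    exact: cvg_harmonic.
(* The grid point must lie strictly to the right of [r0], since the right filter excludes the point
   itself. *)
have hq n : r0 < q n (kap n r).
  by rewrite lt_min r0t andbT kapE ltr_pdivlMr ?ltr0n// truncnS_gt.
have := rcX w r0 r00.
move=> /cvg_at_rightP; apply; split => //.
Unshelve. all: end_near. Qed.

End filtered_space.

Section progressive_integral.
Context (R : realType) d (T : measurableType d).
Context (F : R -> set (set T)) (hF : filtration F).
Notation leb := (@lebesgue_measure R).
Notation Ft t := (g_sigma_algebraType (F t)).

Lemma int_lip (f : R -> R) (M : R) s t : measurable_fun setT f -> (forall r, `|f r| <= M) ->
  0 <= s -> s <= t ->
  `|\int[leb]_(r in `[0, t]) f r - \int[leb]_(r in `[0, s]) f r| <= M * (t - s).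
Proof.
move=> mf fM s0 st; rewrite (@int_ccB _ _ _ _ t)// -?leb_ocE//.
  by apply: int_bnd => //; [exact: leb_oc_fin|exact: measurable_funTS].
by apply: (itg_bnd _ (leb_cc_fin _ _)) => //; exact: measurable_funTS.
Qed.

Lemma int_rc (f : R -> R) (M : R) t : measurable_fun setT f -> (forall r, `|f r| <= M) ->
  0 <= t ->
  \int[leb]_(r in `[0, s]) f r @[s --> t^'+] --> \int[leb]_(r in `[0, t]) f r.
Proof.
move=> mf fM t0; apply/cvgrPdist_le => e e0.
have M0 : 0 <= M by apply: le_trans (fM 0).
near=> s; rewrite distrC (le_trans (int_lip mf fM t0 _))//.
rewrite (@le_trans _ _ ((M + 1) * (s - t)))//.
  by rewrite ler_wpM2r ?subr_ge0// lerDl.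
rewrite mulrC -ler_pdivlMr ?ltr_wpDl// lerBlDl.
near: s; apply: nbhs_right_le.
by rewrite ltrDl divr_gt0// ltr_wpDl.
Unshelve. all: end_near. Qed.

Lemma prog_int (a : R -> T -> R) (M : R) : prog F a -> (forall r w, `|a r w| <= M) ->
  prog F (fun t w => \int[leb]_(r in `[0, t]) a r w).
Proof.
move=> pa aM.
have ma w : measurable_fun setT (a ^~ w).
  exact: (measurableT_comp (prog_joint hF pa) (pair2_measurable w)).
apply: (prog_rc hF).
- move=> r w; have [//|rn] := leP 0 r.
  by rewrite set_itv1 Rintegral_set1 set_itv_ge ?Rintegral_set0// bnd_simp -ltNge.
- move=> t t0.
  have m1 : measurable_fun setT (fun w : Ft t => \int[leb]_(r in `[0, t]) a (Num.min r t) w).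
    (* The Dirac mass is an arbitrary finite measure on [F t]: Fubini is invoked only for the
       measurability of the partial integral with respect to this sigma-algebra. *)
    have := @itg_fub2 _ _ (measurableTypeR R) (Ft t) R (@lebesgue_measure R)
      (\d_ (point : Ft t)) `[0, t]%classic setT (measurable_itv _) measurableT
      (fun r w => a (Num.min r t) w) (fun=> M) (fun=> 1) (pa t t0) _ _ _.
    move=> /(_ _ _ _)/itg_meas; apply.
    + exact/itg_cst/leb_cc_fin.
    + by apply: itg_cst => //; rewrite -ge0_fin_numE// fin_num_measure.
    + by move=> r w _ _; rewrite mulr1.
  rewrite /Fmeas; congr (measurable_fun _ _): m1; apply/funext => w.
  by apply: int_eq => r /=; rewrite in_itv/= => /andP[_ rt]; rewrite (min_idPl rt).
- by move=> w t t0; apply: (int_rc (M := M)).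
Qed.

End progressive_integral.

(** * The exponential martingale of the noise, in real form *)

Section levy_martingale.
Context (R : realType) d (T : measurableType d) (P : probability T R).
Context (F : R -> set (set T)) (hF : filtration F).
Context (alpha : R) (L : R -> T -> R).
Notation leb := (@lebesgue_measure R).
Notation Ft t := (g_sigma_algebraType (F t)).
Implicit Types (r s t xi : R).

Hypothesis pL : prog F L.
Hypothesis indL : forall s t, 0 <= s -> s <= t ->
  forall (B : set T) (C : set R), F s B -> measurable C ->
    P (B `&` increment L s t @^-1` C) = (P B * P (increment L s t @^-1` C))%E.
Hypothesis cosL : forall s t xi, 0 <= s -> s <= t ->
  \int[P]_w cos (xi * increment L s t w) = expR (- ((t - s) * `|xi| `^ alpha)).
Hypothesis sinL : forall s t xi, 0 <= s -> s <= t ->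
  \int[P]_w sin (xi * increment L s t w) = 0.

Let Pfin : (P setT < +oo)%E.
Proof. by rewrite probability_setT ltry. Qed.

(** Independence is given for events. It states that the joint image of [P] under the identity into
    [F s] and the increment agrees with a product measure on rectangles; uniqueness of product
    measures and Fubini do the rest. *)
Lemma indep_expect s t (H : T -> R) (f : R -> R) (M K : R) : 0 <= s -> s <= t ->
  Fmeas F s H -> (forall w, `|H w| <= M) -> measurable_fun setT f ->
  (forall x, `|f x| <= K) ->
  \int[P]_w (H w * f (increment L s t w)) =
  \int[P]_w H w * \int[P]_w f (increment L s t w).
Proof.
move=> s0 st mH HM mf fK; have t0 : 0 <= t by exact: le_trans st.
have mid : measurable_fun setT (id : T -> Ft s) := measurable_Ft_id hF s0.
have mi : measurable_fun setT (increment L s t).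
  by apply: mrB; apply: (prog_meas hF pL).
have mp : measurable_fun setT (fun w : T => (w, increment L s t w) : Ft s * R).
  exact: measurable_fun_pair.
have mHf : measurable_fun setT (fun p : Ft s * R => H p.1 * f p.2).
  apply: mrM; first exact: (measurableT_comp mH measurable_fst).
  exact: (measurableT_comp mf measurable_snd).
have M0 : 0 <= M by apply: le_trans (HM point).
have HfMK p : `|H p.1 * f p.2| <= M * K by rewrite normrM ler_pM.
have Hm : measurable_fun setT H := Fmeas_meas hF s0 mH.
transitivity (\int[pushm P mp]_p (H p.1 * f p.2)).
  rewrite int_pushm//; apply: (itg_bnd measurableT (M := M * K)) => //.
    by apply: mrM => //; exact: measurableT_comp.
  by move=> w _; exact: (HfMK (w, _)).
transitivity (\int[(pushm P mid \x pushm P mi)%E]_p (H p.1 * f p.2)).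
  rewrite /Rintegral; congr fine; apply: eq_measure_integral => A mA _.
  apply/esym/product_measure_unique => // B C mB mC.
  transitivity (P (B `&` increment L s t @^-1` C)); first by [].
  by rewrite indL// -(Ft_measE hF).
have iHf : (pushm P mid \x pushm P mi)%E.-integrable setT
    (EFin \o (fun p : Ft s * R => H p.1 * f p.2)).
  apply: (itg_bnd measurableT (M := M * K)) => //.
  rewrite -setXTT [X in (X < _)%E](_ : _ = pushm P mid setT * pushm P mi setT)%E; last first.
    exact: product_measure1E.
  rewrite lte_mul_pinfty//.
  exact: fin_num_measure.
rewrite /Rintegral -(integral12_prod_meas1 iHf).
have imi : itg (pushm P mi) setT f.
  by apply: (itg_bnd measurableT (M := K)) => //; rewrite -ge0_fin_numE// fin_num_measure.
transitivity (\int[pushm P mid]_x (H x * \int[pushm P mi]_y f y)).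
  rewrite /Rintegral; congr fine; apply: eq_integral => x _; rewrite /fubini_F /=.
  transitivity (\int[pushm P mi]_y (H x * f y))%:E.
    rewrite /Rintegral fineK//; apply: integrable_fin_num => //; exact: itgZ.
  by rewrite RintegralZl.
rewrite RintegralZr//; last first.
  by apply: (itg_bnd measurableT (M := M)) => //; rewrite -ge0_fin_numE// fin_num_measure.
rewrite !int_pushm//.
- apply: (itg_bnd measurableT (M := K)); [exact: Pfin|exact: measurableT_comp|].
  by move=> x _; exact: fK.
- by apply: (itg_bnd measurableT (M := M)).
Qed.

(** The martingale property of [exp(i xi L_t + t |xi|^alpha)], with a phase [B] known at time [s].
    The phase is arbitrary, so the sine version is contained in it through a shift by [pi / 2]. *)
Lemma mart_cos s t xi (H B : T -> R) (M : R) : 0 <= s -> s <= t ->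
  Fmeas F s H -> (forall w, `|H w| <= M) -> Fmeas F s B ->
  \int[P]_w (H w * cos (xi * L t w + B w)) =
  expR (- ((t - s) * `|xi| `^ alpha)) * \int[P]_w (H w * cos (xi * L s w + B w)).
Proof.
move=> s0 st mH HM mB; have t0 : 0 <= t by exact: le_trans st.
have mLs : Fmeas F s (L s) by exact: prog_Fmeas.
have M0 : 0 <= M by apply: le_trans (HM point).
pose H1 w := H w * cos (xi * L s w + B w).
pose H2 w := H w * sin (xi * L s w + B w).
have mH1 : Fmeas F s H1 by rewrite /Fmeas /H1 /=; mr.
have mH2 : Fmeas F s H2 by rewrite /Fmeas /H2 /=; mr.
have bH1 w : `|H1 w| <= M by rewrite normrM -[leRHS]mulr1 ler_pM// cos_max.
have bH2 w : `|H2 w| <= M by rewrite normrM -[leRHS]mulr1 ler_pM// sin_max.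
have mcx : measurable_fun setT (fun x : R => cos (xi * x)) by mr.
have msx : measurable_fun setT (fun x : R => sin (xi * x)) by mr.
have mi : measurable_fun setT (increment L s t).
  by apply: mrB; apply: (prog_meas hF pL).
transitivity (\int[P]_w (H1 w * cos (xi * increment L s t w) - H2 w * sin (xi * increment L s t w))).
  apply: int_eq => w _.
  rewrite (_ : xi * L t w + B w = xi * increment L s t w + (xi * L s w + B w)); last first.
    by rewrite /increment; ring.
  by rewrite cosD /H1 /H2; ring.
have mH1' := Fmeas_meas hF s0 mH1; have mH2' := Fmeas_meas hF s0 mH2.
rewrite RintegralB//; last 2 first.
- apply: (itg_bnd measurableT (M := M)) => //; first by mr.
  by move=> w _; rewrite normrM -[leRHS]mulr1 ler_pM// cos_max.
- apply: (itg_bnd measurableT (M := M)) => //; first by mr.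
  by move=> w _; rewrite normrM -[leRHS]mulr1 ler_pM// sin_max.
rewrite (indep_expect (f := fun x => cos (xi * x)) (M := M) (K := 1))//; last first.
  by move=> x; exact: cos_max.
rewrite (indep_expect (f := fun x => sin (xi * x)) (M := M) (K := 1))//; last first.
  by move=> x; exact: sin_max.
by rewrite cosL// sinL// mulr0 subr0 mulrC.
Qed.

End levy_martingale.

Lemma mrpair (R : realType) d1 d2 d3 (S : measurableType d1) (U : measurableType d2)
    (Z : measurableType d3) (h : S -> U -> R) (f1 : Z -> S) (f2 : Z -> U) :
  measurable_fun setT (fun p : S * U => h p.1 p.2) ->
  measurable_fun setT f1 -> measurable_fun setT f2 ->
  measurable_fun setT (fun z => h (f1 z) (f2 z)).
Proof. by move=> mh m1 m2; exact: (measurableT_comp mh (measurable_fun_pair m1 m2)). Qed.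

Section time_product_measure.
Context (R : realType) d (T : measurableType d) (P : probability T R).

(** The product measure gets a name in order to carry a sigma-finite structure, which Fubini against
    a third measure requires in [ito_superpose]. *)
Definition time_prod : set (measurableTypeR R * T) -> \bar R :=
  (@lebesgue_measure R \x P)%E.

HB.instance Definition _ := Measure.on time_prod.

Lemma time_prodE (A : set (measurableTypeR R)) : measurable A ->
  time_prod (A `*` setT) = lebesgue_measure A.
Proof.
move=> mA; transitivity (lebesgue_measure A * P setT)%E; first exact: product_measure1E.
by rewrite probability_setT mule1.
Qed.

Let time_prod_sigma_finite : sigma_finite setT time_prod.
Proof.
have [G TG mG] := sigma_finiteT (@lebesgue_measure R).
exists (fun n => G n `*` setT); first by rewrite -setXTT TG -setX_bigcupl.
move=> k; have [mGk Gkoo] := mG k; split; first exact: measurableX.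
by rewrite time_prodE.
Qed.

HB.instance Definition _ :=
  Measure_isSigmaFinite.Build _ _ _ time_prod time_prod_sigma_finite.

End time_product_measure.

(** * Ito's formula in expectation *)

Section ito.
Context (R : realType) d (T : measurableType d) (P : probability T R).
Context (F : R -> set (set T)) (hF : filtration F).
Context (alpha : R) (L : R -> T -> R).
Notation leb := (@lebesgue_measure R).
Implicit Types (r s t xi : R).

Hypothesis pL : prog F L.
Hypothesis indL : forall s t, 0 <= s -> s <= t ->
  forall (B : set T) (C : set R), F s B -> measurable C ->
    P (B `&` increment L s t @^-1` C) = (P B * P (increment L s t @^-1` C))%E.
Hypothesis cosL : forall s t xi, 0 <= s -> s <= t ->
  \int[P]_w cos (xi * increment L s t w) = expR (- ((t - s) * `|xi| `^ alpha)).
Hypothesis sinL : forall s t xi, 0 <= s -> s <= t ->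
  \int[P]_w sin (xi * increment L s t w) = 0.

Definition absc tm (c dc : R -> T -> R) := [/\ prog F c, prog F dc,
  (exists M, forall r w, `|dc r w| <= M) & forall w, prim tm (c ^~ w) (dc ^~ w)].

Definition bdd (c : R -> T -> R) := exists M, forall r w, `|c r w| <= M.

Definition ET tm (f : R -> T -> R) :=
  \int[(time_prod P)]_(p in `[0, tm]%classic `*` setT) f p.1 p.2.

Lemma measurable_ET tm : measurable (`[0, tm]%classic `*` [set: T] : set (measurableTypeR R * T)).
Proof. exact: measurableX. Qed.

Let Pf : (P setT < +oo)%E.
Proof. by rewrite probability_setT ltry. Qed.

Lemma ET_fin tm : ((time_prod P) (`[0%R, tm]%classic `*` [set: T]) < +oo)%E.
Proof. by rewrite time_prodE// leb_cc_fin. Qed.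

Lemma ET_mass tm : 0 <= tm -> fine ((time_prod P) (`[0%R, tm]%classic `*` [set: T])) = tm.
Proof. by move=> t0; rewrite time_prodE// leb_ccE// subr0. Qed.

Lemma ET_itg tm (f : R -> T -> R) (M : R) :
  measurable_fun setT (fun p : R * T => f p.1 p.2) -> (forall r w, 0 <= r <= tm -> `|f r w| <= M) ->
  itg (time_prod P) (`[0%R, tm]%classic `*` setT) (fun p => f p.1 p.2).
Proof.
move=> mf fM; apply: (itg_bnd (measurable_ET tm) (M := M)) => //.
- exact: ET_fin.
- exact: measurable_funTS.
- by move=> [r w] [/= + _]; rewrite in_itv; exact: fM.
Qed.

Lemma ET_iter1 tm (f : R -> T -> R) (M : R) :
  measurable_fun setT (fun p : R * T => f p.1 p.2) -> (forall r w, 0 <= r <= tm -> `|f r w| <= M) ->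
  ET tm f = \int[leb]_(r in `[0, tm]) \int[P]_w f r w.
Proof.
move=> mf fM; apply: (@Rint_prod _ _ (measurableTypeR R) T R leb P _ _ _ _ f (fun=> M) (fun=> 1)) => //.
- exact/itg_cst/leb_cc_fin.
- exact: (itg_cst measurableT 1 Pf).
- by move=> x y /= + _; rewrite in_itv mulr1; exact: fM.
Qed.

Lemma ET_iter2 tm (f : R -> T -> R) (M : R) :
  measurable_fun setT (fun p : R * T => f p.1 p.2) -> (forall r w, 0 <= r <= tm -> `|f r w| <= M) ->
  ET tm f = \int[P]_w \int[leb]_(r in `[0, tm]) f r w.
Proof.
move=> mf fM; rewrite (ET_iter1 mf fM).
apply: (@Rfubini _ _ (measurableTypeR R) T R leb P _ _ _ _ f (fun=> M) (fun=> 1)) => //.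
- exact/itg_cst/leb_cc_fin.
- exact: (itg_cst measurableT 1 Pf).
- by move=> x y /= + _; rewrite in_itv mulr1; exact: fM.
Qed.

(** Dynkin's formula for [expR (- (lam * r)) * c * g(X)] with [X = L + Y] and [Y' = a]. Here [g1] is
    meant to be the derivative of [g], and [k] the function [(lam + (-Delta)^(alpha/2)) g]. Leaving
    the triple free makes the identity linear in it. *)
Definition ito_id tm lam (c dc Y a : R -> T -> R) (g g1 k : R -> R) :=
  \int[P]_w (expR (- (lam * tm)) * c tm w * g (L tm w + Y tm w)) -
  \int[P]_w (c 0 w * g (L 0 w + Y 0 w)) =
  ET tm (fun r w => expR (- (lam * r)) * (dc r w * g (L r w + Y r w) +
    c r w * (g1 (L r w + Y r w) * a r w - k (L r w + Y r w)))).

Lemma prim_expR tm (b : R) : prim tm (fun r => expR (b * r)) (fun r => b * expR (b * r)).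
Proof.
have [|tm0] := leP 0 tm; last first.
  split; [by mr|by mr| |].
  - by exists 0 => r /andP[r0 rt]; move: tm0; rewrite ltNge (le_trans r0 rt).
  - by move=> r /andP[r0 rt]; move: tm0; rewrite ltNge (le_trans r0 rt).
move=> tm0.
have h := @prim_comp R tm _ _ expR expR [set x | x <= `|b| * tm] (expR (`|b| * tm))
  (primZ b (prim_id tm)).
apply: prim_ext (h _ _ _ _ _ _) _ => //.
- by move=> u v w /= Su Sv /andP[_ wv]; exact: le_trans wv Sv.
- move=> t /andP[t0 tt] /=; rewrite (le_trans (ler_norm _))// normrM ler_wpM2l//.
  by rewrite ger0_norm.
- move=> u v /= Su Sv.
  wlog uv : u v Su Sv / u < v.
    move=> H; have [uv|vu|->] := ltgtP u v; first exact: H.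
      by rewrite distrC (distrC u); exact: H.
    by rewrite !subrr normr0 mulr0.
  have [|c /[!in_itv]/= /andP[uc cv] e] := @MVT _ expR expR u v uv (fun x _ => is_derive_expR x).
    by apply: continuous_subspaceT => x; exact: continuous_expR.
  rewrite distrC e normrM (distrC u) ler_wpM2r// ger0_norm ?expR_ge0//.
  by rewrite ler_expR (le_trans (ltW cv)).
- by move=> r /=; rewrite mulr1 mulrC.
Qed.

Lemma prim_cosp tm (y dy : R -> R) : prim tm y dy ->
  prim tm (fun r => cos (y r)) (fun r => - sin (y r) * dy r).
Proof.
move=> py; apply: (@prim_comp R tm y dy cos (fun x => - sin x) setT 1) => //.
- exact: continuous_measurable_fun (@continuous_cos R).
- by apply: mrN; exact: continuous_measurable_fun (@continuous_sin R).
- move=> u v _ _.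
  wlog uv : u v / u < v.
    move=> H; have [uv|vu|->] := ltgtP u v; first exact: H.
      by rewrite distrC (distrC u); exact: H.
    by rewrite !subrr normr0 mulr0.
  have [|c _ e] := @MVT _ (@sin R) cos u v uv (fun x _ => is_derive_sin x).
    by apply: continuous_subspaceT => x; exact: continuous_sin.
  by rewrite opprK addrC e normrM mul1r (distrC u) ler_piMl// cos_max.
Qed.

(** The noise is frozen at its terminal value [L tm], so that [G] is absolutely continuous along
    each path. Passing from [L tm] to [L r] by [mart_cos] costs the factor
    [expR (- ((tm - r) * x))], which the second factor of [K] is there to compensate. *)
Lemma ito_cos tm lam (c dc Y a : R -> T -> R) xi theta : 0 <= tm ->
  absc tm c dc -> bdd c -> absc tm Y a ->
  ito_id tm lam c dc Y a (fun x => cos (xi * x + theta))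
    (fun x => - xi * sin (xi * x + theta))
    (fun x => (lam + `|xi| `^ alpha) * cos (xi * x + theta)).
Proof.
move=> tm0 [pc pdc [M1 hM1] primc] [M hM] [pY pa [M2 hM2] primY].
set x := `|xi| `^ alpha.
pose K r := expR (- lam * r) * expR (x * (tm - r)).
pose dK r := - (lam + x) * K r.
have primK : prim tm K dK.
  rewrite (_ : K = fun r => expR (x * tm) * expR (- (lam + x) * r)); last first.
    by apply/funext => r; rewrite /K -!expRD; congr expR; ring.
  apply: prim_ext (primZ (expR (x * tm)) (prim_expR tm (- (lam + x)))) _ => r.
  rewrite /dK /K mulrCA; congr (_ * _); rewrite -!expRD; congr expR; ring.
pose B r w := xi * Y r w + theta.
pose G r w := c r w * K r * cos (xi * L tm w + B r w).
pose dG r w := (dc r w * K r + c r w * dK r) * cos (xi * L tm w + B r w) +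
  (- (xi * (a r w * c r w * K r))) * sin (xi * L tm w + B r w).
have primG w : prim tm (G ^~ w) (dG ^~ w).
  have h1 := primM (primc w) primK.
  have h2 := prim_cosp (primD (prim_cst tm (xi * L tm w)) (primD (primZ xi (primY w)) (prim_cst tm theta))).
  apply: prim_ext (primM h1 h2) _ => r; rewrite /dG /B; ring.
have [mK mdK [MK hMK] _] := primK.
have Kb r : 0 <= r <= tm -> `|K r| <= expR (`|lam| * tm) * expR (x * tm).
  move=> /andP[r0 rt]; rewrite ger0_norm ?mulr_ge0 ?expR_ge0// ler_pM ?expR_ge0//.
    rewrite ler_expR (le_trans (ler_norm _))// normrM normrN ler_wpM2l// ger0_norm//.
  by rewrite ler_expR ler_wpM2l ?powR_ge0// lerBlDr lerDl.
have mL := prog_joint hF pL; have mY := prog_joint hF pY.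
have mc := prog_joint hF pc; have mdc := prog_joint hF pdc; have ma := prog_joint hF pa.
have mLt : measurable_fun setT (fun p : R * T => L tm p.2).
  exact: (measurableT_comp (prog_meas hF pL tm0) measurable_snd).
have mKj : measurable_fun setT (fun p : R * T => K p.1) by exact: (measurableT_comp mK measurable_fst).
have mdKj : measurable_fun setT (fun p : R * T => dK p.1) by exact: (measurableT_comp mdK measurable_fst).
have mdG : measurable_fun setT (fun p : R * T => dG p.1 p.2).
  by rewrite /dG /B; mr.
have M0 : 0 <= M by apply: le_trans (hM 0 point).
have M10 : 0 <= M1 by apply: le_trans (hM1 0 point).
have M20 : 0 <= M2 by apply: le_trans (hM2 0 point).
set KB := expR (`|lam| * tm) * expR (x * tm).
have KB0 : 0 <= KB by rewrite mulr_ge0 ?expR_ge0.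
pose MG := (M1 * KB + M * (`|lam + x| * KB)) * 1 + (`|xi| * (M2 * M * KB)) * 1.
have dGb r w : 0 <= r <= tm -> `|dG r w| <= MG.
  move=> hr; rewrite /dG (le_trans (ler_normD _ _))// lerD// normrM ler_pM ?cos_max ?sin_max//.
    rewrite (le_trans (ler_normD _ _))// lerD// normrM ler_pM// ?Kb//.
    by rewrite /dK normrM normrN ler_pM// Kb.
  rewrite normrN normrM ler_wpM2l// normrM ler_pM ?mulr_ge0 ?Kb//.
  by rewrite normrM ler_pM.
have Gincr w : G tm w - G 0 w = \int[leb]_(r in `[0, tm]) dG r w.
  have [_ _ _ e] := primG w.
  by rewrite (e tm) ?lexx ?tm0// [LHS]addrC addKr.
have EG r : 0 <= r <= tm -> itg P setT (G r).
  move=> /[dup] hr /andP[r0 rt]; apply: (itg_bnd measurableT (M := M * KB * 1)) => //.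
    have mcr := prog_meas hF pc r0; have mYr := prog_meas hF pY r0.
    have mLt' := prog_meas hF pL tm0.
    by rewrite /G /B; mr.
  by move=> w _; rewrite /G normrM ler_pM ?cos_max// normrM ler_pM// Kb.
rewrite /ito_id.
have -> : \int[P]_w (expR (- (lam * tm)) * c tm w * cos (xi * (L tm w + Y tm w) + theta)) =
    \int[P]_w G tm w.
  apply: int_eq => w _; rewrite /G /K /B subrr mulr0 expR0 mulr1 mulNr.
  by rewrite mulrDr addrA; ring.
have -> : \int[P]_w (c 0 w * cos (xi * (L 0 w + Y 0 w) + theta)) = \int[P]_w G 0 w.
  have mc0 := prog_Fmeas pc (lexx 0).
  have mB0 : Fmeas F 0 (B 0) by apply: mrD => //; apply: mrM => //; exact: prog_Fmeas pY (lexx 0).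
  have := mart_cos hF pL indL cosL sinL xi (lexx 0) tm0 mc0 (hM 0) mB0.
  rewrite subr0 -/x => h.
  transitivity (expR (x * tm) * \int[P]_w (c 0 w * cos (xi * L tm w + B 0 w))).
    rewrite h mulrA -expRD mulrC (mulrC tm) subrr expR0 mulr1.
    by apply: int_eq => w _; rewrite /B mulrDr addrA.
  rewrite -RintegralZl//.
    by apply: int_eq => w _; rewrite /G /K mulr0 expR0 mul1r subr0; ring.
  apply: (itg_bnd measurableT (M := M * 1)) => //.
    have mcr := prog_meas hF pc (lexx 0); have mYr := prog_meas hF pY (lexx 0).
    have mLt' := prog_meas hF pL tm0.
    by rewrite /B; mr.
  by move=> w _; rewrite normrM ler_pM ?cos_max.
rewrite -RintegralB//; [|by apply: EG; rewrite tm0 lexx|by apply: EG; rewrite tm0 lexx].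
rewrite (_ : \int[P]_w (G tm w - G 0 w) = \int[P]_w \int[leb]_(r in `[0, tm]) dG r w); last first.
  by apply: int_eq => w _; exact: Gincr.
rewrite -(@Rfubini _ _ (measurableTypeR R) T R leb P _ _ _ _ dG (fun=> MG) (fun=> 1))//; last 3 first.
- exact/itg_cst/leb_cc_fin.
- exact: itg_cst.
- by move=> r w /= + _; rewrite in_itv/= mulr1; exact: dGb.
pose RH r w := expR (- (lam * r)) * (dc r w * cos (xi * (L r w + Y r w) + theta) +
  c r w * (- xi * sin (xi * (L r w + Y r w) + theta) * a r w -
   (lam + x) * cos (xi * (L r w + Y r w) + theta))).
have key r : 0 <= r <= tm -> \int[P]_w dG r w = \int[P]_w RH r w.
  move=> /[dup] hr /andP[r0 rt].
  have [mc' mdc' ma'] := And3 (prog_Fmeas pc r0) (prog_Fmeas pdc r0) (prog_Fmeas pa r0).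
  have mB : Fmeas F r (B r).
    by rewrite /Fmeas /B; have := prog_Fmeas pY r0; rewrite /Fmeas => ?; mr.
  (* The sine in [dG] is the cosine of the same argument lowered by [pi / 2]. *)
  have mB' : Fmeas F r (fun w => B r w - pi / 2) by apply: mrB.
  have mH1 : Fmeas F r (fun w => dc r w * K r + c r w * dK r).
    by rewrite /Fmeas in mc' mdc' *; mr.
  have mH2 : Fmeas F r (fun w => - (xi * (a r w * c r w * K r))).
    by rewrite /Fmeas in mc' ma' *; mr.
  have bH1 w : `|dc r w * K r + c r w * dK r| <= M1 * KB + M * (`|lam + x| * KB).
    rewrite (le_trans (ler_normD _ _))// lerD// normrM ler_pM// ?Kb//.
    by rewrite /dK normrM normrN ler_pM// Kb.
  have bH2 w : `|- (xi * (a r w * c r w * K r))| <= `|xi| * (M2 * M * KB).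
    rewrite normrN normrM ler_wpM2l// normrM ler_pM ?mulr_ge0 ?Kb//.
    by rewrite normrM ler_pM.
  have e1 := mart_cos hF pL indL cosL sinL xi r0 rt mH1 bH1 mB.
  have e2 := mart_cos hF pL indL cosL sinL xi r0 rt mH2 bH2 mB'.
  have [mLr mLtt] := (prog_meas hF pL r0, prog_meas hF pL tm0).
  have [mBm mBm'] := (Fmeas_meas hF r0 mB, Fmeas_meas hF r0 mB').
  have [mH1m mH2m] := (Fmeas_meas hF r0 mH1, Fmeas_meas hF r0 mH2).
  have ig1 (Z : T -> R) : measurable_fun setT Z -> itg P setT
      (fun w => (dc r w * K r + c r w * dK r) * cos (Z w)).
    move=> mZ; apply: (itg_bnd measurableT (M := (M1 * KB + M * (`|lam + x| * KB)) * 1) Pf); first by apply: mrM => //; mr.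
    by move=> w _; rewrite normrM ler_pM ?cos_max// bH1.
  have ig2 (Z : T -> R) : measurable_fun setT Z -> itg P setT
      (fun w => - (xi * (a r w * c r w * K r)) * cos (Z w)).
    move=> mZ; apply: (itg_bnd measurableT (M := (`|xi| * (M2 * M * KB)) * 1) Pf); first by apply: mrM => //; mr.
    by move=> w _; rewrite normrM ler_pM ?cos_max// bH2.
  have dGE w : dG r w = (dc r w * K r + c r w * dK r) * cos (xi * L tm w + B r w) +
      - (xi * (a r w * c r w * K r)) * cos (xi * L tm w + (B r w - pi / 2)).
    by rewrite [xi * L tm w + (_ - _)]addrA cosBpihalf.
  transitivity (expR (- ((tm - r) * x)) *
    \int[P]_w ((dc r w * K r + c r w * dK r) * cos (xi * L r w + B r w) +
      - (xi * (a r w * c r w * K r)) * cos (xi * L r w + (B r w - pi / 2)))).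
    rewrite [X in _ = _ * X]RintegralD//; [|by (apply: ig1 || apply: ig2); mr..].
    rewrite mulrDr -e1 -e2 -RintegralD//; [|by (apply: ig1 || apply: ig2); mr..].
    by apply: int_eq => w _; exact: dGE.
  rewrite -RintegralZl//; last by apply: itgD => //; (apply: ig1 || apply: ig2); mr.
  apply: int_eq => w _; rewrite [xi * L r w + (_ - _)]addrA cosBpihalf /RH /dK /K.
  rewrite (_ : expR (- (lam * r)) = expR (- ((tm - r) * x)) * (expR (- lam * r) * expR (x * (tm - r)))).
    by rewrite /B !mulrDr !addrA; ring.
  by rewrite -!expRD; congr expR; ring.
transitivity (\int[leb]_(r in `[0, tm]) \int[P]_w RH r w).
  by apply: int_eq => r /=; rewrite in_itv; exact: key.
apply/esym; apply: (@ET_iter1 tm RH (expR (`|lam| * tm) * (M1 * 1 + M * (`|xi| * 1 * M2 + `|lam + x| * 1)))).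
  rewrite /RH; mr; exact: (measurableT_comp _ measurable_fst).
move=> r w /andP[r0 rt]; rewrite /RH normrM ler_pM//.
  rewrite ger0_norm ?expR_ge0// ler_expR -mulNr (le_trans (ler_norm _))// normrM normrN.
  by rewrite ler_wpM2l// ger0_norm.
rewrite (le_trans (ler_normD _ _))// lerD// normrM ler_pM ?cos_max//.
rewrite (le_trans (ler_normB _ _))// lerD// normrM ler_pM ?cos_max//.
by rewrite normrM normrN ler_pM ?sin_max.
Qed.

(** Both sides of [ito_id] are linear in the triple; the majorant [B] justifies exchanging the
    integral over the parameter with expectation and time. *)
Lemma ito_superpose dS (S : measurableType dS) (pi_ : {sigma_finite_measure set S -> \bar R})
    (DS : set S) (mDS : measurable DS) (B : S -> R) (g g1 k : S -> R -> R)
    tm lam (c dc Y a : R -> T -> R) :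
  0 <= tm -> absc tm c dc -> bdd c -> absc tm Y a ->
  measurable_fun setT (fun p : S * R => g p.1 p.2) ->
  measurable_fun setT (fun p : S * R => g1 p.1 p.2) ->
  measurable_fun setT (fun p : S * R => k p.1 p.2) ->
  itg pi_ DS B ->
  (forall (s : S) x, DS s -> [/\ `|g s x| <= B s, `|g1 s x| <= B s & `|k s x| <= B s]) ->
  (forall s : S, DS s -> ito_id tm lam c dc Y a (g s) (g1 s) (k s)) ->
  ito_id tm lam c dc Y a (fun x => \int[pi_]_(s in DS) g s x)
    (fun x => \int[pi_]_(s in DS) g1 s x) (fun x => \int[pi_]_(s in DS) k s x).
Proof.
move=> tm0 [pc pdc [M1 hM1] primc] [M hM] [pY pa [M2 hM2] primY] mg mg1 mk iB gB H.
have mL := prog_joint hF pL; have mY := prog_joint hF pY.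
have mc := prog_joint hF pc; have mdc := prog_joint hF pdc; have ma := prog_joint hF pa.
pose X r w := L r w + Y r w.
have mX : measurable_fun setT (fun p : R * T => X p.1 p.2) by apply: mrD.
have mXt r : 0 <= r -> measurable_fun setT (X r).
  by move=> r0; apply: mrD; apply: (prog_meas hF).
have M0 : 0 <= M by apply: le_trans (hM 0 point).
have M10 : 0 <= M1 by apply: le_trans (hM1 0 point).
have M20 : 0 <= M2 by apply: le_trans (hM2 0 point).
have B0 (s : S) : DS s -> 0 <= B s by move=> /(gB s 0)[h _ _]; exact: le_trans h.
have sec (h : S -> R -> R) x : measurable_fun setT (fun p : S * R => h p.1 p.2) ->
    measurable_fun setT (fun s : S => h s x).
  by move=> mh; exact: (measurableT_comp mh (pair2_measurable x)).
have ig x : itg pi_ DS (fun s : S => g s x).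
  apply: (itg_dom mDS _ iB); first exact/measurable_funTS/sec.
  by move=> s /(gB s x)[].
have ig1 x : itg pi_ DS (fun s : S => g1 s x).
  apply: (itg_dom mDS _ iB); first exact/measurable_funTS/sec.
  by move=> s /(gB s x)[].
have ik x : itg pi_ DS (fun s : S => k s x).
  apply: (itg_dom mDS _ iB); first exact/measurable_funTS/sec.
  by move=> s /(gB s x)[].
have fubE r (h : R) : 0 <= r ->
  \int[P]_w (h * c r w * \int[pi_]_(s in DS) g s (X r w)) =
  \int[pi_]_(s in DS) \int[P]_w (h * c r w * g s (X r w)) /\
  itg pi_ DS (fun s : S => \int[P]_w (h * c r w * g s (X r w))).
  move=> r0; have mcr := prog_meas hF pc r0; have mXr := mXt r r0.
  have mgx : measurable_fun setT (fun p : T * S => h * c r p.1 * g p.2 (X r p.1)).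
    apply: mrM; first by apply: mrM => //; exact: (measurableT_comp mcr measurable_fst).
    exact: (mrpair mg measurable_snd (measurableT_comp mXr measurable_fst)).
  have bg w (s : S) : setT w -> DS s -> `|h * c r w * g s (X r w)| <= `|h| * M * B s.
    by move=> _ Ds; have [bgs _ _] := gB s (X r w) Ds; rewrite normrM ler_pM// normrM ler_pM.
  have iC := itg_cst measurableT (`|h| * M) Pf.
  have := @Rfubini _ _ T S R P pi_ _ _ measurableT mDS (fun w (s : S) => h * c r w * g s (X r w)) _ _ mgx iC iB bg.
  have := @itg_fub2 _ _ T S R P pi_ _ _ measurableT mDS (fun w (s : S) => h * c r w * g s (X r w)) _ _ mgx iC iB bg.
  move=> h2 <-; split => //; apply: int_eq => w _.
  by rewrite RintegralZl.
have [e1 i1] := fubE tm (expR (- (lam * tm))) tm0.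
have [e2 i2] := fubE 0 1 (lexx 0).
have e2' : \int[P]_w (c 0 w * \int[pi_]_(s in DS) g s (X 0 w)) =
    \int[pi_]_(s in DS) \int[P]_w (c 0 w * g s (X 0 w)).
  have -> : \int[P]_w (c 0 w * \int[pi_]_(s in DS) g s (X 0 w)) =
     \int[P]_w (1 * c 0 w * \int[pi_]_(s in DS) g s (X 0 w)) by apply: int_eq => w _; rewrite mul1r.
  rewrite e2; apply: int_eq => s _; by apply: int_eq => w _; rewrite mul1r.
have i2' : itg pi_ DS (fun s : S => \int[P]_w (c 0 w * g s (X 0 w))).
  by apply: eq_integrable i2 => // s _; congr EFin; apply: int_eq => w _; rewrite mul1r.
rewrite /ito_id -/(X 0) e1 e2' -RintegralB//.
pose G r w (s : S) := expR (- (lam * r)) * (dc r w * g s (X r w) + c r w * (g1 s (X r w) * a r w - k s (X r w))).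
rewrite (_ : \int[pi_]_(s in DS) _ = \int[pi_]_(s in DS) ET tm (fun r w => G r w s)); last first.
  by apply: int_eq => s Ds; rewrite -(H s Ds).
pose CG := expR (`|lam| * tm) * (M1 + M * (M2 + 1)).
have CG0 : 0 <= CG by rewrite mulr_ge0 ?expR_ge0// addr_ge0// mulr_ge0// addr_ge0.
have hcomp (h : S -> R -> R) : measurable_fun setT (fun p : S * R => h p.1 p.2) ->
    measurable_fun setT (fun p : (R * T) * S => h p.2 (X p.1.1 p.1.2)).
  by move=> mh; exact: (mrpair mh measurable_snd (measurableT_comp mX measurable_fst)).
have pcomp (h : R -> T -> R) : measurable_fun setT (fun p : R * T => h p.1 p.2) ->
    measurable_fun setT (fun p : (R * T) * S => h p.1.1 p.1.2).
  by move=> mh; exact: (measurableT_comp mh measurable_fst).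
have mG : measurable_fun setT (fun p : (measurableTypeR R * T) * S => G p.1.1 p.1.2 p.2).
  have [hg hg1 hk] := And3 (hcomp _ mg) (hcomp _ mg1) (hcomp _ mk).
  have [hc hdc ha] := And3 (pcomp _ mc) (pcomp _ mdc) (pcomp _ ma).
  rewrite /G; mr.
  exact: (measurableT_comp measurable_fst measurable_fst).
have bG p (s : S) : (`[0, tm]%classic `*` [set: T]) p -> DS s -> `|G p.1 p.2 s| <= CG * B s.
  case: p => r w [/= + _] Ds; rewrite in_itv/= => /andP[r0 rt].
  have [bg bg1 bk] := gB s (X r w) Ds; have Bs0 := B0 s Ds.
  rewrite /G /CG normrM -mulrA ler_pM//.
    rewrite ger0_norm ?expR_ge0// ler_expR -mulNr (le_trans (ler_norm _))// normrM normrN.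
    by rewrite ler_wpM2l// ger0_norm.
  rewrite (le_trans (ler_normD _ _))// mulrDl lerD//; first by rewrite normrM ler_pM.
  rewrite normrM -mulrA ler_pM// (le_trans (ler_normB _ _))// mulrDl mul1r lerD//.
  by rewrite normrM mulrC ler_pM.
have iC := itg_cst (measurable_ET tm) CG (ET_fin tm).
rewrite -(@Rfubini _ _ (measurableTypeR R * T)%type S R (time_prod P) pi_ _ _ (measurable_ET tm) mDS
  (fun p (s : S) => G p.1 p.2 s) _ _ mG iC iB bG).
apply: int_eq => -[r w] _ /=; rewrite /G RintegralZl//; last first.
  by apply: itgD => //; apply: itgZ => //; apply: itgB => //; under eq_fun do rewrite mulrC; exact: itgZ.
congr (_ * _); rewrite RintegralD//; [|exact: itgZ|]; last first.
  by apply: itgZ => //; apply: itgB => //; under eq_fun do rewrite mulrC; exact: itgZ.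
rewrite !RintegralZl//; last first.
  by apply: itgB => //; under eq_fun do rewrite mulrC; exact: itgZ.
rewrite RintegralB//; first by rewrite RintegralZr.
by under eq_fun do rewrite mulrC; exact: itgZ.
Qed.

End ito.

(** * Mean values, remainders and integration by parts *)

Section calculus.
Context {R : realType}.
Notation leb := (@lebesgue_measure R).
Implicit Types (f g F G : R -> R) (s t x y : R).

Lemma mvt_lip f (f' : R -> R) (K : R) : (forall x, is_derive x 1 f (f' x)) ->
  (forall x, `|f' x| <= K) -> forall u v, `|f u - f v| <= K * `|u - v|.
Proof.
move=> df bf u v.
wlog uv : u v / u < v.
  move=> H; have [uv|vu|->] := ltgtP u v; first exact: H.
    by rewrite distrC (distrC u); exact: H.
  by rewrite !subrr normr0 mulr0.
have [|c _ e] := @MVT _ f f' u v uv (fun x _ => df x).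
  apply: derivable_within_continuous => x _; have -[] := df x; by [].
by rewrite distrC e normrM (distrC u) ler_wpM2r.
Qed.

Lemma sin_lip s t : `|sin s - sin t| <= `|s - t| :> R.
Proof.
rewrite -[leRHS]mul1r.
exact: (@mvt_lip sin cos 1 (fun x => is_derive_sin x) (fun x => cos_max x) s t).
Qed.

Lemma cos_lip s t : `|cos s - cos t| <= `|s - t| :> R.
Proof.
rewrite -[leRHS]mul1r; apply: (@mvt_lip cos (fun x => - sin x) 1 (fun x => is_derive_cos x)).
by move=> x; rewrite normrN; exact: sin_max.
Qed.

Lemma cos_taylor s t : `|cos t - cos s + sin s * (t - s)| <= (t - s) ^+ 2 :> R.
Proof.
rewrite -[leRHS]mul1r -[sin s]opprK mulNr.
apply: (@taylor1 R cos (fun x => - sin x) setT 1) => // u v _ _.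
by rewrite mul1r opprK addrC distrC; exact: sin_lip.
Qed.

(** Turns a quadratic remainder into differentiability. The kernels and potentials below are
    differentiated this way, through Taylor bounds under the integral sign. *)
Lemma quad_is_derive f (v K x : R) :
  (forall y, `|f y - f x - v * (y - x)| <= K * (y - x) ^+ 2) -> is_derive x 1 f v.
Proof.
move=> H.
have K0 : 0 <= K.
  have := H (x + 1); rewrite (_ : x + 1 - x = 1); last by ring.
  by rewrite expr1n !mulr1; apply: le_trans.
have h : h^-1 *: (f (h *: 1 + x) - f x) @[h --> 0^'] --> v.
  apply/cvgrPdist_le => e e0; near=> h.
  have h0 : h != 0 by near: h; exact: nbhs_dnbhs_neq.
  rewrite -[X in `|X - _|](mulKf h0) -[h^-1 *: _]/(h^-1 * _) -mulrBr normrM normfV.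
  rewrite mulrC ler_pdivrMr ?normr_gt0//.
  have := H (h *: 1 + x); rewrite -[h *: 1]/(h * 1) mulr1 addrK distrC => /le_trans.
  rewrite mulrC (mulrC v) => /(_ (e * `|h|)); apply.
  rewrite mulrC -[h ^+ 2]real_normK ?num_real// expr2 mulrA ler_wpM2r//.
  rewrite (@le_trans _ _ ((K + 1) * `|h|))//; first by rewrite ler_wpM2r// lerDl.
  rewrite mulrC -ler_pdivlMr ?ltr_wpDl//.
  near: h; apply: dnbhs0_le; rewrite divr_gt0// ltr_wpDl//.
by apply: DeriveDef; [apply/cvg_ex; exists v|apply: cvg_lim].
Unshelve. all: end_near. Qed.

Lemma ibp_C1 F G f g a b : a < b ->
  (forall x, is_derive x 1 F (f x)) -> continuous f ->
  (forall x, is_derive x 1 G (g x)) -> continuous g ->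
  \int[leb]_(x in `[a, b]) (F x * g x) = (F b * G b - F a * G a) -
  \int[leb]_(x in `[a, b]) (f x * G x).
Proof.
move=> ab dF cf dG cg.
have cont (H h : R -> R) : (forall x, is_derive x 1 H (h x)) -> continuous H.
  by move=> dH x; apply: differentiable_continuous; apply/derivable1_diffP; have -[] := dH x.
have LR (H h : R -> R) : (forall x, is_derive x 1 H (h x)) -> derivable_oo_LRcontinuous H a b.
  move=> dH; split; first by move=> x _; have -[] := dH x.
  - by apply: cvg_at_right_filter; exact: (cont _ _ dH).
  - by apply: cvg_at_left_filter; exact: (cont _ _ dH).
apply: Rintegration_by_parts => //.
- exact: continuous_subspaceT.
- exact: LR dF.
- by move=> x _; rewrite derive1E; apply: derive_val.
- exact: continuous_subspaceT.
- exact: LR dG.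
- by move=> x _; rewrite derive1E; apply: derive_val.
Qed.

Lemma is_derive_cosZ (a x : R) : is_derive x 1 (fun y => cos (a * y)) (- (a * sin (a * x))).
Proof.
apply: (@quad_is_derive _ _ (a ^+ 2)) => y.
have := cos_taylor (a * x) (a * y); rewrite -mulrBr exprMn.
by congr (`|_| <= _); ring.
Qed.

Lemma is_derive_sinZ (a x : R) : is_derive x 1 (fun y => sin (a * y)) (a * cos (a * x)).
Proof.
apply: (@quad_is_derive _ _ (a ^+ 2)) => y.
have -> : a * cos (a * x) * (y - x) = cos (a * x) * (a * y - a * x) by ring.
rewrite -exprMn (mulrBr a y x) -[leRHS]mul1r.
apply: (@taylor1 R sin cos setT 1) => // u v _ _; rewrite mul1r; exact: cos_lip.
Qed.

Lemma continuous_bounded_itv f a b : a <= b -> continuous f ->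
  exists M, forall x, a <= x <= b -> `|f x| <= M.
Proof.
move=> ab cf.
have [|c _ H] := @EVT_max R (fun x => `|f x|) a b ab.
  by apply: continuous_subspaceT => x; apply: cvg_norm; exact: cf.
by exists `|f c| => x xab; apply: H; rewrite in_itv.
Qed.

Lemma bound_ge0 (I : Type) (f : I -> R) (S : I -> Prop) :
  (exists M, forall x : I, S x -> `|f x| <= M) -> exists2 M : R, 0 <= M & forall x : I, S x -> `|f x| <= M.
Proof.
move=> [M H]; exists (Num.max M 0); first by rewrite le_max lexx orbT.
by move=> x /H h; rewrite le_max h.
Qed.

End calculus.

(** * Mollifiers and resolvent kernels *)

Section mollifier_facts.
Context {R : realType} (phi : R -> R).
Notation leb := (@lebesgue_measure R).
Hypothesis hphi : mollifier phi.

Let phi1 : R -> R := derive1 phi.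
Let phi2 : R -> R := derive1 (derive1 phi).

Lemma phi_ge0 x : 0 <= phi x. Proof. by have [] := hphi. Qed.
Lemma phi_even x : phi (- x) = phi x. Proof. by have [] := hphi. Qed.

Let derivable_continuous (f : R -> R) : (forall x, derivable f x 1) -> continuous f.
Proof. by move=> df x; apply: differentiable_continuous; apply/derivable1_diffP. Qed.

Let is_derive_phi (x : R) : is_derive x 1 phi (phi1 x).
Proof.
have [_ _ sm _ _] := hphi; apply: DeriveDef; first exact: (sm 0%N).
by rewrite /phi1 derive1E.
Qed.

Let is_derive_phi1 (x : R) : is_derive x 1 phi1 (phi2 x).
Proof.
have [_ _ sm _ _] := hphi; apply: DeriveDef; first exact: (sm 1%N).
by rewrite /phi2 derive1E.
Qed.

Lemma phi_cont : continuous phi.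
Proof. by apply: derivable_continuous => x; have -[] := is_derive_phi x. Qed.

Let phi1_cont : continuous phi1.
Proof. by apply: derivable_continuous => x; have -[] := is_derive_phi1 x. Qed.

Let phi2_cont : continuous phi2.
Proof. by have [_ _ sm _ _] := hphi; apply: derivable_continuous; exact: (sm 2%N). Qed.

Let phi_out1 x : 1 < `|x| -> phi x = 0.
Proof.
have [_ _ _ supp _] := hphi; move=> x1; apply/eqP/negPn/negP => nz.
have : closure [set x | phi x != 0] x by exact: subset_closure.
by rewrite supp /= in_itv/= -ler_norml leNgt x1.
Qed.

Let cont_zero_at1 (f : R -> R) : continuous f -> (forall x, 1 < `|x| -> f x = 0) ->
  forall x, 1 <= `|x| -> f x = 0.
Proof.
move=> cf f0 x; rewrite le_eqVlt => /predU1P[x1|]; last exact: f0.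
have c : f (x * (1 + n.+1%:R^-1)) @[n --> \oo] --> f x.
  have c1 : x * (1 + n.+1%:R^-1) @[n --> \oo] --> x * (1 + 0).
    by apply: cvgM; [exact: cvg_cst|apply: cvgD; [exact: cvg_cst|exact: cvg_harmonic]].
  rewrite addr0 mulr1 in c1.
  exact: (cvg_comp _ _ c1 (cf x)).
have c0 : f (x * (1 + n.+1%:R^-1)) @[n --> \oo] --> (0 : R).
  apply: cvg_near_cst; near=> n; apply: f0.
  by rewrite normrM -x1 mul1r ger0_norm ?addr_ge0// ltrDl.
exact: (cvg_unique _ c c0).
Unshelve. all: end_near. Qed.

(** The support condition gives the strict inequality; continuity adds the endpoints, where the
    boundary terms of the integrations by parts have to vanish. *)
Lemma phi_out x : 1 <= `|x| -> phi x = 0.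
Proof. exact/(cont_zero_at1 phi_cont). Qed.

Let phi1_out x : 1 <= `|x| -> phi1 x = 0.
Proof.
apply: (cont_zero_at1 phi1_cont) => {}x x1.
rewrite /phi1 derive1E; have /= <- := @derive_val _ _ _ x 1 (cst 0) _ (is_derive_cst 0 x 1).
apply: near_eq_derive.
have : \forall y \near x, 1 < `|y|.
  have cn : `|y| @[y --> x] --> `|x| by exact: norm_continuous.
  exact: (cvgr_gt _ cn).
by apply: filterS => y; exact: phi_out1.
Qed.

Let phi_meas : measurable_fun setT phi.
Proof. exact: continuous_measurable_fun phi_cont. Qed.

Lemma phi_bound : exists2 M : R, 0 <= M & forall x, `|phi x| <= M.
Proof.
have le11 : -1 <= 1 :> R by rewrite (le_trans (lerN10 _)).
have [M M0 hM] := bound_ge0 (continuous_bounded_itv le11 phi_cont).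
exists M => // x; have [x1|x1] := leP 1 `|x|; first by rewrite phi_out// normr0.
by apply: hM; rewrite -ler_norml ltW.
Qed.

Lemma phi_lip : exists2 K : R, 0 <= K & forall x y, `|phi x - phi y| <= K * `|x - y|.
Proof.
have le11 : -1 <= 1 :> R by rewrite (le_trans (lerN10 _)).
have [M M0 hM] := bound_ge0 (continuous_bounded_itv le11 phi1_cont).
exists M => //; apply: (mvt_lip is_derive_phi) => x.
have [x1|x1] := leP 1 `|x|; first by rewrite phi1_out// normr0.
by apply: hM; rewrite -ler_norml ltW.
Qed.

Lemma phi_itg : itg leb `[-1, 1]%classic phi.
Proof.
have [M _ hM] := phi_bound.
apply: (itg_bnd _ (leb_cc_fin _ _) (M := M)) => //; exact: measurable_funTS.
Qed.

Lemma phi_int1 : \int[leb]_(y in `[-1, 1]) phi y = 1.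
Proof.
have [_ _ _ _ h] := hphi; rewrite /Rintegral -[RHS]/(fine 1%E) -h; congr fine.
rewrite integral_mkcond; apply: eq_integral => x _; rewrite patchE; case: ifPn => //.
rewrite notin_setE /= in_itv/= -ler_norml => /negP; rewrite -ltNge => /ltW x1.
by rewrite phi_out.
Qed.

(** Since [phi] is even, this is its Fourier transform; [mhat1] is the derivative. *)
Definition mhat xi := \int[leb]_(y in `[-1, 1]) (phi y * cos (xi * y)).
Definition mhat1 xi := - \int[leb]_(y in `[-1, 1]) (phi y * (y * sin (xi * y))).

Let itgc (h : R -> R) : measurable_fun setT h -> (forall y, `|y| <= 1 -> `|h y| <= 1) ->
  itg leb `[-1, 1]%classic (fun y => phi y * h y).
Proof.
move=> mh bh; apply: (itg_dom _ _ phi_itg) => //.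
- by apply: measurable_funTS; exact: mrM.
- move=> y /=; rewrite in_itv/= -ler_norml => /bh h1.
  by rewrite normrM (ger0_norm (phi_ge0 y)) -[leRHS]mulr1 ler_wpM2l// phi_ge0.
Qed.

Let int_le (h : R -> R) (K : R) : measurable_fun setT h -> (forall y, `|y| <= 1 -> `|h y| <= K) ->
  `|\int[leb]_(y in `[-1, 1]) (phi y * h y)| <= K.
Proof.
move=> mh bh; rewrite -[leRHS]mulr1 -[X in _ <= _ * X]phi_int1 -RintegralZl//; last exact: phi_itg.
apply: int_dom => //.
- by apply: measurable_funTS; exact: mrM.
- by apply: itgZ => //; exact: phi_itg.
- move=> y /=; rewrite in_itv/= -ler_norml => /bh h1.
  by rewrite normrM (ger0_norm (phi_ge0 y)) mulrC ler_wpM2r// phi_ge0.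
Qed.

Let mcos (xi : R) : measurable_fun setT (fun y : R => cos (xi * y)). Proof. by mr. Qed.
Let msin (xi : R) : measurable_fun setT (fun y : R => sin (xi * y)). Proof. by mr. Qed.

Let mysin (xi : R) : measurable_fun setT (fun y : R => y * sin (xi * y)).
Proof. by mr. Qed.

Let ysin_le (xi y : R) : `|y| <= 1 -> `|y * sin (xi * y)| <= 1.
Proof. by move=> y1; rewrite normrM mulr_ile1// sin_max. Qed.

Lemma mhat_le1 xi : `|mhat xi| <= 1.
Proof. by apply: int_le => // y _; exact: cos_max. Qed.

Lemma mhat_taylor s t : `|mhat t - mhat s - mhat1 s * (t - s)| <= (t - s) ^+ 2.
Proof.
rewrite /mhat /mhat1 mulNr opprK -RintegralB//; try by apply: itgc => // y _; exact: cos_max.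
have ig : itg leb `[-1, 1]%classic (fun y => phi y * (y * sin (s * y))).
  by apply: itgc => // y; exact: ysin_le.
rewrite -RintegralZr// -RintegralD//; last 2 first.
- by apply: itgB => //; apply: itgc => // y _; exact: cos_max.
- exact: itgZr.
rewrite (_ : Rintegral _ _ _ = \int[leb]_(y in `[-1, 1]) (phi y *
   (cos (t * y) - cos (s * y) + y * sin (s * y) * (t - s)))); last first.
  by apply: int_eq => y _; ring.
apply: int_le; first by mr.
move=> y y1; have := cos_taylor (s * y) (t * y).
rewrite -mulrBl exprMn (_ : sin (s * y) * _ = y * sin (s * y) * (t - s)); last by ring.
move=> /le_trans; apply.
by rewrite ler_piMr ?sqr_ge0// -[y ^+ 2]real_normK ?num_real// exprn_ile1.
Qed.

Lemma is_derive_mhat (s : R) : is_derive s 1 mhat (mhat1 s).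
Proof. by apply: (quad_is_derive (K := 1)) => t; rewrite mul1r; exact: mhat_taylor. Qed.

Lemma mhat1_lip s t : `|mhat1 s - mhat1 t| <= `|s - t|.
Proof.
rewrite /mhat1 -opprD normrN -RintegralB//; try by apply: itgc => // y; exact: ysin_le.
rewrite (_ : Rintegral _ _ _ = \int[leb]_(y in `[-1, 1]) (phi y *
   (y * (sin (s * y) - sin (t * y))))); last by apply: int_eq => y _; ring.
apply: int_le; first by mr.
move=> y y1; rewrite normrM (le_trans (ler_piMl _ y1))// (le_trans (sin_lip _ _))//.
by rewrite -mulrBl normrM ler_piMr.
Qed.

Lemma mhat1_le1 xi : `|mhat1 xi| <= 1.
Proof. by rewrite normrN; apply: int_le => // y; exact: ysin_le. Qed.

(** One integration by parts, applied to [phi y * y]. The quantity [xi * mhat1 xi] is invariant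
    under dilations, hence a bound for it serves all levels of mollification at once. *)
Lemma mhat1_decay : exists2 C : R, 0 <= C & forall xi, `|xi * mhat1 xi| <= C.
Proof.
have le11 : -1 <= 1 :> R by rewrite (le_trans (lerN10 _)).
have lt11 : -1 < 1 :> R by rewrite (lt_le_trans (ltrN10 _)).
pose h y := phi y + y * phi1 y.
have ch : continuous h.
  by move=> y; apply: cvgD; [exact: phi_cont|apply: cvgM; [exact: cvg_id|exact: phi1_cont]].
have [M M0 hM] := bound_ge0 (continuous_bounded_itv le11 ch).
exists (M * 2); first by rewrite mulr_ge0.
move=> xi.
have dF (x : R) : is_derive x 1 (fun y => phi y * y) (h x).
  apply: (is_derive_eq (is_deriveM (is_derive_phi x) (is_derive_id x (1 : R)))).
  by rewrite /h -[_ *: 1]/(phi x * 1) mulr1.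
have e := ibp_C1 lt11 dF ch (is_derive_cosZ xi) _.
have {}e : \int[leb]_(y in `[-1, 1]) (phi y * y * - (xi * sin (xi * y))) =
    - \int[leb]_(y in `[-1, 1]) (h y * cos (xi * y)).
  rewrite e; last first.
    by move=> y; apply: cvgN; apply: cvgM; [exact: cvg_cst|
      apply: continuous_comp; [apply: cvgM; [exact: cvg_cst|exact: cvg_id]|exact: continuous_sin]].
  by rewrite !phi_out ?normrN ?normr1// !mul0r subrr sub0r.
have -> : xi * mhat1 xi = \int[leb]_(y in `[-1, 1]) (phi y * y * - (xi * sin (xi * y))).
  rewrite /mhat1 mulrN -mulNr -RintegralZl//; last by apply: itgc => // y; exact: ysin_le.
  by apply: int_eq => y _; ring.
rewrite e normrN (_ : 2 = fine (leb `[-1, 1]%classic)); last by rewrite leb_ccE// opprK.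
apply: int_bnd => //; first exact: leb_cc_fin.
  apply: measurable_funTS; apply: mrM; [exact: (continuous_measurable_fun ch)|by mr].
by move=> y /=; rewrite in_itv/= => hy; rewrite normrM -[leRHS]mulr1 ler_pM ?cos_max ?hM.
Qed.

(** Two integrations by parts. The quadratic decay makes every kernel regular at a fixed level of
    mollification, although not uniformly in the level. *)
Lemma mhat_decay : exists2 C : R, 0 <= C & forall xi, `|xi ^+ 2 * mhat xi| <= C.
Proof.
have le11 : -1 <= 1 :> R by rewrite (le_trans (lerN10 _)).
have lt11 : -1 < 1 :> R by rewrite (lt_le_trans (ltrN10 _)).
have [M M0 hM] := bound_ge0 (continuous_bounded_itv le11 phi2_cont).
exists (M * 2); first by rewrite mulr_ge0.
move=> xi.
have cc : continuous (fun y : R => cos (xi * y)).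
  move=> y; apply: continuous_comp; last exact: continuous_cos.
  by apply: cvgM; [exact: cvg_cst|exact: cvg_id].
have cs : continuous (fun y : R => sin (xi * y)).
  move=> y; apply: continuous_comp; last exact: continuous_sin.
  by apply: cvgM; [exact: cvg_cst|exact: cvg_id].
have e1 : \int[leb]_(y in `[-1, 1]) (phi y * (xi * cos (xi * y))) =
    - \int[leb]_(y in `[-1, 1]) (phi1 y * sin (xi * y)).
  rewrite (ibp_C1 lt11 is_derive_phi phi1_cont (is_derive_sinZ xi)); last first.
    by move=> y; apply: cvgM; [exact: cvg_cst|exact: cc].
  by rewrite !phi_out ?normrN ?normr1// !mul0r subrr sub0r.
have e2 : \int[leb]_(y in `[-1, 1]) (phi1 y * - (xi * sin (xi * y))) =
    - \int[leb]_(y in `[-1, 1]) (phi2 y * cos (xi * y)).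
  rewrite (ibp_C1 lt11 is_derive_phi1 phi2_cont (is_derive_cosZ xi)); last first.
    by move=> y; apply: cvgN; apply: cvgM; [exact: cvg_cst|exact: cs].
  by rewrite !phi1_out ?normrN ?normr1// !mul0r subrr sub0r.
have ig : itg leb `[-1, 1]%classic (fun y => phi1 y * sin (xi * y)).
  have [M1 M10 hM1] := bound_ge0 (continuous_bounded_itv le11 phi1_cont).
  apply: (itg_bnd _ (leb_cc_fin _ _) (M := M1 * 1)) => //.
    apply: measurable_funTS; apply: mrM; [exact: (continuous_measurable_fun phi1_cont)|by mr].
  by move=> y /=; rewrite in_itv/= => hy; rewrite normrM ler_pM ?sin_max ?hM1.
have -> : xi ^+ 2 * mhat xi = - \int[leb]_(y in `[-1, 1]) (phi2 y * cos (xi * y)).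
  rewrite -e2 (_ : \int[leb]_(y in `[-1, 1]) (phi1 y * - (xi * sin (xi * y))) =
     (- xi) * \int[leb]_(y in `[-1, 1]) (phi1 y * sin (xi * y))); last first.
    by rewrite -RintegralZl//; apply: int_eq => y _; ring.
  rewrite mulNr -mulrN -e1 expr2 -mulrA; congr (_ * _).
  rewrite /mhat -RintegralZl//; last by apply: itgc => // y _; exact: cos_max.
  by apply: int_eq => y _; ring.
rewrite normrN (_ : 2 = fine (leb `[-1, 1]%classic)); last by rewrite leb_ccE// opprK.
apply: int_bnd => //; first exact: leb_cc_fin.
  apply: measurable_funTS; apply: mrM; [exact: (continuous_measurable_fun phi2_cont)|by mr].
by move=> y /=; rewrite in_itv/= => hy; rewrite normrM -[leRHS]mulr1 ler_pM ?cos_max ?hM.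
Qed.

End mollifier_facts.

(** * Powers on the half-line and oscillatory integrals *)

Section half_line.
Context {R : realType}.
Notation leb := (@lebesgue_measure R).
Notation HL := (`[(0 : R), +oo[%classic).

Let mHL : measurable (HL : set (measurableTypeR R)) := measurable_itv _.

Lemma int_HL_cvg (f : R -> R) : itg leb HL f ->
  \int[leb]_(x in `[0, n%:R]) f x @[n --> \oo] --> \int[leb]_(x in HL) f x.
Proof.
move=> hf; have mf := itg_meas hf.
have E (n : nat) : \int[leb]_(x in `[0, n%:R]) f x =
    \int[leb]_(x in HL) (f \_ `[0, n%:R]%classic) x.
  rewrite -Rintegral_mkcondr; congr (Rintegral _ _ _).
  apply/seteqP; split => x /=; rewrite !in_itv/=; last by case.
  by move=> /[dup] /andP[x0 _]; rewrite x0.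
rewrite (funext E).
apply: (int_cvg mHL (g := fun x => `|f x|)).
- by move=> n; apply/measurable_restrict => //; apply: measurable_funS mf => //; exact: subIsetl.
- exact: itg_norm.
- by move=> n x _; rewrite patchE; case: ifPn => _ //; rewrite normr0.
- move=> x /=; rewrite in_itv/= andbT => x0.
  apply: cvg_near_cst; near=> n; rewrite patchE mem_set//= in_itv/= x0.
  by near: n; exact: nbhs_infty_ger.
Unshelve. all: end_near. Qed.

Lemma is_derive_powR (a x : R) : 0 < x -> is_derive x 1 (fun y => y `^ a) (a * x `^ (a - 1)).
Proof.
move=> x0; have xin : x \in `]0, +oo[%R by rewrite in_itv/= x0.
apply: DeriveDef; first exact: derivable_powR.
by rewrite -derive1E powR_derive1.
Qed.

Lemma is_derive_shift_powR (a x : R) : 0 <= x ->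
  is_derive x 1 (fun y => (1 + y) `^ a) (a * (1 + x) `^ (a - 1)).
Proof.
move=> x0; have x1 : 0 < 1 + x by rewrite ltr_pwDl.
have h := @is_derive1_comp R (fun y => y `^ a) (fun y => 1 + y) x _ 1 (is_derive_powR a x1) _.
apply: (is_derive_eq (h _)); last by rewrite mulr1.
by apply: (is_derive_eq (is_deriveD (is_derive_cst (1 : R) x (1 : R)) (is_derive_id x (1 : R)))); rewrite add0r.
Qed.

Lemma powR_norm_cvg0 (a : R) : 0 < a -> `|x| `^ a @[x --> (0 : R)] --> (0 : R).
Proof.
move=> a0; apply/cvgrPdist_le => e e0.
have ea : 0 < e `^ a^-1 by rewrite powR_gt0.
have := @nbhs0_le R R _ ea; apply: filterS => y ye.
rewrite sub0r normrN ger0_norm ?powR_ge0//.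
rewrite [leRHS](_ : e = (e `^ a^-1) `^ a); last first.
  by rewrite -powRrM mulVf ?gt_eqF// powRr1// ltW.
by rewrite ge0_ler_powR ?nnegrE ?powR_ge0 ?(ltW a0).
Qed.

Lemma powR_norm_cont (a : R) : 0 < a -> continuous (fun x : R => `|x| `^ a).
Proof.
move=> a0 x; have [->|x0] := eqVneq x 0.
  by rewrite /continuous_at normr0 powR0 ?gt_eqF//; exact: powR_norm_cvg0.
have nx0 : 0 < `|x| by rewrite normr_gt0.
apply: (@continuous_comp _ _ _ (fun y : R => `|y|) (fun y => y `^ a)).
  exact: norm_continuous.
apply: differentiable_continuous; apply/derivable1_diffP.
by have -[] := is_derive_powR a nx0.
Qed.

Lemma shift_powR_itg (p : R) : 1 < p -> itg leb HL (fun x => (1 + x) `^ (- p)).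
Proof.
move=> p1.
have cF (a x : R) : 0 <= x -> {for x, continuous (fun y : R => (1 + y) `^ a)}.
  move=> x0; apply: differentiable_continuous; apply/derivable1_diffP.
  by have -[] := is_derive_shift_powR a x0.
have q0 : 0 < p - 1 by rewrite subr_gt0.
have cw : {within HL, continuous (fun x => (1 + x) `^ (- p))}.
  by apply: continuous_in_subspaceT => x /set_mem /=; rewrite in_itv/= andbT; exact: cF.
have H := @ge0_continuous_FTC2y R (fun x => (1 + x) `^ (- p))
  (fun x => - (p - 1)^-1 * (1 + x) `^ (1 - p)) 0 0 _ cw _ _ _ _.
apply/integrableP; split.
  by apply/measurable_EFinP; exact: subspace_continuous_measurable_fun.
under eq_integral => x _ do rewrite /= ger0_norm ?powR_ge0//.
rewrite H; [exact: ltry| | | | |].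
- by move=> x _; exact: powR_ge0.
- rewrite -[X in _ --> X](mulr0 (- (p - 1)^-1)); apply: cvgM; first exact: cvg_cst.
  apply/cvgrPdist_le => e e0; near=> x; rewrite sub0r normrN ger0_norm ?powR_ge0//.
  have x0 : 0 <= x by near: x; exact: nbhs_pinfty_ge.
  have -> : e = ((e^-1) `^ (p - 1)^-1) `^ (1 - p).
    rewrite -powRrM -[1 - p]opprB [X in _ `^ X]mulrN mulVf ?gt_eqF// powRN powRr1 ?invr_ge0 ?(ltW e0)//.
    by rewrite invrK.
  rewrite -[1 - p]opprB !powRN lef_pV2 ?posrE ?powR_gt0 ?invr_gt0 ?ltr_pwDl//.
  have xe : e^-1 `^ (p - 1)^-1 <= x.
    by near: x; apply: nbhs_pinfty_ge; exact: num_real.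
  have x1 : 0 <= 1 + x by rewrite addr_ge0.
  rewrite ge0_ler_powR ?nnegrE ?powR_ge0 ?(ltW q0)//.
  by rewrite (le_trans xe)// lerDr.
- move=> x x0; apply: derivableM; first exact: derivable_cst.
  by have -[] := is_derive_shift_powR (1 - p) (ltW x0).
- apply: cvgM; first exact: cvg_cst.
  apply: cvg_at_right_filter; exact: (cF (1 - p) 0 (lexx _)).
- move=> x; rewrite in_itv/= andbT => x0; rewrite derive1E.
  have d1 := is_derive_shift_powR (1 - p) (ltW x0).
  have -> : (1 + x) `^ (- p) = - (p - 1)^-1 * ((1 - p) * (1 + x) `^ (1 - p - 1)).
    rewrite mulrA -[1 - p]opprB mulNr mulrN mulVf ?gt_eqF// opprK mul1r.
    by congr (_ `^ _); rewrite opprB; ring.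
  have h := is_deriveZ (- (p - 1)^-1) d1; exact: derive_val.
Unshelve. all: end_near. Qed.

End half_line.

Section oscillatory.
Context {R : realType}.
Notation leb := (@lebesgue_measure R).
Notation HL := (`[(0 : R), +oo[%classic).

Let mHL : measurable (HL : set (measurableTypeR R)) := measurable_itv _.
Implicit Types (G B b : R -> R) (x z : R).

(** Up to normalisation, the inverse Fourier transform of the even extension of [G]; [skern] is its
    derivative in [z]. *)
Definition ckern G z := \int[leb]_(xi in HL) (G xi * cos (xi * z)).
Definition skern G z := \int[leb]_(xi in HL) (G xi * (- (xi * sin (xi * z)))).

Let HLge0 xi : HL xi -> 0 <= xi. Proof. by rewrite /= in_itv/= andbT. Qed.

(** Two integrable moments, which is what makes [ckern] differentiable with a Lipschitz
    derivative. *)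
Definition dom2 G := measurable_fun setT G /\
  exists2 B, itg leb HL B & forall xi, 0 <= xi -> `|G xi| * (1 + xi ^+ 2) <= B xi.

Lemma dom2_mul G (w : R -> R) (c : R) : dom2 G -> measurable_fun setT w ->
  (forall xi, 0 <= xi -> `|w xi| <= c * (1 + xi ^+ 2)) -> itg leb HL (fun xi => G xi * w xi).
Proof.
move=> [mG [B iB hB]] mw hw; apply: (itg_dom mHL _ (itgZ mHL c iB)).
  by apply: measurable_funTS; exact: mrM.
move=> xi /HLge0 x0; rewrite normrM (le_trans (ler_wpM2l _ (hw _ x0)))//.
rewrite mulrCA ler_wpM2l ?hB//.
have := hw xi x0; have := normr_ge0 (w xi) => /le_trans h /h.
by rewrite pmulr_lge0// ltr_wpDr ?sqr_ge0.
Qed.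

Lemma xi_le_sq (xi : R) : `|xi| <= 1 * (1 + xi ^+ 2).
Proof.
rewrite mul1r -[xi ^+ 2]real_normK ?num_real//.
have : 0 <= (`|xi| - 1) ^+ 2 by exact: sqr_ge0.
rewrite sqrrB1; have := normr_ge0 xi; nra.
Qed.

Lemma one_le_sq (xi : R) : 1 <= 1 * (1 + xi ^+ 2).
Proof. by rewrite mul1r lerDl sqr_ge0. Qed.

Lemma dom2_cos G z : dom2 G -> itg leb HL (fun xi => G xi * cos (xi * z)).
Proof.
move=> dG; apply: (dom2_mul (c := 1) dG); first by mr.
by move=> xi _; rewrite (le_trans (cos_max _))// one_le_sq.
Qed.

Lemma dom2_sin G z : dom2 G -> itg leb HL (fun xi => G xi * - (xi * sin (xi * z))).
Proof.
move=> dG; apply: (dom2_mul (c := 1) dG); first by mr.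
move=> xi _; rewrite normrN normrM (le_trans _ (xi_le_sq _))//.
by rewrite ler_piMr// sin_max.
Qed.

Lemma dom2_sqr G : dom2 G -> itg leb HL (fun xi => `|G xi| * xi ^+ 2).
Proof.
move=> [mG [B iB hB]]; apply: (itg_dom mHL _ iB).
  by apply: measurable_funTS; apply: mrM; [mr|exact: exprn_measurable].
move=> xi /HLge0 x0; rewrite ger0_norm ?mulr_ge0 ?sqr_ge0//.
by rewrite (le_trans _ (hB _ x0))// ler_wpM2l// lerDr.
Qed.

Lemma ckernB G G' z : dom2 G -> dom2 G' ->
  ckern (fun xi => G xi - G' xi) z = ckern G z - ckern G' z.
Proof.
move=> dG dG'; rewrite /ckern -RintegralB//; try exact: dom2_cos.
by apply: int_eq => xi _; rewrite mulrBl.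
Qed.

Lemma skernB G G' z : dom2 G -> dom2 G' ->
  skern (fun xi => G xi - G' xi) z = skern G z - skern G' z.
Proof.
move=> dG dG'; rewrite /skern -RintegralB//; try exact: dom2_sin.
by apply: int_eq => xi _; rewrite mulrBl.
Qed.

Lemma ckern_le G b z : dom2 G -> itg leb HL b -> (forall xi, 0 <= xi -> `|G xi| <= b xi) ->
  `|ckern G z| <= \int[leb]_(xi in HL) b xi.
Proof.
move=> dG ib hb; apply: int_dom => //.
  by apply: measurable_funTS; have [mG _] := dG; mr.
by move=> xi /HLge0 x0; rewrite normrM (le_trans _ (hb _ x0))// ler_piMr// cos_max.
Qed.

Definition second_moment G := \int[leb]_(xi in HL) (`|G xi| * xi ^+ 2).

Lemma second_moment_ge0 G : 0 <= second_moment G.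
Proof. by apply: Rintegral_ge0 => xi _; rewrite mulr_ge0 ?sqr_ge0. Qed.

Lemma ckern_taylor G z z' : dom2 G ->
  `|ckern G z' - ckern G z - skern G z * (z' - z)| <= second_moment G * (z' - z) ^+ 2.
Proof.
move=> dG; have [mG _] := dG.
rewrite /ckern /skern -RintegralB//; try exact: dom2_cos.
rewrite -RintegralZr//; last exact: dom2_sin.
rewrite -RintegralB//; last 2 first.
- by apply: itgB => //; exact: dom2_cos.
- by apply: itgZr => //; exact: dom2_sin.
rewrite /second_moment -RintegralZr//; last exact: dom2_sqr.
apply: int_dom => //; [|exact: (itgZr _ _ (dom2_sqr dG))|].
  by apply: measurable_funTS; mr.
move=> xi _.
rewrite (_ : G xi * cos (xi * z') - G xi * cos (xi * z) - G xi * - (xi * sin (xi * z)) * (z' - z) =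
  G xi * (cos (xi * z') - cos (xi * z) + sin (xi * z) * (xi * z' - xi * z))); last by ring.
rewrite normrM -mulrA ler_wpM2l// (le_trans (cos_taylor _ _))//.
by rewrite -mulrBr exprMn.
Qed.

Lemma skern_lip G z z' : dom2 G -> `|skern G z' - skern G z| <= second_moment G * `|z' - z|.
Proof.
move=> dG; have [mG _] := dG.
rewrite /skern -RintegralB//; try exact: dom2_sin.
rewrite /second_moment -RintegralZr//; last exact: dom2_sqr.
apply: int_dom => //; [|exact: (itgZr _ _ (dom2_sqr dG))|].
  by apply: measurable_funTS; mr.
move=> xi _; rewrite (_ : G xi * - (xi * sin (xi * z')) - G xi * - (xi * sin (xi * z)) =
  - (G xi * (xi * (sin (xi * z') - sin (xi * z))))); last by ring.
rewrite normrN normrM -mulrA ler_wpM2l// normrM.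
rewrite (le_trans (ler_wpM2l _ (sin_lip _ _)))// -mulrBr normrM mulrA -expr2.
by rewrite real_normK ?num_real.
Qed.

(** The left side is at least of second order near 0 and at most linear at infinity, so that any
    exponent between one and two interpolates. *)
Lemma sin_sub_cos_le (eta y : R) : 0 < eta -> eta < 1 ->
  `|sin y - y * cos y| <= 2 * `|y| `^ (1 + eta).
Proof.
move=> e0 e1; have [->|y0] := eqVneq y 0.
  by rewrite sin0 mul0r subrr normr0 mulr_ge0// powR_ge0.
have ny0 : 0 < `|y| by rewrite normr_gt0.
have [y1|y1] := leP `|y| 1.
  have h1 : `|sin y - y * cos y| <= 2 * `|y| ^+ 2.
    rewrite (_ : sin y - y * cos y = (sin y - sin 0 - cos 0 * (y - 0)) + y * (cos 0 - cos y)); last first.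
      by rewrite sin0 cos0; ring.
    rewrite (le_trans (ler_normD _ _))// mulrDl mul1r lerD//.
      rewrite real_normK ?num_real// -[y ^+ 2]mul1r -[in leRHS](subr0 y).
      apply: (@taylor1 R sin cos setT 1) => // u v _ _; rewrite mul1r; exact: cos_lip.
    by rewrite normrM expr2 ler_wpM2l// (le_trans (cos_lip _ _))// sub0r normrN.
  rewrite (le_trans h1)// ler_wpM2l// -powR_mulrn//.
  by rewrite ger_powR ?ny0// (_ : 2%:R = 1 + 1 :> R)// lerD2l ltW.
have h1 : `|sin y - y * cos y| <= 2 * `|y|.
  rewrite (le_trans (ler_normB _ _))// mulrDl mul1r lerD//.
    by rewrite (le_trans (sin_max _))// ltW.
  by rewrite normrM ler_piMr// cos_max.
rewrite (le_trans h1)// ler_wpM2l// -[leLHS]powRr1//.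
by apply: ler_powR; [exact: ltW|rewrite lerDl ltW].
Qed.

(** One integration by parts against [S], whose derivative is [z ^+ 2 * (xi * sin (xi * z))],
    together with a bound [2 |xi z|^(1 + eta)] on [S]; division by [z ^+ 2] leaves the exponent
    [eta - 1]. Spending a single derivative of [G] matters, because [|xi|^alpha] is not twice
    differentiable at 0 for [alpha < 2]. *)
Lemma skern_ibp G G' b (eta z : R) : 0 < eta -> eta < 1 -> dom2 G ->
  continuous G -> continuous G' ->
  (forall xi : R, 0 < xi -> is_derive xi 1 G (G' xi)) ->
  (exists C : R, forall xi : R, 0 <= xi -> `|G xi| * xi ^+ 2 <= C) ->
  itg leb HL b -> (forall xi : R, 0 < xi -> xi `^ (1 + eta) * `|G' xi| <= b xi) ->
  (forall xi, 0 <= b xi) ->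
  `|skern G z| <= 2 * (\int[leb]_(xi in HL) b xi) * `|z| `^ (eta - 1).
Proof.
move=> e0 e1 dG cG cG' derG [C hC] ib hb b0.
have Ib0 : 0 <= \int[leb]_(xi in HL) b xi by apply: Rintegral_ge0 => xi _.
(* A negative power of 0 has the value 0 here; the bound is still correct because the kernel
   vanishes at 0. *)
have [->|z0] := eqVneq z 0.
  rewrite /skern (int_eq _ (g := fun=> 0)); last by move=> xi _; rewrite mulr0 sin0 mulr0 oppr0 mulr0.
  by rewrite /Rintegral integral0 normr0 mulr_ge0 ?mulr_ge0// powR_ge0.
have nz0 : 0 < `|z| by rewrite normr_gt0.
suff main : z ^+ 2 * `|skern G z| <= 2 * `|z| `^ (1 + eta) * \int[leb]_(xi in HL) b xi.
  rewrite -(@ler_pM2l _ (z ^+ 2)) ?exprn_even_gt0// (le_trans main)//.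
  have -> : `|z| `^ (1 + eta) = z ^+ 2 * `|z| `^ (eta - 1).
    rewrite (_ : 1 + eta = 2%:R + (eta - 1)); last by ring.
    rewrite [LHS]powRD; last by rewrite normr_eq0 z0 implybT.
    by congr (_ * _); rewrite powR_mulrn// real_normK ?num_real.
  by rewrite le_eqVlt; apply/orP; left; apply/eqP; ring.
pose S xi := sin (xi * z) - z * xi * cos (xi * z).
pose S' xi := z ^+ 2 * (xi * sin (xi * z)).
have dS (xi : R) : is_derive xi 1 S (S' xi).
  have d1 : is_derive xi 1 (fun y => sin (y * z)) (z * cos (z * xi)).
    by under eq_fun do rewrite mulrC; exact: is_derive_sinZ.
  have d2 : is_derive xi 1 (fun y => cos (y * z)) (- (z * sin (z * xi))).
    by under eq_fun do rewrite mulrC; exact: is_derive_cosZ.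
  have d3 := is_deriveZ z (is_derive_id xi (1 : R)).
  have d4 := is_deriveB d1 (is_deriveM d3 d2).
  apply: (is_derive_eq d4); rewrite /S' (mulrC xi z) /GRing.scale/=.
  rewrite (_ : z *: xi = z * xi)//; ring.
have cS : continuous S.
  by move=> x; apply: differentiable_continuous; apply/derivable1_diffP; have -[] := dS x.
have cS' : continuous S'.
  move=> x; apply: cvgM; first exact: cvg_cst.
  apply: cvgM; first exact: cvg_id.
  apply: continuous_comp; last exact: continuous_sin.
  by apply: cvgM; [exact: cvg_id|exact: cvg_cst].
have ibp (n : nat) : (0 < n)%N -> \int[leb]_(xi in `[0, n%:R]) (G xi * S' xi) =
   G n%:R * S n%:R - \int[leb]_(xi in `[0, n%:R]) (G' xi * S xi).
  move=> n0; have n0' : (0 : R) < n%:R by rewrite ltr0n.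
  have LR (f : R -> R) (f' : R -> R) : continuous f -> (forall xi : R, 0 < xi -> is_derive xi 1 f (f' xi)) ->
      derivable_oo_LRcontinuous f 0 n%:R.
    move=> cf df; split.
    - by move=> x; rewrite in_itv/= => /andP[x0 _]; have -[] := df x x0.
    - by apply: cvg_at_right_filter; exact: cf.
    - by apply: cvg_at_left_filter; exact: cf.
  rewrite (@Rintegration_by_parts R G S G' S' 0 n%:R n0').
  - by rewrite [S 0](_ : _ = 0) ?mulr0 ?subr0// /S mul0r sin0 mulr0 mul0r subr0.
  - exact: continuous_subspaceT.
  - exact: LR cG derG.
  - by move=> x; rewrite in_itv/= => /andP[x0 _]; rewrite derive1E; have h := derG x x0; exact: derive_val.
  - exact: continuous_subspaceT.
  - by apply: (LR S S') => // xi _.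
  - by move=> x _; rewrite derive1E; have h := dS x; exact: derive_val.
have c1 : \int[leb]_(xi in `[0, n%:R]) (G xi * S' xi) @[n --> \oo] --> - (z ^+ 2 * skern G z).
  have e : - (z ^+ 2 * skern G z) = \int[leb]_(xi in HL) (G xi * S' xi).
    rewrite -mulNr /skern -RintegralZl//; last exact: dom2_sin.
    by apply: int_eq => xi _; rewrite /S'; ring.
  rewrite e; apply: int_HL_cvg.
  apply: (dom2_mul (c := z ^+ 2) dG); first by rewrite /S'; mr.
  move=> xi _; rewrite /S' normrM ger0_norm ?sqr_ge0// ler_wpM2l ?sqr_ge0//.
  rewrite normrM (le_trans (ler_piMr _ (sin_max _)))//.
  by have := xi_le_sq xi; rewrite mul1r.
have C0 : 0 <= C by have := hC 0 (lexx 0); rewrite expr0n mulr0.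
(* The boundary term at [n] is of order [1 / n]: [G] decays quadratically and [S] grows linearly. At
   0 it vanishes with [S]. *)
have bound (n : nat) : (0 < n)%N -> `|\int[leb]_(xi in `[0, n%:R]) (G xi * S' xi)| <=
   C * (1 + `|z|) * n%:R^-1 + 2 * `|z| `^ (1 + eta) * \int[leb]_(xi in HL) b xi.
  move=> n0; have n0' : (0 : R) < n%:R by rewrite ltr0n.
  have n1' : (1 : R) <= n%:R by rewrite ler1n.
  rewrite ibp// (le_trans (ler_normB _ _))// lerD//.
    rewrite normrM.
    have hS : `|S n%:R| <= (1 + `|z|) * n%:R.
      rewrite (le_trans (ler_normB _ _))// mulrDl mul1r lerD//.
        by rewrite (le_trans (sin_max _)).
      by rewrite !normrM (ger0_norm (ltW n0')) -[leRHS]mulr1 ler_wpM2l ?mulr_ge0 ?cos_max// ltW.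
    have hG : `|G n%:R| <= C / n%:R ^+ 2 by rewrite ler_pdivlMr ?exprn_gt0// hC// ltW.
    rewrite (le_trans (ler_pM _ _ hG hS))//.
    rewrite le_eqVlt; apply/orP; left; apply/eqP; field; by rewrite gt_eqF.
  rewrite -RintegralZl//.
  apply: (@le_trans _ _ (\int[leb]_(xi in `[0, n%:R]) (2 * `|z| `^ (1 + eta) * b xi))).
    apply: int_dom => //.
    - apply: measurable_funTS; apply: mrM; exact: continuous_measurable_fun.
    - apply: (integrableS mHL) => //; last exact: itgZ.
      by apply: subset_itvl; rewrite bnd_simp.
    move=> xi /=; rewrite in_itv/= => /andP[]; rewrite le_eqVlt => /predU1P[<-|xi0] _.
      by rewrite [S 0](_ : _ = 0) ?mulr0 ?normr0 ?mulr_ge0 ?powR_ge0// /S mul0r sin0 mulr0 mul0r subr0.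
    rewrite normrM mulrC.
    have hS : `|S xi| <= 2 * (`|z| `^ (1 + eta) * xi `^ (1 + eta)).
      rewrite -powRM//; last exact: ltW.
      rewrite -[xi in leRHS]gtr0_norm// -normrM /S [xi * z]mulrC.
      exact: sin_sub_cos_le.
    rewrite (le_trans (ler_wpM2r _ hS))// -!mulrA ler_wpM2l// ler_wpM2l ?powR_ge0//.
    exact: hb.
  have iz := itgZ mHL (2 * `|z| `^ (1 + eta)) ib.
  rewrite /Rintegral fine_le//.
  - apply: integrable_fin_num => //; apply: (integrableS mHL _ _ iz) => //.
    by apply: subset_itvl; rewrite bnd_simp.
  - exact: integrable_fin_num.
  - apply: ge0_subset_integral => //.
    + exact: measurable_int iz.
    + by move=> xi _; rewrite lee_fin !mulr_ge0 ?powR_ge0.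
    + by apply: subset_itvl; rewrite bnd_simp.
have -> : z ^+ 2 * `|skern G z| = `|- (z ^+ 2 * skern G z)|.
  by rewrite normrN normrM (ger0_norm (sqr_ge0 _)).
have c2 : (C * (1 + `|z|) * n%:R^-1 + 2 * `|z| `^ (1 + eta) * \int[leb]_(xi in HL) b xi)
   @[n --> \oo] --> 2 * `|z| `^ (1 + eta) * \int[leb]_(xi in HL) b xi.
  rewrite -[X in _ --> X]add0r; apply: cvgD; last exact: cvg_cst.
  rewrite -[X in _ --> X](mulr0 (C * (1 + `|z|))); apply: cvgM; first exact: cvg_cst.
  rewrite -(@cvg_shiftS R); exact: cvg_harmonic.
apply: (ler_cvg_to (cvg_norm c1) c2); near=> n; apply: bound.
by near: n; exists 1%N.
Unshelve. all: end_near. Qed.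

End oscillatory.

(* The Fourier integral of the mollifier is inverted by Abel summation: damping
   by [expR (- (e * x))] yields the Cauchy kernel, an approximate identity. *)
Section cauchy_kernel.
Context {R : realType}.
Notation leb := (@lebesgue_measure R).
Notation HL := (`[(0 : R), +oo[%classic).
Let mHL : measurable (HL : set (measurableTypeR R)) := measurable_itv _.

Lemma lip_continuous (f : R -> R) (K : R) :
  (forall x y, `|f x - f y| <= K * `|x - y|) -> continuous f.
Proof.
move=> fK x; have K0 : 0 <= K.
  by have := le_trans (normr_ge0 _) (fK 1 0); rewrite subr0 normr1 mulr1.
have K1 : 0 < K + 1 by rewrite ltr_wpDl.
apply/cvgrPdist_lt => e e0; have ek : 0 < e / (K + 1) by rewrite divr_gt0.
have := @nbhsx_ballx R R x _ ek; apply: filterS => y xy.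
rewrite (le_lt_trans (fK _ _))// (@le_lt_trans _ _ ((K + 1) * `|x - y|))//.
  by rewrite ler_wpM2r// lerDl.
by rewrite mulrC -ltr_pdivlMr.
Qed.

Lemma int_derive (F f : R -> R) (a b : R) : a < b -> (forall x : R, is_derive x 1 F (f x)) -> continuous f ->
  \int[leb]_(x in `[a, b]) f x = F b - F a.
Proof.
move=> ab dF cf.
have := ibp_C1 ab dF cf (G := fun=> 1) (g := fun=> 0) (fun x => is_derive_cst _ _ _) (@cst_continuous _ _ _).
rewrite !mulr1 (int_eq _ (g := fun=> 0)); last by move=> x _; rewrite mulr0.
rewrite /Rintegral integral0 /= => /eqP; rewrite eq_sym subr_eq0 => /eqP ->.
by congr fine; apply: eq_integral => x _; rewrite mulr1.
Qed.

Lemma exp_decay_itg (e : R) : 0 < e -> e <= 1 -> itg leb HL (fun x => expR (- (e * x))).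
Proof.
move=> e0 e1; apply: (itg_dom mHL _ (itgZ mHL ((2 / e) ^+ 2) (shift_powR_itg (p := 2) _))).
- by apply: measurable_funTS; mr.
- by rewrite ltr1n.
move=> x /=; rewrite in_itv/= andbT => x0.
have x1 : 0 < 1 + x by rewrite ltr_pwDl.
rewrite ger0_norm ?expR_ge0// expRN powRN powR_mulrn ?(ltW x1)// -[leRHS]invrK.
rewrite lef_pV2 ?posrE ?expR_gt0//; last by rewrite invr_gt0 mulr_gt0 ?exprn_gt0 ?invr_gt0 ?divr_gt0 ?exprn_gt0.
rewrite invfM invrK -exprVn -exprMn.
rewrite (_ : e * x = e * x / 2 + e * x / 2); last by field.
rewrite expRD -expr2 ler_pXn2r ?nnegrE ?expR_ge0//; last first.
  by rewrite mulr_ge0 ?invr_ge0 ?divr_ge0 ?(ltW e0) ?(ltW x1).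
rewrite (le_trans _ (expR_ge1Dx _))// invf_div; nra.
Qed.

Lemma exp_cos_integral (e c : R) : 0 < e -> e <= 1 ->
  \int[leb]_(x in HL) (expR (- (e * x)) * cos (x * c)) = e / (e ^+ 2 + c ^+ 2).
Proof.
move=> e0 e1.
have q0 : 0 < e ^+ 2 + c ^+ 2 by rewrite ltr_pwDl ?sqr_ge0// exprn_gt0.
pose F x := expR (- (e * x)) * ((c * sin (c * x) - e * cos (c * x)) / (e ^+ 2 + c ^+ 2)).
have dF (x : R) : is_derive x 1 F (expR (- (e * x)) * cos (x * c)).
  have dE : is_derive x 1 (fun y => expR (- (e * y))) (- e * expR (- (e * x))).
    have h2 : is_derive x 1 (fun y => - (e * y)) (- e).
      apply: (is_derive_eq (is_deriveN (is_deriveZ e (is_derive_id x (1 : R))))).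
      by rewrite /GRing.scale/= mulr1.
    have h := @is_derive1_comp R expR (fun y => - (e * y)) x _ (- e) (is_derive_expR _) h2.
    by apply: (is_derive_eq h); rewrite mulrC.
  have dT : is_derive x 1 (fun y => (c * sin (c * y) - e * cos (c * y)) / (e ^+ 2 + c ^+ 2))
     ((c * (c * cos (c * x)) - e * - (c * sin (c * x))) / (e ^+ 2 + c ^+ 2)).
    under eq_fun do rewrite mulrC; rewrite mulrC.
    exact: (is_deriveZ _ (is_deriveB (is_deriveZ c (is_derive_sinZ c x)) (is_deriveZ e (is_derive_cosZ c x)))).
  apply: (is_derive_eq (is_deriveM dE dT)); rewrite /GRing.scale/= (mulrC x c).
  by field; rewrite gt_eqF.
have cf : continuous (fun x => expR (- (e * x)) * cos (x * c)).
  move=> x; apply: cvgM.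
    apply: (@continuous_comp _ _ _ (fun x => - (e * x)) expR); last exact: continuous_expR.
    by apply: cvgN; apply: cvgM; [exact: cvg_cst|exact: cvg_id].
  apply: continuous_comp; last exact: continuous_cos.
  by apply: cvgM; [exact: cvg_id|exact: cvg_cst].
have iF : itg leb HL (fun x => expR (- (e * x)) * cos (x * c)).
  apply: (itg_dom mHL _ (exp_decay_itg e0 e1)).
    by apply: measurable_funTS; mr.
  by move=> x _; rewrite normrM ger0_norm ?expR_ge0// ler_piMr ?expR_ge0 ?cos_max.
have c1 := int_HL_cvg iF.
have E (n : nat) : (0 < n)%N -> \int[leb]_(x in `[0, n%:R]) (expR (- (e * x)) * cos (x * c)) = F n%:R - F 0.
  move=> n0; have n0' : (0 : R) < n%:R by rewrite ltr0n.
  exact: int_derive.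
have c2 : (F n%:R - F 0) @[n --> \oo] --> - F 0.
  rewrite -[X in _ --> X]add0r; apply: cvgB; last exact: cvg_cst.
  rewrite -(@cvg_shiftS R).
  have h0 : ((`|c| + e) / (e ^+ 2 + c ^+ 2) / e * n.+1%:R^-1) @[n --> \oo] --> 0.
    rewrite -[X in _ --> X](mulr0 ((`|c| + e) / (e ^+ 2 + c ^+ 2) / e)).
    by apply: cvgM; [exact: cvg_cst|exact: cvg_harmonic].
  apply/norm_cvg0P; apply: (squeeze_cvgr _ (cvg_cst 0) h0); near=> n.
  rewrite normr_ge0 /F normrM ger0_norm ?expR_ge0// normrM (gtr0_norm (x := _^-1)) ?invr_gt0//.
  have hb : `|c * sin (c * n.+1%:R) - e * cos (c * n.+1%:R)| <= `|c| + e.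
    rewrite (le_trans (ler_normB _ _))// !normrM (gtr0_norm e0) lerD// ler_piMr ?sin_max ?cos_max//.
    exact: ltW.
  have he : expR (- (e * n.+1%:R)) <= e^-1 * n.+1%:R^-1.
    rewrite -invfM expRN lef_pV2 ?posrE ?expR_gt0 ?mulr_gt0//.
    by rewrite (le_trans _ (expR_ge1Dx _))// lerDr.
  rewrite mulrC -!mulrA ler_pM ?mulr_ge0 ?expR_ge0 ?invr_ge0 ?(ltW q0)//.
  by rewrite ler_wpM2l ?invr_ge0 ?(ltW q0).
rewrite (_ : e / _ = - F 0); last first.
  by rewrite /F mulr0 oppr0 expR0 mulr0 sin0 cos0 mulr0 mulr1 mul1r add0r mulNr opprK.
have c3 : \int[leb]_(x in `[0, n%:R]) (expR (- (e * x)) * cos (x * c)) @[n --> \oo] --> - F 0.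
  apply: cvg_trans c2; apply: near_eq_cvg; near=> n; rewrite E//.
  by near: n; exists 1%N.
exact: (cvg_unique _ c1 c3).
Unshelve. all: end_near. Qed.

(** The kernel has an antiderivative in terms of [atan], whose total increment is [pi]. After
    subtraction of [f y0], the Lipschitz bound dominates the integrand by [K / s]. For [|y0| >= 1]
    the kernel does not place its full mass on the interval, but then [f y0 = 0]. *)
Lemma cauchy_approx (f : R -> R) (s y0 K M : R) : 0 < s -> measurable_fun setT f ->
  (forall y, `|f y| <= M) ->
  (forall x y, `|f x - f y| <= K * `|x - y|) -> (1 <= `|y0| -> f y0 = 0) ->
  \int[leb]_(y in `[-1, 1]) (f y * (n.+1%:R^-1 / (n.+1%:R^-1 ^+ 2 + (s * (y - y0)) ^+ 2))) @[n --> \oo] -->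
  pi / s * f y0.
Proof.
move=> s0 mf fM fK f0.
pose k n y : R := n.+1%:R^-1 / (n.+1%:R^-1 ^+ 2 + (s * (y - y0)) ^+ 2).
have e0 (n : nat) : 0 < n.+1%:R^-1 :> R by rewrite invr_gt0.
have q0 n (y : R) : 0 < n.+1%:R^-1 ^+ 2 + (s * (y - y0)) ^+ 2.
  by rewrite ltr_pwDl ?sqr_ge0// exprn_gt0.
have kc n : continuous (k n).
  move=> y; apply: cvgM; first exact: cvg_cst.
  apply: cvgV; first by rewrite gt_eqF.
  apply: cvgD; first exact: cvg_cst.
  have h : s * (y - y0) @[y --> y] --> s * (y - y0).
    by apply: cvgM; [exact: cvg_cst|apply: cvgB; [exact: cvg_id|exact: cvg_cst]].
  by rewrite expr2; under eq_fun do rewrite expr2; exact: cvgM.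
have mk n : measurable_fun setT (k n) by exact: continuous_measurable_fun.
have kb n y : 0 <= k n y <= n.+1%:R.
  rewrite /k divr_ge0 ?(ltW (e0 n)) ?(ltW (q0 _ _))//= ler_pdivrMr//.
  by rewrite mulrDr expr2 mulrA mulfV// mul1r lerDl mulr_ge0 ?sqr_ge0.
have leb1 := leb_cc_fin (-1 : R) 1.
have dk n (y : R) : is_derive y 1 (fun y => s^-1 * atan (n.+1%:R * s * (y - y0))) (k n y).
  have h2 : is_derive y 1 (fun y => n.+1%:R * s * (y - y0)) (n.+1%:R * s).
    apply: (is_derive_eq (is_deriveZ (n.+1%:R * s) (is_deriveB (is_derive_id y (1 : R)) (is_derive_cst y0 y (1 : R))))).
    by rewrite subr0 /GRing.scale/= mulr1.
  have h := @is_derive1_comp R atan _ y _ _ (is_derive1_atan _) h2.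
  apply: (is_derive_eq (is_deriveZ s^-1 h)); rewrite /GRing.scale/= /k.
  have n0 : n.+1%:R != 0 :> R by [].
  have q1 : 1 + (n.+1%:R * s * (y - y0)) ^+ 2 != 0 by rewrite gt_eqF// ltr_pwDl ?sqr_ge0.
  have q2 : n.+1%:R^-1 ^+ 2 + (s * (y - y0)) ^+ 2 != 0 by rewrite gt_eqF.
  have key (u : R) : u != 0 -> 1 + (u * s * (y - y0)) ^+ 2 != 0 ->
      s^-1 * ((1 + (u * s * (y - y0)) ^+ 2)^-1 * (u * s)) = u^-1 / (u^-1 ^+ 2 + (s * (y - y0)) ^+ 2).
    move=> u0 qu.
    have -> : u^-1 ^+ 2 + (s * (y - y0)) ^+ 2 = (1 + (u * s * (y - y0)) ^+ 2) / u ^+ 2 by field.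
    by field; rewrite u0 qu gt_eqF.
  exact: key.
have intk n : \int[leb]_(y in `[-1, 1]) k n y =
    s^-1 * atan (n.+1%:R * s * (1 - y0)) - s^-1 * atan (n.+1%:R * s * (-1 - y0)).
  have lt11 : (-1 : R) < 1 by lra.
  by rewrite (int_derive lt11 (dk n) (kc n)).
have fk0 : \int[leb]_(y in `[-1, 1]) ((f y - f y0) * k n y) @[n --> \oo] --> (0 : R).
  have -> : (0 : R) = \int[leb]_(y in `[-1, 1]) 0 by rewrite /Rintegral integral0.
  apply: (int_cvg _ (g := fun=> K / s)) => //.
  - by move=> n; apply: measurable_funTS; apply: mrM; [mr|exact: mk].
  - exact: itg_cst.
  - move=> n y _; have [kn0 _] := andP (kb n y).
    rewrite normrM (ger0_norm kn0) (le_trans (ler_wpM2r kn0 (fK _ _)))// /k.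
    rewrite mulrA ler_pdivrMr// -!mulrA.
    have K0 : 0 <= K.
      by have := le_trans (normr_ge0 _) (fK 1 0); rewrite subr0 normr1 mulr1.
    rewrite ler_wpM2l// -(ler_pM2l s0) mulrA (mulrA s) mulfV ?gt_eqF// mul1r.
    rewrite -[(s * _) ^+ 2]real_normK ?num_real// normrM (gtr0_norm s0).
    set u := `|y - y0|; have u0 : 0 <= u by exact: normr_ge0.
    have aux (a b : R) : 0 <= a -> 0 <= b -> a * b <= b ^+ 2 + a ^+ 2 by nra.
    by apply: aux; [rewrite mulr_ge0// ltW|rewrite ltW].
  - move=> y _; have [->|yy] := eqVneq y y0.
      by under eq_fun do rewrite subrr mul0r; exact: cvg_cst.
    rewrite -[X in _ --> X](mulr0 (f y - f y0)); apply: cvgM; first exact: cvg_cst.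
    have p0 : 0 < (s * (y - y0)) ^+ 2.
      have yy' : (y : R) - y0 != 0 by rewrite subr_eq0.
      by rewrite lt_neqAle sqr_ge0 andbT eq_sym expf_eq0/= mulf_eq0 (negbTE yy') orbF gt_eqF.
    have h0 : (n.+1%:R^-1 / (s * (y - y0)) ^+ 2) @[n --> \oo] --> 0.
      rewrite -[X in _ --> X](mul0r ((s * (y - y0)) ^+ 2)^-1).
      by apply: cvgM; [exact: cvg_harmonic|exact: cvg_cst].
    apply: (squeeze_cvgr _ (cvg_cst 0) h0); near=> n.
    have [-> _] /= := andP (kb n y).
    by rewrite ler_wpM2l ?(ltW (e0 n))// lef_pV2 ?posrE// lerDr sqr_ge0.
have ck : f y0 * \int[leb]_(y in `[-1, 1]) k n y @[n --> \oo] --> pi / s * f y0.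
  have [y1|y1] := leP 1 `|y0|.
    by under eq_fun do rewrite f0// mul0r; rewrite f0// mulr0; exact: cvg_cst.
  rewrite mulrC; apply: cvgM; first exact: cvg_cst.
  rewrite (funext intk).
  move: y1; rewrite ltr_norml => /andP[y1 y2].
  have atc (c : R) : 0 < c -> atan (n.+1%:R * s * c) @[n --> \oo] --> pi / 2.
    move=> c0; apply: (@cvg_comp _ _ _ (fun n : nat => n.+1%:R * s * c) atan _ +oo%R); last exact: cvgy_atan.
    apply/cvgryPge => A; near=> n.
    rewrite -mulrA -ler_pdivrMr ?mulr_gt0// (@le_trans _ _ n%:R) ?ler_nat//.
    by near: n; exact: nbhs_infty_ger.
  have -> : pi / s = s^-1 * (pi / 2) - s^-1 * - (pi / 2) by field; rewrite gt_eqF.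
  apply: cvgB; apply: cvgM; try exact: cvg_cst.
    by apply: atc; rewrite subr_gt0.
  have -> : (fun n : nat => atan (n.+1%:R * s * (-1 - y0))) =
      (fun n : nat => - atan (n.+1%:R * s * (1 + y0))).
    by apply/funext => n; rewrite -atanN; congr atan; ring.
  by apply: cvgN; apply: atc; rewrite -ltrBlDl sub0r.
have -> : pi / s * f y0 = 0 + pi / s * f y0 by rewrite add0r.
under eq_fun => n.
  rewrite (_ : Rintegral _ _ _ = \int[leb]_(y in `[-1, 1]) ((f y - f y0) * k n y) +
     f y0 * \int[leb]_(y in `[-1, 1]) k n y); last first.
    have ik : itg leb `[-1, 1]%classic (k n).
      apply: (itg_bnd _ (M := n.+1%:R)) => //; first exact: (measurable_funTS (mk n)).
      by move=> y _; have /andP[k1 k2] := kb n y; rewrite ger0_norm.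
    rewrite -RintegralZl// -RintegralD//; last exact: itgZ.
      by apply: int_eq => y _; rewrite -/(k n y); ring.
    apply: (itg_M _ (M := M + M)) => //; first by apply: measurable_funTS; mr.
    by move=> y _; rewrite (le_trans (ler_normB _ _))// lerD.
  over.
exact: cvgD.
Unshelve. all: end_near. Qed.

End cauchy_kernel.

(** * Fourier inversion for the mollifier *)

Section mollifier_inversion.
Context {R : realType} (phi : R -> R).
Notation leb := (@lebesgue_measure R).
Notation HL := (`[(0 : R), +oo[%classic).
Let mHL : measurable (HL : set (measurableTypeR R)) := measurable_itv _.
Hypothesis hphi : mollifier phi.
Notation II := (`[(-1 : R), 1]%classic).

Lemma mhat_cont : continuous (mhat phi).
Proof.
move=> x; apply: differentiable_continuous; apply/derivable1_diffP.
by have -[] := is_derive_mhat hphi x.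
Qed.

Lemma mhat1_cont : continuous (mhat1 phi).
Proof.
apply: (@lip_continuous R _ 1) => x y; rewrite mul1r; exact: mhat1_lip.
Qed.

Lemma mhat_scale_dom2 (s : R) : 0 < s ->
  exists2 C : R, 0 <= C & forall xi, `|mhat phi (s * xi)| * (1 + xi ^+ 2) <= C.
Proof.
move=> s0; have [C C0 hC] := mhat_decay hphi.
exists (1 + C / s ^+ 2); first by rewrite addr_ge0// divr_ge0// sqr_ge0.
move=> xi; rewrite mulrDr mulr1 lerD ?mhat_le1//.
rewrite ler_pdivlMr ?exprn_gt0// -mulrA -exprMn mulrC (le_trans _ (hC (s * xi)))// normrM.
by rewrite [X in _ <= X * _]ger0_norm ?sqr_ge0// [s * xi]mulrC.
Qed.

Lemma shift2_itg : itg leb HL (fun xi => (1 + xi ^+ 2)^-1).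
Proof.
have h2 : (1 : R) < 2 by rewrite ltr1n.
apply: (itg_dom mHL _ (itgZ mHL 2 (shift_powR_itg h2))).
  apply: measurable_funTS; apply: continuous_measurable_fun => x.
  by apply: cvgV; [rewrite gt_eqF// ltr_pwDl ?sqr_ge0|apply: cvgD; [exact: cvg_cst|exact: exprn_continuous]].
move=> x /=; rewrite in_itv/= andbT => x0.
have x1 : 0 < 1 + x by rewrite ltr_pwDl.
have q0 : 0 < 1 + x ^+ 2 by rewrite ltr_pwDl ?sqr_ge0.
rewrite ger0_norm ?invr_ge0 ?(ltW q0)// powRN powR_mulrn ?(ltW x1)//.
rewrite ler_pdivlMr ?exprn_gt0// mulrC ler_pdivrMr//.
have := sqr_ge0 (1 - x); rewrite !expr2; lra.
Qed.

(** Fubini and the product formula for cosines turn the damped integral into half the sum of two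
    Cauchy integrals, centred at [z / s] and [- (z / s)]; their limits are merged by the evenness of
    [phi]. *)
Lemma mollifier_inversion (n : nat) (z : R) :
  mollifier_seq phi n z = ckern (fun xi => mhat phi ((2 ^+ n)^-1 * xi) / pi) z.
Proof.
set s : R := (2 ^+ n)^-1; have s0 : 0 < s by rewrite invr_gt0 exprn_gt0.
have [C C0 hC] := mhat_scale_dom2 s0.
have mm : measurable_fun setT (fun xi => mhat phi (s * xi)).
  apply: mrcont; first exact: mhat_cont.
  by mr.
have [M M0 phiM] := phi_bound hphi.
have [K K0 phiK] := phi_lip hphi.
have mphi : measurable_fun setT phi by exact: continuous_measurable_fun (phi_cont hphi).
have pi0 : 0 < pi :> R by exact: pi_gt0.
have e0 (k : nat) : 0 < k.+1%:R^-1 :> R by rewrite invr_gt0.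
have e1 (k : nat) : k.+1%:R^-1 <= 1 :> R by rewrite invf_le1// ler1n.
pose I k := \int[leb]_(xi in HL) (expR (- (k.+1%:R^-1 * xi)) * (mhat phi (s * xi) * cos (xi * z))).
have c1 : I k @[k --> \oo] --> \int[leb]_(xi in HL) (mhat phi (s * xi) * cos (xi * z)).
  apply: (int_cvg mHL (g := fun xi => C * (1 + xi ^+ 2)^-1)).
  - by move=> k; apply: measurable_funTS; mr.
  - exact: itgZ shift2_itg.
  - move=> k xi /=; rewrite in_itv/= andbT => xi0.
    rewrite normrM ger0_norm ?expR_ge0// (le_trans (ler_piMl _ _))//.
      by rewrite -expR0 ler_expR oppr_le0 mulr_ge0// ltW.
    rewrite normrM (le_trans (ler_piMr _ (cos_max _)))//.
    by rewrite ler_pdivlMr ?hC// ltr_pwDl ?sqr_ge0.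
  - move=> xi _; rewrite -[X in _ --> X]mul1r; apply: cvgM; last exact: cvg_cst.
    have h : expR y @[y --> (0 : R)] --> (1 : R) by rewrite -expR0; exact: continuous_expR.
    apply: (cvg_comp _ _ _ h).
    rewrite -oppr0 -(mul0r xi); apply: cvgN; apply: cvgM; last exact: cvg_cst.
    exact: cvg_harmonic.
have c2 y0 := cauchy_approx (y0 := y0) s0 mphi phiM phiK (fun h => phi_out hphi h).
have IE k : I k = 2^-1 * (
   \int[leb]_(y in II) (phi y * (k.+1%:R^-1 / (k.+1%:R^-1 ^+ 2 + (s * (y - z / s)) ^+ 2))) +
   \int[leb]_(y in II) (phi y * (k.+1%:R^-1 / (k.+1%:R^-1 ^+ 2 + (s * (y - - (z / s))) ^+ 2)))).
  rewrite /I.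
  pose f (xi y : R) := phi y * (expR (- (k.+1%:R^-1 * xi)) * (cos (s * xi * y) * cos (xi * z))).
  have mf : measurable_fun setT (fun p : R * R => f p.1 p.2).
    apply: mrM; first exact: (measurableT_comp mphi measurable_snd).
    by rewrite /f; mr.
  rewrite (int_eq _ (g := fun xi : measurableTypeR R => \int[leb]_(y in II) f xi y)); last first.
    move=> xi _; rewrite /mhat mulrCA mulrC -RintegralZl//; last first.
      apply: (itg_bnd _ (M := M)) => //; first exact: leb_cc_fin.
        by apply: measurable_funTS; mr.
      by move=> y _; rewrite normrM (le_trans (ler_piMr _ (cos_max _)))// phiM.
    by apply: int_eq => y _; rewrite /f; ring.
  rewrite (@Rfubini _ _ (measurableTypeR R) (measurableTypeR R) R leb leb HL II mHL _ f
     (fun xi => expR (- (k.+1%:R^-1 * xi))) (fun=> M) mf).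
  - pose q (y : R) : R := k.+1%:R^-1 / (k.+1%:R^-1 ^+ 2 + y ^+ 2).
    have q0 (y : R) : 0 < k.+1%:R^-1 ^+ 2 + y ^+ 2.
      by rewrite ltr_pwDl ?sqr_ge0// exprn_gt0.
    have qc : continuous q.
      move=> y; apply: cvgM; first exact: cvg_cst.
      apply: cvgV; first by rewrite gt_eqF.
      by apply: cvgD; [exact: cvg_cst|exact: exprn_continuous].
    have qM (y : R) : `|q y| <= k.+1%:R.
      rewrite /q ger0_norm ?divr_ge0 ?(ltW (e0 _)) ?(ltW (q0 _))//= ler_pdivrMr//.
      by rewrite mulrDr expr2 mulrA mulfV// mul1r lerDl mulr_ge0 ?sqr_ge0.
    have iq (y0 : R) : itg leb II (fun y => phi y * q (s * (y - y0))).
      apply: (itg_bnd _ (M := M * k.+1%:R)) => //; first exact: leb_cc_fin.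
        apply: measurable_funTS; apply: mrM => //; apply: mrcont => //; mr.
      by move=> y _; rewrite normrM ler_pM.
    have E (y : R) : \int[leb]_(xi in HL) f xi y =
        2^-1 * (phi y * q (s * (y - z / s)) + phi y * q (s * (y - - (z / s)))).
      have ex (c : R) := exp_cos_integral c (e0 k) (e1 k).
      have ix (c : R) : itg leb HL (fun x => expR (- (k.+1%:R^-1 * x)) * cos (x * c)).
        apply: (itg_dom mHL _ (exp_decay_itg (e0 k) (e1 k))).
          by apply: measurable_funTS; mr.
        by move=> x _; rewrite normrM ger0_norm ?expR_ge0// ler_piMr ?expR_ge0 ?cos_max.
      rewrite /q -mulrDr -(ex (s * (y - z / s))) -(ex (s * (y - - (z / s)))).
      rewrite -RintegralD//; try exact: ix.
      rewrite -RintegralZl//; last by apply: itgD.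
      rewrite -RintegralZl//; last by apply: itgZ => //; exact: itgD.
      apply: int_eq => x _; rewrite /f.
      have -> : x * (s * (y - z / s)) = s * x * y - x * z by field; rewrite gt_eqF.
      have -> : x * (s * (y - - (z / s))) = s * x * y + x * z by field; rewrite gt_eqF.
      by rewrite cosB cosD; field.
    rewrite [LHS](int_eq _ (g := fun y : measurableTypeR R => 2^-1 * (phi y * q (s * (y - z / s)) + phi y * q (s * (y - - (z / s)))))); last first.
      by move=> y _; exact: E.
    by rewrite RintegralZl// ?RintegralD//; exact: itgD.
  - exact: measurable_itv.
  - exact: exp_decay_itg.
  - by apply: itg_cst => //; exact: leb_cc_fin.
  move=> xi y _ _; rewrite /f normrM mulrC ler_pM// normrM ger0_norm ?expR_ge0//.
  by rewrite ler_piMr ?expR_ge0// normrM mulr_ile1 ?cos_max.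
have c3 : I k @[k --> \oo] --> 2^-1 * (pi / s * phi (z / s) + pi / s * phi (- (z / s))).
  rewrite (funext IE); apply: cvgM; first exact: cvg_cst.
  by apply: cvgD; exact: c2.
have H := cvg_unique (@Rhausdorff R) c1 c3; rewrite /ckern /mollifier_seq.
rewrite (int_eq _ (g := fun xi : measurableTypeR R => pi^-1 * (mhat phi (s * xi) * cos (xi * z)))); last first.
  by move=> xi _; ring.
rewrite RintegralZl//; last first.
  apply: (itg_dom mHL _ (itgZ mHL C shift2_itg)); first by apply: measurable_funTS; mr.
  move=> xi _; rewrite normrM (le_trans (ler_piMr _ (cos_max _)))//.
  by rewrite ler_pdivlMr ?hC// ltr_pwDl ?sqr_ge0.
rewrite H (phi_even hphi) /s invrK mulrC [z * _]mulrC.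
have pn : pi != 0 :> R by rewrite gt_eqF.
have key (p a b : R) : p != 0 -> a * b = p^-1 * (2^-1 * (p * b * a + p * b * a)) by move=> p0; field.
exact: key.
Qed.
End mollifier_inversion.

Lemma powRD_gt0 (R : realType) (x a b : R) : 0 < x -> x `^ (a + b) = x `^ a * x `^ b.
Proof. by move=> x0; rewrite powRD//; apply/implyP => _; rewrite gt_eqF. Qed.

(** * The resolvent symbol and its multipliers *)

Section resolvent_multiplier.
Context {R : realType} (alpha eta lam : R).
Notation leb := (@lebesgue_measure R).
Notation HL := (`[(0 : R), +oo[%classic).
Let mHL : measurable (HL : set (measurableTypeR R)) := measurable_itv _.
Hypothesis alpha1 : 1 < alpha.
Hypothesis eta0 : 0 < eta.
Hypothesis eta1 : eta < 1.
Hypothesis etaa : eta < alpha - 1.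
Hypothesis lam1 : 1 <= lam.

Definition resolvent_symbol (xi : R) := (lam + `|xi| `^ alpha)^-1.

Let alpha0 : 0 < alpha. Proof. exact: lt_trans alpha1. Qed.
Let lam0 : 0 < lam. Proof. exact: lt_le_trans lam1. Qed.
Let den0 (xi : R) : 0 < lam + `|xi| `^ alpha. Proof. by rewrite ltr_pwDl ?powR_ge0. Qed.

Lemma resolvent_symbol_gt0 xi : 0 < resolvent_symbol xi. Proof. by rewrite invr_gt0. Qed.
Lemma resolvent_symbol_le1 xi : resolvent_symbol xi <= 1.
Proof. by rewrite invf_le1// (le_trans lam1)// lerDl powR_ge0. Qed.

Lemma resolvent_symbol_powR_le1 xi : `|xi| `^ alpha * resolvent_symbol xi <= 1.
Proof. by rewrite ler_pdivrMr// mul1r lerDr ltW. Qed.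

Lemma resolvent_symbol_cont : continuous resolvent_symbol.
Proof.
move=> x; apply: cvgV; first by rewrite gt_eqF.
by apply: cvgD; [exact: cvg_cst|exact: powR_norm_cont].
Qed.

Lemma resolvent_symbol_meas : measurable_fun setT resolvent_symbol.
Proof. exact: continuous_measurable_fun resolvent_symbol_cont. Qed.

Lemma powR_norm_meas (b : R) : 0 <= b -> measurable_fun setT (fun xi : R => `|xi| `^ b).
Proof.
rewrite le_eqVlt => /predU1P[<-|b0].
  by under eq_fun do rewrite powRr0; mr.
exact: continuous_measurable_fun (powR_norm_cont b0).
Qed.

(** At infinity the integrand is of order [xi^(b - alpha)]. With [b = eta] this is where the
    condition [eta < alpha - 1] enters. *)
Lemma resolvent_symbol_itg (b : R) : 0 <= b -> b < alpha - 1 -> itg leb HL (fun xi => `|xi| `^ b * resolvent_symbol xi).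
Proof.
move=> b0 ba; have p1 : 1 < alpha - b by lra.
apply: (itg_dom mHL _ (itgZ mHL (2 `^ alpha) (shift_powR_itg p1))).
  by apply: measurable_funTS; apply: mrM; [exact: powR_norm_meas|exact: resolvent_symbol_meas].
move=> x /=; rewrite in_itv/= andbT => x0.
have x1 : 0 < 1 + x by rewrite ltr_pwDl.
rewrite ger0_norm ?mulr_ge0 ?powR_ge0 ?(ltW (resolvent_symbol_gt0 _))//.
rewrite opprB powRD_gt0//.
rewrite mulrCA ler_pM ?powR_ge0 ?(ltW (resolvent_symbol_gt0 _))//.
  by rewrite ge0_ler_powR ?nnegrE ?(ltW x1)// ger0_norm// lerDr.
rewrite /resolvent_symbol powRN ler_pdivlMr ?powR_gt0// mulrC ler_pdivrMr//.
rewrite mulrDr (ger0_norm x0) -powRM//.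
have [x2|x2] := leP x 1.
  apply: (@le_trans _ _ (2 `^ alpha)).
    by rewrite ge0_ler_powR ?nnegrE ?(ltW x1) ?(ltW alpha0)//; lra.
  rewrite (@le_trans _ _ (2 `^ alpha * lam)) ?lerDl ?powR_ge0//.
  by rewrite ler_peMr ?powR_ge0.
apply: (@le_trans _ _ ((2 * x) `^ alpha)); last by rewrite lerDr mulr_ge0 ?powR_ge0// ltW.
by rewrite ge0_ler_powR ?nnegrE ?(ltW x1) ?(ltW alpha0) ?mulr_ge0//; lra.
Qed.

Section multiplier.
Context (m m1 w : R -> R) (C K : R).
Hypothesis mC : forall xi, `|m xi| * (1 + xi ^+ 2) <= C.
Hypothesis cm : continuous m.
Hypothesis cm1 : continuous m1.
Hypothesis dm : forall xi : R, is_derive xi 1 m (m1 xi).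
Hypothesis mw : measurable_fun setT w.
Hypothesis w0 : forall xi, 0 <= w xi <= K.
Hypothesis hw : forall xi, 0 <= xi -> `|m xi| <= w xi.
Hypothesis hw1 : forall xi, 0 <= xi -> `|xi * m1 xi| <= w xi.

Context (p : R) (p0 : 0 < p).
Let G xi := p * (m xi * resolvent_symbol xi).

Lemma multiplier_dom2 : dom2 G.
Proof.
split; first by apply: mrM; [mr|apply: mrM; [exact: continuous_measurable_fun cm|exact: resolvent_symbol_meas]].
exists (fun xi => C * p * (`|xi| `^ 0 * resolvent_symbol xi)).
  by apply: itgZ => //; apply: resolvent_symbol_itg => //; rewrite subr_gt0.
move=> xi _; rewrite powRr0 mul1r /G !normrM (gtr0_norm (resolvent_symbol_gt0 _)) (gtr0_norm p0).
rewrite (_ : _ * _ = `|m xi| * (1 + xi ^+ 2) * p * resolvent_symbol xi); last by ring.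
by rewrite ler_wpM2r ?(ltW (resolvent_symbol_gt0 _))// ler_wpM2r ?(ltW p0).
Qed.

Let wH_itg (b : R) : 0 <= b -> b < alpha - 1 -> itg leb HL (fun xi => w xi * (`|xi| `^ b * resolvent_symbol xi)).
Proof.
move=> b0 ba; apply: (itg_M _ (M := K)) => //; first exact: resolvent_symbol_itg.
  exact: measurable_funTS.
by move=> x _; have /andP[h1 h2] := w0 x; rewrite ger0_norm.
Qed.

Lemma multiplier_ckern z : `|ckern G z| <= p * \int[leb]_(xi in HL) (w xi * (`|xi| `^ 0 * resolvent_symbol xi)).
Proof.
have a0 : 0 < alpha - 1 by rewrite subr_gt0.
rewrite -RintegralZl//; last exact: wH_itg.
apply: ckern_le; first exact: multiplier_dom2.
  by apply: itgZ => //; exact: wH_itg.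
move=> xi xi0; rewrite /G !normrM (gtr0_norm p0) (gtr0_norm (resolvent_symbol_gt0 _)) powRr0 mul1r.
by rewrite ler_wpM2l ?(ltW p0)// ler_wpM2r ?(ltW (resolvent_symbol_gt0 _)) ?hw.
Qed.

Let Hs1 (xi : R) := - (alpha * `|xi| `^ (alpha - 1) * (resolvent_symbol xi * resolvent_symbol xi)).

Let is_derive_Hs (xi : R) : 0 < xi -> is_derive xi 1 resolvent_symbol (Hs1 xi).
Proof.
move=> x0; have d1 : is_derive xi 1 (fun y : R => lam + `|y| `^ alpha) (alpha * xi `^ (alpha - 1)).
  have d2 := is_deriveD (is_derive_cst lam xi (1 : R)) (is_derive_powR alpha x0).
  rewrite add0r in d2; have [dd de] := d2; apply: DeriveDef.
    apply: near_eq_derivable dd; rewrite ?oner_neq0//.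
    near=> y; have y0 : 0 < y by near: y; exact: lt_nbhsr.
    by rewrite /= (gtr0_norm y0).
  rewrite -de; apply: near_eq_derive; rewrite ?oner_neq0//.
  near=> y; have y0 : 0 < y by near: y; exact: lt_nbhsr.
  by rewrite /= (gtr0_norm y0).
have nz : lam + `|xi| `^ alpha != 0 by rewrite gt_eqF.
have d2 := @is_deriveV R (fun y : R => lam + `|y| `^ alpha) xi _ _ nz d1.
have -> : resolvent_symbol = (fun y : R => (lam + `|y| `^ alpha)^-1) by [].
apply: (is_derive_eq d2).
by rewrite /Hs1 /resolvent_symbol (gtr0_norm x0) /GRing.scale/= expr2 invfM; ring.
Unshelve. all: end_near. Qed.

(** Since [xi] times the derivative of the resolvent symbol is at most [alpha] times the symbol, a
    common majorant [w] of [m] and [xi m'] gives [xi |G'| <= p (1 + alpha) w] times the symbol, and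
    [skern_ibp] applies. Bounds for the mollified kernels and for their differences are two
    instances. *)
Lemma multiplier_skern z : `|skern G z| <=
  2 * (p * (1 + alpha) * \int[leb]_(xi in HL) (w xi * (`|xi| `^ eta * resolvent_symbol xi))) * `|z| `^ (eta - 1).
Proof.
rewrite -RintegralZl//; last exact: (wH_itg (ltW eta0)).
have cH1 : continuous Hs1.
  move=> x; apply: cvgN; apply: cvgM; last by apply: cvgM; exact: resolvent_symbol_cont.
  by apply: cvgM; [exact: cvg_cst|apply: powR_norm_cont; rewrite subr_gt0].
apply: (@skern_ibp _ G (fun xi => p * (m1 xi * resolvent_symbol xi + m xi * Hs1 xi))) => //.
- exact: multiplier_dom2.
- by move=> x; apply: cvgM; [exact: cvg_cst|apply: cvgM; [exact: cm|exact: resolvent_symbol_cont]].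
- move=> x; apply: cvgM; first exact: cvg_cst.
  by apply: cvgD; apply: cvgM; [exact: cm1|exact: resolvent_symbol_cont|exact: cm|exact: cH1].
- move=> xi xi0; have d := is_deriveZ p (is_deriveM (dm xi) (is_derive_Hs xi0)).
  by apply: (is_derive_eq d); rewrite /GRing.scale/=; ring.
- exists (p * C) => xi _; rewrite /G !normrM (gtr0_norm p0) (gtr0_norm (resolvent_symbol_gt0 _)) -mulrA.
  rewrite ler_wpM2l ?(ltW p0)// mulrAC (le_trans _ (mC xi))//.
  rewrite (@le_trans _ _ (`|m xi| * xi ^+ 2))//.
    by apply: ler_piMr; [rewrite mulr_ge0 ?sqr_ge0|exact: resolvent_symbol_le1].
  by rewrite ler_wpM2l// lerDr.
- by apply: itgZ => //; exact: (wH_itg (ltW eta0)).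
- move=> xi xi0; rewrite normrM (gtr0_norm p0).
  have hp := resolvent_symbol_gt0 xi; have nx := gtr0_norm xi0; rewrite nx.
  have [wx _] := andP (w0 xi).
  have e1 : xi `^ (1 + eta) = xi `^ eta * xi.
    by rewrite addrC powRD_gt0// powRr1// ltW.
  have e2 : xi `^ alpha = xi `^ (alpha - 1) * xi.
    by rewrite -[X in _ = _ * X](powRr1 (ltW xi0)) -powRD_gt0// subrK.
  have hh := resolvent_symbol_powR_le1 xi; rewrite nx e2 in hh.
  have h1 := hw1 (ltW xi0); have h0 := hw (ltW xi0); rewrite normrM nx in h1.
  have t1 : xi * `|m1 xi * resolvent_symbol xi + m xi * Hs1 xi| <= (1 + alpha) * w xi * resolvent_symbol xi.
    rewrite -[X in X * _]nx -normrM.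
    rewrite (_ : xi * _ = xi * m1 xi * resolvent_symbol xi - alpha * m xi * (xi `^ (alpha - 1) * xi * resolvent_symbol xi) * resolvent_symbol xi); last first.
      by rewrite /Hs1 nx; ring.
    rewrite (le_trans (ler_normB _ _))// -[leRHS]mulrA mulrDl mul1r lerD//.
      by rewrite !normrM nx (gtr0_norm hp) ler_wpM2r// ltW.
    rewrite !normrM (gtr0_norm hp) (gtr0_norm alpha0) -!mulrA ler_wpM2l ?(ltW alpha0)//.
    rewrite nx (ger0_norm (powR_ge0 _ _)).
    rewrite (_ : `|m xi| * _ = `|m xi| * (xi `^ (alpha - 1) * xi * resolvent_symbol xi) * resolvent_symbol xi); last by ring.
    by rewrite ler_wpM2r ?(ltW hp)// (le_trans _ h0)// ler_piMr.
  rewrite e1 (_ : _ * _ * _ = p * xi `^ eta * (xi * `|m1 xi * resolvent_symbol xi + m xi * Hs1 xi|)); last by ring.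
  rewrite (_ : p * (1 + alpha) * _ = p * xi `^ eta * ((1 + alpha) * w xi * resolvent_symbol xi)); last by ring.
  by rewrite ler_wpM2l// mulr_ge0 ?powR_ge0// ltW.
move=> xi; have [wx _] := andP (w0 xi).
by rewrite !mulr_ge0 ?addr_ge0 ?powR_ge0 ?(ltW p0) ?(ltW alpha0) ?(ltW (resolvent_symbol_gt0 _)).
Qed.
End multiplier.
End resolvent_multiplier.

Section smoothed_resolvent.
Context {R : realType} (phi : R -> R) (alpha eta : R).
Notation leb := (@lebesgue_measure R).
Notation HL := (`[(0 : R), +oo[%classic).
Let mHL : measurable (HL : set (measurableTypeR R)) := measurable_itv _.
Hypothesis hphi : mollifier phi.
Hypothesis alpha1 : 1 < alpha.
Hypothesis eta0 : 0 < eta.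
Hypothesis eta1 : eta < 1.
Hypothesis etaa : eta < alpha - 1.

(** The symbol of the resolvent kernel convolved with the mollifier; [pi^-1] normalises the inverse
    transform on the half-line. *)
Definition smoothed_symbol (lam : R) (n : nat) (xi : R) :=
  pi^-1 * (mhat phi ((2 ^+ n)^-1 * xi) * resolvent_symbol alpha lam xi).

Definition symbol_mass (lam : R) := \int[leb]_(xi in HL) (`|xi| `^ eta * resolvent_symbol alpha lam xi).

Let sg0 (n : nat) : 0 < (2 ^+ n)^-1 :> R. Proof. by rewrite invr_gt0 exprn_gt0. Qed.
Let pi0 : 0 < pi^-1 :> R. Proof. by rewrite invr_gt0 pi_gt0. Qed.
Let cM (n : nat) : continuous (fun xi : R => mhat phi ((2 ^+ n)^-1 * xi)).
Proof.
move=> x; apply: (continuous_comp (f := fun xi : R => (2 ^+ n)^-1 * xi)); last exact: mhat_cont.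
by apply: cvgM; [exact: cvg_cst|exact: cvg_id].
Qed.
Let cM1 (n : nat) : continuous (fun xi : R => (2 ^+ n)^-1 * mhat1 phi ((2 ^+ n)^-1 * xi)).
Proof.
move=> x; apply: cvgM; first exact: cvg_cst.
apply: (continuous_comp (f := fun xi : R => (2 ^+ n)^-1 * xi)); last exact: mhat1_cont.
by apply: cvgM; [exact: cvg_cst|exact: cvg_id].
Qed.
Let dM (n : nat) (xi : R) : is_derive xi 1 (fun xi => mhat phi ((2 ^+ n)^-1 * xi))
  ((2 ^+ n)^-1 * mhat1 phi ((2 ^+ n)^-1 * xi)).
Proof.
have d1 : is_derive xi 1 (fun y : R => (2 ^+ n)^-1 * y) ((2 ^+ n)^-1).
  by apply: (is_derive_eq (is_deriveZ (2 ^+ n)^-1 (is_derive_id xi (1 : R)))); rewrite /GRing.scale/= mulr1.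
apply: (is_derive_eq (@is_derive1_comp R (mhat phi) _ xi _ _ (is_derive_mhat hphi _) d1)).
by rewrite mulrC.
Qed.

Lemma smoothed_symbol_dom2 lam n : 1 <= lam -> dom2 (smoothed_symbol lam n).
Proof.
move=> l1; have [C C0 hC] := mhat_scale_dom2 hphi (sg0 n).
exact: (multiplier_dom2 alpha1 l1 hC (@cM n) pi0).
Qed.

(** The constant [1 + C1] is an admissible majorant for all levels, by dilation invariance. The
    dependence on [lam] is kept explicit, since smallness will come from it. *)
Lemma smoothed_symbol_bound : exists2 C : R, 0 <= C & forall lam n z, 1 <= lam ->
  `|ckern (smoothed_symbol lam n) z| <= C * \int[leb]_(xi in HL) (`|xi| `^ 0 * resolvent_symbol alpha lam xi) /\
  `|skern (smoothed_symbol lam n) z| <= C * symbol_mass lam * `|z| `^ (eta - 1).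
Proof.
have [C1 C10 hC1] := mhat1_decay hphi.
have alpha0 : 0 < alpha by exact: lt_trans alpha1.
exists (2 * (pi^-1 * (1 + alpha) * (1 + C1))); first by rewrite !mulr_ge0 ?addr_ge0 ?(ltW pi0) ?(ltW alpha0).
move=> lam n z l1; have [C C0 hC] := mhat_scale_dom2 hphi (sg0 n).
have ha : 1 <= 2 * (1 + alpha) by lra.
have w0 (xi : R) : 0 <= 1 + C1 <= 1 + C1 by rewrite lexx addr_ge0.
have h0 (xi : R) : 0 <= xi -> `|mhat phi ((2 ^+ n)^-1 * xi)| <= 1 + C1.
  by move=> _; rewrite (le_trans (mhat_le1 hphi _))// lerDl.
have h1 (xi : R) : 0 <= xi -> `|xi * ((2 ^+ n)^-1 * mhat1 phi ((2 ^+ n)^-1 * xi))| <= 1 + C1.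
  by move=> _; rewrite mulrCA mulrA (le_trans (hC1 _))// lerDr.
have mw : measurable_fun setT (fun _ : R => 1 + C1) by mr.
have I0 (b : R) : 0 <= b -> b < alpha - 1 ->
    \int[leb]_(xi in HL) ((1 + C1) * (`|xi| `^ b * resolvent_symbol alpha lam xi)) =
    (1 + C1) * \int[leb]_(xi in HL) (`|xi| `^ b * resolvent_symbol alpha lam xi).
  by move=> b0 ba; rewrite RintegralZl//; exact: resolvent_symbol_itg.
have a10 : 0 < alpha - 1 by rewrite subr_gt0.
split.
  apply: (le_trans (multiplier_ckern alpha1 l1 hC (@cM n) mw w0 h0 pi0 z)).
  rewrite I0// mulrA ler_wpM2r//.
    apply: Rintegral_ge0 => xi _; rewrite mulr_ge0 ?powR_ge0// ltW//; exact: resolvent_symbol_gt0.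
  rewrite mulrA ler_wpM2r ?addr_ge0//.
  by rewrite mulrCA ler_peMr ?(ltW pi0).
apply: (le_trans (multiplier_skern alpha1 eta0 eta1 etaa l1 hC (@cM n) (@cM1 n) (dM n) mw w0 h0 h1 pi0 z)).
by rewrite I0 ?(ltW eta0)// !mulrA.
Qed.

(** Two dilated copies of [mhat] with scales below [2^-N] differ by at most a constant, and by at
    most [2^-N |xi|], because the derivative of [mhat] is bounded by one. The minimum tends to zero
    pointwise and stays bounded. *)
Let wN (N : nat) (xi : R) := Num.min 1 ((2 ^+ N)^-1 * `|xi|).

Let int0 : \int[leb]_(xi in HL) (0 : R) = 0. Proof. by rewrite /Rintegral integral0. Qed.

Let wN_cvg (lam b : R) : 1 <= lam -> 0 <= b -> b < alpha - 1 ->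
  \int[leb]_(xi in HL) (wN N xi * (`|xi| `^ b * resolvent_symbol alpha lam xi)) @[N --> \oo] --> 0.
Proof.
move=> l1 b0 ba; rewrite -[X in _ --> X]int0.
have i0 := resolvent_symbol_itg alpha1 l1 b0 ba.
have H0 xi : 0 <= `|xi| `^ b * resolvent_symbol alpha lam xi.
  by rewrite mulr_ge0 ?powR_ge0// ltW//; exact: resolvent_symbol_gt0.
apply: (int_cvg mHL _ i0).
- move=> N; apply: mrM; last exact: itg_meas i0.
  by apply: measurable_funTS; rewrite /wN; mr.
- move=> N xi _; rewrite normrM (ger0_norm (H0 _)) ler_piMl//.
  by rewrite ger0_norm ?ge_min ?lexx// le_min ler01 mulr_ge0// ltW.
move=> xi _; rewrite -[X in _ --> X](mul0r (`|xi| `^ b * resolvent_symbol alpha lam xi)).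
apply: cvgM; last exact: cvg_cst.
have h : ((2 ^+ N)^-1 * `|xi|) @[N --> \oo] --> 0.
  rewrite -[X in _ --> X](mul0r `|xi|); apply: cvgM; last exact: cvg_cst.
  under eq_fun do rewrite -exprVn.
  by apply: cvg_expr; rewrite ger0_norm ?invr_ge0// invf_lt1// ltr1n.
apply: (squeeze_cvgr _ (cvg_cst 0) h); near=> N.
by rewrite le_min ler01 mulr_ge0 ?(ltW (sg0 _))//= ge_min lexx orbT.
Unshelve. all: end_near. Qed.

(** The difference of two symbols is itself of multiplier type, with majorant [D * wN N]. Dominated
    convergence makes the resulting constants vanish as [N] grows. *)
Lemma smoothed_symbol_cauchy lam : 1 <= lam -> exists del : nat -> R, [/\ forall N, 0 <= del N,
  del N @[N --> \oo] --> 0 & forall N n k z, (N <= n)%N -> (N <= k)%N ->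
  `|ckern (smoothed_symbol lam n) z - ckern (smoothed_symbol lam k) z| <= del N /\
  `|skern (smoothed_symbol lam n) z - skern (smoothed_symbol lam k) z| <= del N * `|z| `^ (eta - 1)].
Proof.
move=> l1; have [C1 C10 hC1] := mhat1_decay hphi.
have alpha0 : 0 < alpha by exact: lt_trans alpha1.
have a10 : 0 < alpha - 1 by rewrite subr_gt0.
(* Large enough for both requirements: [|mhat| <= 1] occurs twice in [m], and the decay constant
   [C1] twice in [xi m1]. *)
pose D := 2 * (1 + C1); have D0 : 0 <= D by rewrite mulr_ge0// addr_ge0.
pose J (b : R) N := \int[leb]_(xi in HL) (wN N xi * (`|xi| `^ b * resolvent_symbol alpha lam xi)).
have wN0 N xi : 0 <= wN N xi by rewrite le_min ler01 mulr_ge0// ltW.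
have J0 b N : 0 <= J b N.
  by apply: Rintegral_ge0 => xi _; rewrite !mulr_ge0 ?powR_ge0// ltW//; exact: resolvent_symbol_gt0.
pose A := pi^-1 * D; pose B := 2 * (pi^-1 * (1 + alpha) * D).
have A0 : 0 <= A by rewrite mulr_ge0 ?(ltW pi0).
have B0 : 0 <= B by rewrite !mulr_ge0 ?addr_ge0 ?(ltW pi0) ?(ltW alpha0).
exists (fun N => A * J 0 N + B * J eta N); split.
- by move=> N; rewrite addr_ge0// mulr_ge0.
- rewrite -[X in _ --> X]add0r; apply: cvgD.
    rewrite -[X in _ --> X](mulr0 A); apply: cvgM; [exact: cvg_cst|exact: wN_cvg].
  rewrite -[X in _ --> X](mulr0 B); apply: cvgM; [exact: cvg_cst|exact: (wN_cvg l1 (ltW eta0))].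
move=> N n k z Nn Nk.
have [Cn Cn0 hCn] := mhat_scale_dom2 hphi (sg0 n).
have [Ck Ck0 hCk] := mhat_scale_dom2 hphi (sg0 k).
pose m xi := mhat phi ((2 ^+ n)^-1 * xi) - mhat phi ((2 ^+ k)^-1 * xi).
pose m1 xi := (2 ^+ n)^-1 * mhat1 phi ((2 ^+ n)^-1 * xi) - (2 ^+ k)^-1 * mhat1 phi ((2 ^+ k)^-1 * xi).
have cm : continuous m by move=> x; apply: cvgB; exact: cM.
have cm1 : continuous m1 by move=> x; apply: cvgB; exact: cM1.
have dm (xi : R) : is_derive xi 1 m (m1 xi) by exact: (is_deriveB (dM n xi) (dM k xi)).
have hm xi : `|m xi| * (1 + xi ^+ 2) <= Cn + Ck.
  rewrite (@le_trans _ _ ((`|mhat phi ((2 ^+ n)^-1 * xi)| + `|mhat phi ((2 ^+ k)^-1 * xi)|) * (1 + xi ^+ 2)))//.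
    by rewrite ler_wpM2r ?ler_normB// addr_ge0 ?sqr_ge0.
  by rewrite mulrDl lerD.
have sle i : (N <= i)%N -> (2 ^+ i)^-1 <= (2 ^+ N)^-1 :> R.
  by move=> Ni; rewrite lef_pV2 ?posrE ?exprn_gt0// ler_eXn2l// ltr1n.
pose w xi := D * wN N xi.
have mw : measurable_fun setT w by rewrite /w /wN; mr.
have w0 xi : 0 <= w xi <= D.
  by rewrite mulr_ge0//= ler_piMr// ge_min lexx.
have h0 xi : 0 <= xi -> `|m xi| <= w xi.
  move=> xi0; rewrite /w /wN minr_pMr// mulr1 le_min; apply/andP; split.
    rewrite (le_trans (ler_normB _ _))// (le_trans (lerD (mhat_le1 hphi _) (mhat_le1 hphi _)))// /D.
    by have := C10; lra.
  have := mvt_lip (is_derive_mhat hphi) (mhat1_le1 hphi) ((2 ^+ n)^-1 * xi) ((2 ^+ k)^-1 * xi).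
  rewrite mul1r => /le_trans; apply; rewrite -mulrBl normrM.
  rewrite mulrA ler_wpM2r// (@le_trans _ _ (2 ^+ N)^-1)//.
    rewrite ler_norml; have := sle n Nn; have := sle k Nk; have := sg0 n; have := sg0 k.
    by move=> p1 p2 p3 p4; apply/andP; split; lra.
  by rewrite ler_peMl ?(ltW (sg0 _))// /D; have := C10; lra.
have h1 xi : 0 <= xi -> `|xi * m1 xi| <= w xi.
  move=> xi0; rewrite /m1 mulrBr (le_trans (ler_normB _ _))//.
  have key i : (N <= i)%N -> `|xi * ((2 ^+ i)^-1 * mhat1 phi ((2 ^+ i)^-1 * xi))| <= (1 + C1) * wN N xi.
    move=> Ni; rewrite mulrCA mulrA /wN minr_pMr ?addr_ge0// mulr1 le_min; apply/andP; split.
      by rewrite (le_trans (hC1 _))// lerDr.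
    rewrite normrM (le_trans (ler_piMr _ (mhat1_le1 hphi _)))// normrM (gtr0_norm (sg0 _)).
    rewrite mulrA ler_wpM2r// (le_trans (sle i Ni))// ler_peMl ?(ltW (sg0 _))//.
    by rewrite lerDl.
  rewrite (le_trans (lerD (key _ Nn) (key _ Nk)))// /w /D.
  by rewrite le_eqVlt; apply/orP; left; apply/eqP; ring.
have WE : (fun xi => smoothed_symbol lam n xi - smoothed_symbol lam k xi) = (fun xi => pi^-1 * (m xi * resolvent_symbol alpha lam xi)).
  by apply/funext => xi; rewrite /smoothed_symbol /m; ring.
have JE b : 0 <= b -> b < alpha - 1 ->
   \int[leb]_(xi in HL) (w xi * (`|xi| `^ b * resolvent_symbol alpha lam xi)) = D * J b N.
  move=> b0 ba; rewrite /J -RintegralZl//.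
    by apply: int_eq => xi _; rewrite /w -mulrA.
  apply: (itg_M _ (M := 1)) => //; first exact: resolvent_symbol_itg.
    by apply: measurable_funTS; rewrite /wN; mr.
  by move=> xi _; rewrite ger0_norm ?wN0// ge_min lexx.
have dn : dom2 (smoothed_symbol lam n) by exact: smoothed_symbol_dom2.
have dk : dom2 (smoothed_symbol lam k) by exact: smoothed_symbol_dom2.
rewrite -ckernB// -skernB// WE; split.
  apply: (le_trans (multiplier_ckern alpha1 l1 hm cm mw w0 h0 pi0 z)).
  by rewrite (JE 0 (lexx 0) a10) mulrA lerDl mulr_ge0.
apply: (le_trans (multiplier_skern alpha1 eta0 eta1 etaa l1 hm cm cm1 dm mw w0 h0 h1 pi0 z)).
rewrite JE ?(ltW eta0)// ler_wpM2r ?powR_ge0//.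
rewrite (_ : 2 * _ = B * J eta N); last by rewrite /B; ring.
by rewrite lerDr mulr_ge0.
Qed.

Lemma symbol_mass_ge0 lam : 1 <= lam -> 0 <= symbol_mass lam.
Proof.
move=> l1; apply: Rintegral_ge0 => xi _; rewrite mulr_ge0 ?powR_ge0// ltW//; exact: resolvent_symbol_gt0.
Qed.

(** The source of the contraction: a large [lam] makes the derivative of the resolvent kernel small
    relative to [|z|^(eta - 1)]. *)
Lemma symbol_mass_cvg0 : symbol_mass n.+1%:R @[n --> \oo] --> 0.
Proof.
rewrite -[X in _ --> X]int0.
have l1 (n : nat) : 1 <= n.+1%:R :> R by rewrite ler1n.
apply: (int_cvg mHL _ (resolvent_symbol_itg alpha1 (lexx 1) (ltW eta0) etaa)).
- by move=> n; exact: itg_meas (resolvent_symbol_itg alpha1 (l1 n) (ltW eta0) etaa).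
- move=> n xi _; rewrite ger0_norm; last by rewrite mulr_ge0 ?powR_ge0// ltW//; exact: resolvent_symbol_gt0.
  rewrite ler_wpM2l ?powR_ge0// /resolvent_symbol lef_pV2 ?posrE ?ltr_pwDl ?powR_ge0//.
  by rewrite lerD2r.
move=> xi _; rewrite -[X in _ --> X](mulr0 (`|xi| `^ eta)).
apply: cvgM; first exact: cvg_cst.
apply: (squeeze_cvgr _ (cvg_cst 0) cvg_harmonic); near=> n.
rewrite ltW ?resolvent_symbol_gt0//= /harmonic /resolvent_symbol lef_pV2 ?posrE ?ltr_pwDl ?powR_ge0//.
by rewrite lerDl powR_ge0.
Unshelve. all: end_near. Qed.

End smoothed_resolvent.

(** * Fixed points of contractions in the sup norm *)

Lemma cauchy_bound_cvg (R : realType) (s b : nat -> R) :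
  b n @[n --> \oo] --> 0 -> (forall j n, (j <= n)%N -> `|s n - s j| <= b j) ->
  exists l, s n @[n --> \oo] --> l /\ forall j, `|l - s j| <= b j.
Proof.
move=> b0 sb.
have cs : cvg (s n @[n --> \oo]).
  apply/cauchy_cvgP; apply: cauchy_exP => e e0.
  have /cvgrPdist_lt /(_ e e0) [N _ bN] := b0.
  exists (s N); exists N => // n /= Nn.
  rewrite /ball/= distrC (le_lt_trans (sb _ _ Nn))//.
  by have := bN N (leqnn N); rewrite sub0r normrN => /(le_lt_trans (ler_norm _)).
exists (lim (s n @[n --> \oo])); split => // j.
have h : `|s n - s j| @[n --> \oo] --> `|lim (s n @[n --> \oo]) - s j|.
  by apply: cvg_norm; apply: cvgB => //; exact: cvg_cst.
apply: (ler_cvg_to h (cvg_cst (b j))); near=> n; apply: sb.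
by near: n; exists j.
Unshelve. all: end_near. Qed.

(** Banach iteration started from 0. Limits are taken pointwise, which preserves measurability; the
    sup norm bounds follow from the geometric tails. *)
Lemma contraction_fix (R : realType) (S : (R -> R) -> R -> R) (B : R) :
  0 <= B ->
  (forall f : R -> R, measurable_fun setT f -> (forall x, `|f x| <= B) ->
     measurable_fun setT (S f) /\ forall x, `|S f x| <= B) ->
  (forall (f g : R -> R) (e : R), measurable_fun setT f -> measurable_fun setT g ->
     (forall x, `|f x| <= B) -> (forall x, `|g x| <= B) ->
     (forall x, `|f x - g x| <= e) -> forall x, `|S f x - S g x| <= e / 4) ->
  exists v : R -> R, [/\ measurable_fun setT v, forall x, `|v x| <= B & forall x, v x = S v x].
Proof.
move=> B0 Sgood Scontr.
pose s j := iter j S (fun=> 0).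
have sg j : measurable_fun setT (s j) /\ forall x, `|s j x| <= B.
  elim: j => [|j [m1 b1]] /=; first by split=> [|x]; [mr|rewrite normr0].
  exact: Sgood.
have sS j x : `|s j.+1 x - s j x| <= B * (4^-1) ^+ j.
  elim: j x => [|j IH] x.
    by rewrite expr0 mulr1 /= subr0; have [_] := sg 1%N; apply.
  have [m1 b1] := sg j; have [m2 b2] := sg j.+1.
  by rewrite exprSr mulrA; exact: Scontr.
pose b j : R := 2 * B * (4^-1) ^+ j.
have b0 : b n @[n --> \oo] --> 0.
  rewrite -[X in _ --> X](mulr0 (2 * B)); apply: cvgM; first exact: cvg_cst.
  by apply: cvg_expr; rewrite ger0_norm ?invr_ge0// invf_lt1// ltr1n.
have sb x j n : (j <= n)%N -> `|s n x - s j x| <= b j.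
  move=> jn; rewrite -(subnK jn) addnC; set i := (n - j)%N.
  suff : `|s (j + i)%N x - s j x| <= b j - b (j + i)%N.
    move=> /le_trans; apply; rewrite gerBl /b !mulr_ge0 ?exprn_ge0 ?invr_ge0//.
  elim: i => [|i IH]; first by rewrite addn0 !subrr normr0.
  rewrite (_ : s (j + i.+1)%N x - s j x = (s (j + i)%N.+1 x - s (j + i)%N x) + (s (j + i)%N x - s j x)); last first.
    by rewrite addnS; ring.
  rewrite (le_trans (ler_normD _ _))// (le_trans (lerD (sS _ _) IH))//.
  rewrite /b addnS exprSr; have : 0 <= B * 4^-1 ^+ (j + i) by rewrite mulr_ge0 ?exprn_ge0.
  set X := 4^-1 ^+ (j + i); move=> BX; lra.
have /choice [v hv] x := cauchy_bound_cvg b0 (sb x).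
have mv : measurable_fun setT v.
  by apply: (measurable_fun_cvg (h := s)) => [j|x _]; [have [] := sg j|have [] := hv x].
have bv x : `|v x| <= B.
  have [c _] := hv x; apply: (ler_cvg_to (cvg_norm c) (cvg_cst B)).
  by apply: nearW => j; have [_] := sg j; apply.
exists v; split=> // x.
apply/eqP; rewrite -subr_eq0 -normr_le0.
have c : (b n.+1 + b n / 4) @[n --> \oo] --> 0.
  rewrite -[X in _ --> X]addr0; apply: cvgD; first by rewrite (@cvg_shiftS R).
  by rewrite -[X in _ --> X](mul0r 4^-1); apply: cvgM => //; exact: cvg_cst.
apply: (ler_cvg_to (cvg_cst _) c); apply: nearW => j.
have [_ h1] := hv x; have [m1 b1] := sg j.
rewrite (_ : v x - S v x = (v x - s j.+1 x) + (S (s j) x - S v x)); last by rewrite /=; ring.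
rewrite (le_trans (ler_normD _ _))// lerD//.
by apply: Scontr => // y; have [_ h2] := hv y; rewrite distrC.
Qed.

(** * The Zvonkin transform *)

Section potentials.
Context {R : realType} (eta N : R).
Notation mT := (measurableTypeR R).
Context (kap : {finite_measure set mT -> \bar R}).
Implicit Types (k f g : R -> R) (x z M K c : R).

Definition sing z := `|z| `^ (eta - 1).
Hypothesis singN : forall x, itg kap setT (fun y : mT => sing (x - y)) /\
  \int[kap]_y sing (x - y) <= N.

Definition pot k f x := \int[kap]_y (k (x - y) * f y).
Definition kmass := fine (kap setT).
Definition bmeas f M := measurable_fun setT f /\ forall x, `|f x| <= M.
Definition kitg k := measurable_fun setT k /\
  forall x, itg kap setT (fun y : mT => k (x - y)).

Let kfin : (kap setT < +oo)%E.
Proof. by rewrite ltey_eq fin_num_measure. Qed.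

Lemma kmass_ge0 : 0 <= kmass. Proof. exact: fine_ge0. Qed.

Lemma mrshift k x : measurable_fun setT k -> measurable_fun setT (fun y : mT => k (x - y)).
Proof. by move=> mk; apply: mrcomp => //; mr. Qed.

Lemma kitg_bnd k K : measurable_fun setT k -> (forall z, `|k z| <= K) -> kitg k.
Proof.
move=> mk kK; split => // x; apply: (itg_bnd _ (M := K)) => //; exact: mrshift.
Qed.

Lemma kitg_sing k c : measurable_fun setT k -> (forall z, `|k z| <= c * sing z) -> kitg k.
Proof.
move=> mk kK; split => // x; have [i _] := singN x.
by apply: (itg_dom _ _ (itgZ _ c i)) => //; exact: mrshift.
Qed.

Lemma kitgB k k' : kitg k -> kitg k' -> kitg (fun z => k z - k' z).
Proof. by move=> [m1 i1] [m2 i2]; split=> [|x]; [mr|exact: itgB]. Qed.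

Lemma pot_itg k f M x : kitg k -> bmeas f M -> itg kap setT (fun y : mT => k (x - y) * f y).
Proof.
move=> [mk ik] [mf fM]; have := itg_M measurableT (M := M) (ik x) mf (fun y _ => fM y).
by apply: eq_integrable => // y _ /=; rewrite mulrC.
Qed.

Lemma pot_bnd k f K M x : kitg k -> bmeas f M -> (forall z, `|k z| <= K) ->
  `|pot k f x| <= K * M * kmass.
Proof.
move=> ik bf kK; apply: int_bnd => //.
  exact: itg_meas (pot_itg x ik bf).
by move=> y _; rewrite normrM; have [_ fM] := bf; rewrite ler_pM.
Qed.

Lemma pot_sing k f c M x : kitg k -> bmeas f M -> (forall z, `|k z| <= c * sing z) -> 0 <= c ->
  `|pot k f x| <= c * M * N.
Proof.
move=> ik [mf fM] kc c0; have [i iN] := singN x.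
have M0 : 0 <= M := le_trans (normr_ge0 _) (fM 0).
apply: (@le_trans _ _ (c * M * \int[kap]_y sing (x - y))); last by rewrite ler_wpM2l ?mulr_ge0.
rewrite -RintegralZl//; apply: int_dom => //.
- by have := itg_meas (pot_itg x ik (conj mf fM)).
- exact: itgZ.
move=> y _; rewrite normrM mulrAC; apply: ler_pM => //.
Qed.

Lemma potBl k k' f M x : kitg k -> kitg k' -> bmeas f M ->
  pot k f x - pot k' f x = pot (fun z => k z - k' z) f x.
Proof.
move=> ik ik' bf; rewrite /pot -RintegralB//; try exact: pot_itg bf.
by apply: int_eq => y _; rewrite mulrBl.
Qed.

Lemma potBr k f g M M' x : kitg k -> bmeas f M -> bmeas g M' ->
  pot k f x - pot k g x = pot k (fun y => f y - g y) x.
Proof.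
move=> ik bf bg; rewrite /pot -RintegralB//; [|exact: pot_itg bf|exact: pot_itg bg].
by apply: int_eq => y _; rewrite mulrBr.
Qed.

Lemma pot_lip k f (A M x x' : R) : kitg k -> bmeas f M -> (forall z z', `|k z - k z'| <= A * `|z - z'|) ->
  `|pot k f x - pot k f x'| <= A * M * kmass * `|x - x'|.
Proof.
move=> ik bf kA; rewrite /pot -RintegralB//; try exact: pot_itg bf.
rewrite mulrAC; apply: int_bnd => //.
  by apply: itg_meas; apply: itgB => //; exact: pot_itg bf.
move=> y _; have [_ fM] := bf.
rewrite -mulrBl normrM mulrAC ler_pM//.
by rewrite (le_trans (kA _ _))// opprB addrA subrK.
Qed.

Lemma pot_taylor k k1 f (A M x x' : R) : kitg k -> kitg k1 -> bmeas f M ->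
  (forall z z', `|k z' - k z - k1 z * (z' - z)| <= A * (z' - z) ^+ 2) ->
  `|pot k f x' - pot k f x - pot k1 f x * (x' - x)| <= A * M * kmass * (x' - x) ^+ 2.
Proof.
move=> ik ik1 bf kA; rewrite /pot -RintegralB//; try exact: pot_itg bf.
rewrite -RintegralZr//; last exact: pot_itg bf.
rewrite -RintegralB//; last 2 first.
- by apply: itgB => //; exact: pot_itg bf.
- by apply: itgZr => //; exact: pot_itg bf.
rewrite mulrAC; apply: int_bnd => //.
  apply: itg_meas; apply: itgB => //; first by apply: itgB => //; exact: pot_itg bf.
  by apply: itgZr => //; exact: pot_itg bf.
move=> y _; have [_ fM] := bf.
rewrite (_ : _ - _ = (k (x' - y) - k (x - y) - k1 (x - y) * ((x' - y) - (x - y))) * f y); last by ring.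
rewrite normrM mulrAC ler_pM//.
by rewrite (le_trans (kA _ _))// opprB addrA subrK.
Qed.

(** On the support of the kernel the factor [w] deviates from [w x] by at most [om]. The error is
    expressed through the potential of [1], that is through the mollified total variation, because
    this is the quantity whose occupation can be estimated. *)
Lemma pot_osc k f g w (om M M' eps x : R) : kitg k -> bmeas f M -> bmeas w M' -> bmeas g 1 ->
  (forall z, 0 <= k z) -> (forall z, eps <= `|z| -> k z = 0) ->
  (forall y, `|x - y| <= eps -> `|w y - w x| <= om) -> (forall y, f y = w y * g y) ->
  `|pot k f x - w x * pot k g x| <= om * pot k (fun=> 1) x.
Proof.
move=> ik bf bw bg k0 kout wom fE.
have b1 : bmeas (fun=> 1 : R) 1 by split=> [|z]; [mr|rewrite normr1].
rewrite /pot -RintegralZl//; last exact: pot_itg bg.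
rewrite -RintegralB//; [|exact: pot_itg bf|by apply: itgZ => //; exact: pot_itg bg].
rewrite -RintegralZl//; last exact: pot_itg b1.
apply: int_dom => //.
- apply: itg_meas; apply: itgB => //; first exact: pot_itg bf.
  by apply: itgZ => //; exact: pot_itg bg.
- by apply: itgZ => //; exact: pot_itg b1.
move=> y _; rewrite fE (_ : _ - _ = k (x - y) * g y * (w y - w x)); last by ring.
rewrite mulr1; have [e|e] := leP eps `|x - y|; first by rewrite kout// mul0r mul0r normr0 mulr0.
rewrite normrM mulrC; apply: ler_pM => //; first by apply: wom; exact: ltW.
rewrite normrM ger0_norm// ler_piMr//; by have [_] := bg; apply.
Qed.

End potentials.

Section zvonkin.
Context {R : realType} (eta N : R).
Notation mT := (measurableTypeR R).
Context (kap : {finite_measure set mT -> \bar R}).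
Hypothesis singN : forall x : R, itg kap setT (fun y : mT => sing eta (x - y)) /\
  \int[kap]_y sing eta (x - y) <= N.
Context (phi : R -> R) (hphi : mollifier phi).
Context (W : nat -> R -> R) (q G0 : R) (del : nat -> R).
Hypothesis W2 : forall n, dom2 (W n).
Hypothesis q0 : 0 <= q.
Hypothesis qN : q * N <= 4^-1.
Hypothesis Wcos : forall n z, `|ckern (W n) z| <= G0.
Hypothesis Wsin : forall n z, `|skern (W n) z| <= q * sing eta z.
Hypothesis del0 : forall n, 0 <= del n.
Hypothesis delc : del n @[n --> \oo] --> 0.
Hypothesis Wdel : forall m n k z, (m <= n)%N -> (m <= k)%N ->
  `|ckern (W n) z - ckern (W k) z| <= del m /\
  `|skern (W n) z - skern (W k) z| <= del m * sing eta z.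

Definition Up n (f : R -> R) := pot kap (ckern (W n)) f.
Definition Vp n (f : R -> R) := pot kap (skern (W n)) f.
Definition Mp n (f : R -> R) := pot kap (mollifier_seq phi n) f.

Let N0 : 0 <= N.
Proof. by have [_] := singN 0; apply: le_trans; apply: Rintegral_ge0 => y _; exact: powR_ge0. Qed.

Let A n := second_moment (W n).
Let A0 n : 0 <= A n. Proof. exact: second_moment_ge0. Qed.

Lemma skernW_lip n z z' : `|skern (W n) z - skern (W n) z'| <= A n * `|z - z'|.
Proof. exact: skern_lip. Qed.

Lemma skern_meas n : measurable_fun setT (skern (W n)).
Proof. exact: continuous_measurable_fun (lip_continuous (@skernW_lip n)). Qed.

Lemma ckern_derive n (z : R) : is_derive z 1 (ckern (W n)) (skern (W n) z).
Proof. by apply: quad_is_derive => z'; exact: ckern_taylor. Qed.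

Lemma ckern_meas n : measurable_fun setT (ckern (W n)).
Proof.
apply: continuous_measurable_fun => z; apply: differentiable_continuous.
by apply/derivable1_diffP; have -[] := ckern_derive n z.
Qed.

Lemma ckern_kitg n : kitg kap (ckern (W n)).
Proof. exact: kitg_bnd (ckern_meas n) (Wcos n). Qed.

Lemma skern_kitg n : kitg kap (skern (W n)).
Proof. by apply: (kitg_sing singN (c := q)); [exact: skern_meas|exact: Wsin]. Qed.

Lemma moll_bound n : exists2 B : R, 0 <= B & forall z, `|mollifier_seq phi n z| <= B.
Proof.
have [B B0 hB] := phi_bound hphi; exists (2 ^+ n * B) => [|z]; first by rewrite mulr_ge0 ?exprn_ge0.
by rewrite normrM (ger0_norm (exprn_ge0 _ _))// ler_wpM2l ?exprn_ge0.
Qed.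

Lemma moll_lip n : exists2 K : R, 0 <= K &
  forall z z', `|mollifier_seq phi n z - mollifier_seq phi n z'| <= K * `|z - z'|.
Proof.
have [K K0 hK] := phi_lip hphi; exists (2 ^+ n * (K * 2 ^+ n)) => [|z z'].
  by rewrite !mulr_ge0 ?exprn_ge0.
rewrite -mulrBr normrM (ger0_norm (exprn_ge0 _ _))// -mulrA ler_wpM2l ?exprn_ge0//.
by rewrite (le_trans (hK _ _))// -mulrA ler_wpM2l// -mulrBr normrM ger0_norm ?exprn_ge0.
Qed.

Lemma moll_ge0 n z : 0 <= mollifier_seq phi n z.
Proof. by rewrite mulr_ge0 ?exprn_ge0// (phi_ge0 hphi). Qed.

Lemma moll_out n z : (2 ^+ n)^-1 <= `|z| -> mollifier_seq phi n z = 0.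
Proof.
move=> nz; rewrite /mollifier_seq (phi_out hphi) ?mulr0//.
by rewrite normrM (ger0_norm (exprn_ge0 _ _))// -ler_pdivrMl ?mulr1 ?exprn_gt0.
Qed.

Lemma moll_kitg n : kitg kap (mollifier_seq phi n).
Proof.
have [B _ hB] := moll_bound n; have [K _ hK] := moll_lip n.
exact: kitg_bnd (continuous_measurable_fun (lip_continuous hK)) hB.
Qed.

Section bounded_density.
Context (f : R -> R) (M : R) (fM : bmeas f M).
Let M0 : 0 <= M. Proof. by have [_ h] := fM; exact: le_trans (normr_ge0 _) (h 0). Qed.

Lemma Up_bnd n x : `|Up n f x| <= G0 * M * kmass kap.
Proof. exact: pot_bnd (ckern_kitg n) fM (Wcos n). Qed.

Lemma Vp_bnd n x : `|Vp n f x| <= M / 4.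
Proof.
have h : `|Vp n f x| <= q * M * N := pot_sing singN x (skern_kitg n) fM (Wsin n) q0.
by apply: (le_trans h); rewrite mulrAC mulrC ler_wpM2l.
Qed.

Lemma Up_taylor n x x' :
  `|Up n f x' - Up n f x - Vp n f x * (x' - x)| <= A n * M * kmass kap * (x' - x) ^+ 2.
Proof.
by apply: pot_taylor fM _; [exact: ckern_kitg|exact: skern_kitg|move=> z z'; exact: ckern_taylor].
Qed.

Lemma Up_derive n (x : R) : is_derive x 1 (Up n f) (Vp n f x).
Proof. by apply: quad_is_derive => x'; exact: Up_taylor. Qed.

Lemma Up_lip n x x' : `|Up n f x - Up n f x'| <= M / 4 * `|x - x'|.
Proof. by apply: (mvt_lip (Up_derive n)) => y; exact: Vp_bnd. Qed.

Lemma Vp_lip n x x' : `|Vp n f x - Vp n f x'| <= A n * M * kmass kap * `|x - x'|.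
Proof. by apply: pot_lip fM _; [exact: skern_kitg|exact: skernW_lip]. Qed.

Lemma Mp_bnd n : exists2 B : R, 0 <= B & forall x, `|Mp n f x| <= B.
Proof.
have [B B0 hB] := moll_bound n; exists (B * M * kmass kap) => [|x].
  by rewrite !mulr_ge0 ?kmass_ge0.
exact: pot_bnd (moll_kitg n) fM hB.
Qed.

Lemma Mp_lip n : exists2 K : R, 0 <= K & forall x x', `|Mp n f x - Mp n f x'| <= K * `|x - x'|.
Proof.
have [K K0 hK] := moll_lip n; exists (K * M * kmass kap) => [|x x'].
  by rewrite !mulr_ge0 ?kmass_ge0.
exact: pot_lip (moll_kitg n) fM hK.
Qed.

Lemma Up_meas n : measurable_fun setT (Up n f).
Proof. exact: continuous_measurable_fun (lip_continuous (Up_lip n)). Qed.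

Lemma Vp_meas n : measurable_fun setT (Vp n f).
Proof. exact: continuous_measurable_fun (lip_continuous (Vp_lip n)). Qed.

Lemma Mp_meas n : measurable_fun setT (Mp n f).
Proof. by have [K _ hK] := Mp_lip n; exact: continuous_measurable_fun (lip_continuous hK). Qed.

Lemma Up_del m n k x : (m <= n)%N -> (m <= k)%N ->
  `|Up n f x - Up k f x| <= del m * M * kmass kap.
Proof.
move=> mn mk; rewrite /Up (potBl _ (ckern_kitg n) (ckern_kitg k) fM).
apply: (pot_bnd _ _ fM) => [|z]; first exact: kitgB (ckern_kitg n) (ckern_kitg k).
by have [] := Wdel z mn mk.
Qed.

Lemma Vp_del m n k x : (m <= n)%N -> (m <= k)%N ->
  `|Vp n f x - Vp k f x| <= del m * M * N.
Proof.
move=> mn mk; rewrite /Vp (potBl _ (skern_kitg n) (skern_kitg k) fM).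
apply: (pot_sing singN _ _ fM) => [|z|]; first exact: kitgB (skern_kitg n) (skern_kitg k).
  by have [] := Wdel z mn mk.
exact: del0.
Qed.
End bounded_density.

Lemma bmeas1 : bmeas (fun=> 1 : R) 1.
Proof. by split=> [|z]; [mr|rewrite normr1]. Qed.

Lemma Mp1_ge0 n x : 0 <= Mp n (fun=> 1) x.
Proof. by apply: Rintegral_ge0 => y _; rewrite mulr1 moll_ge0. Qed.

Lemma Mp_le n f x : bmeas f 1 -> `|Mp n f x| <= Mp n (fun=> 1) x.
Proof.
move=> bf; have [mf f1] := bf; apply: int_dom => //.
- exact: itg_meas (pot_itg x (moll_kitg n) bf).
- exact: pot_itg x (moll_kitg n) bmeas1.
by move=> y _; rewrite mulr1 normrM ger0_norm ?moll_ge0// ler_piMr ?moll_ge0.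
Qed.

Context (h : R -> R) (bh : bmeas h 1).

Let fh (v : R -> R) y := (1 + v y) * h y.

Let fh_bmeas v B : bmeas v B -> bmeas (fh v) (1 + B).
Proof.
move=> [mv vB]; have [mh h1] := bh; split=> [|y]; first by rewrite /fh; mr.
rewrite normrM (le_trans (ler_piMr _ (h1 _)))//.
by rewrite (le_trans (ler_normD _ _))// normr1 lerD2l.
Qed.

Let fhB v w B B' (e : R) : bmeas v B -> bmeas w B' -> (forall y, `|v y - w y| <= e) ->
  bmeas (fun y => fh v y - fh w y) e.
Proof.
move=> [mv vB] [mw wB] vw; have [mh h1] := bh; split=> [|y]; first by rewrite /fh; mr.
rewrite (_ : _ - _ = (v y - w y) * h y); last by rewrite /fh; ring.
by rewrite normrM (le_trans (ler_piMr _ (h1 _))).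
Qed.

(** The contraction factor is [q N <= 1/4], and the ball of radius [1/3] is invariant because
    [(1 + 1/3) / 4 = 1/3]. *)
Lemma zvonkin_fix n : exists v, bmeas v 3^-1 /\ forall x, v x = Vp n (fh v) x.
Proof.
have [||| v [mv v3 vE]] := @contraction_fix R (fun v => Vp n (fh v)) 3^-1.
- by [].
- move=> v mv vB; have b := fh_bmeas (conj mv vB).
  split=> [|x]; first exact: Vp_meas b n.
  by apply: (le_trans (Vp_bnd b n x)); lra.
- move=> v w e mv mw vB wB vw x.
  have bv := conj mv vB : bmeas v _; have bw := conj mw wB : bmeas w _.
  rewrite /Vp (potBr _ (skern_kitg n) (fh_bmeas bv) (fh_bmeas bw)).
  exact: Vp_bnd (fhB bv bw vw) n x.
by exists v.
Qed.

Definition vz n := sval (cid (zvonkin_fix n)).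
Definition fz n := fh (vz n).
Definition uz n := Up n (fz n).
Definition kz n := Mp n (fz n).

Lemma vz_bmeas n : bmeas (vz n) 3^-1.
Proof. by have [] := svalP (cid (zvonkin_fix n)). Qed.

Lemma vzE n x : vz n x = Vp n (fz n) x.
Proof. by have [_] := svalP (cid (zvonkin_fix n)); apply. Qed.

Lemma fz_bmeas n : bmeas (fz n) (1 + 3^-1).
Proof. exact: fh_bmeas (vz_bmeas n). Qed.

Lemma uz_lip n x x' : `|uz n x - uz n x'| <= 2^-1 * `|x - x'|.
Proof. by apply: (le_trans (Up_lip (fz_bmeas n) n x x')); rewrite ler_wpM2r//; lra. Qed.

Lemma vz_lip n x x' : `|vz n x - vz n x'| <= A n * (1 + 3^-1) * kmass kap * `|x - x'|.
Proof. rewrite !vzE; exact: Vp_lip (fz_bmeas n) n x x'. Qed.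

(** Two fixed points differ by a quarter of their distance plus the effect of changing the kernel,
    which is at most [3/4 d]. Iterating this inequality from the crude bound [d + 1] leads to
    [d]. *)
Lemma vz_del m n k x : (m <= n)%N -> (m <= k)%N -> `|vz n x - vz k x| <= 2 * del m * N.
Proof.
move=> mn mk; pose d := 2 * del m * N; have d0 : 0 <= d by rewrite !mulr_ge0.
have bn := vz_bmeas n; have bk := vz_bmeas k.
have step (e : R) : (forall y, `|vz n y - vz k y| <= e) -> forall y, `|vz n y - vz k y| <= e / 4 + 3 / 4 * d.
  move=> ve y; rewrite !vzE.
  rewrite (_ : _ - _ = (Vp n (fz n) y - Vp n (fz k) y) + (Vp n (fz k) y - Vp k (fz k) y)); last by rewrite addrA subrK.
  rewrite (le_trans (ler_normD _ _))// lerD//.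
    rewrite /Vp (potBr _ (skern_kitg n) (fz_bmeas n) (fz_bmeas k)).
    exact: Vp_bnd (fhB bn bk ve) n y.
  apply: (le_trans (Vp_del (fz_bmeas k) y mn mk)).
  have hd : 0 <= del m * N by rewrite mulr_ge0.
  by rewrite /d; lra.
have main j : forall y, `|vz n y - vz k y| <= d + 4^-1 ^+ j.
  elim: j => [|j IH] y.
    have [_ n3] := bn; have [_ k3] := bk.
    by rewrite expr0 (le_trans (ler_normB _ _))// (le_trans (lerD (n3 _) (k3 _)))//; lra.
  by rewrite (le_trans (step _ IH y))// exprS; lra.
have c : (d + 4^-1 ^+ j) @[j --> \oo] --> d.
  rewrite -[X in _ --> X]addr0; apply: cvgD; first exact: cvg_cst.
  by apply: cvg_expr; rewrite ger0_norm ?invr_ge0// invf_lt1// ltr1n.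
by apply: (ler_cvg_to (cvg_cst _) c); apply: nearW => j; exact: main.
Qed.

Lemma uz_del m n k x : (m <= n)%N -> (m <= k)%N ->
  `|uz n x - uz k x| <= 2 * (G0 * N + 1) * kmass kap * del m.
Proof.
move=> mn mk; have bn := vz_bmeas n; have bk := vz_bmeas k; rewrite /uz.
rewrite (_ : _ - _ = (Up n (fz n) x - Up n (fz k) x) + (Up n (fz k) x - Up k (fz k) x)); last by rewrite addrA subrK.
rewrite (le_trans (ler_normD _ _))//.
have -> : 2 * (G0 * N + 1) * kmass kap * del m =
   G0 * (2 * del m * N) * kmass kap + 2 * del m * kmass kap by ring.
rewrite lerD//.
  rewrite /Up (potBr _ (ckern_kitg n) (fz_bmeas n) (fz_bmeas k)).
  by apply: Up_bnd; apply: (fhB bn bk) => y; exact: vz_del.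
apply: (le_trans (Up_del (fz_bmeas k) x mn mk)).
by rewrite ler_wpM2r ?kmass_ge0//; have := del0 m; nra.
Qed.

(* [kz n] is the mollification of [(1 + vz n) h kap], which is close to [1 + vz n]
   times the mollified measure although [vz n] has no modulus of continuity
   uniform in [n]: [vz m] with a smaller index [m] serves as a substitute. *)
Lemma kz_osc : exists om : nat -> R, [/\ forall n, 0 <= om n, om n @[n --> \oo] --> 0 &
  forall n x, `|kz n x - (1 + vz n x) * Mp n h x| <= om n * Mp n (fun=> 1) x].
Proof.
have osc n (om x : R) : (forall y, `|x - y| <= (2 ^+ n)^-1 -> `|vz n y - vz n x| <= om) ->
    `|kz n x - (1 + vz n x) * Mp n h x| <= om * Mp n (fun=> 1) x.
  move=> vo; have [mv v3] := vz_bmeas n.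
  apply: (@pot_osc R kap _ (fz n) h (fun y => 1 + vz n y) om (1 + 3^-1) (1 + 3^-1) ((2 ^+ n)^-1) x) => //.
  - exact: moll_kitg.
  - exact: fz_bmeas.
  - split=> [|y]; first by mr.
    by rewrite (le_trans (ler_normD _ _))// normr1 lerD2l.
  - exact: moll_ge0.
  - exact: moll_out.
  by move=> y xy; rewrite opprD addrACA subrr add0r; exact: vo.
pose L m := A m * (1 + 3^-1) * kmass kap.
have L0 m : 0 <= L m by rewrite !mulr_ge0 ?kmass_ge0//; lra.
pose c n m := 4 * del m * N + L m * (2 ^+ n)^-1.
have c0 n m : 0 <= c n m by apply: addr_ge0; [rewrite !mulr_ge0|rewrite mulr_ge0 ?L0 ?invr_ge0 ?exprn_ge0].
have oscm n m x : (m <= n)%N -> `|kz n x - (1 + vz n x) * Mp n h x| <= c n m * Mp n (fun=> 1) x.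
  move=> mn; apply: osc => y xy.
  have split3 (a1 a2 a3 a4 : R) : a1 - a4 = (a1 - a2) + (a2 - a3) - (a4 - a3) by ring.
  rewrite (split3 _ (vz m y) (vz m x)).
  rewrite (le_trans (ler_normB _ _))// (le_trans (lerD (ler_normD _ _) (lexx _)))//.
  have h1 := vz_del y mn (leqnn m); have h2 := vz_del x mn (leqnn m).
  have h3 : `|vz m y - vz m x| <= L m * (2 ^+ n)^-1.
    apply: (le_trans (vz_lip m y x)); rewrite ler_wpM2l ?L0//.
    by rewrite distrC.
  rewrite /c; lra.
(* The minimum over the auxiliary index is a null sequence: a suitable fixed [m] makes the first
   term of [c n m] small, and then [n] the second one. *)
pose om n := \big[Num.min/(c n 0%N)]_(m < n.+1) c n m.
have omle n m : (m <= n)%N -> om n <= c n m.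
  move=> mn; rewrite /om; have mn' : (m < n.+1)%N by [].
  exact: (bigmin_le_cond (c n 0%N) (j := Ordinal mn') (P := xpredT) (fun i : 'I_n.+1 => c n i)).
have omE n : exists2 m, (m <= n)%N & om n = c n m.
  rewrite /om; elim/big_ind : _ => [|a b [m1 h1 ->] [m2 h2 ->]|i _].
  - by exists 0%N.
  - by have [_|_] := leP (c n m1) (c n m2); [exists m1|exists m2].
  - by exists i => //; rewrite -ltnS.
have om0 n : 0 <= om n by have [m _ ->] := omE n.
exists om; split=> //; last by move=> n x; have [m mn ->] := omE n; exact: oscm.
apply/cvgrPdist_lt => e e0.
have /cvgrPdist_lt dc : (4 * del m * N) @[m --> \oo] --> 0.
  rewrite -[X in _ --> X](mul0r N) -[X in X * N](mulr0 4).
  by apply: cvgM; [apply: cvgM => //; exact: cvg_cst|exact: cvg_cst].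
have e2 : 0 < e / 2 by rewrite divr_gt0.
have [m _ hm] := dc _ e2; have := hm m (leqnn m); rewrite sub0r normrN => dm.
have /cvgrPdist_lt lc : (L m * (2 ^+ n)^-1) @[n --> \oo] --> 0.
  rewrite -[X in _ --> X](mulr0 (L m)); apply: cvgM; first exact: cvg_cst.
  under eq_fun do rewrite -exprVn.
  by apply: cvg_expr; rewrite ger0_norm ?invr_ge0// invf_lt1// ltr1n.
have [n0 _ hn] := lc _ e2.
near=> n; rewrite sub0r normrN ger0_norm//.
have mn : (m <= n)%N by near: n; exists m.
rewrite (le_lt_trans (omle _ _ mn))// /c.
have := hn n; rewrite sub0r normrN => /(_ _) hn'.
have hn2 : `|L m * (2 ^+ n)^-1| < e / 2 by apply: hn'; near: n; exists n0.
have := ler_norm (4 * del m * N); have := ler_norm (L m * (2 ^+ n)^-1); lra.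
Unshelve. all: end_near. Qed.

End zvonkin.

(** * Ito's formula for potentials *)

Section ito_potential.
Context (R : realType) d (T : measurableType d) (P : probability T R).
Context (F : R -> set (set T)) (hF : filtration F).
Context (alpha : R) (L : R -> T -> R).
Notation leb := (@lebesgue_measure R).
Notation HL := (`[(0 : R), +oo[%classic).
Let mHL : measurable (HL : set (measurableTypeR R)) := measurable_itv _.
Hypothesis pL : prog F L.
Hypothesis indL : forall s t, 0 <= s -> s <= t ->
  forall (B : set T) (C : set R), F s B -> measurable C ->
    P (B `&` increment L s t @^-1` C) = (P B * P (increment L s t @^-1` C))%E.
Hypothesis cosL : forall s t xi, 0 <= s -> s <= t ->
  \int[P]_w cos (xi * increment L s t w) = expR (- ((t - s) * `|xi| `^ alpha)).
Hypothesis sinL : forall s t xi, 0 <= s -> s <= t ->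
  \int[P]_w sin (xi * increment L s t w) = 0.

Lemma absc_scale tm (K : R) (c dc : R -> T -> R) : absc F tm c dc ->
  absc F tm (fun r w => K * c r w) (fun r w => K * dc r w).
Proof.
move=> [pc pdc [M hM] pr]; split.
- by apply: progM => //; exact: prog_cst.
- by apply: progM => //; exact: prog_cst.
- by exists (`|K| * M) => r w; rewrite normrM ler_wpM2l.
- by move=> w; exact: primZ.
Qed.

Lemma bdd_scale (K : R) (c : R -> T -> R) : bdd c -> bdd (fun r w => K * c r w).
Proof. by move=> [M hM]; exists (`|K| * M) => r w; rewrite normrM ler_wpM2l. Qed.

Lemma ito_scale tm lam (K : R) (c dc Y a : R -> T -> R) g g1 k :
  ito_id P L tm lam (fun r w => K * c r w) (fun r w => K * dc r w) Y a g g1 k ->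
  ito_id P L tm lam c dc Y a (fun x => K * g x) (fun x => K * g1 x) (fun x => K * k x).
Proof.
rewrite /ito_id => H.
rewrite (int_eq P (g := fun w => expR (- (lam * tm)) * (K * c tm w) * g (L tm w + Y tm w))); last first.
  by move=> w _; ring.
rewrite (int_eq P (D := setT) (f := fun w => c 0 w * (K * g (L 0 w + Y 0 w)))
   (g := fun w => K * c 0 w * g (L 0 w + Y 0 w))); last by move=> w _; ring.
by rewrite H; apply: int_eq => p _; ring.
Qed.

Context (lam : R) (lam1 : 1 <= lam) (alpha1 : 1 < alpha) (phi : R -> R) (hphi : mollifier phi).

Section kernel.
Context (n : nat).
Let W := smoothed_symbol phi alpha lam n.
Let s0 : 0 < (2 ^+ n)^-1 :> R. Proof. by rewrite invr_gt0 exprn_gt0. Qed.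
Let W2 : dom2 W. Proof. exact: smoothed_symbol_dom2. Qed.
Let pi0 : 0 < pi^-1 :> R. Proof. by rewrite invr_gt0 pi_gt0. Qed.
Let mm : measurable_fun setT (fun xi : R => mhat phi ((2 ^+ n)^-1 * xi)).
Proof. by apply: mrcont; [exact: mhat_cont|mr]. Qed.

(** Multiplication by [lam + |xi|^alpha] cancels the resolvent factor of the symbol; what is left is
    the transform of the mollifier, and [mollifier_inversion] identifies the third member of the
    triple. *)
Lemma ito_kernel tm (c dc Y a : R -> T -> R) (y : R) : 0 <= tm -> absc F tm c dc -> bdd c ->
  absc F tm Y a ->
  ito_id P L tm lam c dc Y a (fun x => ckern W (x - y)) (fun x => skern W (x - y))
    (fun x => mollifier_seq phi n (x - y)).
Proof.
move=> tm0 hc bc hY.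
have [C C0 hC] := mhat_scale_dom2 hphi s0.
have [mW [B iB hB]] := W2.
pose kk (xi x : R) := pi^-1 * mhat phi ((2 ^+ n)^-1 * xi) * cos (xi * (x - y)).
have -> : (fun x => mollifier_seq phi n (x - y)) = (fun x => \int[leb]_(xi in HL) kk xi x).
  apply/funext => x; rewrite (mollifier_inversion hphi); apply: int_eq => xi _.
  by rewrite /kk [pi^-1 * _]mulrC.
apply: (@ito_superpose R d T P F hF L pL _ (measurableTypeR R) leb HL mHL
  (fun xi => B xi + pi^-1 * (C * (1 + xi ^+ 2)^-1))
  (fun xi x => W xi * cos (xi * (x - y))) (fun xi x => W xi * (- (xi * sin (xi * (x - y))))) kk) => //.
- apply: mrM; first exact: (measurableT_comp mW measurable_fst).
  by mr.
- apply: mrM; first exact: (measurableT_comp mW measurable_fst).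
  by mr.
- apply: mrM; last by mr.
  by apply: mrM; [mr|exact: (measurableT_comp mm measurable_fst)].
- apply: itgD => //; apply: itgZ => //; apply: itgZ => //; exact: shift2_itg.
- move=> xi x; rewrite /= in_itv/= andbT => xi0.
  have c1 := cos_max (xi * (x - y)); have c2 := sin_max (xi * (x - y)).
  have q0 : 0 < 1 + xi ^+ 2 by rewrite ltr_pwDl ?sqr_ge0.
  have E0 : 0 <= pi^-1 * (C * (1 + xi ^+ 2)^-1) by apply: mulr_ge0; [exact: ltW|apply: divr_ge0 => //; exact: ltW].
  have hB' := hB xi xi0.
  have WB : `|W xi| <= B xi.
    by rewrite (le_trans _ hB')// ler_peMr// lerDl sqr_ge0.
  have WB1 : `|W xi| * `|xi| <= B xi.
    by rewrite (le_trans _ hB')// ler_wpM2l// (le_trans (xi_le_sq xi))// mul1r.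
  have B0 : 0 <= B xi := le_trans (normr_ge0 _) WB.
  split.
  + by rewrite normrM (le_trans (ler_piMr _ c1))// (le_trans WB)// lerDl.
  + rewrite (normrM (W xi)) normrN (normrM xi) (@le_trans _ _ (`|W xi| * `|xi|))//.
      by rewrite ler_wpM2l// ler_piMr.
    by rewrite (le_trans WB1)// lerDl.
  + rewrite /kk normrM (le_trans (ler_piMr _ c1))// normrM (gtr0_norm pi0).
    rewrite (@le_trans _ _ (pi^-1 * (C * (1 + xi ^+ 2)^-1)))//; last by rewrite lerDr.
    by rewrite ler_wpM2l ?(ltW pi0)// ler_pdivlMr// hC.
- move=> xi; rewrite /= in_itv/= andbT => xi0.
  have -> : kk xi = (fun x => W xi * ((lam + `|xi| `^ alpha) * cos (xi * x + - (xi * y)))).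
    apply/funext => x; rewrite /kk /W /smoothed_symbol /resolvent_symbol mulrBr.
    have den : lam + `|xi| `^ alpha != 0 by rewrite gt_eqF// ltr_pwDl ?powR_ge0// (lt_le_trans _ lam1).
    by rewrite [RHS]mulrA; congr (_ * _); rewrite -!mulrA mulVf ?mulr1.
  have -> : (fun x => W xi * cos (xi * (x - y))) = (fun x => W xi * cos (xi * x + - (xi * y))).
    by apply/funext => x; rewrite mulrBr.
  have -> : (fun x => W xi * - (xi * sin (xi * (x - y)))) =
      (fun x => W xi * (- xi * sin (xi * x + - (xi * y)))).
    by apply/funext => x; rewrite mulrBr mulNr.
  apply: ito_scale; apply: (ito_cos hF pL indL cosL sinL) => //; first exact: absc_scale.
  exact: bdd_scale.
Qed.
End kernel.

Context (kap : {finite_measure set (measurableTypeR R) -> \bar R}).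

(** A second superposition, over the centre [y] of the kernel against [f y kap(dy)]. *)
Lemma ito_pot n (f : R -> R) (M : R) tm (c dc Y a : R -> T -> R) : bmeas f M -> 0 <= tm ->
  absc F tm c dc -> bdd c -> absc F tm Y a ->
  ito_id P L tm lam c dc Y a (Up kap (smoothed_symbol phi alpha lam) n f) (Vp kap (smoothed_symbol phi alpha lam) n f)
    (Mp kap phi n f).
Proof.
move=> [mf fM] tm0 hc bc hY; set W := smoothed_symbol phi alpha lam.
have W2 k : dom2 (W k) by exact: smoothed_symbol_dom2.
have [mW [B iB hB]] := W2 n.
pose K := \int[leb]_(xi in HL) B xi.
have kc z : `|ckern (W n) z| <= K.
  apply: ckern_le => // xi xi0; rewrite (le_trans _ (hB _ xi0))//.
  by rewrite ler_peMr// lerDl sqr_ge0.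
have ks z : `|skern (W n) z| <= K.
  apply: int_dom => //; first by apply: measurable_funTS; mr.
  move=> xi /=; rewrite in_itv/= andbT => xi0; rewrite (le_trans _ (hB _ xi0))//.
  rewrite normrM ler_wpM2l// normrN normrM (le_trans (ler_piMr _ (sin_max _)))//.
  by rewrite (le_trans (xi_le_sq xi))// mul1r.
have [B' B'0 kmo] := moll_bound hphi n.
have M0 : 0 <= M := le_trans (normr_ge0 _) (fM 0).
have K0 : 0 <= K := le_trans (normr_ge0 _) (kc 0).
have mmo : measurable_fun setT (mollifier_seq phi n).
  by have [K' _ hK] := moll_lip hphi n; exact: continuous_measurable_fun (lip_continuous hK).
have mf1 : measurable_fun setT (fun p : measurableTypeR R * R => f p.1).
  exact: (measurableT_comp mf measurable_fst).
have mdif : measurable_fun setT (fun p : measurableTypeR R * R => p.2 - p.1).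
  by mr.
apply: (@ito_superpose R d T P F hF L pL _ (measurableTypeR R) kap setT measurableT
  (fun=> (K + B') * M)
  (fun y x => ckern (W n) (x - y) * f y) (fun y x => skern (W n) (x - y) * f y)
  (fun y x => mollifier_seq phi n (x - y) * f y)) => //.
- by apply: mrM => //; apply: (mrcomp _ mdif); exact: ckern_meas.
- by apply: mrM => //; apply: (mrcomp _ mdif); exact: skern_meas.
- by apply: mrM => //; exact: (mrcomp mmo mdif).
- by apply: itg_cst => //; rewrite ltey_eq fin_num_measure.
- move=> y x _; rewrite !(normrM _ (f y)); split; apply: ler_pM => //.
  + by rewrite (le_trans (kc _))// lerDl.
  + by rewrite (le_trans (ks _))// lerDl.
  + by rewrite (le_trans (kmo _))// lerDr.
move=> y _.
have -> : (fun x => ckern (W n) (x - y) * f y) = (fun x => f y * ckern (W n) (x - y)).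
  by apply/funext => x; rewrite mulrC.
have -> : (fun x => skern (W n) (x - y) * f y) = (fun x => f y * skern (W n) (x - y)).
  by apply/funext => x; rewrite mulrC.
have -> : (fun x => mollifier_seq phi n (x - y) * f y) = (fun x => f y * mollifier_seq phi n (x - y)).
  by apply/funext => x; rewrite mulrC.
apply: ito_scale; apply: ito_kernel => //; first exact: absc_scale.
exact: bdd_scale.
Qed.

End ito_potential.

(** * The weighted stability estimate *)

(* [log_ramp] vanishes on the negative half-line and climbs to [1 / 2] between
   [0] and [sqrt s], whereas [x log_ramp'(x)] is of order [1 / ramp_scale]. *)
Section logarithmic_ramp.
Context {R : realType} (s : R).
Hypothesis s0 : 0 < s.
Hypothesis s1 : s < 1.

Definition ramp_scale := - ln (s ^+ 2).
Definition pospart (x : R) := Num.max x 0.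
Definition log_ramp (x : R) :=
  (ln (s ^+ 2 + pospart x ^+ 2) - ln (1 + pospart x ^+ 2) - ln (s ^+ 2)) / ramp_scale.
Definition log_ramp1 (x : R) :=
  (2 * (pospart x / (s ^+ 2 + pospart x ^+ 2)) - 2 * (pospart x / (1 + pospart x ^+ 2))) / ramp_scale.

Let s20 : 0 < s ^+ 2. Proof. by rewrite exprn_gt0. Qed.
Let s21 : s ^+ 2 < 1. Proof. by rewrite expr_lt1// ltW. Qed.

Lemma ramp_scale_gt0 : 0 < ramp_scale.
Proof. by rewrite oppr_gt0 ln_lt0// s20. Qed.

Lemma pospart_ge0 x : 0 <= pospart x. Proof. by rewrite le_max lexx orbT. Qed.
Lemma pospart_pos x : 0 <= x -> pospart x = x. Proof. by move=> x0; rewrite /pospart max_l. Qed.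
Lemma pospart_neg x : x <= 0 -> pospart x = 0. Proof. by move=> x0; rewrite /pospart max_r. Qed.

Lemma pospart_lip x y : `|pospart x - pospart y| <= `|x - y|.
Proof.
have [x0|/ltW x0] := leP 0 x; have [y0|/ltW y0] := leP 0 y; rewrite ?(pospart_pos x0) ?(pospart_neg x0) ?(pospart_pos y0) ?(pospart_neg y0) ?subr0 ?sub0r ?normrN//.
- by rewrite !ger0_norm ?subr_ge0 ?(le_trans y0)// lerDl oppr_ge0.
- by rewrite distrC !ger0_norm ?subr_ge0 ?(le_trans x0)// lerDl oppr_ge0.
- by rewrite normr0.
Qed.

Let pp2_taylor x y : `|pospart y ^+ 2 - pospart x ^+ 2 - 2 * pospart x * (y - x)| <= 1 * (y - x) ^+ 2.
Proof.
rewrite mul1r; have h := sqr_ge0 (y - x).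
have [x0|/ltW x0] := leP 0 x; have [y0|/ltW y0] := leP 0 y; rewrite ?(pospart_pos x0) ?(pospart_neg x0) ?(pospart_pos y0) ?(pospart_neg y0).
- by rewrite (_ : _ - _ = (y - x) ^+ 2) ?ger0_norm//; ring.
- have xy : 0 <= x * - y by rewrite mulr_ge0 ?oppr_ge0.
  have x2 := sqr_ge0 x; have y2 := sqr_ge0 y; rewrite ger0_norm; lra.
- have xy : 0 <= y * - x by rewrite mulr_ge0 ?oppr_ge0.
  have x2 := sqr_ge0 x; have y2 := sqr_ge0 y; rewrite ger0_norm; lra.
- by rewrite expr0n !(mulr0, mul0r) !subrr normr0.
Qed.

Let pp2_derive (x : R) : is_derive x 1 (fun y => pospart y ^+ 2) (2 * pospart x).
Proof. by apply: quad_is_derive => y; exact: pp2_taylor. Qed.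

Let den_gt0 (a x : R) : 0 < a -> 0 < a + pospart x ^+ 2.
Proof. by move=> a0; rewrite ltr_pwDl ?sqr_ge0. Qed.

Let ln_derive (a x : R) : 0 < a ->
  is_derive x 1 (fun y => ln (a + pospart y ^+ 2)) (2 * (pospart x / (a + pospart x ^+ 2))).
Proof.
move=> a0; have d1 := is_deriveD (is_derive_cst a x (1 : R)) (pp2_derive x); rewrite add0r in d1.
apply: (is_derive_eq (@is_derive1_comp R (@ln R) (fun y => a + pospart y ^+ 2) x _ _ (is_derive1_ln (den_gt0 x a0)) d1)).
by rewrite mulrC mulrA.
Qed.

Lemma log_ramp_derive (x : R) : is_derive x 1 log_ramp (log_ramp1 x).
Proof.
have d := is_deriveB (is_deriveB (ln_derive x s20) (ln_derive x ltr01)) (is_derive_cst (ln (s ^+ 2)) x (1 : R)).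
have d2 := is_deriveZ ramp_scale^-1 d; rewrite subr0 in d2.
have -> : log_ramp = ramp_scale^-1 \*: ((fun y => ln (s ^+ 2 + pospart y ^+ 2)) - (fun y => ln (1 + pospart y ^+ 2)) - cst (ln (s ^+ 2))).
  by apply/funext => y; rewrite /log_ramp mulrC.
by apply: (is_derive_eq d2); rewrite /log_ramp1 /GRing.scale/= mulrC.
Qed.

Let frac_lip (a p q : R) : 0 < a -> 0 <= p -> 0 <= q ->
  `|p / (a + p ^+ 2) - q / (a + q ^+ 2)| <= a^-1 * `|p - q|.
Proof.
move=> a0 p0 q0.
have P0 : 0 < a + p ^+ 2 by rewrite ltr_pwDl ?sqr_ge0.
have Q0 : 0 < a + q ^+ 2 by rewrite ltr_pwDl ?sqr_ge0.
rewrite (_ : _ - _ = (p - q) * (a - p * q) / ((a + p ^+ 2) * (a + q ^+ 2))); last first.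
  by field; rewrite !gt_eqF.
have PQ : 0 < (a + p ^+ 2) * (a + q ^+ 2) by rewrite mulr_gt0.
rewrite normrM (gtr0_norm (x := _^-1)) ?invr_gt0// ler_pdivrMr// normrM mulrC mulrAC ler_wpM2r//.
rewrite ler_pdivlMl// mulrC.
have pq : 0 <= p * q by rewrite mulr_ge0.
have h : `|a - p * q| <= a + p * q.
  by rewrite (le_trans (ler_normB _ _))// !ger0_norm// ltW.
rewrite (le_trans (ler_wpM2r (ltW a0) h))//.
have := sqr_ge0 (p - q); have := mulr_ge0 (sqr_ge0 p) (sqr_ge0 q).
have : 0 <= a * (p - q) ^+ 2 by rewrite mulr_ge0 ?sqr_ge0// ltW.
have : 0 <= a * (p * q) by rewrite mulr_ge0// ltW.
nra.
Qed.

Lemma log_ramp1_lip x y : `|log_ramp1 x - log_ramp1 y| <= (2 * (s ^+ 2)^-1 + 2) / ramp_scale * `|x - y|.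
Proof.
have L0 := ramp_scale_gt0.
rewrite /log_ramp1 -mulrBl normrM (gtr0_norm (x := _^-1)) ?invr_gt0// mulrAC ler_wpM2r ?invr_ge0 ?(ltW L0)//.
have h1 := frac_lip s20 (pospart_ge0 x) (pospart_ge0 y); have h2 := frac_lip ltr01 (pospart_ge0 x) (pospart_ge0 y).
have h3 := pospart_lip x y; rewrite invr1 mul1r in h2.
set A := pospart x / (s ^+ 2 + _) in h1 *; set B := pospart y / (s ^+ 2 + _) in h1 *.
set C := pospart x / _ in h2 *; set D := pospart y / _ in h2 *.
rewrite (_ : 2 * A - 2 * C - (2 * B - 2 * D) = 2 * (A - B) - 2 * (C - D)); last by ring.
have h4 : (s ^+ 2)^-1 * `|pospart x - pospart y| <= (s ^+ 2)^-1 * `|x - y| by rewrite ler_wpM2l// invr_ge0 ltW.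
apply: (le_trans (ler_normB _ _)); rewrite (normrM 2 (A - B)) (normrM 2 (C - D)) (@gtr0_norm _ 2)//.
lra.
Qed.

Lemma log_ramp_neg x : x <= 0 -> log_ramp x = 0.
Proof. by move=> x0; rewrite /log_ramp pospart_neg// expr0n addr0 addr0 ln1 subr0 subrr mul0r. Qed.

Lemma log_ramp1_neg x : x <= 0 -> log_ramp1 x = 0.
Proof. by move=> x0; rewrite /log_ramp1 pospart_neg// !mul0r mulr0 subrr mul0r. Qed.

Lemma log_ramp_le1 x : log_ramp x <= 1.
Proof.
rewrite ler_pdivrMr ?ramp_scale_gt0// mul1r /ramp_scale -[leRHS]add0r lerD2r subr_le0.
by rewrite ler_ln ?posrE ?den_gt0// lerD2r ltW.
Qed.

Lemma log_ramp1_ge0 x : 0 <= log_ramp1 x.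
Proof.
apply: divr_ge0; last exact/ltW/ramp_scale_gt0.
rewrite subr_ge0 ler_wpM2l// ler_wpM2l ?pospart_ge0// lef_pV2 ?posrE ?den_gt0//.
by rewrite lerD2r ltW.
Qed.

Let log_ramp_ln x : log_ramp x = ln ((s ^+ 2 + pospart x ^+ 2) / ((1 + pospart x ^+ 2) * s ^+ 2)) / ramp_scale.
Proof.
rewrite /log_ramp ln_div ?posrE ?mulr_gt0 ?den_gt0// [ln ((1 + _) * _)]lnM ?posrE ?den_gt0//.
by rewrite opprD addrA.
Qed.

Lemma log_ramp_ge0 x : 0 <= log_ramp x.
Proof.
rewrite log_ramp_ln divr_ge0 ?(ltW ramp_scale_gt0)// ln_ge0// ler_pdivlMr ?mulr_gt0 ?den_gt0//.
by have := sqr_ge0 (pospart x); have := s21; nra.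
Qed.

Lemma log_ramp_half x : 0 <= x -> s <= x ^+ 2 -> 2^-1 <= log_ramp x.
Proof.
move=> x0 sx; rewrite log_ramp_ln pospart_pos// ler_pdivlMr ?ramp_scale_gt0// /ramp_scale.
have -> : 2^-1 * - ln (s ^+ 2) = ln s^-1.
  by rewrite lnV ?posrE// lnXn//; field.
rewrite ler_ln ?posrE ?invr_gt0 ?divr_gt0 ?mulr_gt0 ?ltr_pwDl ?sqr_ge0//.
rewrite ler_pdivlMr ?mulr_gt0 ?ltr_pwDl ?sqr_ge0// mulrC -mulrA expr2 -mulrA mulfV ?gt_eqF// mulr1.
by have := s0; have := s1; nra.
Qed.

(** The factor [3 / 2 * x + d] majorises [|D + w|] at [D = x] when [|w| <= D / 2 + d]. Its first
    part is paid by [x log_ramp1 x <= 2 / ramp_scale], its second by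
    [log_ramp1 x <= 1 / (s ramp_scale)]; hence [d] must be at most of order [s]. *)
Lemma log_ramp1_bound x d : 0 <= d -> 0 <= x -> log_ramp1 x * (3 / 2 * x + d) <= (3 + d / s) / ramp_scale.
Proof.
move=> d0 x0; have L0 := ramp_scale_gt0.
rewrite /log_ramp1 pospart_pos// mulrAC ler_wpM2r ?invr_ge0 ?(ltW L0)//.
have q0 : 0 < s ^+ 2 + x ^+ 2 by rewrite ltr_pwDl ?sqr_ge0.
apply: (@le_trans _ _ (2 * (x / (s ^+ 2 + x ^+ 2)) * (3 / 2 * x + d))).
  rewrite ler_wpM2r ?addr_ge0 ?mulr_ge0//.
  by rewrite gerBl mulr_ge0// divr_ge0// addr_ge0 ?sqr_ge0.
have h1 : x / (s ^+ 2 + x ^+ 2) * x <= 1.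
  by rewrite mulrAC ler_pdivrMr// mul1r -expr2 lerDr ltW.
have h2 : 2 * (x / (s ^+ 2 + x ^+ 2)) <= s^-1.
  rewrite mulrA ler_pdivrMr// ler_pdivlMl//.
  by have := sqr_ge0 (s - x); nra.
rewrite mulrDr lerD//; first by lra.
by rewrite mulrC ler_wpM2l.
Qed.

Lemma log_ramp1_le x : log_ramp1 x <= (s * ramp_scale)^-1.
Proof.
have L0 := ramp_scale_gt0; have [x0|/ltW x0] := leP 0 x; last first.
  by rewrite log_ramp1_neg// invr_ge0 mulr_ge0 ?(ltW s0) ?(ltW L0).
rewrite /log_ramp1 pospart_pos// invfM ler_wpM2r ?invr_ge0 ?(ltW L0)//.
have q0 : 0 < s ^+ 2 + x ^+ 2 by rewrite ltr_pwDl ?sqr_ge0.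
apply: (@le_trans _ _ (2 * (x / (s ^+ 2 + x ^+ 2)))).
  by rewrite gerBl mulr_ge0// divr_ge0// addr_ge0 ?sqr_ge0.
rewrite mulrA ler_pdivrMr// ler_pdivlMl//.
by have := sqr_ge0 (s - x); nra.
Qed.

Lemma log_ramp_meas : measurable_fun setT log_ramp.
Proof.
apply: continuous_measurable_fun => x; apply: differentiable_continuous.
by apply/derivable1_diffP; have -[] := log_ramp_derive x.
Qed.

Lemma log_ramp1_meas : measurable_fun setT log_ramp1.
Proof. exact: continuous_measurable_fun (lip_continuous log_ramp1_lip). Qed.

End logarithmic_ramp.

(** * Killed paths *)

Section killed_paths.
Context (R : realType).
Notation leb := (@lebesgue_measure R).

Lemma is_derive_expN (x : R) : is_derive x 1 (fun y => expR (- y)) (- expR (- x)).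
Proof.
have h2 := is_deriveN (is_derive_id x (1 : R)).
apply: (is_derive_eq (@is_derive1_comp R expR (fun y => - y) x _ _ (is_derive_expR _) h2)).
by rewrite mulrN1.
Qed.

Lemma prim_expN tm (I b : R -> R) : prim tm I b -> (forall t, 0 <= t <= tm -> 0 <= I t) ->
  prim tm (fun t => expR (- I t)) (fun t => - expR (- I t) * b t).
Proof.
move=> pI I0.
apply: (@prim_comp R tm I b (fun y => expR (- y)) (fun y => - expR (- y)) [set x | 0 <= x] 1) => //.
- by mr.
- by mr.
- by move=> u v w /= u0 _ /andP[uw _]; exact: le_trans uw.
- by move=> x _; exact: is_derive_expN.
move=> u v /= u0 v0.
wlog uv : u v u0 v0 / u < v.
  move=> H; have [uv|vu|->] := ltgtP u v; first exact: H.
    by rewrite distrC (distrC u); exact: H.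
  by rewrite !subrr normr0 mulr0.
have [|c /[!in_itv]/= /andP[uc cv] e] := @MVT _ (fun y => expR (- y)) (fun y => - expR (- y)) u v uv (fun x _ => is_derive_expN x).
  apply: continuous_subspaceT => x; apply: differentiable_continuous.
  by apply/derivable1_diffP; have -[] := is_derive_expN x.
rewrite opprK addrC e normrM (distrC u) ler_wpM2r// normrN ger0_norm ?expR_ge0//.
by rewrite -expR0 ler_expR oppr_le0 (le_trans u0)// ltW.
Qed.

(** Killing at rate [b] removes a total mass below one, however large [b] is. This tames drifts
    without moments. *)
Lemma prim_exp_int tm (I b : R -> R) : 0 <= tm -> prim tm I b -> (forall t, 0 <= t <= tm -> 0 <= I t) -> I 0 = 0 ->
  \int[leb]_(r in `[0, tm]) (expR (- I r) * b r) = 1 - expR (- I tm).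
Proof.
move=> tm0 pI I0 I00; have pE := prim_expN pI I0; have [_ _ _ h] := pE.
have := h tm; rewrite lexx tm0 => /(_ isT); rewrite I00 oppr0 expR0 => ->.
rewrite opprD addrA subrr add0r.
have iE := prim_itg pE (lexx tm).
rewrite -[RHS]mulN1r -RintegralZl//; apply: int_eq => r _; ring.
Qed.

Lemma int_ge0 (D : set (measurableTypeR R)) (f : R -> R) : (forall x, D x -> 0 <= f x) ->
  0 <= \int[leb]_(x in D) f x.
Proof. by move=> f0; apply: Rintegral_ge0. Qed.

(* A killing rate: if [|D'| <= M], passing from [eta0] to [2 eta0] takes [D] at
   least the time [eta0 / M], during which the rate accumulates mass [1]. *)
Definition overK (M eta0 : R) (D : R -> R) (r : R) := M / eta0 * (eta0 <= D r)%R%:R.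

Lemma overK_event (M eta0 tm t : R) (D Dd : R -> R) : 0 < M -> 0 < eta0 -> prim tm D Dd ->
  D 0 = 0 -> (forall r, `|Dd r| <= M) -> 0 <= t <= tm -> 2 * eta0 <= D t ->
  measurable_fun setT (overK M eta0 D) ->
  1 <= \int[leb]_(r in `[0, tm]) overK M eta0 D r.
Proof.
move=> M0 e0 pD D0 DM /andP[t0 tt] Dt mo.
have [mD mDd _ _] := pD.
have inc u v : 0 <= u -> u <= v -> v <= tm -> `|D v - D u| <= M * (v - u).
  move=> u0 uv vt; rewrite (prim_incr pD u0 uv vt) -leb_ocE//.
  by apply: int_bnd => //; [exact: leb_oc_fin|exact: measurable_funTS].
set a := t - eta0 / M.
have aM : eta0 / M * M = eta0 by rewrite mulfVK ?gt_eqF.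
have eM : 0 < eta0 / M by rewrite divr_gt0.
have a0 : 0 <= a.
  have := inc 0 t (lexx 0) t0 tt; rewrite D0 !subr0 => /(le_trans (ler_norm _)) h.
  by rewrite subr_ge0 ler_pdivrMr// mulrC (le_trans _ h)// (le_trans _ Dt)//; lra.
have at_ : a <= t by rewrite gerBl ltW.
have ob r : 0 <= overK M eta0 D r <= M / eta0.
  have Me : 0 < M / eta0 by rewrite divr_gt0.
  by rewrite /overK; case: (eta0 <= D r); rewrite ?mulr1 ?mulr0 ?lexx ?ltW.
have io s u : itg leb `]s, u]%classic (overK M eta0 D).
  apply: (itg_bnd _ (M := M / eta0)) => //; first exact: leb_oc_fin.
    exact: measurable_funTS.
  by move=> r _; have /andP[h1 h2] := ob r; rewrite ger0_norm.
have io2 u : itg leb `[0, u]%classic (overK M eta0 D).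
  apply: (itg_bnd _ (M := M / eta0)) => //; first exact: leb_cc_fin.
    exact: measurable_funTS.
  by move=> r _; have /andP[h1 h2] := ob r; rewrite ger0_norm.
have E : \int[leb]_(r in `]a, t]) overK M eta0 D r = 1.
  rewrite (int_eq _ (g := fun=> M / eta0)).
    rewrite Rintegral_cst// leb_ocE//.
    by rewrite /a opprB addrC addrNK; field; rewrite !gt_eqF.
  move=> r /=; rewrite in_itv/= => /andP[ar rt]; rewrite /overK.
  suff -> : eta0 <= D r by rewrite mulr1.
  have := inc r t (le_trans a0 (ltW ar)) rt tt => /(le_trans (ler_norm _)) h.
  have h2 : M * (t - r) <= eta0.
    rewrite -aM mulrC ler_wpM2r ?(ltW M0)//; move: ar; rewrite /a; lra.
  lra.
have h1 := int_ccB (io2 tm) a0 at_ tt.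
have h2 := int_ccB (io2 tm) t0 tt (lexx tm).
have p1 : 0 <= \int[leb]_(r in `[0, a]) overK M eta0 D r by apply: int_ge0 => r _; have /andP[] := ob r.
have p2 : 0 <= \int[leb]_(r in `]t, tm]) overK M eta0 D r by apply: int_ge0 => r _; have /andP[] := ob r.
rewrite E in h1; lra.
Qed.
End killed_paths.

(** * Bounded processes over time and probability *)

Section bounded_processes.
Context (R : realType) d (T : measurableType d) (P : probability T R) (tm : R).

Lemma P_lty : (P setT < +oo)%E. Proof. by rewrite probability_setT ltry. Qed.
Let Pf := P_lty.

Lemma int_le d' (T' : measurableType d') (m : {measure set T' -> \bar R}) (D : set T') f g :
  measurable D -> itg m D f -> itg m D g -> (forall x, D x -> f x <= g x) ->
  \int[m]_(x in D) f x <= \int[m]_(x in D) g x.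
Proof.
move=> mD hf hg fg; rewrite -subr_ge0 -RintegralB//.
by apply: Rintegral_ge0 => x Dx; rewrite subr_ge0 fg.
Qed.

(** The bound is required on [[0, tm]] only, since factors such as [expR (- (lam * r))] are
    unbounded at negative times. *)
Definition ebd (f : R -> T -> R) := measurable_fun setT (fun p : R * T => f p.1 p.2) /\
  exists M : R, forall r w, 0 <= r <= tm -> `|f r w| <= M.

Lemma ebdD f g : ebd f -> ebd g -> ebd (fun r w => f r w + g r w).
Proof.
move=> [mf [A hA]] [mg [B hB]]; split; first exact: mrD.
by exists (A + B) => r w h; rewrite (le_trans (ler_normD _ _))// lerD ?hA ?hB.
Qed.

Lemma ebdM f g : ebd f -> ebd g -> ebd (fun r w => f r w * g r w).
Proof.
move=> [mf [A hA]] [mg [B hB]]; split; first exact: mrM.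
by exists (A * B) => r w h; rewrite normrM ler_pM ?hA ?hB.
Qed.

Lemma ebdN f : ebd f -> ebd (fun r w => - f r w).
Proof.
by move=> [mf [A hA]]; split; [exact: mrN|exists A => r w h; rewrite normrN hA].
Qed.

Lemma ebdB f g : ebd f -> ebd g -> ebd (fun r w => f r w - g r w).
Proof. by move=> hf hg; apply: ebdD => //; exact: ebdN. Qed.

Lemma ebd_cst (K : R) : ebd (fun _ _ => K).
Proof. by split; [mr|exists `|K|]. Qed.

Lemma ebdZ (K : R) f : ebd f -> ebd (fun r w => K * f r w).
Proof. by move=> hf; apply: ebdM => //; exact: ebd_cst. Qed.

Lemma ebd_norm f : ebd f -> ebd (fun r w => `|f r w|).
Proof. by move=> [mf [A hA]]; split; [exact: mrnorm|exists A => r w h; rewrite normr_id hA]. Qed.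

Lemma ebd_itg f : ebd f -> itg (time_prod P) (`[0%R, tm]%classic `*` setT) (fun p => f p.1 p.2).
Proof. by move=> [mf [A hA]]; exact: ET_itg mf hA. Qed.

Lemma ebd_iter f : ebd f -> ET P tm f = \int[P]_w \int[@lebesgue_measure R]_(r in `[0, tm]) f r w.
Proof. by move=> [mf [A hA]]; exact: ET_iter2 mf hA. Qed.

Let mE : measurable (`[0%R, tm]%classic `*` [set: T] : set (measurableTypeR R * T)) := measurable_ET _.

Lemma ETD f g : ebd f -> ebd g -> ET P tm (fun r w => f r w + g r w) = ET P tm f + ET P tm g.
Proof. by move=> hf hg; rewrite /ET RintegralD//; exact: ebd_itg. Qed.

Lemma ETZ (K : R) f : ebd f -> ET P tm (fun r w => K * f r w) = K * ET P tm f.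
Proof. by move=> hf; rewrite /ET RintegralZl//; exact: ebd_itg. Qed.

Lemma ETB f g : ebd f -> ebd g -> ET P tm (fun r w => f r w - g r w) = ET P tm f - ET P tm g.
Proof. by move=> hf hg; rewrite /ET RintegralB//; exact: ebd_itg. Qed.

Lemma ET_le f g : ebd f -> ebd g -> (forall r w, 0 <= r <= tm -> f r w <= g r w) ->
  ET P tm f <= ET P tm g.
Proof.
move=> hf hg fg; apply: int_le => //; try exact: ebd_itg.
by move=> [r w] [/=]; rewrite in_itv/= => h _; exact: fg.
Qed.

Lemma ET_eq f g : (forall r w, 0 <= r <= tm -> f r w = g r w) -> ET P tm f = ET P tm g.
Proof. by move=> fg; apply: int_eq => -[r w] [/=]; rewrite in_itv/= => h _; exact: fg. Qed.

Lemma ebd_path f w : 0 <= tm -> ebd f -> itg (@lebesgue_measure R) `[0, tm]%classic (f ^~ w).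
Proof.
move=> tm0 [mf [A hA]]; apply: (itg_bnd _ (M := A)) => //; first exact: leb_cc_fin.
  apply: measurable_funTS; exact: (measurableT_comp mf (pair2_measurable w)).
by move=> r /=; rewrite in_itv/=; exact: hA.
Qed.

Lemma ebd_at f r : 0 <= r <= tm -> ebd f -> itg P setT (f r).
Proof.
move=> hr [mf [A hA]]; apply: (itg_bnd _ (M := A)) => //.
  exact: (measurableT_comp mf (pair1_measurable r)).
by move=> w _; exact: hA.
Qed.

Lemma int_P_cst (K : R) : \int[P]_w K = K.
Proof.
transitivity (K * fine (P setT)); first exact: Rintegral_cst.
by rewrite probability_setT mulr1.
Qed.

Lemma ebd_iter_itg f : ebd f ->
  itg P setT (fun w => \int[@lebesgue_measure R]_(r in `[0, tm]) f r w).
Proof.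
move=> [mf [A hA]].
apply: (@itg_fub2 _ _ (measurableTypeR R) T R (@lebesgue_measure R) P `[0, tm]%classic setT
  (measurable_itv _) measurableT f (fun=> A) (fun=> 1)) => //.
- exact/itg_cst/leb_cc_fin.
- exact: itg_cst.
- by move=> x y /= + _; rewrite in_itv mulr1; exact: hA.
Qed.

End bounded_processes.

(** * The weighted estimate *)

Section main_estimate.
Context (R : realType) d (T : measurableType d) (P : probability T R).
Context (F : R -> set (set T)) (hF : filtration F).
Notation leb := (@lebesgue_measure R).

Definition pint (a : R -> T -> R) t w := \int[leb]_(r in `[0, t]) a r w.

Lemma prog_path (X : R -> T -> R) w : prog F X -> measurable_fun setT (X ^~ w).
Proof. by move=> pX; exact: (measurableT_comp (prog_joint hF pX) (pair2_measurable w)). Qed.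

Lemma pint0 a w : pint a 0 w = 0.
Proof. by rewrite /pint set_itv1 Rintegral_set1. Qed.

Lemma pint_absc tm a : prog F a -> bdd a -> absc F tm (pint a) a.
Proof.
move=> pa [M hM]; split => //; last first.
- move=> w; split.
  + by apply: prog_path; exact: (prog_int hF pa hM).
  + exact: prog_path.
  + by exists M => r _.
  + by move=> t _; rewrite pint0 add0r.
- by exists M.
- exact: (prog_int hF pa hM).
Qed.

Lemma pint_ge0 a t w : (forall r, 0 <= a r w) -> 0 <= pint a t w.
Proof. by move=> a0; apply: int_ge0 => r _. Qed.

Context (tm lam M eta0 s delta : R) (D Dd wp e j : R -> T -> R).
Hypothesis tm0 : 0 <= tm.
Hypothesis lam0 : 0 <= lam.
Hypothesis M0 : 0 < M.
Hypothesis eta00 : 0 < eta0.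
Hypothesis s0 : 0 < s.
Hypothesis s1 : s < 1.
Hypothesis seta : s <= eta0 ^+ 2.
Hypothesis delta0 : 0 <= delta.
Hypothesis deta : delta <= eta0 / 4.
Hypothesis aD : absc F tm D Dd.
Hypothesis D0 : forall w, D 0 w = 0.
Hypothesis DdM : forall r w, `|Dd r w| <= M.
Hypothesis pj : prog F j.
Hypothesis bj : bdd j.
Hypothesis j0 : forall r w, 0 <= j r w.
Hypothesis pe : prog F e.
Hypothesis be : bdd e.
Hypothesis pw : prog F wp.
Hypothesis wD : forall (r : R) w, 0 <= r <= tm -> `|wp r w| <= 2^-1 * `|D r w| + delta.
Hypothesis Hid : forall c dc, absc F tm c dc -> bdd c ->
  \int[P]_w (expR (- (lam * tm)) * c tm w * wp tm w) - \int[P]_w (c 0 w * wp 0 w) =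
  ET P tm (fun r w => expR (- (lam * r)) * (dc r w * wp r w + c r w * (e r w - Dd r w))).

Let oK r w := overK M eta0 (D ^~ w) r.
Let b r w := oK r w + j r w.
Let Jm := pint j.
Let Im := pint b.
(** The extra rate [j] will be 0 in the existence proof and the variation of the drifts in the
    uniqueness proof. *)
Definition ramp_weight r w := log_ramp s (D r w) * expR (- Im r w).
Definition ramp_weight1 r w := log_ramp s (D r w) * (- expR (- Im r w) * b r w) +
  expR (- Im r w) * (log_ramp1 s (D r w) * Dd r w).

Let K0 : 0 < M / eta0. Proof. by rewrite divr_gt0. Qed.
Let ok0 r w : 0 <= oK r w.
Proof. by rewrite /oK /overK; case: (eta0 <= D r w); rewrite ?mulr1 ?mulr0 ?lexx ?ltW. Qed.
Let okM r w : oK r w <= M / eta0.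
Proof. by rewrite /oK /overK; case: (eta0 <= D r w); rewrite ?mulr1 ?mulr0 ?lexx ?ltW. Qed.
Let b0 r w : 0 <= b r w. Proof. by rewrite addr_ge0. Qed.
Let pD : prog F D. Proof. by case: aD. Qed.
Let pDd : prog F Dd. Proof. by case: aD. Qed.

Lemma prog_overK : prog F (fun r w => overK M eta0 (D ^~ w) r).
Proof.
apply: (@prog_comp _ _ _ F (fun x => M / eta0 * (eta0 <= x)%R%:R)) => //.
apply: mrM; first by mr.
have -> : (fun x : R => (eta0 <= x)%R%:R) = (\1_[set x | eta0 <= x] : R -> R).
  apply/funext => x; rewrite indicE; case: (boolP (eta0 <= x)) => h.
    by rewrite mem_set.
  by rewrite memNset//; apply/negP.
apply: measurable_indic; rewrite -set_itvcy; exact: measurable_itv.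
Qed.

Let pb : prog F b. Proof. by apply: progD => //; exact: prog_overK. Qed.
Let bb : bdd b.
Proof.
have [B hB] := bj; exists (M / eta0 + B) => r w.
by rewrite (le_trans (ler_normD _ _))// lerD// ger0_norm.
Qed.
Let aI : absc F tm Im b. Proof. exact: pint_absc. Qed.
Let aJ : absc F tm Jm j. Proof. exact: pint_absc. Qed.
Let boK : bdd oK.
Proof. by exists (M / eta0) => r w; rewrite ger0_norm. Qed.
Let aO : absc F tm (pint oK) oK.
Proof. by apply: pint_absc => //; exact: prog_overK. Qed.
Let I0 r w : 0 <= Im r w. Proof. exact: pint_ge0. Qed.
Let ImE r w : Im r w = pint oK r w + Jm r w.
Proof.
rewrite /Im /pint -RintegralD//.
- have [B hB] := boK; apply: (itg_bnd _ (M := B)) => //; first exact: leb_cc_fin.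
  by apply: measurable_funTS; exact: prog_path prog_overK.
- have [B hB] := bj; apply: (itg_bnd _ (M := B)) => //; first exact: leb_cc_fin.
  by apply: measurable_funTS; exact: prog_path pj.
Qed.

Let e1 r w : expR (- Im r w) <= 1.
Proof. by rewrite -expR0 ler_expR oppr_le0. Qed.
Let eJ r w : expR (- Im r w) <= expR (- Jm r w).
Proof. by rewrite ler_expR lerN2 ImE lerDr pint_ge0. Qed.

Lemma ramp_weight_absc : absc F tm ramp_weight ramp_weight1.
Proof.
have [pI _ _ primI] := aI; have [_ _ _ primD] := aD.
have pE : prog F (fun r w => expR (- Im r w)).
  by apply: (prog_comp (h := fun x => expR (- x))) => //; mr.
have pchi : prog F (fun r w => log_ramp s (D r w)) by apply: prog_comp => //; exact: log_ramp_meas.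
have pchi1 : prog F (fun r w => log_ramp1 s (D r w)) by apply: prog_comp => //; exact: log_ramp1_meas.
split.
- exact: progM.
- apply: progD; first apply: progM => //.
    apply: progM => //; apply: (prog_comp (h := fun x => - x)) => //; mr.
  by apply: progM => //; exact: progM.
- have [B hB] := bb; exists (B + (s * ramp_scale s)^-1 * M) => r w.
  have h1 := log_ramp_ge0 s0 s1 (D r w); have h2 := log_ramp_le1 s0 s1 (D r w).
  have h3 := log_ramp1_ge0 s0 s1 (D r w); have h4 := log_ramp1_le s0 s1 (D r w).
  rewrite (le_trans (ler_normD _ _))// lerD//.
    rewrite normrM ger0_norm// (le_trans (ler_piMl _ h2))// normrM normrN.
    by rewrite [X in X * _]ger0_norm ?expR_ge0// (le_trans (ler_piMl _ (e1 _ _))).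
  rewrite normrM ger0_norm ?expR_ge0// (le_trans (ler_piMl _ (e1 _ _)))//.
  by rewrite normrM ler_pM// ger0_norm.
move=> w; apply: primM; last exact: prim_expN.
apply: (@prim_comp R tm (D ^~ w) (Dd ^~ w) (log_ramp s) (log_ramp1 s) setT _ (primD w)) => //.
- exact: log_ramp_meas.
- exact: log_ramp1_meas.
- by move=> x _; exact: log_ramp_derive.
- by move=> u v _ _; exact: log_ramp1_lip.
Qed.

Lemma ramp_weight_ge0 r w : 0 <= ramp_weight r w.
Proof. by rewrite mulr_ge0 ?expR_ge0 ?log_ramp_ge0. Qed.

Lemma ramp_weight_le r w : ramp_weight r w <= expR (- Jm r w).
Proof. by rewrite /ramp_weight (le_trans (ler_piMl _ _)) ?expR_ge0 ?log_ramp_le1// eJ. Qed.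

Let cw1 r w : ramp_weight r w <= 1.
Proof. by rewrite (le_trans (ramp_weight_le _ _))// -expR0 ler_expR oppr_le0 pint_ge0. Qed.

Lemma ramp_weight_bdd : bdd ramp_weight.
Proof. by exists 1 => r w; rewrite ger0_norm ?ramp_weight_ge0. Qed.

Lemma ramp_weight1_le r w : `|ramp_weight1 r w| <= expR (- Im r w) * b r w +
  (s * ramp_scale s)^-1 * (expR (- Jm r w) * `|Dd r w|).
Proof.
have h1 := log_ramp_ge0 s0 s1 (D r w); have h2 := log_ramp_le1 s0 s1 (D r w).
have h3 := log_ramp1_ge0 s0 s1 (D r w); have h4 := log_ramp1_le s0 s1 (D r w).
rewrite (le_trans (ler_normD _ _))// lerD//.
  rewrite normrM ger0_norm// (le_trans (ler_piMl _ h2))// normrM normrN.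
  by rewrite ger0_norm ?expR_ge0// ger0_norm.
rewrite (normrM (expR _)) (normrM (log_ramp1 _ _)) [X in X * _ <= _]ger0_norm ?expR_ge0// (ger0_norm h3) mulrCA.
by apply: ler_pM => //; rewrite ler_wpM2r ?eJ.
Qed.

Let Ex r := expR (- (lam * r)).
Let Ex1 r : 0 <= r -> 0 <= Ex r <= 1.
Proof. by move=> r0; rewrite expR_ge0/= -expR0 ler_expR oppr_le0 mulr_ge0. Qed.

Let mj X : prog F X -> measurable_fun setT (fun p : R * T => X p.1 p.2).
Proof. exact: prog_joint. Qed.

Let dM r w : 0 <= r <= tm -> `|D r w| <= M * tm.
Proof.
move=> /andP[r0 rt]; have [_ _ _ primD] := aD; have [_ mDd _ h] := primD w.
have -> := h r; last by rewrite r0.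
rewrite D0 add0r (le_trans (int_bnd (M := M) _ _ _ _))//; first exact: leb_cc_fin.
  exact: measurable_funTS.
by rewrite leb_ccE// subr0 ler_wpM2l// ltW.
Qed.

Let bdd_ebd X : prog F X -> bdd X -> ebd tm X.
Proof. by move=> pX [A hA]; split; [exact: mj|exists A => r w _]. Qed.

Let eD : ebd tm D. Proof. by split; [exact: mj|exists (M * tm)]. Qed.
Let eDd : ebd tm Dd. Proof. by apply: bdd_ebd => //; exists M. Qed.
Let ew : ebd tm wp.
Proof.
split; first exact: mj.
by exists (2^-1 * (M * tm) + delta) => r w h; rewrite (le_trans (wD _ h))// lerD2r ler_wpM2l ?dM.
Qed.
Let ee : ebd tm e. Proof. exact: bdd_ebd. Qed.
Let ej : ebd tm j. Proof. exact: bdd_ebd. Qed.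
Let eo : ebd tm oK. Proof. by apply: bdd_ebd => //; exact: prog_overK. Qed.
Let ec : ebd tm ramp_weight. Proof. by apply: bdd_ebd; [have [] := ramp_weight_absc|exact: ramp_weight_bdd]. Qed.
Let edc : ebd tm ramp_weight1. Proof. by have [_ p [A hA] _] := ramp_weight_absc; split; [exact: mj|exists A]. Qed.
Let eEx : ebd tm (fun r (_ : T) => Ex r).
Proof.
split; first by rewrite /Ex; mr.
by exists 1 => r w /andP[r0 _]; have /andP[h1 h2] := Ex1 r0; rewrite ger0_norm.
Qed.
Let eexp X : prog F X -> (forall r w, 0 <= X r w) -> ebd tm (fun r w => expR (- X r w)).
Proof.
move=> pX X0; apply: bdd_ebd; first by apply: (prog_comp (h := fun x => expR (- x))) => //; mr.
by exists 1 => r w; rewrite ger0_norm ?expR_ge0// -expR0 ler_expR oppr_le0.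
Qed.
Let eEI : ebd tm (fun r w => expR (- Im r w)). Proof. by apply: eexp => //; case: aI. Qed.
Let J0 r w : 0 <= Jm r w. Proof. exact: pint_ge0. Qed.
Let eEJ : ebd tm (fun r w => expR (- Jm r w)). Proof. by apply: eexp => //; case: aJ. Qed.
Let O0 r w : 0 <= pint oK r w. Proof. exact: pint_ge0. Qed.
Let eEO : ebd tm (fun r w => expR (- pint oK r w)). Proof. by apply: eexp => //; case: aO. Qed.

(** Killing contributes at most one to the variation of the weight, by [prim_exp_int]; the ramp
    contributes its maximal slope times the weighted variation of [D]. The uniqueness proof needs
    this bound to integrate by parts against the weight. *)
Lemma ramp_weight1_int w : \int[leb]_(r in `[0, tm]) `|ramp_weight1 r w| <=
  1 + (s * ramp_scale s)^-1 * \int[leb]_(r in `[0, tm]) (expR (- Jm r w) * `|Dd r w|).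
Proof.
have e1' : ebd tm (fun r w => expR (- Im r w) * b r w) by apply: ebdM => //; exact: bdd_ebd.
have e2' : ebd tm (fun r w => expR (- Jm r w) * `|Dd r w|) by apply: ebdM => //; exact: ebd_norm.
have e3' := ebdZ ((s * ramp_scale s)^-1) e2'.
rewrite -RintegralZl//; last exact: ebd_path e2'.
apply: (@le_trans _ _ (\int[leb]_(r in `[0, tm]) (expR (- Im r w) * b r w) +
  \int[leb]_(r in `[0, tm]) ((s * ramp_scale s)^-1 * (expR (- Jm r w) * `|Dd r w|)))).
  rewrite -RintegralD//; [|exact: ebd_path e1'|exact: ebd_path e3'].
  apply: int_le => //; first exact: ebd_path (ebd_norm edc).
    by apply: itgD => //; [exact: ebd_path e1'|exact: ebd_path e3'].
  by move=> r _; exact: ramp_weight1_le.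
rewrite lerD2r; have [_ _ _ pI] := aI.
rewrite (prim_exp_int tm0 (pI w))//; last by rewrite /Im pint0.
Qed.

Let kap := (3 + delta / s) / ramp_scale s.

(** The density of [Ex * ramp_weight * D] along a path. Its term [ramp_weight * Dd] cancels the one
    with opposite sign in [f1]. *)
Let f2 r w := Ex r * (ramp_weight r w * Dd r w + D r w * ramp_weight1 r w) - lam * (Ex r * (ramp_weight r w * D r w)).
Let ef2 : ebd tm f2.
Proof.
apply: ebdB; first by apply: ebdM => //; apply: ebdD; exact: ebdM.
by apply: ebdZ; apply: ebdM => //; exact: ebdM.
Qed.

Let z_int w : \int[leb]_(r in `[0, tm]) f2 r w = Ex tm * ramp_weight tm w * D tm w.
Proof.
have [_ _ _ primD] := aD; have [_ _ _ primc] := ramp_weight_absc.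
have p := primM (prim_expR tm (- lam)) (primM (primc w) (primD w)).
have [_ _ _ h] := p.
transitivity (expR (- lam * tm) * (ramp_weight tm w * D tm w)); last by rewrite /Ex mulNr mulrA.
rewrite (h tm); last by rewrite lexx tm0.
rewrite [X in X + _](_ : _ = 0) ?add0r; last by rewrite D0 !mulr0.
apply: int_eq => r _; rewrite /f2 /Ex mulNr.
have key (x1 x2 x3 x4 x5 : R) : x1 * (x2 * x5 + x4 * x3) - lam * (x1 * (x2 * x4)) =
  x1 * (x2 * x5 + x4 * x3) + x2 * x4 * (- lam * x1) by ring.
exact: key.
Qed.

Let f1 r w := Ex r * (ramp_weight1 r w * wp r w + ramp_weight r w * (e r w - Dd r w)).
Let ef1 : ebd tm f1.
Proof.
apply: ebdM => //; apply: ebdD; first exact: ebdM.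
by apply: ebdM => //; exact: ebdB.
Qed.

Let g r w := Ex r * (kap * (expR (- Jm r w) * `|Dd r w|) + delta * (expR (- Jm r w) * j r w)
  - eta0 / 8 * (expR (- Im r w) * oK r w) + ramp_weight r w * e r w).

(** After the cancellation of the drift, three parts of the density of the weight meet the factor
    [D + wp]: the slope of the ramp costs [kap |Dd|], killing by overshoot gains [eta0 / 8], and
    killing by [j] costs at most [delta], because [D + wp >= - delta] for [D > 0]. For [D <= 0]
    weight and density vanish. *)
Let pointwise r w : 0 <= r <= tm -> f1 r w + f2 r w <= g r w.
Proof.
move=> hr; have /andP[r0 rt] := hr; have /andP[x0 x1] := Ex1 r0.
rewrite (_ : f1 r w + f2 r w = Ex r * (ramp_weight1 r w * (D r w + wp r w) - lam * (ramp_weight r w * D r w) + ramp_weight r w * e r w)); last first.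
  by rewrite /f1 /f2; ring.
rewrite /g ler_wpM2l// lerD2r.
have W := wD w hr; have c0 := ramp_weight_ge0 r w.
have EI := expR_ge0 (- Im r w); have EJ := expR_ge0 (- Jm r w).
have k0 : 0 <= kap.
  by rewrite /kap divr_ge0 ?(ltW (ramp_scale_gt0 _ _))// addr_ge0// divr_ge0// ltW.
have [Dn|/ltW Dp] := leP (D r w) 0.
  have -> : ramp_weight1 r w = 0 by rewrite /ramp_weight1 log_ramp_neg// log_ramp1_neg// !mul0r mulr0 addr0.
  have -> : ramp_weight r w = 0 by rewrite /ramp_weight log_ramp_neg// mul0r.
  have -> : oK r w = 0.
    by rewrite /oK /overK leNgt (le_lt_trans Dn)//= mulr0.
  by rewrite !(mul0r, mulr0) !subr0; apply: addr_ge0; apply: mulr_ge0 => //; apply: mulr_ge0.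
rewrite (ger0_norm Dp) in W.
have [W1 W2] : - (2^-1 * D r w + delta) <= wp r w /\ wp r w <= 2^-1 * D r w + delta.
  by move: W; rewrite ler_norml => /andP[].
have h1 := log_ramp_ge0 s0 s1 (D r w); have h2 := log_ramp_le1 s0 s1 (D r w).
have h3 := log_ramp1_ge0 s0 s1 (D r w); have h4 := log_ramp1_bound s0 s1 delta0 Dp.
have lc : 0 <= lam * (ramp_weight r w * D r w) by rewrite mulr_ge0// mulr_ge0.
have t1 : expR (- Im r w) * (log_ramp1 s (D r w) * Dd r w) * (D r w + wp r w) <=
    kap * (expR (- Jm r w) * `|Dd r w|).
  rewrite (le_trans (ler_norm _))// (normrM _ (D r w + wp r w)) (normrM (expR _)) (normrM (log_ramp1 _ _)) (ger0_norm EI) (ger0_norm h3).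
  rewrite (_ : _ * _ * _ = log_ramp1 s (D r w) * `|D r w + wp r w| * (expR (- Im r w) * `|Dd r w|)); last by ring.
  apply: ler_pM; [exact: mulr_ge0|exact: mulr_ge0| |by rewrite ler_wpM2r ?eJ].
  rewrite (le_trans _ h4)// ler_wpM2l// ler_norml; apply/andP; split; lra.
(* Where [D >= eta0], one has [D + wp >= eta0 / 2 - delta >= eta0 / 4], and the ramp is at least
   [1 / 2] because [s <= eta0 ^+ 2]. *)
have t2 : log_ramp s (D r w) * (expR (- Im r w) * oK r w) * (D r w + wp r w) >= eta0 / 8 * (expR (- Im r w) * oK r w).
  rewrite /oK /overK; case: (leP eta0 (D r w)) => [De|_]; last by rewrite !mulr0 mul0r.
  rewrite /= mulr1 [leRHS]mulrAC.
  have A0 : 0 <= expR (- Im r w) * (M / eta0) by rewrite mulr_ge0// ltW.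
  have hh : 2^-1 <= log_ramp s (D r w).
    apply: log_ramp_half => //; rewrite (le_trans seta)// ler_pXn2r ?nnegrE// ltW//.
  have hq : eta0 / 8 <= log_ramp s (D r w) * (D r w + wp r w).
    have aux (a b' c f : R) : a <= b' -> c <= a / 4 -> - (2^-1 * b' + c) <= f -> a / 4 <= b' + f by lra.
    have hz : eta0 / 4 <= D r w + wp r w by exact: aux De deta W1.
    rewrite (_ : eta0 / 8 = 2^-1 * (eta0 / 4)); last by field.
    by apply: ler_pM => //; rewrite divr_ge0 ?(ltW eta00).
  by rewrite ler_wpM2r.
have t3 : log_ramp s (D r w) * (expR (- Im r w) * j r w) * (D r w + wp r w) >= - (delta * (expR (- Jm r w) * j r w)).
  have A0 : 0 <= expR (- Im r w) * j r w by rewrite mulr_ge0.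
  have A1 : expR (- Im r w) * j r w <= expR (- Jm r w) * j r w by rewrite ler_wpM2r ?eJ.
  have B0 : 0 <= log_ramp s (D r w) * (expR (- Im r w) * j r w) by rewrite mulr_ge0.
  have B1 : log_ramp s (D r w) * (expR (- Im r w) * j r w) <= expR (- Jm r w) * j r w.
    by rewrite (le_trans (ler_piMl _ h2)).
  have q : log_ramp s (D r w) * (expR (- Im r w) * j r w) * (D r w + wp r w) >=
     log_ramp s (D r w) * (expR (- Im r w) * j r w) * - delta.
    by rewrite ler_wpM2l//; lra.
  apply: (le_trans _ q); rewrite mulrN lerN2 mulrC ler_wpM2l//.
rewrite /ramp_weight1 /b; move: t1 t2 t3 lc.
move: (expR (- Im r w)) (expR (- Jm r w)) (log_ramp s _) (log_ramp1 s _) (ramp_weight r w) => X1 X2 X3 X4 X5.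
move: (D r w + wp r w) (oK r w) (j r w) => Y1 Y2 Y3 t1 t2 t3 lc.
rewrite (_ : (X3 * (- X1 * (Y2 + Y3)) + X1 * (X4 * Dd r w)) * Y1 =
  X1 * (X4 * Dd r w) * Y1 - X3 * (X1 * Y2) * Y1 - X3 * (X1 * Y3) * Y1); last by ring.
lra.
Qed.

(** Ito's identity for [wp] and the product rule for [D], both tested with [ramp_weight], are added.
    One [delta] is the lower bound of the terminal value, the other the cost of killing by [j],
    whose total mass is at most one. The gain from killing by overshoot is moved to the left. *)
Lemma main_estimate :
  eta0 / 8 * expR (- (lam * tm)) *
    \int[P]_w (expR (- Jm tm w) * (1 - expR (- pint oK tm w))) <=
  2 * delta + kap * ET P tm (fun r w => expR (- Jm r w) * `|Dd r w|)
  + ET P tm (fun r w => expR (- (lam * r)) * (ramp_weight r w * e r w)).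
Proof.
have tt : 0 <= tm <= tm by rewrite tm0 lexx.
have H := Hid ramp_weight_absc ramp_weight_bdd.
have c00 w : ramp_weight 0 w = 0 by rewrite /ramp_weight D0 log_ramp_neg// mul0r.
rewrite [\int[P]_w (ramp_weight 0 w * _)](int_eq _ (g := fun=> 0)) in H; last by move=> w _; rewrite c00 mul0r.
rewrite (int_P_cst P 0) subr0 in H.
have H2 : \int[P]_w (Ex tm * ramp_weight tm w * D tm w) = ET P tm f2.
  by rewrite (ebd_iter P ef2); apply: int_eq => w _; rewrite z_int.
have iA : itg P setT (fun w => Ex tm * ramp_weight tm w * wp tm w).
  by apply: (ebd_at P tt (f := fun r w => Ex r * ramp_weight r w * wp r w)); do 2 apply: ebdM => //.
have iB : itg P setT (fun w => Ex tm * ramp_weight tm w * D tm w).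
  by apply: (ebd_at P tt (f := fun r w => Ex r * ramp_weight r w * D r w)); do 2 apply: ebdM => //.
have low : - delta <= \int[P]_w (Ex tm * ramp_weight tm w * wp tm w) + \int[P]_w (Ex tm * ramp_weight tm w * D tm w).
  rewrite -RintegralD// -[leLHS](int_P_cst P); apply: int_le => //.
  - exact: (itg_cst measurableT _ (P_lty P)).
  - exact: itgD.
  move=> w _; have /andP[x0 x1] := Ex1 tm0; have c0 := ramp_weight_ge0 tm w; have c1 := cw1 tm w.
  rewrite -mulrDr; have [Dn|/ltW Dp] := leP (D tm w) 0.
    by rewrite /ramp_weight log_ramp_neg// mul0r mulr0 mul0r oppr_le0.
  have := wD w tt; rewrite (ger0_norm Dp) ler_norml => /andP[W1 _].
  have q0 : 0 <= Ex tm * ramp_weight tm w by rewrite mulr_ge0.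
  have q1 : Ex tm * ramp_weight tm w <= 1 by rewrite mulr_ile1.
  apply: (@le_trans _ _ (Ex tm * ramp_weight tm w * - delta)).
    by rewrite mulrN lerN2 ler_piMl.
  by rewrite ler_wpM2l//; lra.
rewrite [X in _ <= X + _]H H2 -(ETD P ef1 ef2) in low.
have eg1 : ebd tm (fun r w => expR (- Jm r w) * `|Dd r w|) by apply: ebdM => //; exact: ebd_norm.
have eg2 : ebd tm (fun r w => expR (- Jm r w) * j r w) by apply: ebdM.
have eg3 : ebd tm (fun r w => expR (- Im r w) * oK r w) by apply: ebdM.
have eg4 : ebd tm (fun r w => Ex r * (ramp_weight r w * e r w)) by apply: ebdM => //; exact: ebdM.
have k0 : 0 <= kap.
  by rewrite /kap divr_ge0 ?(ltW (ramp_scale_gt0 _ _))// addr_ge0// divr_ge0// ltW.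
pose g' r w := kap * (expR (- Jm r w) * `|Dd r w|) + delta * (expR (- Jm r w) * j r w)
  - eta0 / 8 * Ex tm * (expR (- Im r w) * oK r w) + Ex r * (ramp_weight r w * e r w).
have eg' : ebd tm g'.
  apply: ebdD => //; apply: ebdB; last exact: ebdZ.
  by apply: ebdD; exact: ebdZ.
have up : ET P tm (fun r w => f1 r w + f2 r w) <= ET P tm g'.
  apply: ET_le => //; first exact: ebdD.
  move=> r w hr; apply: (le_trans (pointwise w hr)).
  have /andP[r0 rt] := hr; have /andP[x0 x1] := Ex1 r0.
  rewrite /g /g' mulrDr lerD2r mulrBr lerB//.
    rewrite ler_piMl// addr_ge0//; apply: mulr_ge0 => //; apply: mulr_ge0 => //; exact: expR_ge0.
  rewrite [leRHS]mulrA [Ex r * _]mulrC; apply: ler_wpM2r; first by apply: mulr_ge0 => //; exact: expR_ge0.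
  rewrite ler_wpM2l ?divr_ge0 ?(ltW eta00)//.
  by rewrite ler_expR lerN2 ler_wpM2l.
have E : ET P tm g' = kap * ET P tm (fun r w => expR (- Jm r w) * `|Dd r w|) +
    delta * ET P tm (fun r w => expR (- Jm r w) * j r w) -
    eta0 / 8 * Ex tm * ET P tm (fun r w => expR (- Im r w) * oK r w) +
    ET P tm (fun r w => Ex r * (ramp_weight r w * e r w)).
  rewrite ETD//; last by apply: ebdB; [apply: ebdD|]; exact: ebdZ.
  rewrite ETB; [|by apply: ebdD; exact: ebdZ|exact: ebdZ].
  by rewrite ETD; [|exact: ebdZ..]; rewrite !ETZ.
have Jle : ET P tm (fun r w => expR (- Jm r w) * j r w) <= 1.
  rewrite (ebd_iter P eg2) -[leRHS](int_P_cst P); apply: int_le => //.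
  - exact: ebd_iter_itg.
  - exact: (itg_cst measurableT _ (P_lty P)).
  move=> w _; have [_ _ _ pJ] := aJ.
  have -> : \int[leb]_(r in `[0, tm]) (expR (- Jm r w) * j r w) = 1 - expR (- Jm tm w).
    by apply: (prim_exp_int tm0 (pJ w)) => //; rewrite /Jm pint0.
  by rewrite gerBl expR_ge0.
(* The factor [expR (- Jm)] decreases in time, so its terminal value may be taken out of the time
   integral; the remaining integral is explicit. *)
have Ole : \int[P]_w (expR (- Jm tm w) * (1 - expR (- pint oK tm w))) <=
    ET P tm (fun r w => expR (- Im r w) * oK r w).
  rewrite (ebd_iter P eg3); apply: int_le => //.
  - apply: (ebd_at P tt (f := fun r w => expR (- Jm r w) * (1 - expR (- pint oK r w)))).
    by apply: ebdM => //; apply: ebdB => //; exact: ebd_cst.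
  - exact: ebd_iter_itg.
  move=> w _; have [_ _ _ pO] := aO.
  rewrite -(prim_exp_int tm0 (pO w))//; last by rewrite pint0.
  have eO2 : ebd tm (fun r w => expR (- pint oK r w) * oK r w) by exact: ebdM.
  rewrite -RintegralZl//; last exact: ebd_path eO2.
  apply: int_le => //.
  - by apply: itgZ => //; exact: ebd_path eO2.
  - exact: ebd_path eg3.
  move=> r /=; rewrite in_itv/= => /andP[r0 rt].
  rewrite mulrA ler_wpM2r// -expRD ler_expR ImE opprD addrC lerD2l lerN2.
  have [Bj hBj] := bj; have ij : itg leb `[0, tm]%classic (j ^~ w) by exact: ebd_path ej.
  have := int_ccB ij (lexx 0) r0 rt; have := int_ccB ij r0 rt (lexx tm).
  rewrite set_itv1 Rintegral_set1 subr0 => q1 q2.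
  by rewrite -subr_ge0 /Jm /pint q1; apply: int_ge0 => x _.
rewrite E in up; have lu := le_trans low up.
have A0 : 0 <= eta0 / 8 * Ex tm by rewrite mulr_ge0 ?expR_ge0// divr_ge0// ltW.
have q3 := ler_wpM2l A0 Ole; have q1 := ler_piMr delta0 Jle.
move: lu q3 q1; rewrite -/(Ex tm).
by move: (ET _ _ _) (ET _ _ _) (ET _ _ _) (ET _ _ _) (Rintegral _ _ _) => a1 a2 a3 a4 a5 lu q3 q1; lra.
Qed.

Lemma main_event w t : 0 <= t <= tm -> 2 * eta0 <= D t w -> 1 <= pint oK tm w.
Proof.
move=> ht Dt; have [_ _ _ primD] := aD.
apply: (overK_event M0 eta00 (primD w) (D0 w) _ ht Dt) => //.
exact: prog_path prog_overK.
Qed.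

End main_estimate.

(* [kap] is the total variation of [mu] and [h] its sign, so that [mu = h kap]. *)
Record zvonkin_data (R : realType) (alpha : R) (phi h : R -> R)
    (kap : {finite_measure set (measurableTypeR R) -> \bar R}) := ZvonkinData {
  zeta : R; zN : R; zlam : R; zq : R; zG : R; zdel : nat -> R;
  zsing : forall x : R, itg kap setT (fun y : measurableTypeR R => sing zeta (x - y)) /\
    \int[kap]_y sing zeta (x - y) <= zN;
  zlam1 : 1 <= zlam;
  zalpha1 : 1 < alpha;
  zphi : mollifier phi;
  zh : bmeas h 1;
  zq0 : 0 <= zq;
  zqN : zq * zN <= 4^-1;
  zcos : forall n z, `|ckern (smoothed_symbol phi alpha zlam n) z| <= zG;
  zsin : forall n z, `|skern (smoothed_symbol phi alpha zlam n) z| <= zq * sing zeta z;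
  zdel0 : forall n, 0 <= zdel n;
  zdelc : zdel n @[n --> \oo] --> 0;
  zdelW : forall m n k z, (m <= n)%N -> (m <= k)%N ->
    `|ckern (smoothed_symbol phi alpha zlam n) z - ckern (smoothed_symbol phi alpha zlam k) z| <= zdel m /\
    `|skern (smoothed_symbol phi alpha zlam n) z - skern (smoothed_symbol phi alpha zlam k) z| <= zdel m * sing zeta z }.

(** Only [lam] has to be chosen: it is an integer [n.+1] so large that the kernel constant times [N]
    is below [1/4]. The sequence [zdel] is then taken for this [lam]. *)
Lemma zvonkin_data_exists (R : realType) (alpha eta N : R) (phi h : R -> R)
    (kap : {finite_measure set (measurableTypeR R) -> \bar R}) :
  1 < alpha < 2 -> 0 < eta < alpha - 1 -> mollifier phi -> bmeas h 1 ->
  (forall x : R, itg kap setT (fun y : measurableTypeR R => sing eta (x - y)) /\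
    \int[kap]_y sing eta (x - y) <= N) ->
  exists z : zvonkin_data alpha phi h kap, True.
Proof.
move=> /andP[a1 a2] /andP[e0 ea] hphi bh hN.
have e1 : eta < 1 by lra.
have N0 : 0 <= N.
  by have [_] := hN 0; apply: le_trans; apply: Rintegral_ge0 => y _; exact: powR_ge0.
have [C C0 hC] := smoothed_symbol_bound hphi a1 e0 e1 ea.
have c : (C * symbol_mass alpha eta n.+1%:R * N) @[n --> \oo] --> 0.
  rewrite -[X in _ --> X](mul0r N) -[X in X * N](mulr0 C).
  apply: cvgM; last exact: cvg_cst.
  by apply: cvgM; [exact: cvg_cst|exact: symbol_mass_cvg0].
have q4 : 0 < 4^-1 :> R by rewrite invr_gt0.
have /cvgrPdist_lt /(_ _ q4) [n _ /(_ n (leqnn n))] := c.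
rewrite sub0r normrN => hn.
have l1 : 1 <= n.+1%:R :> R by rewrite ler1n.
have [del [d0 dc dW]] := smoothed_symbol_cauchy hphi a1 e0 e1 ea l1.
unshelve eexists; last by [].
apply: (@ZvonkinData R alpha phi h kap eta N n.+1%:R (C * symbol_mass alpha eta n.+1%:R)
  (C * \int[@lebesgue_measure R]_(xi in `[0, +oo[) (`|xi| `^ 0 * resolvent_symbol alpha n.+1%:R xi)) del) => //.
- by rewrite mulr_ge0 ?symbol_mass_ge0.
- by rewrite (le_trans (ler_norm _))// ltW.
- by move=> k z; have [] := hC n.+1%:R k z l1.
- by move=> k z; have [] := hC n.+1%:R k z l1.
Qed.

(** The properties of the noise on which Ito's formula rests; the last two are the real and
    imaginary parts of the characteristic function of the increments. *)
Record driver (R : realType) d (T : measurableType d) (P : probability T R)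
    (F : R -> set (set T)) (alpha : R) (L : R -> T -> R) : Prop := Driver {
  drF : filtration F;
  drL : prog F L;
  drind : forall s t, 0 <= s -> s <= t ->
    forall (B : set T) (C : set R), F s B -> measurable C ->
    P (B `&` increment L s t @^-1` C) = (P B * P (increment L s t @^-1` C))%E;
  drcos : forall s t xi, 0 <= s -> s <= t ->
    \int[P]_w cos (xi * increment L s t w) = expR (- ((t - s) * `|xi| `^ alpha));
  drsin : forall s t xi, 0 <= s -> s <= t ->
    \int[P]_w sin (xi * increment L s t w) = 0 }.

(** * Events of small probability *)

Section small_events.
Context (R : realType) d (T : measurableType d) (P : probability T R).

(* Events such as [exceed] quantify over uncountably many times, hence the
   measurable cover. *)
Definition small (E : set T) (rho : R) :=
  exists A : set T, [/\ measurable A, E `<=` A & (P A <= rho%:E)%E].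

Lemma small_sub E E' rho : small E rho -> E' `<=` E -> small E' rho.
Proof. by move=> [A [mA EA PA]] EE; exists A; split => //; exact: subset_trans EA. Qed.

Lemma small_le E (rho rho' : R) : small E rho -> rho <= rho' -> small E rho'.
Proof. by move=> [A [mA EA PA]] rr; exists A; split => //; rewrite (le_trans PA)// lee_fin. Qed.

Lemma smallU E E' (rho rho' : R) : small E rho -> small E' rho' -> small (E `|` E') (rho + rho').
Proof.
move=> [A [mA EA PA]] [B [mB EB PB]]; exists (A `|` B); split.
- exact: measurableU.
- exact: setUSS.
- by rewrite (le_trans (measureU2 _ _ _))// EFinD leeD.
Qed.

Lemma small_null E : P.-negligible E -> small E 0.
Proof. by move=> [A [mA PA EA]]; exists A; split => //; rewrite PA. Qed.

Lemma small_negligible E : (forall rho : R, 0 < rho -> small E rho) -> P.-negligible E.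
Proof.
move=> h; have hs (n : nat) : small E n.+1%:R^-1 by apply: h; rewrite invr_gt0.
have [A hA] := choice hs.
have mI : measurable (\bigcap_n A n).
  by apply: bigcap_measurable => // n _; have [] := hA n.
exists (\bigcap_n A n); split => //.
  apply/eqP; rewrite -measure_le0; apply/lee_addgt0Pr => e e0; rewrite add0e.
  have [n _ hn] : \forall n \near \oo, n.+1%:R^-1 < e.
    have /cvgrPdist_lt /(_ e e0) := @cvg_harmonic R; apply: filterS => n.
    by rewrite /harmonic/= sub0r normrN ger0_norm.
  have [mA _ PA] := hA n.
  rewrite (@le_trans _ _ (P (A n)))//.
    by apply: le_measure; rewrite ?inE//; exact: bigcap_inf.
  by rewrite (le_trans PA)// lee_fin ltW//; exact: hn (leqnn n).
by move=> w Ew n _; have [_ EA _] := hA n; exact: EA.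
Qed.

Lemma borel_cantelli (E : nat -> set T) : (forall n, small (E n) (2^-1 ^+ n)) ->
  exists N : set T, [/\ measurable N, P N = 0%E &
    forall w, ~ N w -> exists m, forall n, (m <= n)%N -> ~ E n w].
Proof.
move=> /choice[A hA].
have mA n : measurable (A n) by have [] := hA n.
exists (lim_sup_set A); split.
- by apply: bigcap_measurable => // n _; exact: bigcup_measurable.
- apply: lim_sup_set_cvg0 => //.
  apply: (@le_lt_trans _ _ (\sum_(0 <= k <oo) ((2^-1 ^+ k)%:E : \bar R))%E).
    by apply: lee_nneseries => // n _; have [] := hA n.
  apply: (@le_lt_trans _ _ 2%:E); last exact: ltry.
  apply: lime_le; first by apply: is_cvg_nneseries => n _ _; rewrite lee_fin exprn_ge0.
  apply: nearW => n; rewrite sumEFin lee_fin.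
  suff -> : \sum_(0 <= k < n) (2^-1 ^+ k : R) = 2 - 2 * 2^-1 ^+ n.
    by rewrite gerBl mulr_ge0// exprn_ge0.
  elim: n => [|n IH]; first by rewrite big_nil expr0 mulr1 subrr.
  by rewrite big_nat_recr//= IH exprS; field.
move=> w nw; apply: contrapT => h; apply: nw => m _ /=.
have : exists n, (m <= n)%N /\ E n w.
  apply: contrapT => hn; apply: h; exists m => n mn En; apply: hn.
  by exists n.
by move=> [n [mn En]]; exists n => //=; have [_ EA _] := hA n; exact: EA.
Qed.

End small_events.

(** * Bounds carried by the analytic data *)

Section analytic_data.
Context {R : realType} {alpha : R} {phi h : R -> R}.
Context {kap : {finite_measure set (measurableTypeR R) -> \bar R}}.
Context (z : zvonkin_data alpha phi h kap).
Implicit Types (f : R -> R) (x : R).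

Notation W := (smoothed_symbol phi alpha (zlam z)).

Definition zW2 n : dom2 (W n) := smoothed_symbol_dom2 (zphi z) (zalpha1 z) n (zlam1 z).
Definition zU n f := Up kap W n f.
Definition zV n f := Vp kap W n f.
Definition zM (_ : zvonkin_data alpha phi h kap) n f := Mp kap phi n f.
Definition zmu n := zM z n h.
Definition zam n := zM z n (fun=> 1).
Definition zu n := uz (zsing z) zW2 (zq0 z) (zqN z) (zsin z) (zh z) n.
Definition zv n := vz (zsing z) zW2 (zq0 z) (zqN z) (zsin z) (zh z) n.
Definition zk n := kz (zsing z) phi zW2 (zq0 z) (zqN z) (zsin z) (zh z) n.
Definition zf n := fz (zsing z) zW2 (zq0 z) (zqN z) (zsin z) (zh z) n.

Definition zGk := zG z * kmass kap.
Definition zCu := 2 * (zG z * zN z + 1) * kmass kap.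
Definition zCv := 2 * zN z.

Lemma zG0 : 0 <= zG z. Proof. exact: le_trans (normr_ge0 _) (zcos z 0 0). Qed.
Lemma zN0 : 0 <= zN z.
Proof. by have [_] := zsing z 0; apply: le_trans; apply: Rintegral_ge0 => y _; exact: powR_ge0. Qed.
Lemma zGk0 : 0 <= zGk. Proof. by rewrite mulr_ge0 ?zG0 ?kmass_ge0. Qed.
Lemma zCu0 : 0 <= zCu.
Proof. by rewrite !mulr_ge0 ?kmass_ge0// addr_ge0// mulr_ge0 ?zG0 ?zN0. Qed.
Lemma zlam0 : 0 <= zlam z. Proof. exact: le_trans (zlam1 z). Qed.

Lemma zf_bmeas n : bmeas (zf n) (1 + 3^-1). Proof. exact: fz_bmeas. Qed.

Lemma zvE n x : zv n x = zV n (zf n) x. Proof. exact: vzE. Qed.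
Lemma zkE n : zk n = zM z n (zf n). Proof. by []. Qed.

Lemma zU_bnd f n x : bmeas f 1 -> `|zU n f x| <= zGk.
Proof. by move=> bf; have := Up_bnd kap zW2 (zcos z) bf n x; rewrite mulr1. Qed.

Lemma zU_meas f M n : bmeas f M -> measurable_fun setT (zU n f).
Proof. by move=> bf; apply: (Up_meas (zsing z) zW2 (zq0 z) (zqN z) (zcos z) (zsin z) bf). Qed.

Lemma zV_meas f M n : bmeas f M -> measurable_fun setT (zV n f).
Proof. by move=> bf; apply: (Vp_meas (zsing z) zW2 (zsin z) bf). Qed.

Lemma zM_meas f M n : bmeas f M -> measurable_fun setT (zM z n f).
Proof. by move=> bf; apply: (Mp_meas kap (zphi z) bf). Qed.

Lemma zV_bnd f M n x : bmeas f M -> `|zV n f x| <= M / 4.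
Proof. by move=> bf; exact: (Vp_bnd (zsing z) zW2 (zq0 z) (zqN z) (zsin z) bf). Qed.

Lemma zU_del f m n k x : bmeas f 1 -> (m <= n)%N -> (m <= k)%N ->
  `|zU n f x - zU k f x| <= zdel z m * kmass kap.
Proof.
move=> bf mn mk.
by have := Up_del kap zW2 (zcos z) (zdelW z) bf x mn mk; rewrite mulr1.
Qed.

Lemma zV_del f m n k x : bmeas f 1 -> (m <= n)%N -> (m <= k)%N ->
  `|zV n f x - zV k f x| <= zdel z m * zN z.
Proof.
move=> bf mn mk.
by have := Vp_del (zsing z) zW2 (zsin z) (zdel0 z) (zdelW z) bf x mn mk; rewrite mulr1.
Qed.

Lemma zM_bnd f M n : bmeas f M -> exists2 B : R, 0 <= B & forall x, `|zM z n f x| <= B.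
Proof. by move=> bf; exact: (Mp_bnd kap (zphi z) bf). Qed.

Lemma zM_lip f M n : bmeas f M ->
  exists2 K : R, 0 <= K & forall x x', `|zM z n f x - zM z n f x'| <= K * `|x - x'|.
Proof. by move=> bf; exact: (Mp_lip kap (zphi z) bf). Qed.

Lemma zam_ge0 n x : 0 <= zam n x. Proof. exact: (Mp1_ge0 kap (zphi z)). Qed.

Lemma zM_le f n x : bmeas f 1 -> `|zM z n f x| <= zam n x.
Proof. exact: (Mp_le kap (zphi z)). Qed.

Lemma zu_lip n x x' : `|zu n x - zu n x'| <= 2^-1 * `|x - x'|.
Proof. exact: (uz_lip _ _ _ _ (zcos z)). Qed.

Lemma zv_bmeas n : bmeas (zv n) 3^-1. Proof. exact: vz_bmeas. Qed.

Lemma zv_lip n : exists2 K : R, 0 <= K & forall x x', `|zv n x - zv n x'| <= K * `|x - x'|.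
Proof.
exists (second_moment (W n) * (1 + 3^-1) * kmass kap); last exact: vz_lip.
by rewrite !mulr_ge0 ?kmass_ge0 ?second_moment_ge0//; lra.
Qed.

Lemma zu_del m n k x : (m <= n)%N -> (m <= k)%N -> `|zu n x - zu k x| <= zCu * zdel z m.
Proof. exact: (uz_del _ _ _ _ (zcos z) _ (zdel0 z) (zdelW z)). Qed.

Lemma zv_del m n k x : (m <= n)%N -> (m <= k)%N -> `|zv n x - zv k x| <= zCv * zdel z m.
Proof.
move=> mn mk; have := vz_del (zsing z) zW2 (zq0 z) (zqN z) (zsin z) (zdel0 z) (zdelW z) (zh z) x mn mk.
by rewrite -mulrA [zdel z m * _]mulrC mulrA.
Qed.

Lemma zk_osc : exists om : nat -> R, [/\ forall n, 0 <= om n, om n @[n --> \oo] --> 0 &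
  forall n x, `|zk n x - (1 + zv n x) * zmu n x| <= om n * zam n x].
Proof. exact: (kz_osc _ (zphi z) _ _ _ _ (zdel0 z) (zdelc z) (zdelW z)). Qed.

End analytic_data.

Lemma P_bnd (R : realType) d (T : measurableType d) (P : probability T R) (f : T -> R) (K : R) :
  measurable_fun setT f -> (forall w, `|f w| <= K) -> `|\int[P]_w f w| <= K.
Proof.
move=> mf fB; rewrite -[leRHS](int_P_cst P); apply: int_dom => //.
exact: (itg_cst measurableT _ (P_lty P)).
Qed.

Lemma krylov_arith (R : realFieldType) (x1 x2 x3 i j G : R) :
  x1 <= x2 + x3 -> `|i| <= G -> `|j| <= G -> x1 - (i - j) <= 2 * G + x2 + x3.
Proof. by rewrite !ler_norml => ? /andP[? ?] /andP[? ?]; lra. Qed.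

(** * Existence *)

Section approximants.
Context {R : realType} {d} {T : measurableType d} {P : probability T R}.
Context {F : R -> set (set T)} {alpha : R} {L : R -> T -> R} (hL : driver P F alpha L).
Context {phi h : R -> R} {kap : {finite_measure set (measurableTypeR R) -> \bar R}}.
Context (z : zvonkin_data alpha phi h kap) (x0 : R).
Notation leb := (@lebesgue_measure R).
Notation lam := (zlam z).
Let hF : filtration F := drF hL.

Definition admissible (a : R -> T -> R) := prog F a /\ bdd a.
Definition drifted (a : R -> T -> R) r w := L r w + (x0 + pint a r w).

Lemma pint_prog a : admissible a -> prog F (pint a).
Proof. by move=> [pa [M hM]]; exact: (prog_int hF pa hM). Qed.

Lemma drifted_prog a : admissible a -> prog F (drifted a).
Proof.
move=> ha; apply: progD; first exact: drL hL.
by apply: progD; [exact: prog_cst|exact: pint_prog].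
Qed.

Lemma prog_ebd tm X : prog F X -> bdd X -> ebd tm X.
Proof.
by move=> pX [A hA]; split; [apply: (prog_joint hF pX)|exists A => r w _].
Qed.

Lemma absc_ebd tm c dc : absc F tm c dc -> bdd c -> ebd tm c /\ ebd tm dc.
Proof. by move=> [pc pdc bdc _] bc; split; exact: prog_ebd. Qed.

Lemma comp_ebd tm (f : R -> R) X (B : R) : measurable_fun setT f -> (forall x, `|f x| <= B) ->
  prog F X -> ebd tm (fun r w => f (X r w)).
Proof.
move=> mf fB pX; apply: prog_ebd; first exact: prog_comp.
by exists B => r w.
Qed.

Lemma exp_ebd tm : ebd tm (fun r (_ : T) => expR (- (lam * r))).
Proof.
split; first by mr.
by exists 1 => r w /andP[r0 _]; rewrite ger0_norm ?expR_ge0// -expR0 ler_expR oppr_le0 mulr_ge0 ?zlam0.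
Qed.

Lemma exp_le1 r : 0 <= r -> expR (- (lam * r)) <= 1.
Proof. by move=> r0; rewrite -expR0 ler_expR oppr_le0 mulr_ge0 ?zlam0. Qed.

Lemma ito_a (f : R -> R) (M tm : R) n a c dc : admissible a -> bmeas f M -> 0 <= tm -> absc F tm c dc -> bdd c ->
  \int[P]_w (expR (- (lam * tm)) * c tm w * zU z n f (drifted a tm w)) -
  \int[P]_w (c 0 w * zU z n f (drifted a 0 w)) =
  ET P tm (fun r w => expR (- (lam * r)) * (dc r w * zU z n f (drifted a r w) +
    c r w * (zV z n f (drifted a r w) * a r w - zM z n f (drifted a r w)))).
Proof.
move=> [pa ba] bf tm0 hc bc; have [FF pL iL cL sL] := hL.
have aY : absc F tm (fun r w => x0 + pint a r w) a.
  have [p1 p2 p3 p4] := pint_absc hF tm pa ba; split => //.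
    by apply: progD => //; exact: prog_cst.
  by move=> w; apply: (prim_ext (primD (prim_cst tm x0) (p4 w))) => r; rewrite add0r.
exact: (ito_pot FF pL iL cL sL (zlam1 z) (zalpha1 z) (zphi z) kap n bf tm0 hc bc aY).
Qed.

(** Ito's formula for the potential of [1] trades the occupation of the mollified total variation
    for boundary terms, the variation of the weight, and the gradient of the potential times the
    drift. The gradient is at most [1/4], so that the last term can be absorbed whenever the drift
    is itself of the form [mu_n(X)]. *)
Lemma krylov tm k a c dc : admissible a -> 0 <= tm -> absc F tm c dc -> (forall r w, 0 <= c r w <= 1) ->
  ET P tm (fun r w => expR (- (lam * r)) * (c r w * zam z k (drifted a r w))) <=
  2 * zGk z + zGk z * ET P tm (fun r w => `|dc r w|) +
  4^-1 * ET P tm (fun r w => expR (- (lam * r)) * (c r w * `|a r w|)).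
Proof.
move=> ha tm0 hc c01; have b1 := @bmeas1 R; have [pa ba] := ha.
have bc : bdd c by exists 1 => r w; have /andP[h0 h1] := c01 r w; rewrite ger0_norm.
have := ito_a k ha b1 tm0 hc bc.
set g := zU z k (fun=> 1); set g1 := zV z k (fun=> 1).
have gB x : `|g x| <= zGk z by exact: zU_bnd.
have g1B x : `|g1 x| <= 4^-1 by have := zV_bnd z k x b1; rewrite mul1r.
have [ec edc] := absc_ebd hc bc; have eE := exp_ebd tm.
have pX := drifted_prog ha.
have eg := comp_ebd tm (zU_meas z k b1) gB pX.
have eg1 := comp_ebd tm (zV_meas z k b1) g1B pX.
have [B B0 hB] := zM_bnd z k b1.
have ek := comp_ebd tm (zM_meas z k b1) hB pX.
have ea := prog_ebd tm pa ba.
have eS := ebdM eE (ebdD (ebdM edc eg) (ebdM ec (ebdM eg1 ea))).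
move=> H.
have E : ET P tm (fun r w => expR (- (lam * r)) * (c r w * zam z k (drifted a r w))) =
   ET P tm (fun r w => expR (- (lam * r)) * (dc r w * g (drifted a r w) + c r w * (g1 (drifted a r w) * a r w))) -
   ET P tm (fun r w => expR (- (lam * r)) * (dc r w * g (drifted a r w) +
    c r w * (g1 (drifted a r w) * a r w - zM z k (fun=> 1) (drifted a r w)))).
  rewrite -ETB.
  - by apply: ET_eq => r w _; rewrite /zam; ring.
  - exact: eS.
  - exact: (ebdM eE (ebdD (ebdM edc eg) (ebdM ec (ebdB (ebdM eg1 ea) ek)))).
rewrite E -H.
have tt : 0 <= tm <= tm by rewrite tm0 lexx.
have t0 : 0 <= (0 : R) <= tm by rewrite lexx tm0.
have bnd (f : T -> R) : measurable_fun setT f -> (forall w, `|f w| <= zGk z) -> `|\int[P]_w f w| <= zGk z.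
  by move=> mf fB; exact: P_bnd.
have i1 : `|\int[P]_w (expR (- (lam * tm)) * c tm w * g (drifted a tm w))| <= zGk z.
  apply: bnd.
    exact: (itg_meas (ebd_at P tt (ebdM (ebdM eE ec) eg))).
  move=> w; have /andP[h0 h1] := c01 tm w; rewrite normrM (le_trans (ler_piMl _ _))//.
  by rewrite ger0_norm ?mulr_ge0 ?expR_ge0// mulr_ile1 ?expR_ge0 ?exp_le1.
have i2 : `|\int[P]_w (c 0 w * g (drifted a 0 w))| <= zGk z.
  apply: bnd.
    exact: (itg_meas (ebd_at P t0 (ebdM ec eg))).
  by move=> w; have /andP[h0 h1] := c01 0 w; rewrite normrM (le_trans (ler_piMl _ _))// ger0_norm.
have up : ET P tm (fun r w => expR (- (lam * r)) * (dc r w * g (drifted a r w) + c r w * (g1 (drifted a r w) * a r w))) <=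
   zGk z * ET P tm (fun r w => `|dc r w|) + 4^-1 * ET P tm (fun r w => expR (- (lam * r)) * (c r w * `|a r w|)).
  have ea' := ebd_norm ea; have edc' := ebd_norm edc.
  have eA : ebd tm (fun r w => expR (- (lam * r)) * (c r w * `|a r w|)) by exact: (ebdM eE (ebdM ec ea')).
  rewrite -ETZ// -(ETZ P 4^-1)// -ETD; [|exact: ebdZ|exact: ebdZ].
  apply: ET_le.
  - exact: eS.
  - by apply: ebdD; exact: ebdZ.
  move=> r w /andP[r0 rt]; have /andP[h0 h1] := c01 r w.
  have e0 := expR_ge0 (- (lam * r)); have e1 := exp_le1 r0.
  rewrite mulrDr lerD//.
    rewrite (le_trans (ler_norm _))// normrM (ger0_norm e0) (le_trans (ler_piMl _ e1))//.
    by rewrite normrM mulrC ler_wpM2r.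
  rewrite (le_trans (ler_norm _))// normrM (ger0_norm e0) [leRHS]mulrCA ler_wpM2l//.
  rewrite !normrM (ger0_norm h0) [leRHS]mulrCA.
  exact: (ler_wpM2l h0 (ler_wpM2r (normr_ge0 _) (g1B _))).
exact: krylov_arith up i1 i2.
Qed.

End approximants.

Lemma mass_le (R : realType) d (T : measurableType d) (P : probability T R) (A : set T)
    (f : T -> R) (c K : R) : measurable A -> itg P setT f -> (forall w, 0 <= f w) -> 0 < c ->
  (forall w, A w -> c <= f w) -> c^-1 * \int[P]_w f w <= K -> (P A <= K%:E)%E.
Proof.
move=> mA itf f0 c0 cf fK.
have PA : (P A < +oo)%E by rewrite (le_lt_trans (probability_le1 P mA))// ltry.
have E : \int[P]_w (\1_A w : R) = fine (P A) by rewrite /Rintegral integral_indic// setIT.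
rewrite -(fineK (x := P A)) ?ge0_fin_numE// lee_fin -E (le_trans _ fK)//.
rewrite -RintegralZl//; apply: int_le => //.
- apply: (itg_bnd _ (M := 1)) => //; first exact: P_lty.
  by move=> w _; rewrite indicE; case: (_ \in _); rewrite ?normr1 ?normr0.
- exact: itgZ.
move=> w _; rewrite indicE; case: (boolP (w \in A)) => [/set_mem Aw|_].
  by rewrite mulrC ler_pdivlMr// mul1r cf.
by rewrite mulr_ge0// invr_ge0 ltW.
Qed.

(** With [s = expR (- y)] one has [ramp_scale s = 2 * y], so a large [y] brings the ramp term below
    [rho / 2]. Only afterwards is [theta <= s] fixed, which gives [delta / s <= 1] and leaves shares
    of [rho / 6] for each [delta] and for [eps]. *)
Lemma scale_choice (R : realType) (K C eta0 rho : R) : 0 <= K -> 0 <= C -> 0 < eta0 -> 0 < rho ->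
  exists s theta : R, [/\ 0 < s < 1, s <= eta0 ^+ 2, 0 < theta, theta <= eta0 / 4 &
   forall delta eps : R, 0 <= delta -> delta <= theta -> eps <= theta ->
    K * (2 * delta + (3 + delta / s) / ramp_scale s * C + eps) <= rho].
Proof.
move=> K0 C0 e0 r0; set y := 1 + (eta0 ^+ 2)^-1 + 4 * (K * C) / rho.
have e2 : 0 < eta0 ^+ 2 by rewrite exprn_gt0.
have q0 : 0 <= 4 * (K * C) / rho by rewrite divr_ge0 ?(ltW r0)// !mulr_ge0.
have i0 : 0 < (eta0 ^+ 2)^-1 by rewrite invr_gt0.
have y0 : 0 < y by rewrite /y; lra.
have ye : expR (- y) <= y^-1.
  by rewrite expRN lef_pV2 ?posrE ?expR_gt0//; have := @expR_ge1Dx R y; lra.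
have s1 : expR (- y) < 1 by rewrite -expR0 ltr_expR oppr_lt0.
have se : expR (- y) <= eta0 ^+ 2.
  by rewrite (le_trans ye)// -[leRHS]invrK lef_pV2 ?posrE// /y; lra.
have rE : ramp_scale (expR (- y)) = 2 * y.
  by rewrite /ramp_scale -expRM_natl expRK mulrN opprK.
have s0 := expR_gt0 (- y); move: (expR (- y)) s0 s1 se rE {ye} => s s0 s1 se rE.
pose th := Num.min s (Num.min (eta0 / 4) (rho / (6 * (K + 1)))).
have K1 : 0 < 6 * (K + 1) by rewrite mulr_gt0// ltr_wpDl.
exists s, th; split => //.
- by rewrite s0.
- by rewrite !lt_min s0 !divr_gt0.
- by rewrite /th !ge_min lexx orbT.
move=> delta eps d0; rewrite /th !le_min => /and3P[ds _ dr] /and3P[_ _ er].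
have dsl : delta / s <= 1 by rewrite ler_pdivrMr// mul1r.
have hA : K * ((3 + delta / s) / ramp_scale s * C) <= rho / 2.
  rewrite rE (_ : K * _ = (3 + delta / s) * (K * C) / (2 * y)); last by field; rewrite !gt_eqF.
  rewrite ler_pdivrMr ?mulr_gt0// (_ : rho / 2 * (2 * y) = rho * y); last by field.
  apply: (@le_trans _ _ (4 * (K * C))).
    by rewrite ler_wpM2r ?mulr_ge0//; lra.
  rewrite [leRHS]mulrC -ler_pdivrMr// /y; lra.
have hB (x : R) : x <= rho / (6 * (K + 1)) -> K * x <= rho / 6.
  move=> hx; rewrite (le_trans (ler_wpM2l K0 hx))//.
  rewrite (_ : K * _ = K / (K + 1) * (rho / 6)); last by field; rewrite gt_eqF// ltr_wpDl.
  rewrite ler_piMl ?(divr_ge0 (ltW r0))// ler_pdivrMr ?ltr_wpDl// mul1r; lra.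
have := hB _ dr; have := hB _ er; move: hA.
move: ((3 + delta / s) / ramp_scale s * C) => Z; rewrite !mulrDr; lra.
Qed.

Section weighted_bound_small.
Context {R : realType} {d} {T : measurableType d} {P : probability T R}.
Context {F : R -> set (set T)} (hF : filtration F).
Notation leb := (@lebesgue_measure R).

(** What is retained of [ramp_weight] for the estimate of the error term: domination by the killing
    factor of [j], and a variation controlled by the scale [s]. *)
Definition weight tm (s : R) (j Dd c dc : R -> T -> R) := [/\ absc F tm c dc,
  (forall r w, 0 <= c r w <= expR (- pint j r w)) &
  forall w, \int[leb]_(r in `[0, tm]) `|dc r w| <=
   1 + (s * ramp_scale s)^-1 * \int[leb]_(r in `[0, tm]) (expR (- pint j r w) * `|Dd r w|)].

Context (tm lam eta0 s delta C eps rho : R) (D Dd wp e j : R -> T -> R).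

(** On the event the overshoot rate has accumulated mass one, so [1 - expR (- O) >= 1 / 2]; together
    with [eta0 / 8] from [main_estimate] this gives the factor [16 / eta0]. The two exponentials
    undo the discount and the killing by [j]. *)
Lemma weighted_bound_small : 0 <= tm -> 0 <= lam -> 0 < eta0 -> 0 < s < 1 -> s <= eta0 ^+ 2 ->
  0 <= delta -> delta <= eta0 / 4 -> absc F tm D Dd -> bdd Dd -> (forall w, D 0 w = 0) ->
  prog F j -> bdd j -> (forall r w, 0 <= j r w) -> prog F e -> bdd e -> prog F wp ->
  (forall (r : R) w, 0 <= r <= tm -> `|wp r w| <= 2^-1 * `|D r w| + delta) ->
  (forall c dc, absc F tm c dc -> bdd c ->
    \int[P]_w (expR (- (lam * tm)) * c tm w * wp tm w) - \int[P]_w (c 0 w * wp 0 w) =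
    ET P tm (fun r w => expR (- (lam * r)) * (dc r w * wp r w + c r w * (e r w - Dd r w)))) ->
  ET P tm (fun r w => expR (- pint j r w) * `|Dd r w|) <= C ->
  (forall c dc, weight tm s j Dd c dc ->
    ET P tm (fun r w => expR (- (lam * r)) * (c r w * e r w)) <= eps) ->
  small P [set w | pint j tm w <= rho /\ exists2 t, 0 <= t <= tm & 2 * eta0 <= D t w]
    (16 / eta0 * expR (lam * tm) * expR rho *
      (2 * delta + (3 + delta / s) / ramp_scale s * C + eps)).
Proof.
move=> tm0 lam0 eta00 /andP[s0 s1] seta delta0 deta aD [M1 hM1] D0 pj bj j0 pe be pw wD Hid hC heps.
set M := Num.max M1 1; have M0 : 0 < M by rewrite lt_max ltr01 orbT.
have DdM r w : `|Dd r w| <= M by rewrite le_max hM1.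
have bDd : bdd Dd by exists M.
have main := main_estimate hF tm0 lam0 M0 eta00 s0 s1 seta delta0 deta aD D0 DdM pj bj j0 pe be pw wD Hid.
have heps' := heps (ramp_weight M eta0 s D j) (ramp_weight1 M eta0 s D Dd j).
have ov0 r w : 0 <= overK M eta0 (D ^~ w) r.
  rewrite /overK; have h : 0 <= M / eta0 by rewrite divr_ge0 ?ltW.
  by case: (eta0 <= D r w); rewrite ?mulr1 ?mulr0.
have wc : weight tm s j Dd (ramp_weight M eta0 s D j) (ramp_weight1 M eta0 s D Dd j).
  split.
  - exact: (ramp_weight_absc hF).
  - move=> r w; have -> := ramp_weight_ge0 M eta0 D j s0 s1 r w.
    rewrite andTb; exact: (ramp_weight_le hF M0 eta00 s0 s1 aD pj bj).
  - by move=> w; exact: (ramp_weight1_int hF).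
have {heps heps'} heps := heps' wc.
set O := pint (fun r w => overK M eta0 (D ^~ w) r) in main.
have pO : prog F (fun r w => overK M eta0 (D ^~ w) r) by exact: (prog_overK M eta0 aD).
have bO : bdd (fun r w => overK M eta0 (D ^~ w) r).
  exists (M / eta0) => r w; rewrite ger0_norm// /overK; have h : 0 <= M / eta0 by rewrite divr_ge0 ?ltW.
  by case: (eta0 <= D r w); rewrite ?mulr1 ?mulr0.
have [pO' _ _ _] := pint_absc hF tm pO bO; have [pJ _ _ _] := pint_absc hF tm pj bj.
have mJ : measurable_fun setT (pint j tm) by exact: (prog_meas hF).
have mO : measurable_fun setT (O tm) by exact: (prog_meas hF).
exists [set w | pint j tm w <= rho /\ 1 <= O tm w]; split.
- rewrite (_ : [set w | _] = pint j tm @^-1` `]-oo, rho] `&` O tm @^-1` `[1, +oo[); last first.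
    by apply/seteqP; split=> w /=; rewrite !in_itv/= andbT.
  by apply: measurableI; rewrite -[X in measurable X]setTI; [exact: mJ|exact: mO].
- move=> w [wr [t ht Dt]]; split => //.
  exact: (main_event hF M0 eta00 aD D0 DdM ht Dt).
pose f w := expR (- pint j tm w) * (1 - expR (- O tm w)).
have J0 w : 0 <= pint j tm w by exact: pint_ge0.
have O0 w : 0 <= O tm w.
  exact: pint_ge0.
have eO w : expR (- O tm w) <= 1 by rewrite -expR0 ler_expR oppr_le0.
have eJ w : expR (- pint j tm w) <= 1 by rewrite -expR0 ler_expR oppr_le0.
have f0 w : 0 <= f w by rewrite mulr_ge0 ?expR_ge0 ?subr_ge0.
have itf : itg P setT f.
  apply: (itg_bnd _ (M := 1)) => //; first exact: P_lty.
    by rewrite /f; mr.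
  by move=> w _; rewrite ger0_norm// mulr_ile1 ?expR_ge0 ?subr_ge0// gerBl expR_ge0.
apply: (mass_le (c := expR (- rho) * 2^-1) _ itf) => //.
- rewrite (_ : [set w | _] = pint j tm @^-1` `]-oo, rho] `&` O tm @^-1` `[1, +oo[); last first.
    by apply/seteqP; split=> w /=; rewrite !in_itv/= andbT.
  by apply: measurableI; rewrite -[X in measurable X]setTI; [exact: mJ|exact: mO].
- by rewrite mulr_gt0 ?expR_gt0.
- move=> w [wr wO]; apply: ler_pM => //; rewrite ?expR_ge0 ?invr_ge0// ?ler_expR ?lerN2//.
  have h1 : expR (- O tm w) <= 2^-1.
    rewrite expRN lef_pV2 ?posrE ?expR_gt0//.
    by have := @expR_ge1Dx R (O tm w); lra.
  by lra.
rewrite -/f in main.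
have k0 : 0 <= (3 + delta / s) / ramp_scale s.
  by rewrite divr_ge0 ?(ltW (ramp_scale_gt0 _ _))// addr_ge0// divr_ge0// ltW.
have hk := ler_wpM2l k0 hC.
move: main hk heps; rewrite -/f.
have -> : expR (lam * tm) = (expR (- (lam * tm)))^-1 by rewrite expRN invrK.
have -> : expR rho = (expR (- rho))^-1 by rewrite expRN invrK.
have := expR_gt0 (- (lam * tm)); have := expR_gt0 (- rho).
move: (expR (- (lam * tm))) (expR (- rho)) => E1 E2.
move: (\int[P]_w f w) (ET P tm _) (ET P tm _) (_ / ramp_scale s) => x1 x2 x3 x4 E20 E10 h1 h2 h3.
have {h2 h3}h1 : eta0 / 8 * E1 * x1 <= 2 * delta + x4 * C + eps.
  by apply: (le_trans h1); lra.
move: h1; move: (2 * delta + x4 * C + eps) => y h1.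
rewrite (_ : 16 / eta0 * E1^-1 * E2^-1 * y = (E2 * 2^-1)^-1 * ((eta0 / 8 * E1)^-1 * y)); last first.
  by field; rewrite !gt_eqF.
rewrite ler_wpM2l ?invr_ge0 ?mulr_ge0 ?(ltW E20)//.
by rewrite [leRHS]mulrC ler_pdivlMr 1?mulrC// mulr_gt0// divr_gt0.
Qed.

End weighted_bound_small.

(** The order of quantifiers is the point: [s] and [theta] depend on the tolerances alone, so that
    levels of approximation can be selected afterwards to meet them. *)
Lemma main_choice (R : realType) (tm lam eta0 rho C K0 : R) : 0 <= tm -> 0 <= lam -> 0 < eta0 ->
  0 < rho -> 0 <= C ->
  exists s theta : R, [/\ 0 < s < 1, 0 < theta &
  forall d (T : measurableType d) (P : probability T R) (F : R -> set (set T)) (hF : filtration F)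
    (D Dd wp e j : R -> T -> R) (delta : R),
  0 <= delta -> delta <= theta -> absc F tm D Dd -> bdd Dd -> (forall w, D 0 w = 0) ->
  prog F j -> bdd j -> (forall r w, 0 <= j r w) -> prog F e -> bdd e -> prog F wp ->
  (forall (r : R) w, 0 <= r <= tm -> `|wp r w| <= 2^-1 * `|D r w| + delta) ->
  (forall c dc, absc F tm c dc -> bdd c ->
    \int[P]_w (expR (- (lam * tm)) * c tm w * wp tm w) - \int[P]_w (c 0 w * wp 0 w) =
    ET P tm (fun r w => expR (- (lam * r)) * (dc r w * wp r w + c r w * (e r w - Dd r w)))) ->
  ET P tm (fun r w => expR (- pint j r w) * `|Dd r w|) <= C ->
  (forall c dc, weight (F := F) tm s j Dd c dc ->
    ET P tm (fun r w => expR (- (lam * r)) * (c r w * e r w)) <= theta) ->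
  small P [set w | pint j tm w <= K0 /\ exists2 t, 0 <= t <= tm & 2 * eta0 <= D t w] rho].
Proof.
move=> tm0 lam0 e0 r0 C0.
have K00 : 0 <= 16 / eta0 * expR (lam * tm) * expR K0.
  by rewrite !mulr_ge0 ?expR_ge0// invr_ge0 ltW.
have [s [theta [s01 se t0 te hs]]] := scale_choice K00 C0 e0 r0.
exists s, theta; split => // d T P F hF D Dd wp e j delta d0 dt aD bD D0 pj bj j0 pe be pw wD Hid hC heps.
apply: small_le (hs delta theta d0 dt (lexx _)).
exact: (weighted_bound_small hF K0 tm0 lam0 e0 s01 se d0 (le_trans dt te) aD bD D0 pj bj j0 pe be pw wD Hid hC heps).
Qed.

(** * Approximate solutions by Picard iteration *)

Section approximate_solutions.
Context {R : realType} {d} {T : measurableType d} {P : probability T R}.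
Context {F : R -> set (set T)} {alpha : R} {L : R -> T -> R} (hL : driver P F alpha L).
Context {phi h : R -> R} {kap : {finite_measure set (measurableTypeR R) -> \bar R}}.
Context (z : zvonkin_data alpha phi h kap) (x0 : R).
Notation leb := (@lebesgue_measure R).
Notation lam := (zlam z).
Notation Xa := (drifted (L := L) x0).
Let hF : filtration F := drF hL.

Lemma admissible_itg a w t : admissible (F := F) a -> itg leb `[0, t]%classic (a ^~ w).
Proof.
move=> [pa [M hM]]; apply: (itg_bnd _ (M := M)) => //; first exact: leb_cc_fin.
by apply: measurable_funTS; exact: (prog_path hF).
Qed.

Lemma pintB a b t w : admissible (F := F) a -> admissible (F := F) b ->
  pint (fun r w => a r w - b r w) t w = pint a t w - pint b t w.
Proof. by move=> ha hb; rewrite /pint RintegralB//; exact: admissible_itg. Qed.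

Lemma admissibleB a b : admissible (F := F) a -> admissible (F := F) b -> admissible (F := F) (fun r w => a r w - b r w).
Proof.
move=> [pa [A hA]] [pb [B hB]]; split; first exact: progB.
by exists (A + B) => r w; rewrite (le_trans (ler_normB _ _))// lerD.
Qed.

Lemma driftedB a b t w : Xa a t w - Xa b t w = pint a t w - pint b t w.
Proof. by rewrite /drifted opprD addrACA subrr add0r opprD addrACA subrr add0r. Qed.

Lemma comp_admissible (f : R -> R) (B : R) X : measurable_fun setT f -> (forall x, `|f x| <= B) ->
  prog F X -> admissible (F := F) (fun r w => f (X r w)).
Proof. by move=> mf fB pX; split; [exact: prog_comp|exists B]. Qed.

Lemma ito_diff (f f' : R -> R) (M M' tm : R) n n' a a' c dc : admissible (F := F) a -> admissible (F := F) a' ->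
  bmeas f M -> bmeas f' M' -> 0 <= tm -> absc F tm c dc -> bdd c ->
  let w r p := zU z n f (Xa a r p) - zU z n' f' (Xa a' r p) in
  let b r p := (zV z n f (Xa a r p) * a r p - zM z n f (Xa a r p)) -
               (zV z n' f' (Xa a' r p) * a' r p - zM z n' f' (Xa a' r p)) in
  \int[P]_p (expR (- (lam * tm)) * c tm p * w tm p) - \int[P]_p (c 0 p * w 0 p) =
  ET P tm (fun r p => expR (- (lam * r)) * (dc r p * w r p + c r p * b r p)).
Proof.
move=> ha ha' bf bf' tm0 hc bc w b.
have H := ito_a hL z x0 n ha bf tm0 hc bc; have H' := ito_a hL z x0 n' ha' bf' tm0 hc bc.
have [ec edc] := absc_ebd hL hc bc; have eE := exp_ebd (T := T) z tm.
have U g K k q : admissible (F := F) q -> bmeas g K -> ebd tm (fun r p => zU z k g (Xa q r p)).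
  move=> hq bg; have [pq _] := hq; apply: (comp_ebd hL tm (B := zG z * K * kmass kap)).
  - exact: zU_meas bg.
  - by move=> x; exact: (Up_bnd kap (zW2 z) (zcos z) bg k x).
  - exact: (drifted_prog hL).
have V g K k q : admissible (F := F) q -> bmeas g K ->
    ebd tm (fun r p => zV z k g (Xa q r p) * q r p - zM z k g (Xa q r p)).
  move=> hq bg; have pX := drifted_prog hL x0 hq; have [B B0 hB] := zM_bnd z k bg.
  have [pq bq] := hq.
  apply: ebdB; last exact: (comp_ebd hL tm (zM_meas z k bg) hB pX).
  apply: ebdM; last exact: (prog_ebd hL).
  by apply: (comp_ebd hL tm (B := K / 4) (zV_meas z k bg) _ pX) => x; exact: zV_bnd.
have U1 := U _ _ n _ ha bf; have U2 := U _ _ n' _ ha' bf'.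
have V1 := V _ _ n _ ha bf; have V2 := V _ _ n' _ ha' bf'.
have tt : 0 <= tm <= tm by rewrite tm0 lexx.
have t0 : 0 <= (0 : R) <= tm by rewrite lexx tm0.
have EC : ebd tm (fun r p => expR (- (lam * r)) * c r p) by exact: ebdM.
have i1 g K k q : admissible (F := F) q -> bmeas g K ->
   itg P setT (fun p => expR (- (lam * tm)) * c tm p * zU z k g (Xa q tm p)).
  move=> hq bg; apply: (ebd_at P tt (f := fun r p => expR (- (lam * r)) * c r p * zU z k g (Xa q r p))).
  by apply: ebdM => //; exact: U bg.
have i2 g K k q : admissible (F := F) q -> bmeas g K ->
   itg P setT (fun p => c 0 p * zU z k g (Xa q 0 p)).
  move=> hq bg; apply: (ebd_at P t0 (f := fun r p => c r p * zU z k g (Xa q r p))).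
  by apply: ebdM => //; exact: U bg.
transitivity (ET P tm (fun r w => expR (- (lam * r)) * (dc r w * zU z n f (Xa a r w) +
    c r w * (zV z n f (Xa a r w) * a r w - zM z n f (Xa a r w)))) -
  ET P tm (fun r w => expR (- (lam * r)) * (dc r w * zU z n' f' (Xa a' r w) +
    c r w * (zV z n' f' (Xa a' r w) * a' r w - zM z n' f' (Xa a' r w))))).
  have key (a1 b1 a2 b2 : R) : a1 - b1 - (a2 - b2) = a1 - a2 - (b1 - b2) by ring.
  rewrite -H -H' key; congr (_ - _).
    by rewrite -RintegralB//; [apply: int_eq => p _; rewrite mulrBr|exact: i1 bf|exact: i1 bf'].
  by rewrite -RintegralB//; [apply: int_eq => p _; rewrite mulrBr|exact: i2 bf|exact: i2 bf'].
rewrite -ETB.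
- apply: ET_eq => r p _; rewrite /w /b; rewrite -mulrBr; congr (_ * _).
  have key (x1 x2 x3 x4 x5 x6 : R) : x1 * x2 + x3 * x4 - (x1 * x5 + x3 * x6) = x1 * (x2 - x5) + x3 * (x4 - x6) by ring.
  exact: key.
- by apply: ebdM => //; apply: ebdD; exact: ebdM.
- by apply: ebdM => //; apply: ebdD; exact: ebdM.
Qed.

(** An iterate of finite order takes the place of the exact solution of the mollified equation: it
    is bounded and progressive by construction, and an error [2^-n] on [[0, n]] is harmless. The
    weight [expR (2 * K * r)] makes each iteration halve the error on all time intervals. *)
Lemma picard n : exists a, admissible (F := F) a /\
  forall r w, 0 <= r <= n%:R -> `|a r w - zmu z n (Xa a r w)| <= 2^-1 ^+ n.
Proof.
have [B B0 hB] := zM_bnd z n (zh z); have [K K0 hK] := zM_lip z n (zh z).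
pose a := fix a i := if i is j.+1 then fun r w => zmu z n (Xa (a j) r w) else fun _ _ => 0 : R.
have ha i : admissible (F := F) (a i).
  elim: i => [|i IH] /=; first by split; [exact: prog_cst|exists 0 => r w; rewrite normr0].
  by apply: comp_admissible hB _ => //; [exact: zM_meas (zh z)|exact: (drifted_prog hL)].
have step i r w : 0 <= r -> `|a i.+1 r w - a i r w| <= B * expR (2 * K * r) * 2^-1 ^+ i.
  elim: i r => [|i IH] r r0.
    rewrite subr0 expr0 mulr1 (le_trans (hB _))// ler_peMr// -expR0 ler_expR.
    by rewrite !mulr_ge0.
  rewrite (le_trans (hK _ _))// driftedB -(pintB r w (ha i.+1) (ha i)).
  have iE : itg leb `[0, r]%classic (fun s => 2 * K * expR (2 * K * s)).
    exact: prim_itg (prim_expR r (2 * K)) (lexx r).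
  have E : \int[leb]_(s in `[0, r]) (2 * K * expR (2 * K * s)) = expR (2 * K * r) - 1.
    have [_ _ _ /(_ r)] := prim_expR r (2 * K); rewrite r0 lexx => /(_ isT) ->.
    by rewrite mulr0 expR0 addrC addKr.
  (* The case of a constant drift is separate because the general step divides by [2 * K]. *)
  have [->|Kp] := eqVneq K 0.
    by rewrite mul0r !mulr_ge0 ?expR_ge0// exprn_ge0.
  have Kn : 0 < K by rewrite lt_neqAle eq_sym Kp.
  have c0 : 0 <= B * 2^-1 ^+ i / (2 * K) by rewrite divr_ge0 ?mulr_ge0// exprn_ge0.
  apply: (@le_trans _ _ (K * (B * 2^-1 ^+ i / (2 * K) * (expR (2 * K * r) - 1)))).
    rewrite ler_wpM2l// -E -RintegralZl//.
    apply: int_dom => //.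
    - exact: itg_meas (admissible_itg w r (admissibleB (ha i.+1) (ha i))).
    - exact: itgZ.
    move=> s /=; rewrite in_itv/= => /andP[s0 _]; rewrite (le_trans (IH s s0))//.
    by rewrite [leRHS](_ : _ = B * expR (2 * K * s) * 2^-1 ^+ i)//; field; rewrite gt_eqF.
  rewrite exprS (_ : K * _ = B * (2^-1 * 2^-1 ^+ i) * (expR (2 * K * r) - 1)); last by field; rewrite gt_eqF.
  rewrite [leRHS]mulrAC; apply: ler_wpM2l; first by rewrite !mulr_ge0// exprn_ge0.
  by rewrite gerBl.
have c : (B * expR (2 * K * n%:R) * 2^-1 ^+ i) @[i --> \oo] --> (0 : R).
  rewrite -[X in _ --> X](mulr0 (B * expR (2 * K * n%:R))); apply: cvgM; first exact: cvg_cst.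
  by apply: cvg_expr; rewrite ger0_norm// invf_lt1// ltr1n.
have e0 : 0 < 2^-1 ^+ n :> R by rewrite exprn_gt0.
have /cvgrPdist_lt /(_ _ e0) [k _ /(_ k (leqnn k))] := c.
rewrite sub0r normrN => hk.
exists (a k); split; first exact: ha.
move=> r w /andP[r0 rn]; rewrite distrC.
apply: (le_trans (step k r w r0)); apply: (le_trans _ (ltW hk)); apply: (le_trans _ (ler_norm _)).
rewrite ler_wpM2r ?exprn_ge0// ler_wpM2l// ler_expR ler_wpM2l// mulr_ge0//.
Qed.

End approximate_solutions.

Lemma cvg0_le (R : realType) (u : nat -> R) (theta : R) : u n @[n --> \oo] --> 0 -> 0 < theta ->
  exists N, forall n, (N <= n)%N -> u n <= theta.
Proof.
move=> uc t0; have /cvgrPdist_le /(_ _ t0) [N _ hN] := uc.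
exists N => n Nn; have := hN n Nn.
by rewrite /= sub0r normrN; apply: le_trans; exact: ler_norm.
Qed.

Lemma nat_ge (R : realType) (tm : R) : exists N, forall n, (N <= n)%N -> tm <= n%:R.
Proof.
exists (Num.truncn tm).+1 => n hn; apply: ltW; apply: lt_le_trans (truncnS_gt tm) _.
by rewrite ler_nat.
Qed.

(** * Cauchy estimates for the approximate solutions *)

Section existence_estimates.
Context {R : realType} {d} {T : measurableType d} {P : probability T R}.
Context {F : R -> set (set T)} {alpha : R} {L : R -> T -> R} (hL : driver P F alpha L).
Context {phi h : R -> R} {kap : {finite_measure set (measurableTypeR R) -> \bar R}}.
Context (z : zvonkin_data alpha phi h kap) (x0 : R).
Notation leb := (@lebesgue_measure R).
Notation lam := (zlam z).
Notation Xa := (drifted (L := L) x0).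
Let hF : filtration F := drF hL.

Lemma ET_cst (tm K : R) : 0 <= tm -> ET P tm (fun _ _ => K) = K * tm.
Proof.
move=> tm0; rewrite /ET Rintegral_cst ?ET_mass//; exact: measurable_ET.
Qed.

Lemma pint_0 t w : pint (fun (_ : R) (_ : T) => 0 : R) t w = 0.
Proof. by rewrite /pint Rintegral_cst// mul0r. Qed.

Context (aN : nat -> R -> T -> R).
Hypothesis haN : forall n, admissible (F := F) (aN n).
Hypothesis hN : forall n r w, 0 <= r <= n%:R ->
  `|aN n r w - zmu z n (Xa (aN n) r w)| <= 2^-1 ^+ n.

Let E r := expR (- (lam * r)).
Let X n := Xa (aN n).

Let half1 n : (2^-1 ^+ n : R) <= 1.
Proof. by rewrite exprn_ile1// invf_le1// ler1n. Qed.

Let aN_le n r w : 0 <= r <= n%:R -> `|aN n r w| <= zam z n (X n r w) + 1.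
Proof.
move=> hr; rewrite -[aN n r w](subrK (zmu z n (X n r w))) addrC.
rewrite (le_trans (ler_normD _ _))// lerD//; first exact: zM_le (zh z).
exact: le_trans (hN _ hr) (half1 n).
Qed.

Let eE tm : ebd tm (fun r (_ : T) => E r). Proof. exact: exp_ebd. Qed.
Let pX n : prog F (X n). Proof. exact: (drifted_prog hL). Qed.
Let ea tm n : ebd tm (aN n). Proof. by have [p b] := haN n; exact: (prog_ebd hL). Qed.
Let eM tm f M k n : bmeas f M -> ebd tm (fun r w => zM z k f (X n r w)).
Proof. by move=> bf; have [B B0 hB] := zM_bnd z k bf; exact: (comp_ebd hL tm (zM_meas z k bf) hB). Qed.
Let b1 : bmeas (fun=> 1 : R) 1. Proof. exact: bmeas1. Qed.
Let eam tm k n : ebd tm (fun r w => zam z k (X n r w)). Proof. exact: eM b1. Qed.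
Let E1 r : 0 <= r -> 0 <= E r <= 1. Proof. by move=> r0; rewrite expR_ge0 exp_le1. Qed.

(** At the level [k = n] the estimate of [krylov] closes on itself, because the drift is at most the
    mollified total variation plus one and enters with the factor [1/4]. The resulting bound on the
    drift is then inserted at an arbitrary level [k]. *)
Lemma occupation tm n k : 0 <= tm -> tm <= n%:R ->
  ET P tm (fun r w => E r * zam z k (X n r w)) <= 3 * zGk z + tm /\
  ET P tm (fun r w => E r * `|aN n r w|) <= 3 * zGk z + 2 * tm.
Proof.
move=> tm0 tn.
have c1 : absc F tm (fun _ _ => 1 : R) (fun _ _ => 0).
  split; [exact: prog_cst..| |]; first by exists 0 => r w; rewrite normr0.
  by move=> w; exact: prim_cst.
have K i : ET P tm (fun r w => E r * zam z i (X n r w)) <= 2 * zGk z + 4^-1 * ET P tm (fun r w => E r * `|aN n r w|).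
  have := krylov hL z x0 i (haN n) tm0 c1 => /(_ (fun _ _ => introT andP (conj ler01 (lexx 1)))).
  rewrite (@ET_eq _ _ _ P tm (fun r w => `|0 : R|) (fun _ _ => 0)); last by move=> r w _; rewrite normr0.
  rewrite ET_cst// mul0r mulr0 addr0.
  rewrite (@ET_eq _ _ _ P tm _ (fun r w => E r * zam z i (X n r w))); last by move=> r w _; rewrite mul1r.
  rewrite (@ET_eq _ _ _ P tm (fun r w => expR (- (lam * r)) * (1 * `|aN n r w|)) (fun r w => E r * `|aN n r w|))//.
  by move=> r w _; rewrite mul1r.
have A : ET P tm (fun r w => E r * `|aN n r w|) <= ET P tm (fun r w => E r * zam z n (X n r w)) + tm.
  rewrite -[X in _ + X]mul1r -ET_cst// -ETD; [|by apply: ebdM|exact: ebd_cst].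
  apply: ET_le.
  - by apply: ebdM => //; exact: ebd_norm.
  - by apply: ebdD; [exact: ebdM|exact: ebd_cst].
  move=> r w /andP[r0 rt]; have /andP[e0 e1] := E1 r0.
  have hr : 0 <= r <= n%:R by rewrite r0 (le_trans rt).
  apply: (le_trans (ler_wpM2l e0 (aN_le w hr))).
  by rewrite mulrDr mulr1 lerD2l.
have G0 := zGk0 z; have hn := K n; have hk := K k; move: hn hk A.
move: (ET P tm _) (ET P tm _) (ET P tm _) => y1 y2 y3 hn hk A; split; lra.
Qed.

Let ETabs tm f : 0 <= tm -> ebd tm f -> ET P tm f <= expR (lam * tm) * ET P tm (fun r w => E r * `|f r w|).
Proof.
move=> tm0 ef; have ef' := ebd_norm ef.
rewrite -ETZ; last exact: ebdM.
apply: ET_le => //; first by apply: ebdZ; exact: ebdM.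
move=> r w /andP[r0 rt]; apply: (le_trans (ler_norm _)).
rewrite mulrA -expRD ler_peMl// -expR0 ler_expR -mulrN -mulrDr mulr_ge0 ?zlam0//.
by rewrite subr_ge0.
Qed.

Let one_exp r w : expR (- pint (fun (_ : R) (_ : T) => 0 : R) r w) = 1.
Proof. by rewrite pint_0 oppr0 expR0. Qed.

Let le2 (a b c : R) : a <= c -> b <= c -> a + b <= 2 * c.
Proof. by move=> h1 h2; rewrite mulrDl !mul1r lerD. Qed.

(** The amount by which the transformed drift misses its ideal value; it is made of the Picard error
    and of the commutator bounded in [zk_osc]. *)
Let er n r w := (1 + zv z n (X n r w)) * aN n r w - zk z n (X n r w).

Let er_ebd tm n : ebd tm (er n).
Proof.
have [mv hv] := zv_bmeas z n.
apply: ebdB; last exact: eM (zf_bmeas z n).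
by apply: ebdM => //; apply: ebdD; [exact: ebd_cst|exact: (comp_ebd hL tm mv hv)].
Qed.

Let er_prog n : prog F (er n).
Proof.
have [pa ba] := haN n; have [mv hv] := zv_bmeas z n.
apply: progB; last exact: (prog_comp (zM_meas z n (zf_bmeas z n)) (pX n)).
by apply: progM => //; apply: progD; [exact: prog_cst|exact: prog_comp].
Qed.

Let er_bdd n : bdd (er n).
Proof.
have [pa [A hA]] := haN n; have [mv hv] := zv_bmeas z n.
have [B B0 hB] := zM_bnd z n (zf_bmeas z n).
exists ((1 + 3^-1) * A + B) => r w; rewrite (le_trans (ler_normB _ _))// lerD//.
  by rewrite normrM ler_pM// (le_trans (ler_normD _ _))// normr1 lerD2l.
exact: hB.
Qed.

Let ETtri tm f g g' : ebd tm f -> ebd tm g -> ebd tm g' ->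
  (forall r w, `|f r w| <= `|g r w| + `|g' r w|) ->
  ET P tm (fun r w => E r * `|f r w|) <=
  ET P tm (fun r w => E r * `|g r w|) + ET P tm (fun r w => E r * `|g' r w|).
Proof.
move=> /ebd_norm ef /ebd_norm eg /ebd_norm eg' H; rewrite -ETD; [|exact: ebdM..].
apply: ET_le; first exact: ebdM.
  by apply: ebdD; exact: ebdM.
by move=> r w /andP[rr rt]; have /andP[x1 x2] := E1 rr; rewrite -mulrDr ler_wpM2l.
Qed.

(** Here [j = 0]: the expected variation of the drifts is bounded by [occupation], and no killing is
    called for. *)
Lemma main_choice0 tm eta0 rho C : 0 <= tm -> 0 < eta0 -> 0 < rho -> 0 <= C ->
  exists2 theta : R, 0 < theta & forall (Dd wp e : R -> T -> R) (delta : R),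
  0 <= delta -> delta <= theta -> admissible (F := F) Dd -> admissible (F := F) e -> prog F wp ->
  (forall (r : R) w, 0 <= r <= tm -> `|wp r w| <= 2^-1 * `|pint Dd r w| + delta) ->
  (forall c dc, absc F tm c dc -> bdd c ->
    \int[P]_w (expR (- (lam * tm)) * c tm w * wp tm w) - \int[P]_w (c 0 w * wp 0 w) =
    ET P tm (fun r w => expR (- (lam * r)) * (dc r w * wp r w + c r w * (e r w - Dd r w)))) ->
  ET P tm (fun r w => E r * `|Dd r w|) <= C -> ET P tm (fun r w => E r * `|e r w|) <= theta ->
  small P [set w | exists2 t, 0 <= t <= tm & 2 * eta0 <= pint Dd t w] rho.
Proof.
move=> tm0 e0 r0 C0; have C0' : 0 <= expR (lam * tm) * C by rewrite mulr_ge0 ?expR_ge0.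
have [s [theta [s01 t0 hs]]] := main_choice 0 tm0 (zlam0 z) e0 r0 C0'.
exists theta => // Dd wp e delta d0 dt [pd bd] [pe be] pw wD Hid hC he.
have b0 : bdd (fun (_ : R) (_ : T) => 0 : R) by exists 0 => r w; rewrite normr0.
have p0 : prog F (fun (_ : R) (_ : T) => 0 : R) by exact: prog_cst.
have eDd := prog_ebd hL tm pd bd; have ee := prog_ebd hL tm pe be.
have hC' : ET P tm (fun r w => expR (- pint (fun _ _ => 0) r w) * `|Dd r w|) <= expR (lam * tm) * C.
  rewrite (@ET_eq _ _ _ P tm _ (fun r w => `|Dd r w|)); last by move=> r w _; rewrite one_exp mul1r.
  apply: le_trans (ETabs tm0 (ebd_norm eDd)) _; rewrite ler_wpM2l ?expR_ge0//.
  by apply: le_trans hC; rewrite le_eqVlt; apply/orP; left; apply/eqP; apply: ET_eq => r w _; rewrite normr_id.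
have D0 w : pint Dd 0 w = 0 by exact: pint0.
have he' c dc : weight (F := F) tm s (fun _ _ => 0) Dd c dc ->
    ET P tm (fun r w => expR (- (lam * r)) * (c r w * e r w)) <= theta.
  move=> [hc c01 _]; apply: le_trans he.
  have bc : bdd c.
    by exists 1 => r w; have /andP[q0] := c01 r w; rewrite one_exp ger0_norm.
  have [ec edc] := absc_ebd hL hc bc.
  apply: ET_le.
  - by apply: ebdM => //; exact: ebdM.
  - by apply: ebdM => //; exact: ebd_norm.
  move=> r w /andP[rr rt]; have /andP[x1 x2] := E1 rr; rewrite ler_wpM2l//.
  have /andP[q0] := c01 r w; rewrite one_exp => q1.
  by rewrite (le_trans (ler_norm _))// normrM (ger0_norm q0) ler_piMl.
have := hs d T P F hF (pint Dd) Dd wp e (fun _ _ => 0) delta d0 dt (pint_absc hF tm pd bd) bd D0 p0 b0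
  (fun _ _ => lexx 0) pe be pw wD Hid hC' he'.
by move=> H; apply: (small_sub H) => w [t ht Dt]; split; [rewrite pint_0|exists t].
Qed.

(** In Ito's formula [v a - k] equals [er - a]. Subtracting two formulas thus produces the
    difference of the errors minus [Dd], as [main_choice0] requires, while the Lipschitz bound and
    the convergence of the functions [u] give the condition on [wp]. *)
Lemma cauchy_approximants tm eta0 rho : 0 <= tm -> 0 < eta0 -> 0 < rho ->
  exists N, forall n m, (N <= n)%N -> (N <= m)%N ->
    small P [set w | exists2 t, 0 <= t <= tm & 2 * eta0 <= pint (aN n) t w - pint (aN m) t w] rho.
Proof.
move=> tm0 e0 r0.
have [om [om0 omc homk]] := zk_osc z.
have G0 := zGk0 z.
have C0 : 0 <= 2 * (3 * zGk z + 2 * tm) by rewrite mulr_ge0// addr_ge0// mulr_ge0.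
have [theta t0 hs] := main_choice0 tm0 e0 r0 C0.
have [N1 hN1] : exists N, forall n, (N <= n)%N -> zCu z * zdel z n <= theta.
  apply: cvg0_le t0; rewrite -[X in _ --> X](mulr0 (zCu z)).
  by apply: cvgM; [exact: cvg_cst|exact: zdelc].
have [N2 hN2] : exists N, forall n, (N <= n)%N ->
    (1 + 3^-1) * tm * 2^-1 ^+ n + (3 * zGk z + tm) * om n <= theta / 2.
  have t2 : 0 < theta / 2 by rewrite divr_gt0.
  apply: cvg0_le t2; rewrite -[X in _ --> X](addr0 0); apply: cvgD.
    rewrite -[X in _ --> X](mulr0 ((1 + 3^-1) * tm)); apply: cvgM; first exact: cvg_cst.
    by apply: cvg_expr; rewrite ger0_norm// invf_lt1// ltr1n.
  by rewrite -[X in _ --> X](mulr0 (3 * zGk z + tm)); apply: cvgM; [exact: cvg_cst|].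
have [N3 hN3] := nat_ge tm.
exists (maxn N1 (maxn N2 N3)) => n m; rewrite !geq_max => /and3P[n1 n2 n3] /and3P[m1 m2 m3].
have tn := hN3 n n3; have tm' := hN3 m m3.
have hD := admissibleB (haN n) (haN m).
have eerr k : (N2 <= k)%N -> tm <= k%:R -> ET P tm (fun r w => E r * `|er k r w|) <= theta / 2.
  move=> k2 tk; apply: le_trans (hN2 k k2).
  have [H _] := occupation k tm0 tk.
  apply: (@le_trans _ _ ((1 + 3^-1) * 2^-1 ^+ k * tm + om k * ET P tm (fun r w => E r * zam z k (X k r w)))); last first.
    by rewrite mulrAC lerD2l mulrC ler_wpM2r.
  rewrite -(ET_cst ((1 + 3^-1) * 2^-1 ^+ k) tm0) -(ETZ P (om k)); last exact: ebdM.
  rewrite -ETD; [|exact: ebd_cst|by apply: ebdZ; exact: ebdM].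
  apply: ET_le.
  - by apply: ebdM => //; exact: ebd_norm.
  - by apply: ebdD; [exact: ebd_cst|apply: ebdZ; exact: ebdM].
  move=> r w /andP[rr rt]; have /andP[x1 x2] := E1 rr.
  have hr : 0 <= r <= k%:R by rewrite rr (le_trans rt).
  have h1 : `|er k r w| <= (1 + 3^-1) * 2^-1 ^+ k + om k * zam z k (X k r w).
    have -> : er k r w = (1 + zv z k (X k r w)) * (aN k r w - zmu z k (X k r w)) -
       (zk z k (X k r w) - (1 + zv z k (X k r w)) * zmu z k (X k r w)).
      by rewrite /er mulrBr opprB addrA subrK.
    apply: (le_trans (ler_normB _ _)); apply: lerD; last exact: homk.
    rewrite normrM ler_pM//; last exact: hN.
    have [_ hv] := zv_bmeas z k.
    by rewrite (le_trans (ler_normD _ _))// normr1 lerD2l.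
  apply: (le_trans (ler_wpM2l x1 h1)); rewrite mulrDr (mulrCA _ (om k)) lerD2r ler_piMl// mulr_ge0 ?exprn_ge0//.
set dl := zCu z * zdel z (maxn N1 (maxn N2 N3)).
have H := hs (fun r w => aN n r w - aN m r w) (fun r w => zu z n (X n r w) - zu z m (X m r w))
  (fun r w => er n r w - er m r w) dl.
have {H} : small P [set w | exists2 t, 0 <= t <= tm & 2 * eta0 <= pint (fun r w => aN n r w - aN m r w) t w] rho; last first.
  by move=> H; apply: (small_sub H) => w [t ht Dt]; exists t => //; rewrite (pintB hL).
apply: H.
- by rewrite mulr_ge0 ?zCu0 ?zdel0.
- by apply: hN1; rewrite leq_maxl.
- exact: hD.
- by apply: admissibleB; split.
- exact: progB (prog_comp (zU_meas z n (zf_bmeas z n)) (pX n)) (prog_comp (zU_meas z m (zf_bmeas z m)) (pX m)).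
- move=> r w hr; rewrite (pintB hL)// -(driftedB x0 (L := L)).
  apply: (le_trans (ler_distD (zu z n (X m r w)) _ _)); apply: lerD; first exact: zu_lip.
  apply: zu_del; rewrite geq_max.
  + by rewrite n1 geq_max n2.
  + by rewrite m1 geq_max m2.
- move=> c dc hc bc.
  rewrite (ito_diff hL z x0 n m (haN n) (haN m) (zf_bmeas z n) (zf_bmeas z m) tm0 hc bc).
  apply: ET_eq => r w _; congr (_ * (_ + _ * _)); rewrite -!zvE /er !zkE.
  have key (v a k v' a' k' : R) : v * a - k - (v' * a' - k') = (1 + v) * a - k - ((1 + v') * a' - k') - (a - a') by ring.
  exact: key.
- apply: (@le_trans _ _ (ET P tm (fun r w => E r * `|aN n r w|) + ET P tm (fun r w => E r * `|aN m r w|))); last first.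
    by apply: le2; apply: (occupation _ _ _).2.
  by apply: ETtri => [|||r w]; [exact: ebdB (ea tm n) (ea tm m)|exact: ea|exact: ea|exact: ler_normB].
- apply: (@le_trans _ _ (ET P tm (fun r w => E r * `|er n r w|) + ET P tm (fun r w => E r * `|er m r w|))); last first.
    by rewrite [leRHS](_ : _ = theta / 2 + theta / 2) ?lerD ?eerr//; field.
  by apply: ETtri => [|||r w]; [exact: ebdB (er_ebd tm n) (er_ebd tm m)|exact: er_ebd|exact: er_ebd|exact: ler_normB].
Qed.

(** Two levels of mollification are compared along one process [X n], uniformly in [n]; the
    gradients of the two potentials are uniformly close, and their difference multiplies a drift of
    bounded expected variation. The cases of interest are [f = h], for the drift, and [f = 1], for
    its variation. *)
Lemma cauchy_occupation f tm eta0 rho : bmeas f 1 -> 0 <= tm -> 0 < eta0 -> 0 < rho ->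
  exists N, forall k k' n, (N <= k)%N -> (N <= k')%N -> tm <= n%:R ->
    small P [set w | exists2 t, 0 <= t <= tm &
      2 * eta0 <= pint (fun r w => zM z k f (X n r w)) t w - pint (fun r w => zM z k' f (X n r w)) t w] rho.
Proof.
move=> bf tm0 e0 r0; have G0 := zGk0 z.
have C0 : 0 <= 2 * (3 * zGk z + tm) by rewrite mulr_ge0// addr_ge0// mulr_ge0.
have [theta t0 hs] := main_choice0 tm0 e0 r0 C0.
have [N1 hN1] : exists N, forall n, (N <= n)%N -> kmass kap * zdel z n <= theta.
  apply: cvg0_le t0; rewrite -[X in _ --> X](mulr0 (kmass kap)).
  by apply: cvgM; [exact: cvg_cst|exact: zdelc].
have [N2 hN2] : exists N, forall n, (N <= n)%N -> zN z * (3 * zGk z + 2 * tm) * zdel z n <= theta.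
  apply: cvg0_le t0; rewrite -[X in _ --> X](mulr0 (zN z * (3 * zGk z + 2 * tm))).
  by apply: cvgM; [exact: cvg_cst|exact: zdelc].
exists (maxn N1 N2) => k k' n Nk Nk' tn.
have [B B0 hB] := zM_bnd z k bf; have [B' B0' hB'] := zM_bnd z k' bf.
have hk := comp_admissible (zM_meas z k bf) hB (pX n); have hk' := comp_admissible (zM_meas z k' bf) hB' (pX n).
have [pa ba] := haN n.
have mV j := zV_meas z j bf; have V1 j x := zV_bnd z j x bf.
set dl := zdel z (maxn N1 N2).
have vd x : `|zV z k f x - zV z k' f x| <= dl * zN z by exact: zV_del.
have hV j := comp_admissible (mV j) (V1 j) (pX n).
have [pV bV] := admissibleB (hV k) (hV k').
have he : admissible (F := F) (fun r w => (zV z k f (X n r w) - zV z k' f (X n r w)) * aN n r w).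
  split; first exact: progM.
  have [A hA] := ba; have [A' hA'] := bV; exists (A' * A) => r w.
  by rewrite normrM ler_pM.
have H := hs (fun r w => zM z k f (X n r w) - zM z k' f (X n r w))
  (fun r w => zU z k f (X n r w) - zU z k' f (X n r w))
  (fun r w => (zV z k f (X n r w) - zV z k' f (X n r w)) * aN n r w) (kmass kap * dl).
have {H} : small P [set w | exists2 t, 0 <= t <= tm & 2 * eta0 <= pint (fun r w => zM z k f (X n r w) - zM z k' f (X n r w)) t w] rho; last first.
  by move=> H; apply: (small_sub H) => w [t ht Dt]; exists t => //; rewrite (pintB hL).
apply: H.
- by rewrite mulr_ge0 ?kmass_ge0 ?zdel0.
- by apply: hN1; rewrite leq_maxl.
- exact: admissibleB.
- exact: he.
- exact: progB (prog_comp (zU_meas z k bf) (pX n)) (prog_comp (zU_meas z k' bf) (pX n)).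
- move=> r w hr; rewrite (le_trans (zU_del _ _ bf Nk Nk'))// mulrC lerDr mulr_ge0//.
- move=> c dc hc bc.
  rewrite (ito_diff hL z x0 k k' (haN n) (haN n) bf bf tm0 hc bc).
  apply: ET_eq => r w _; congr (_ * (_ + _ * _)).
  have key (v a m v' m' : R) : v * a - m - (v' * a - m') = (v - v') * a - (m - m') by ring.
  exact: key.
- have a1 i x := ger0_norm (zam_ge0 z i x).
  apply: (@le_trans _ _ (ET P tm (fun r w => E r * zam z k (X n r w)) + ET P tm (fun r w => E r * zam z k' (X n r w)))); last first.
    by apply: le2; apply: (occupation _ _ _).1.
  have am i : ET P tm (fun r w => E r * zam z i (X n r w)) = ET P tm (fun r w => E r * `|zam z i (X n r w)|).
    by apply: ET_eq => r w _; rewrite a1.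
  rewrite !am; apply: ETtri => [|||r w]; [exact: ebdB (eM tm k n bf) (eM tm k' n bf)|exact: eam|exact: eam|].
  by rewrite !a1 (le_trans (ler_normB _ _))// lerD ?zM_le.
- apply: (@le_trans _ _ (dl * zN z * ET P tm (fun r w => E r * `|aN n r w|))).
    have e1 := ebd_norm (ea tm n).
    rewrite -ETZ; last exact: ebdM.
    apply: ET_le.
    + by apply: ebdM => //; apply: ebd_norm; exact: (prog_ebd hL _ he.1 he.2).
    + by apply: ebdZ; exact: ebdM.
    move=> r w /andP[rr rt]; have /andP[x1 x2] := E1 rr.
    by rewrite normrM [leLHS]mulrCA; apply: ler_wpM2r; [exact: mulr_ge0|exact: vd].
  apply: (@le_trans _ _ (dl * zN z * (3 * zGk z + 2 * tm))).
    by rewrite ler_wpM2l ?mulr_ge0 ?zdel0 ?zN0//; apply: (occupation _ _ _).2.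
  rewrite (_ : _ * _ = zN z * (3 * zGk z + 2 * tm) * dl); last by rewrite -mulrA mulrC.
  by apply: hN2; rewrite leq_maxr.
Qed.

End existence_estimates.

Lemma fast_seq (Nf : nat -> nat) : exists ns : nat -> nat,
  {homo ns : i j / (i < j)%N} /\ forall i, (Nf i <= ns i)%N /\ (i <= ns i)%N.
Proof.
pose ns := fix ns i := if i is j.+1 then maxn (Nf i) (ns j).+1 else Nf 0%N.
have S i : (ns i < ns i.+1)%N by rewrite /= leq_maxr.
exists ns; split; first exact: homo_ltn ltn_trans S.
move=> i; split; first by case: i => [|i] //=; rewrite leq_maxl.
by elim: i => [|i IH] //; exact: leq_ltn_trans IH (S i).
Qed.

(** * Exceedance events *)

Section exceedance.
Context {R : realType} {d} {T : measurableType d} (P : probability T R).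
Implicit Types f g : R -> T -> R.

Definition exceed tm eta f := [set w | exists2 t, 0 <= t <= tm & eta <= f t w].

Definition gap f g (t : R) (w : T) := `|f t w - g t w|.

Lemma small_gap tm eta rho f g : small P (exceed tm (2 * (eta / 2)) (fun t w => f t w - g t w)) (rho / 2) ->
  small P (exceed tm (2 * (eta / 2)) (fun t w => g t w - f t w)) (rho / 2) ->
  small P (exceed tm eta (gap f g)) rho.
Proof.
move=> h1 h2; have H := smallU h1 h2.
have -> : rho = rho / 2 + rho / 2 by field.
apply: small_sub H _ => w [t ht]; rewrite /gap => hw.
have E : 2 * (eta / 2) = eta by field.
have [h|h] := leP 0 (f t w - g t w); [left|right]; exists t => //; rewrite E.
  by rewrite ger0_norm in hw.
by rewrite ltr0_norm// opprB in hw.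
Qed.

Lemma small_exceedD tm (e1 e2 r1 r2 : R) f1 f2 f : small P (exceed tm e1 f1) r1 -> small P (exceed tm e2 f2) r2 ->
  (forall t w, 0 <= t <= tm -> f t w <= f1 t w + f2 t w) ->
  small P (exceed tm (e1 + e2) f) (r1 + r2).
Proof.
move=> h1 h2 H; apply: small_sub (smallU h1 h2) _ => w [t ht hw].
have := le_trans hw (H t w ht); have [h|h] := leP e1 (f1 t w); first by left; exists t.
by move=> q; right; exists t => //; lra.
Qed.

Lemma small_tail (E : nat -> set T) i : (forall n, small P (E n) (2^-1 ^+ n)) ->
  small P (\bigcup_(n in [set n | (i <= n)%N]) E n) (2 * 2^-1 ^+ i).
Proof.
move=> /choice[A hA].
have mA n : measurable (A n) by have [] := hA n.
exists (\bigcup_n A (i + n)%N); split.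
- exact: bigcup_measurable.
- move=> w [n /= hn En]; exists (n - i)%N => //; rewrite subnKC//.
  by have [_ + _] := hA n; apply.
apply: (le_trans (@measure_sigma_subadditive _ _ _ P (\bigcup_n A (i + n)%N) (fun n => A (i + n)%N) _ _ _)) => //.
  exact: bigcup_measurable.
apply: (@le_trans _ _ (\sum_(0 <= k <oo) ((2^-1 ^+ (i + k))%:E : \bar R))%E).
  by apply: lee_nneseries => // n _; have [] := hA (i + n)%N.
apply: lime_le; first by apply: is_cvg_nneseries => n _ _; rewrite lee_fin exprn_ge0.
apply: nearW => n; rewrite sumEFin lee_fin.
suff -> : \sum_(0 <= k < n) (2^-1 ^+ (i + k) : R) = 2 * 2^-1 ^+ i - 2 * 2^-1 ^+ (i + n).
  by rewrite gerBl mulr_ge0// exprn_ge0.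
elim: n => [|n IH]; first by rewrite big_nil addn0 subrr.
by rewrite big_nat_recr//= IH addnS exprS; field.
Qed.

End exceedance.

Lemma pint_lip (R : realType) d (T : measurableType d) (F : R -> set (set T))
  (hF : filtration F) (a : R -> T -> R) (M : R) w s t :
  prog F a -> (forall r w, `|a r w| <= M) -> 0 <= s -> 0 <= t ->
  `|pint a t w - pint a s w| <= M * `|t - s|.
Proof.
move=> pa aM s0 t0; wlog st : s t s0 t0 / s <= t.
  move=> H; have [st|/ltW ts] := leP s t; first exact: H.
  by rewrite distrC (distrC t); exact: H.
have [_ _ _ /(_ w) p] := pint_absc hF t pa (ex_intro _ M aM).
rewrite (prim_incr p s0 st (lexx t)) [X in _ * X]ger0_norm ?subr_ge0// -leb_ocE//.
apply: int_bnd => //; first exact: leb_oc_fin.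
by apply: measurable_funTS; exact: (prog_path hF).
Qed.

(** * Passage to the limit *)

Section existence.
Context {R : realType} {d} {T : measurableType d} {P : probability T R}.
Context {F : R -> set (set T)} {alpha : R} {L : R -> T -> R} (hL : driver P F alpha L).
Context {phi h : R -> R} {kap : {finite_measure set (measurableTypeR R) -> \bar R}}.
Context (z : zvonkin_data alpha phi h kap) (x0 : R).
Notation leb := (@lebesgue_measure R).
Notation lam := (zlam z).
Notation Xa := (drifted (L := L) x0).
Let hF : filtration F := drF hL.
Hypothesis nullF : forall N t, 0 <= t -> measurable N -> P N = 0%E -> F t N.

Let half_cvg : (2^-1 ^+ n : R) @[n --> \oo] --> 0.
Proof. by apply: cvg_expr; rewrite ger0_norm// invf_lt1// ltr1n. Qed.

Let half_gt0 n : 0 < 2^-1 ^+ n :> R. Proof. by rewrite exprn_gt0. Qed.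

Lemma geometric_tail (b : nat -> R) (i j : nat) : (i <= j)%N ->
  (forall n, (i <= n)%N -> `|b n.+1 - b n| <= 2^-1 ^+ n) ->
  `|b j - b i| <= 2 * 2^-1 ^+ i - 2 * 2^-1 ^+ j.
Proof.
move=> /subnKC <- H; elim: (j - i)%N => [|n IH]; first by rewrite addn0 !subrr normr0.
rewrite addnS (le_trans (ler_distD (b (i + n)%N) _ _))// addrC.
rewrite (le_trans (lerD IH (H _ (leq_addr _ _))))// exprS; lra.
Qed.

(** Along a fast subsequence Borel-Cantelli yields locally uniform convergence off a null set [N0].
    On [N0] the limit is put to 0, which keeps it adapted because null events belong to every [F t];
    negative times repeat the value at 0, as [prog_rc] expects. *)
Lemma driven_limit : exists (aN : nat -> R -> T -> R) (ns : nat -> nat) (A : R -> T -> R),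
  [/\ (forall n, admissible (F := F) (aN n)) /\ (forall n r w, 0 <= r <= n%:R ->
         `|aN n r w - zmu z n (Xa (aN n) r w)| <= 2^-1 ^+ n),
    forall i, (i <= ns i)%N,
    prog F A /\ (forall r w, A r w = A (Num.max r 0) w),
    forall w, continuous (A ^~ w) &
    forall tm eta rho : R, 0 < eta -> 0 < rho -> exists I, forall i, (I <= i)%N ->
      small P (exceed tm eta (gap A (pint (aN (ns i))))) rho].
Proof.
have [aN haN'] := choice (picard hL z x0).
have haN n : admissible (F := F) (aN n) by have [] := haN' n.
have hN n r w : 0 <= r <= n%:R -> `|aN n r w - zmu z n (Xa (aN n) r w)| <= 2^-1 ^+ n.
  by have [_] := haN' n; exact.
pose An n := pint (aN n).
have cau (i : nat) : exists N, forall n m, (N <= n)%N -> (N <= m)%N ->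
    small P (exceed i%:R (2^-1 ^+ i) (gap (An n) (An m))) (2^-1 ^+ i).
  have q0 : 0 < 2^-1 ^+ i / 2 :> R by rewrite divr_gt0.
  have [N hNN] := cauchy_approximants hL haN hN (ler0n R i) q0 q0.
  by exists N => n m Nn Nm; apply: small_gap; exact: hNN.
have [Nf hNf] := choice cau.
have [ns [ns_lt ns_ge]] := fast_seq Nf.
pose B i := An (ns i).
have ns_le i j : (i <= j)%N -> (ns i <= ns j)%N.
  by rewrite leq_eqVlt => /orP[/eqP->//|/ns_lt/ltnW].
pose Ev i := exceed i%:R (2^-1 ^+ i) (gap (B i.+1) (B i)).
have smE i : small P (Ev i) (2^-1 ^+ i).
  apply: hNf; last by have [] := ns_ge i.
  by apply: leq_trans (ns_le i i.+1 (leqnSn i)); have [] := ns_ge i.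
have [N0 [mN0 PN0 hN0]] := borel_cantelli smE.
have stepE i j t w : (i <= j)%N -> ~ Ev j w -> 0 <= t <= i%:R -> `|B j.+1 t w - B j t w| <= 2^-1 ^+ j.
  move=> ij nE /andP[t0 ti]; rewrite leNgt; apply/negP => hh; apply: nE.
  by exists t; rewrite ?t0 ?(le_trans ti) ?ler_nat// ltW.
have lim0 w : ~ N0 w -> forall t, 0 <= t -> exists l : R, B i t w @[i --> \oo] --> l.
  move=> nw t t0; have [m hm] := hN0 w nw; have [k hk] := nat_ge t.
  pose mk := maxn m k.
  have c : (2 * 2^-1 ^+ (j + mk) : R) @[j --> \oo] --> 0.
    rewrite -[X in _ --> X](mulr0 2); apply: cvgM; first exact: cvg_cst.
    by rewrite (cvg_shiftn mk (fun n => 2^-1 ^+ n : R)).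
  have [|l [hl _]] := cauchy_bound_cvg (s := fun j => B (j + mk)%N t w) c.
    move=> i j ij; apply: (le_trans (geometric_tail (b := fun j => B j t w) (i := (i + mk)%N) _ _)).
    - by rewrite leq_add2r.
    - move=> n nn; apply: (stepE n n) => //; last by rewrite t0 hk// (leq_trans _ nn)// (leq_trans (leq_maxr m k))// leq_addl.
      by apply: hm; rewrite (leq_trans _ nn)// (leq_trans (leq_maxl m k))// leq_addl.
    - by rewrite gerBl mulr_ge0.
  by exists l; move: hl; rewrite (cvg_shiftn mk (fun n => B n t w)).
pose A r w := if pselect (N0 w) then 0 else lim (B i (Num.max r 0) w @[i --> \oo]).
have m00 (r : R) : 0 <= Num.max r 0 by rewrite le_max lexx orbT.
have AE w t : ~ N0 w -> 0 <= t -> B i t w @[i --> \oo] --> A t w.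
  move=> nw t0; have [l hl] := lim0 w nw t t0; have -> : A t w = lim (B i (Num.max t 0) w @[i --> \oo]).
    by rewrite /A; case: pselect.
  rewrite max_l//; have -> : lim (B i t w @[i --> \oo]) = l by apply: cvg_lim.
  exact: hl.
have AM r w : A r w = A (Num.max r 0) w by rewrite /A [Num.max (Num.max _ _) _]max_l.
have tailA i t w : ~ N0 w -> 0 <= t <= i%:R -> (forall j, (i <= j)%N -> ~ Ev j w) ->
    `|A t w - B i t w| <= 2 * 2^-1 ^+ i.
  move=> nw /andP[t0 ti] hj; have c := AE w t nw t0.
  have c2 : `|B j t w - B i t w| @[j --> \oo] --> `|A t w - B i t w|.
    by apply: cvg_norm; apply: cvgB => //; exact: cvg_cst.
  apply: (cvgr_to_le c2); exists i => // j /= ij.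
  apply: (le_trans (geometric_tail (b := fun j => B j t w) ij _)).
    by move=> n ni; apply: (stepE i) => //; [exact: hj|rewrite t0].
  by rewrite gerBl mulr_ge0.
have smA i tm : tm <= i%:R -> small P [set w | exists2 t, 0 <= t <= tm & 2 * 2^-1 ^+ i < gap A (B i) t w] (2 * 2^-1 ^+ i).
  move=> ti; have h1 := small_tail i smE.
  have h2 : small P N0 0 by exists N0; split => //; rewrite PN0.
  have := smallU h1 h2; rewrite addr0 => H; apply: small_sub H _ => w [t /andP[t0 tt] hw].
  apply: contrapT => /not_orP[nE nN]; move: hw; rewrite /gap ltNge => /negP; apply.
  apply: tailA => //; first by rewrite t0 (le_trans tt).
  by move=> j ij Ej; apply: nE; exists j.
have cvgA tm eta rho : 0 < eta -> 0 < rho -> exists I, forall i, (I <= i)%N ->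
    small P (exceed tm eta (gap A (B i))) rho.
  move=> e0 r0.
  have c : (3 * 2^-1 ^+ i : R) @[i --> \oo] --> 0.
    by rewrite -[X in _ --> X](mulr0 3); apply: cvgM; [exact: cvg_cst|].
  have [I1 h1] := cvg0_le c e0; have [I2 h2] := cvg0_le c r0; have [I3 h3] := nat_ge tm.
  exists (maxn I1 (maxn I2 I3)) => i; rewrite !geq_max => /and3P[i1 i2 i3].
  have g0 := half_gt0 i.
  apply: small_le (_ : 2 * 2^-1 ^+ i <= rho); last by apply: le_trans (h2 i i2); lra.
  apply: small_sub (smA i tm (h3 i i3)) _ => w [t ht hw]; exists t => //.
  by apply: lt_le_trans hw; apply: lt_le_trans (h1 i i1); lra.
(* On a neighbourhood of [r] the limit is uniformly close to one [B i], and [B i] is Lipschitz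
   because its density is bounded. *)
have contA w : continuous (A ^~ w).
  have [nw|nw] := pselect (N0 w).
    rewrite (_ : A ^~ w = fun=> 0); last by apply/funext => r; rewrite /A; case: pselect.
    by move=> r; exact: cvg_cst.
  move=> r; apply/cvgrPdist_lt => e e0.
  have e8 : 0 < e / 8 by rewrite divr_gt0.
  have [m hm] := hN0 w nw; have [I1 h1] := cvg0_le half_cvg e8; have [I3 h3] := nat_ge (Num.max r 0 + 1).
  pose i := maxn m (maxn I1 I3).
  have im : (m <= i)%N by rewrite leq_maxl.
  have i1 : (I1 <= i)%N by rewrite /i !leq_max leqnn orbT.
  have i3 : (I3 <= i)%N by rewrite /i !leq_max leqnn !orbT.
  have hi := h1 i i1; have hr := h3 i i3.
  have [pa [M hM]] := haN (ns i).
  have M0 : 0 <= M by exact: le_trans (normr_ge0 _) (hM 0 w).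
  have tl s : s <= r + 1 -> `|A s w - B i (Num.max s 0) w| <= e / 4.
    move=> sr; rewrite AM; apply: (le_trans (tailA i _ _ nw _ _)).
    - rewrite m00/=; apply: le_trans hr; rewrite ge_max; apply/andP; split.
        by apply: (le_trans sr); rewrite lerD2r le_max lexx.
      by rewrite ler_wpDr.
    - by move=> j ij; apply: hm; exact: leq_trans ij.
    - by move: hi; lra.
  have d0 : 0 < Num.min 1 (e / (4 * (M + 1))).
    by rewrite lt_min ltr01 divr_gt0// mulr_gt0// ltr_wpDl.
  near=> s.
  have ds : `|r - s| < Num.min 1 (e / (4 * (M + 1))).
    by near: s; apply/nbhs_ballP; eexists; first exact: d0.
  move: ds; rewrite lt_min => /andP[d1 d2].
  have sr : s <= r + 1 by move: d1; rewrite ltr_norml => /andP[? ?]; lra.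
  have h2 : `|B i (Num.max r 0) w - B i (Num.max s 0) w| <= e / 4.
    rewrite (le_trans (pint_lip hF w pa hM (m00 s) (m00 r)))//.
    apply: (@le_trans _ _ (M * (e / (4 * (M + 1))))).
      rewrite ler_wpM2l// (le_trans _ (ltW d2))//; exact: pospart_lip.
    rewrite mulrA ler_pdivrMr ?mulr_gt0 ?ltr_wpDl//.
    rewrite (_ : e / 4 * (4 * (M + 1)) = M * e + e); last by field.
    by rewrite lerDl ltW.
  have t1 := tl r (_ : r <= r + 1); rewrite lerDl ler01 in t1; have {}t1 := t1 isT.
  have t2 := tl s sr; rewrite distrC in t2.
  have := ler_distD (B i (Num.max r 0) w) (A r w) (A s w).
  have := ler_distD (B i (Num.max s 0) w) (B i (Num.max r 0) w) (A s w).
  move: t1 t2 h2 e0; clear.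
  move: `|_ - _| `|_ - _| `|_ - _| `|_ - _| `|_ - _| => a1 a2 a3 a4 a5; lra.
have pA : prog F A.
  apply: (prog_rc hF AM) => [t t0|w t t0]; last exact: (cvg_at_right_filter (contA w t)).
  have mN : measurable (~` N0 : set (g_sigma_algebraType (F t))).
    by apply: measurableC; rewrite (Ft_measE hF)//; exact: nullF.
  apply: (@measurable_fun_cvg _ (g_sigma_algebraType (F t)) R setT (fun i w => B i t w * \1_(~` N0) w) (A t)).
    move=> i; apply: mrM; last exact: measurable_indic.
    exact: (prog_Fmeas (pint_prog hL (haN (ns i))) t0).
  move=> w _; rewrite indicE; have [nw|nw] := pselect (N0 w).
    have -> : (w \in ~` N0) = false by apply: memNset => q; exact: q nw.
    rewrite (_ : A t w = 0); last by rewrite /A; case: pselect.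
    by under eq_fun do rewrite mulr0; exact: cvg_cst.
  have -> : (w \in ~` N0) = true by exact: mem_set.
  by under eq_fun do rewrite mulr1; exact: AE.
exists aN, ns, A; split => //.
by move=> i; have [] := ns_ge i.
Unshelve. all: by end_near.
Qed.

End existence.

(** * The limit process solves the equation *)

Section existence.
Context {R : realType} {d} {T : measurableType d} {P : probability T R}.
Context {F : R -> set (set T)} {alpha : R} {L : R -> T -> R} (hL : driver P F alpha L).
Context {phi h : R -> R} {kap : {finite_measure set (measurableTypeR R) -> \bar R}}.
Context (z : zvonkin_data alpha phi h kap) (x0 : R).
Notation leb := (@lebesgue_measure R).
Notation lam := (zlam z).
Notation Xa := (drifted (L := L) x0).
Let hF : filtration F := drF hL.

Section limit_process.
Context (aN : nat -> R -> T -> R) (ns : nat -> nat) (A : R -> T -> R).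
Hypothesis haN : forall n, admissible (F := F) (aN n).
Hypothesis hN : forall n r w, 0 <= r <= n%:R ->
  `|aN n r w - zmu z n (Xa (aN n) r w)| <= 2^-1 ^+ n.
Hypothesis ns_ge : forall i, (i <= ns i)%N.
Hypothesis pA : prog F A.
Hypothesis cvgA : forall tm eta rho : R, 0 < eta -> 0 < rho -> exists I, forall i, (I <= i)%N ->
      small P (exceed tm eta (gap A (pint (aN (ns i))))) rho.

Let X r w := L r w + (x0 + A r w).
Let pX : prog F X.
Proof. by apply: progD; [exact: drL hL|apply: progD => //; exact: prog_cst]. Qed.
Let Xi i := Xa (aN (ns i)).
Let pXi i : prog F (Xi i). Proof. exact: (drifted_prog hL). Qed.
Let occ k f (Y : R -> T -> R) := pint (fun r w => zM z k f (Y r w)).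

(** At a fixed level the mollified density is Lipschitz, hence the occupation integral depends
    continuously on the drift part, uniformly on bounded time intervals. *)
Lemma occ_lip f k tm eta rho : bmeas f 1 -> 0 <= tm -> 0 < eta -> 0 < rho ->
  exists I, forall i, (I <= i)%N -> small P (exceed tm eta (gap (occ k f X) (occ k f (Xi i)))) rho.
Proof.
move=> bf tm0 e0 r0; have [K K0 hK] := zM_lip z k bf; have [B B0 hB] := zM_bnd z k bf.
have q0 : 0 < eta / (K * tm + 1) by rewrite divr_gt0// ltr_wpDl// mulr_ge0.
have [I hI] := cvgA tm q0 r0; exists I => i Ii.
apply: (small_sub (hI i Ii)) => w [t /andP[t0 tt] hw].
apply: contrapT => hn; move: hw; rewrite /gap leNgt => /negP; apply.
have aX Y : prog F Y -> admissible (F := F) (fun r w => zM z k f (Y r w)).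
  by move=> pY; exact: (comp_admissible (zM_meas z k bf) hB pY).
rewrite /occ -(pintB hL t w (aX _ pX) (aX _ (pXi i))).
apply: (@le_lt_trans _ _ (K * (eta / (K * tm + 1)) * fine (leb `[0, t]%classic))).
  apply: int_bnd => //; first exact: leb_cc_fin.
    exact: itg_meas (admissible_itg hL w t (admissibleB (aX _ pX) (aX _ (pXi i)))).
  move=> r /=; rewrite in_itv/= => /andP[rr rt]; rewrite (le_trans (hK _ _))// ler_wpM2l//.
  rewrite /X /Xi /drifted opprD addrACA subrr add0r opprD addrACA subrr add0r.
  by rewrite ltW// ltNge; apply/negP => hh; apply: hn; exists r; rewrite ?rr ?(le_trans rt).
rewrite leb_ccE// subr0.
apply: (@le_lt_trans _ _ (K * tm / (K * tm + 1) * eta)).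
  rewrite (_ : K * tm / (K * tm + 1) * eta = K * (eta / (K * tm + 1)) * tm); last by move: (_ + 1)^-1 => c; ring.
  by rewrite ler_wpM2l// mulr_ge0// ltW.
by rewrite gtr_pMl// ltr_pdivrMr ?mul1r ?ltrDl// ltr_wpDl// mulr_ge0.
Qed.

Lemma occ_cauchy_approx f tm eta rho : bmeas f 1 -> 0 <= tm -> 0 < eta -> 0 < rho ->
  exists N, forall k k' i, (N <= k)%N -> (N <= k')%N -> tm <= i%:R ->
    small P (exceed tm eta (gap (occ k f (Xi i)) (occ k' f (Xi i)))) rho.
Proof.
move=> bf tm0 e0 r0; have e2 : 0 < eta / 2 by rewrite divr_gt0. have r2 : 0 < rho / 2 by rewrite divr_gt0.
have [N hNN] := cauchy_occupation hL haN hN bf tm0 e2 r2.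
exists N => k k' i kN kN' ti.
have tn : tm <= (ns i)%:R by apply: le_trans ti _; rewrite ler_nat.
by apply: small_gap; exact: hNN.
Qed.

Lemma occ_cauchy f tm eta rho : bmeas f 1 -> 0 <= tm -> 0 < eta -> 0 < rho ->
  exists N, forall k k', (N <= k)%N -> (N <= k')%N ->
    small P (exceed tm eta (gap (occ k f X) (occ k' f X))) rho.
Proof.
move=> bf tm0 e0 r0; have e3 : 0 < eta / 3 by rewrite divr_gt0. have r3 : 0 < rho / 3 by rewrite divr_gt0.
have [N hNN] := occ_cauchy_approx bf tm0 e3 r3.
exists N => k k' kN kN'.
have [I1 h1] := occ_lip k bf tm0 e3 r3; have [I2 h2] := occ_lip k' bf tm0 e3 r3.
have [I3 h3] := nat_ge tm.
pose i := maxn I1 (maxn I2 I3).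
have i1 : (I1 <= i)%N by rewrite leq_maxl.
have i2 : (I2 <= i)%N by rewrite /i !leq_max leqnn orbT.
have i3 : (I3 <= i)%N by rewrite /i !leq_max leqnn !orbT.
have s1 := h1 i i1; have s2 := h2 i i2; have s3 := hNN k k' i kN kN' (h3 i i3).
rewrite (_ : eta = eta / 3 + (eta / 3 + eta / 3)); last by field.
rewrite (_ : rho = rho / 3 + (rho / 3 + rho / 3)); last by field.
have H := small_exceedD s3 s2 (fun t w _ => lexx _).
apply: (small_exceedD s1 H) => t w _; rewrite /gap.
have tri (a b c e : R) : `|a - b| <= `|a - c| + (`|c - e| + `|b - e|).
  by rewrite (le_trans (ler_distD c _ _))// lerD2l (distrC b) ler_distD.
exact: tri.
Qed.

(** Four comparisons: from [X] to [Xi i] at level [k], from level [k] to level [ns i] along [Xi i],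
    from there to the Picard drift, and from the Picard drift to [A]. The index [i] may depend on
    [k], but the threshold [N] does not depend on [i]. *)
Lemma occ_drift tm eta rho : 0 <= tm -> 0 < eta -> 0 < rho -> exists N, forall k, (N <= k)%N ->
  small P (exceed tm eta (gap (occ k h X) A)) rho.
Proof.
move=> tm0 e0 r0; have bh := zh z.
have e4 : 0 < eta / 4 by rewrite divr_gt0. have r4 : 0 < rho / 4 by rewrite divr_gt0.
have [N hNN] := occ_cauchy_approx bh tm0 e4 r4.
exists N => k kN.
have [I1 h1] := occ_lip k bh tm0 e4 r4; have [I2 h2] := cvgA tm e4 r4; have [I3 h3] := nat_ge tm.
have c : (tm * 2^-1 ^+ i) @[i --> \oo] --> (0 : R).
  rewrite -[X in _ --> X](mulr0 tm); apply: cvgM; first exact: cvg_cst.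
  by apply: cvg_expr; rewrite ger0_norm// invf_lt1// ltr1n.
have e8 : 0 < eta / 8 by rewrite divr_gt0.
have [I4 h4] := cvg0_le c e8.
pose i := maxn (maxn I1 I2) (maxn (maxn I3 I4) N).
have i1 : (I1 <= i)%N by rewrite /i !leq_max leqnn.
have i2 : (I2 <= i)%N by rewrite /i !leq_max leqnn !orbT.
have i3 : (I3 <= i)%N by rewrite /i !leq_max leqnn !orbT.
have i4 : (I4 <= i)%N by rewrite /i !leq_max leqnn !orbT.
have i5 : (N <= i)%N by rewrite /i !leq_max leqnn !orbT.
have ti := h3 i i3.
have s1 := h1 i i1; have s2 := h2 i i2.
have s3 := hNN k (ns i) i kN (leq_trans i5 (ns_ge i)) ti.
have s4 : small P (exceed tm (eta / 4) (gap (occ (ns i) h (Xi i)) (pint (aN (ns i))))) (rho / 4).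
  exists set0; split => //; last by rewrite measure0 lee_fin ltW.
  move=> w [t /andP[t0 tt]]; rewrite leNgt => /negP; apply; rewrite /gap.
  have [B B0 hB] := zM_bnd z (ns i) bh.
  have aX : admissible (F := F) (fun r w => zM z (ns i) h (Xi i r w)).
    exact: (comp_admissible (zM_meas z (ns i) bh) hB (pXi i)).
  rewrite /occ -(pintB hL t w aX (haN (ns i))).
  apply: (@le_lt_trans _ _ (2^-1 ^+ i * fine (leb `[0, t]%classic))).
    apply: int_bnd => //; first exact: leb_cc_fin.
      exact: itg_meas (admissible_itg hL w t (admissibleB aX (haN (ns i)))).
    move=> r /=; rewrite in_itv/= => /andP[rr rt]; rewrite distrC.
    apply: (le_trans (hN _ _)).
      by rewrite rr (le_trans rt)// (le_trans tt)// (le_trans ti)// ler_nat.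
    by rewrite ler_wiXn2l// invf_le1// ler1n.
  rewrite leb_ccE// subr0; apply: (@le_lt_trans _ _ (2^-1 ^+ i * tm)).
    by rewrite ler_wpM2l// exprn_ge0.
  by rewrite mulrC (le_lt_trans (h4 i i4))//; lra.
rewrite (_ : eta = eta / 4 + (eta / 4 + (eta / 4 + eta / 4))); last by field.
rewrite (_ : rho = rho / 4 + (rho / 4 + (rho / 4 + rho / 4))); last by field.
have H1 := small_exceedD s4 s2 (fun t w _ => lexx _).
have H2 := small_exceedD s3 H1 (fun t w _ => lexx _).
apply: (small_exceedD s1 H2) => t w _; rewrite /gap.
apply: (le_trans (ler_distD (occ k h (Xi i) t w) _ _)); rewrite lerD2l.
apply: (le_trans (ler_distD (occ (ns i) h (Xi i) t w) _ _)); rewrite lerD2l.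
by rewrite (le_trans (ler_distD (pint (aN (ns i)) t w) _ _))// lerD2l distrC.
Qed.

(** The Cauchy property for [f = 1] makes consecutive occupation integrals along a fast subsequence
    differ summably; the finitely many first ones are bounded by their sum. As [|mu_n|] is dominated
    by the mollified total variation, this supplies the second condition on a solution. *)
Lemma occ_bounded : exists2 nk : nat -> nat, {homo nk : i j / (i < j)%N} &
  P.-negligible [set w | ~ forall t : R, 0 <= t -> exists M : R, forall k,
        pint (fun r w => zam z (nk k) (X r w)) t w <= M].
Proof.
have b1 := @bmeas1 R; pose f1 := fun _ : R => 1 : R.
have cau (j : nat) : exists N, forall k k', (N <= k)%N -> (N <= k')%N ->
    small P (exceed j%:R (2^-1 ^+ j) (gap (occ k f1 X) (occ k' f1 X))) (2^-1 ^+ j).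
  by apply: occ_cauchy => //; rewrite exprn_gt0.
have [Nf hNf] := choice cau.
have [nk [nk_lt nk_ge]] := fast_seq Nf.
exists nk => //.
pose Ev j := exceed j%:R (2^-1 ^+ j) (gap (occ (nk j.+1) f1 X) (occ (nk j) f1 X)).
have smE j : small P (Ev j) (2^-1 ^+ j).
  have [h1 _] := nk_ge j; apply: hNf => //.
  by apply: leq_trans h1 _; apply: ltnW; exact: nk_lt.
have [N1 [mN1 PN1 hN1]] := borel_cantelli smE.
exists N1; split => // w /= hw; apply: contrapT => nw; apply: hw => t t0.
have [m0 hm0] := hN1 w nw; have [k hk] := nat_ge t.
pose m := maxn m0 k; pose s j := occ (nk j) f1 X t w.
have s0 j : 0 <= s j by rewrite /s /occ /pint; apply: int_ge0 => r _; exact: (zam_ge0 z (nk j)).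
have st n : (m <= n)%N -> `|s n.+1 - s n| <= 2^-1 ^+ n.
  rewrite geq_max => /andP[n1 n2]; rewrite leNgt; apply/negP => hh; apply: (hm0 n n1).
  by exists t; [rewrite t0 hk|exact: ltW].
exists (\sum_(j < m.+1) s j + 2) => j.
have le_s i : (i <= m)%N -> s i <= \sum_(j < m.+1) s j.
  move=> im; have hi : (i < m.+1)%N by rewrite ltnS.
  by rewrite (bigD1 (Ordinal hi))//= lerDl sumr_ge0.
have [jm|/ltnW mj] := leqP j m; first by rewrite (le_trans (le_s j jm))// lerDl.
have gt := geometric_tail mj st; have h1 : 2^-1 ^+ m <= 1 :> R by rewrite exprn_ile1// invf_le1// ler1n.
have h2 : 0 <= 2^-1 ^+ j :> R by rewrite exprn_ge0.
change (s j <= \sum_(j < m.+1) s j + 2); have := le_s m (leqnn m); move: gt.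
by move: (\sum_(_ < _) _) (s j) (s m) h1 h2 => a1 a2 a3 h1 h2 /ler_normlW h3 h4; lra.
Qed.

End limit_process.

Lemma driven_existence : (forall N t, 0 <= t -> measurable N -> P N = 0%E -> F t N) ->
  exists A : R -> T -> R,
  [/\ prog F A /\ (forall r w, A r w = A (Num.max r 0) w),
    forall w, continuous (A ^~ w),
    forall tm eta rho : R, 0 <= tm -> 0 < eta -> 0 < rho -> exists N, forall k, (N <= k)%N ->
      small P (exceed tm eta (gap (pint (fun r w => zmu z k (L r w + (x0 + A r w)))) A)) rho &
    exists2 nk : nat -> nat, {homo nk : i j / (i < j)%N} &
      P.-negligible [set w | ~ forall t : R, 0 <= t -> exists M : R, forall k,
        pint (fun r w => zam z (nk k) (L r w + (x0 + A r w))) t w <= M]].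
Proof.
move=> nullF.
have [aN [ns [A [[haN hN] nsg [pA AM] contA cvgA]]]] := driven_limit hL z x0 nullF.
exists A; split => //.
  by move=> tm eta rho tm0 e0 r0; exact: (occ_drift haN hN nsg pA cvgA).
exact: (occ_bounded haN hN nsg pA cvgA).
Qed.

End existence.

(** * Uniqueness *)

(* Approximating the cadlag path [f] uniformly by step functions on a finite
   partition, then integrating by parts on each cell. *)
Section step_pairing.
Context (R : realType) (tm : R) (f : R -> R) (Bf eps BV : R).
Notation leb := (@lebesgue_measure R).
Hypothesis tm0 : 0 <= tm.
Hypothesis mf : measurable_fun setT f.
Hypothesis fB : forall r, `|f r| <= Bf.
Hypothesis f_right : forall t, 0 <= t -> f s @[s --> t^'+] --> f t.
Hypothesis f_left : forall t, 0 < t -> cvg (f s @[s --> t^'-]).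
Hypothesis eps0 : 0 < eps.
Hypothesis BV0 : 0 <= BV.

(** The constant [C] is uniform in the weight and in [g]. Up to an [eps] share of its weighted [L^1]
    norm, [g] is felt only through the sup norm of its primitive [G]. *)
Definition pairing_bound t C := forall (c dc G g : R -> R) (gam : R), prim tm c dc -> prim tm G g ->
  (forall r, 0 <= r <= tm -> 0 <= c r <= 1) -> \int[leb]_(r in `[0, tm]) `|dc r| <= BV ->
  (forall r, 0 <= r <= tm -> `|G r| <= gam) ->
  `|\int[leb]_(r in `[0, t]) (c r * f r * g r)| <=
    eps * \int[leb]_(r in `[0, t]) (c r * `|g r|) + C * gam.

Let bitg (h : R -> R) (M : R) : measurable_fun setT h -> (forall r, 0 <= r <= tm -> `|h r| <= M) ->
  itg leb `[0, tm]%classic h.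
Proof.
move=> mh hM; apply: (itg_bnd _ (M := M)) => //; first exact: leb_cc_fin.
  exact: measurable_funTS.
Qed.

Let sub_oc s t h : 0 <= s -> t <= tm -> itg leb `[0, tm]%classic h -> itg leb `]s, t]%classic h.
Proof.
move=> s0 tt; apply: integrableS => // r /=; rewrite !in_itv/= => /andP[sr rt].
by rewrite (le_trans s0 (ltW sr)) (le_trans rt).
Qed.

Let sub_oo s t h : 0 <= s -> t <= tm -> itg leb `[0, tm]%classic h -> itg leb `]s, t[%classic h.
Proof.
move=> s0 tt; apply: integrableS => // r /=; rewrite !in_itv/= => /andP[sr rt].
by rewrite (le_trans s0 (ltW sr)) (le_trans (ltW rt)).
Qed.

Lemma pairing_step s t psi C : 0 <= s -> s <= t -> t <= tm ->
  (forall r, s < r < t -> `|f r - psi| <= eps) -> pairing_bound s C ->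
  pairing_bound t (C + `|psi| * (2 + BV)).
Proof.
move=> s0 st tt fpsi H c dc G g gam pc pG c01 dcB Ggam.
have [mc mdc [M hM] _] := pc; have [mG mg [M' hM'] _] := pG.
have tt' : 0 <= t <= tm by rewrite (le_trans s0 st).
have ss : 0 <= s <= tm by rewrite s0 (le_trans st).
have gam0 : 0 <= gam by exact: le_trans (normr_ge0 _) (Ggam _ tt').
have c1 r : 0 <= r <= tm -> `|c r| <= 1 by move=> hr; have /andP[q0 q1] := c01 r hr; rewrite ger0_norm.
have icfg : itg leb `[0, tm]%classic (fun r => c r * f r * g r).
  apply: (bitg (M := 1 * Bf * M')) => [|r hr]; first by apply: mrM => //; exact: mrM.
  by rewrite !normrM ler_pM ?mulr_ge0 ?hM'// ler_pM ?c1.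
have icg : itg leb `[0, tm]%classic (fun r => c r * g r).
  apply: (bitg (M := 1 * M')) => [|r hr]; first exact: mrM.
  by rewrite normrM ler_pM ?hM' ?c1.
have icag : itg leb `[0, tm]%classic (fun r => c r * `|g r|).
  apply: (bitg (M := 1 * M')) => [|r hr]; first by apply: mrM => //; exact: mrnorm.
  by rewrite normrM normr_id ler_pM ?hM' ?c1.
have iGd : itg leb `[0, tm]%classic (fun r => G r * dc r).
  apply: (bitg (M := gam * M)) => [|r hr]; first exact: mrM.
  by rewrite normrM ler_pM ?hM ?Ggam.
have iad : itg leb `[0, tm]%classic (fun r => `|dc r|).
  by apply: (bitg (M := M)) => [|r hr]; [exact: mrnorm|rewrite normr_id hM].
have idf : itg leb `[0, tm]%classic (fun r => c r * (f r - psi) * g r).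
  apply: (bitg (M := 1 * (Bf + `|psi|) * M')) => [|r hr].
    by apply: mrM => //; apply: mrM => //; apply: mrB => //; exact: mrcst.
  rewrite !normrM ler_pM ?mulr_ge0 ?hM'// ler_pM ?c1//.
  by rewrite (le_trans (ler_normB _ _))// lerD2r.
have e1 := int_ccB icfg s0 st tt; have e2 := int_ccB icag s0 st tt.
have -> : \int[leb]_(r in `[0, t]) (c r * f r * g r) = \int[leb]_(r in `[0, s]) (c r * f r * g r) +
   (psi * \int[leb]_(r in `]s, t]) (c r * g r) + \int[leb]_(r in `]s, t]) (c r * (f r - psi) * g r)).
  rewrite -RintegralZl//; last exact: sub_oc icg.
  rewrite -RintegralD//; [|by apply: itgZ => //; exact: sub_oc icg|exact: sub_oc idf].
  rewrite -(subrK (\int[leb]_(r in `[0, s]) (c r * f r * g r)) (\int[leb]_(r in `[0, t]) _)) e1 addrC.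
  by congr (_ + _); apply: int_eq => r _; ring.
have p := prim_incr (primM pc pG) s0 st tt.
have A1 : `|\int[leb]_(r in `]s, t]) (c r * g r)| <= gam * (2 + BV).
  have E : \int[leb]_(r in `]s, t]) (c r * g r) = c t * G t - c s * G s - \int[leb]_(r in `]s, t]) (G r * dc r).
    rewrite p RintegralD//; [|exact: sub_oc icg|exact: sub_oc iGd].
    by rewrite addrK.
  have b1 u : 0 <= u <= tm -> `|c u * G u| <= gam.
    by move=> hu; rewrite normrM -[gam]mul1r ler_pM ?c1 ?Ggam.
  have b2 : `|\int[leb]_(r in `]s, t]) (G r * dc r)| <= gam * BV.
    apply: (@le_trans _ _ (gam * \int[leb]_(r in `]s, t]) `|dc r|)).
      rewrite -RintegralZl//; last exact: sub_oc iad.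
      apply: int_dom => //; first by apply: itg_meas; exact: sub_oc iGd.
        by apply: itgZ => //; exact: sub_oc iad.
      move=> r /=; rewrite in_itv/= => /andP[sr rt]; rewrite normrM ler_wpM2r// Ggam//.
      by rewrite (le_trans s0 (ltW sr)) (le_trans rt).
    rewrite ler_wpM2l// (le_trans _ dcB)//.
    have q1 := int_ccB iad s0 st tt.
    have t0 : 0 <= t by exact: le_trans st.
    have q2 := int_ccB iad t0 tt (lexx tm).
    have q3 : \int[leb]_(r in `[0, t]) `|dc r| <= \int[leb]_(r in `[0, tm]) `|dc r|.
      by rewrite -subr_ge0 q2; exact: int_ge0.
    by rewrite -q1 lerBlDr (le_trans q3)// lerDl; exact: int_ge0.
  have h1 := b1 t tt'; have h2 := b1 s ss; rewrite E.
  have key (a b e q p0 : R) : `|a| <= q -> `|b| <= q -> `|e| <= q * p0 -> `|a - b - e| <= q * (2 + p0).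
    move=> h3 h4 h5; rewrite (le_trans (ler_normB _ _))// mulrDr mulr_natr mulr2n lerD//.
    by rewrite (le_trans (ler_normB _ _))// lerD.
  exact: key.
have A2 : `|\int[leb]_(r in `]s, t]) (c r * (f r - psi) * g r)| <= eps * \int[leb]_(r in `]s, t]) (c r * `|g r|).
  (* The right endpoint is dropped: [f] may jump there, and its closeness to [psi] is assumed on the
     open cell only. *)
  rewrite -!(@Rintegral_itv_bndo_bndc R (BRight s) t); [|exact: sub_oo icag|exact: sub_oo idf].
  rewrite -RintegralZl//; last exact: sub_oo icag.
  apply: int_dom => //; first by apply: itg_meas; exact: sub_oo idf.
    by apply: itgZ => //; exact: sub_oo icag.
  move=> r /=; rewrite in_itv/= => /andP[sr rt].
  have hr : 0 <= r <= tm by rewrite (le_trans s0 (ltW sr)) (le_trans (ltW rt)).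
  have /andP[q0 q1] := c01 r hr.
  rewrite !normrM (ger0_norm q0) mulrA (mulrC eps) ler_wpM2r// ler_wpM2l// fpsi//.
  by rewrite sr.
have := H c dc G g gam pc pG c01 dcB Ggam; move: A1 A2 e2.
have key (a b x y z1 z2 z3 C0 p0 q0 : R) : `|x| <= gam * p0 -> `|y| <= eps * z1 -> z2 - z3 = z1 ->
   `|a| <= eps * z3 + C0 * gam -> `|a + (q0 * x + y)| <= eps * z2 + (C0 + `|q0| * p0) * gam.
  move=> hx hy hz ha; rewrite (le_trans (ler_normD _ _))//.
  have h1 : `|q0 * x + y| <= `|q0| * (gam * p0) + eps * z1.
    by rewrite (le_trans (ler_normD _ _))// lerD// normrM ler_wpM2l.
  rewrite (le_trans (lerD ha h1))// -hz le_eqVlt; apply/orP; left; apply/eqP; ring.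
exact: key.
Qed.

Lemma step_pairing : exists2 C, 0 <= C & pairing_bound tm C.
Proof.
pose Q t := exists2 C, 0 <= C & pairing_bound t C.
have Qstep s t psi : 0 <= s -> s <= t -> t <= tm ->
    (forall r, s < r < t -> `|f r - psi| <= eps) -> Q s -> Q t.
  move=> s0 st tt fp [C C0 hC]; exists (C + `|psi| * (2 + BV)); last exact: pairing_step hC.
  by rewrite addr_ge0// mulr_ge0// addr_ge0.
have Q0 : Q 0.
  exists 0 => // c dc G g gam _ _ _ _ _.
  by rewrite !set_itv1 !Rintegral_set1 normr0 mulr0 mul0r addr0.
(* Real induction: the left limit at the supremum shows that it is attained, and right-continuity
   that it cannot lie below [tm]. *)
pose S := [set t | 0 <= t <= tm /\ Q t].
have S0 : S 0 by rewrite /S /= lexx tm0.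
have hS : has_sup S.
  by split; [exists 0|exists tm => t [/andP[_ h] _]].
set sg := sup S.
have sg0 : 0 <= sg by apply: (ub_le_sup hS.2 S0).
have sgt : sg <= tm by apply: ge_sup => [|t [/andP[_ h] _]] //; exists 0.
have Qsg : Q sg.
  have [->//|sgn] := eqVneq sg 0.
  have sgp : 0 < sg by rewrite lt_neqAle eq_sym sgn.
  have cl := f_left sgp.
  set l := lim (f s @[s --> sg^'-]) in cl.
  have [dl dl0 hdl] : exists2 dl : R, 0 < dl & forall r, sg - dl < r < sg -> `|f r - l| <= eps.
    have /cvgrPdist_le /(_ eps eps0) : f s @[s --> sg^'-] --> l by exact: cl.
    rewrite near_withinE => /nbhs_ballP[dl /= dl0 hd]; exists dl => // r /andP[r1 r2].
    rewrite distrC; apply: hd => //; rewrite /ball/= ger0_norm ?subr_ge0 ?ltW//; lra.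
  have [s [/andP[s0 st] Qs] sdl] := sup_adherent dl0 hS.
  have ssg : s <= sg by apply: (ub_le_sup hS.2); split => //; rewrite s0.
  apply: (Qstep s sg l) => // r /andP[r1 r2]; apply: hdl.
  by rewrite r2 andbT (lt_trans _ r1).
have [e|/eqP sgn] := eqVneq sg tm; first by rewrite e in Qsg.
have sgl : sg < tm by rewrite lt_neqAle sgt andbT; apply/eqP.
have [dl dl0 hdl] : exists2 dl : R, 0 < dl & forall r, sg < r < sg + dl -> `|f r - f sg| <= eps.
  have /cvgrPdist_le /(_ eps eps0) := f_right sg0.
  rewrite near_withinE => /nbhs_ballP[dl /= dl0 hd]; exists dl => // r /andP[r1 r2].
  rewrite distrC; apply: hd => //; rewrite /ball/= ler0_norm ?subr_le0 ?ltW//; lra.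
pose t := Num.min tm (sg + dl).
have tsg : sg < t by rewrite lt_min sgl ltrDl.
have : t <= sg.
  apply: (ub_le_sup hS.2); split.
    by rewrite (le_trans sg0 (ltW tsg)) ge_min lexx.
  apply: (Qstep sg t (f sg)) => //; first exact: ltW.
    by rewrite ge_min lexx.
  move=> r /andP[r1 r2]; apply: hdl; rewrite r1/= (lt_le_trans r2)// ge_min lexx orbT//.
by rewrite leNgt tsg.
Qed.

End step_pairing.

Lemma int_bounded_cvg0 (R : realType) d (T : measurableType d) (P : probability T R) (f : nat -> T -> R)
    (K : R) (N0 : set T) : measurable N0 -> P N0 = 0%E ->
  (forall n, measurable_fun setT (f n)) -> (forall n w, `|f n w| <= K) ->
  (forall w, ~ N0 w -> f n w @[n --> \oo] --> 0) -> \int[P]_w f n w @[n --> \oo] --> 0.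
Proof.
move=> mN PN mf fK fc; have Pf := P_lty P.
have mi : measurable_fun setT (\1_N0 : T -> R) by exact: measurable_indic.
have mj : measurable_fun setT (\1_(~` N0) : T -> R) by apply: measurable_indic; exact: measurableC.
have i01 (A : set T) w : 0 <= (\1_A w : R) <= 1 by rewrite indicE; case: (_ \in _); rewrite ?lexx ler01.
have E w : 1 = \1_N0 w + \1_(~` N0) w :> R.
  by rewrite !indicE in_setC; case: (_ \in _); rewrite ?addr0 ?add0r.
have inull : \int[P]_w (\1_N0 w : R) = 0.
  by rewrite /Rintegral integral_indic// setIT; exact: (congr1 fine PN).
have ib (g : T -> R) : measurable_fun setT g -> (forall w, `|g w| <= K) -> itg P setT g.
  by move=> mg gK; apply: (itg_bnd _ (M := K)).
have K0 (w : T) : 0 <= K by exact: le_trans (normr_ge0 _) (fK 0%N w).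
have bnd A n w : `|\1_A w * f n w| <= K.
  have /andP[q0 q1] := i01 A w.
  by rewrite normrM (ger0_norm q0) -[K]mul1r ler_pM.
have splitE n : \int[P]_w f n w = \int[P]_w (\1_(~` N0) w * f n w).
  rewrite [LHS](int_eq _ (g := fun w => \1_N0 w * f n w + \1_(~` N0) w * f n w)); last first.
    by move=> w _; rewrite -mulrDl -E mul1r.
  rewrite RintegralD//; [|by apply: ib => //; exact: mrM..].
  rewrite [X in X + _](_ : _ = 0) ?add0r//; apply/eqP; rewrite -normr_le0.
  apply: (@le_trans _ _ (\int[P]_w (K * \1_N0 w))).
    apply: int_dom => //; first exact: mrM.
      apply: itgZ => //; apply: (itg_bnd _ (M := 1)) => // w _.
      by have /andP[q0 q1] := i01 N0 w; rewrite ger0_norm.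
    by move=> w _; have /andP[q0 q1] := i01 N0 w; rewrite normrM (ger0_norm q0) mulrC ler_wpM2r.
  rewrite RintegralZl// ?inull ?mulr0//.
  by apply: (itg_bnd _ (M := 1)) => // w _; have /andP[q0 q1] := i01 N0 w; rewrite ger0_norm.
have -> : (fun n => \int[P]_w f n w) = (fun n => \int[P]_w (\1_(~` N0) w * f n w)).
  by apply/funext => n; rewrite splitE.
suff : \int[P]_w (\1_(~` N0) w * f n w) @[n --> \oo] --> \int[P]_w (0 : R).
  by rewrite (int_P_cst P 0).
apply: (int_cvg measurableT (g := fun=> K)) => //.
- by move=> n; exact: mrM.
- exact: (itg_cst measurableT _ Pf).
- move=> w _; have [nw|nw] := pselect (N0 w).
    have -> : (fun n => \1_(~` N0) w * f n w) = fun=> 0; last exact: cvg_cst.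
    apply/funext => n; rewrite indicE.
    have -> : (w \in ~` N0) = false by apply: memNset => q; exact: q nw.
    by rewrite mul0r.
  have -> : (fun n => \1_(~` N0) w * f n w) = f ^~ w; last exact: fc.
  apply/funext => n; rewrite indicE.
  have -> : (w \in ~` N0) = true by exact: mem_set.
  by rewrite mul1r.
Qed.

Lemma small_decr (R : realType) d (T : measurableType d) (P : probability T R) (E : nat -> set T)
    (rho : R) : (forall n, measurable (E n)) -> (forall n, E n.+1 `<=` E n) ->
  P.-negligible (\bigcap_n E n) -> 0 < rho -> exists n, (P (E n) <= rho%:E)%E.
Proof.
move=> mE dE [N [mN PN EN]] r0.
have mI : measurable (\bigcap_n E n) by exact: bigcap_measurable.
have I0 : P (\bigcap_n E n) = 0%E.
  by apply/eqP; rewrite -measure_le0 -PN le_measure ?inE.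
have PE n : (P (E n) < +oo)%E by rewrite (le_lt_trans (probability_le1 P (mE n)))// ltry.
have c := nonincreasing_cvg_mu (PE 0%N) mE mI (_ : nonincreasing_seq E).
have {c} : P (E n) @[n --> \oo] --> 0%E.
  by rewrite -I0; apply: c; apply/nonincreasing_seqP => n; exact/subsetPset.
move=> /fine_cvg /cvgrPdist_lt /(_ _ r0) [n _ /(_ n (leqnn n))] /=.
rewrite sub0r normrN => hn; exists n; rewrite -[P (E n)]fineK ?ge0_fin_numE// lee_fin.
exact: le_trans (ler_norm _) (ltW hn).
Qed.

Lemma norm_third (R : realFieldType) (x y u t : R) :
  `|x| <= t / 3 -> `|y| <= t / 3 -> `|u| <= t / 3 -> `|x + y - u| <= t.
Proof. by rewrite !ler_norml => /andP[? ?] /andP[? ?] /andP[? ?]; apply/andP; split; lra. Qed.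

Lemma ET_path_le (R : realType) d (T : measurableType d) (P : probability T R) (tm K : R)
    (f : R -> T -> R) : ebd tm f ->
  (forall w, \int[@lebesgue_measure R]_(r in `[0, tm]) f r w <= K) -> ET P tm f <= K.
Proof.
move=> ef fK; rewrite (ebd_iter P ef) -[leRHS](int_P_cst P); apply: int_le => //.
- exact: ebd_iter_itg.
- exact: (itg_cst measurableT _ (P_lty P)).
Qed.

(** * Ito's formula along an arbitrary solution *)

Section one_solution.
Context {R : realType} {d} {T : measurableType d} {P : probability T R}.
Context {F : R -> set (set T)} {alpha : R} {L : R -> T -> R} (hL : driver P F alpha L).
Context {phi h : R -> R} {kap : {finite_measure set (measurableTypeR R) -> \bar R}}.
Context (z : zvonkin_data alpha phi h kap) (x0 : R).
Notation leb := (@lebesgue_measure R).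
Notation lam := (zlam z).
Notation Xa := (drifted (L := L) x0).
Let hF : filtration F := drF hL.
Hypothesis L_right : forall w t, 0 <= t -> L s w @[s --> t^'+] --> L t w.
Hypothesis L_left : forall w t, 0 < t -> cvg (L s w @[s --> t^'-]).

Context (A : R -> T -> R) (p : nat -> nat) (N0 : set T).
Hypothesis pA : prog F A.
Hypothesis cA : forall w, continuous (A ^~ w).
Hypothesis p_ge : forall i, (i <= p i)%N.
Hypothesis mN0 : measurable N0.
Hypothesis PN0 : P N0 = 0%E.

Definition Xs r w := L r w + (x0 + A r w).
Definition drift i r w := zmu z (p i) (Xs r w).
Let a := drift.

Hypothesis unif : forall w, ~ N0 w -> forall tm eta : R, 0 < eta -> exists I, forall i, (I <= i)%N ->
  forall t, 0 <= t <= tm -> `|pint (a i) t w - A t w| <= eta.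

Let pX : prog F Xs.
Proof. by apply: progD; [exact: drL hL|apply: progD => //; exact: prog_cst]. Qed.
Lemma drift_admissible i : admissible (F := F) (a i).
Proof.
have [B B0 hB] := zM_bnd z (p i) (zh z).
exact: (comp_admissible (zM_meas z (p i) (zh z)) hB pX).
Qed.
Let ha := drift_admissible.
(** The drift part [A] of the solution is merely continuous, so Ito's formula is applied to [Y j],
    whose drift part has the density [a j] and converges to [A]. *)
Let Y j := Xa (a j).
Let pY j : prog F (Y j). Proof. exact: (drifted_prog hL). Qed.
Let E r := expR (- (lam * r)).
Definition defect i j r w := (1 + zv z (p i) (Y j r w)) * a j r w - zk z (p i) (Y j r w).

(** The last condition is what killing by the variation of [a i] and [a j] achieves; it stands in
    for a moment bound on the drift. *)
Definition test_weight tm B i j c dc := [/\ absc F tm c dc, (forall r w, 0 <= c r w <= 1),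
  (forall w, \int[leb]_(r in `[0, tm]) `|dc r w| <= B) &
  forall w, \int[leb]_(r in `[0, tm]) (c r w * (`|a i r w| + `|a j r w|)) <= 1].

Let E1 r : 0 <= r -> 0 <= E r <= 1. Proof. by move=> r0; rewrite expR_ge0 exp_le1. Qed.
Let eE tm : ebd tm (fun r (_ : T) => E r). Proof. exact: exp_ebd. Qed.
Let ea tm i : ebd tm (a i). Proof. by have [q b] := ha i; exact: (prog_ebd hL). Qed.
Let ev tm i j : ebd tm (fun r w => 1 + zv z (p i) (Y j r w)).
Proof.
have [mv hv] := zv_bmeas z (p i).
by apply: ebdD; [exact: ebd_cst|exact: (comp_ebd hL tm mv hv)].
Qed.
Let v1 i x : `|1 + zv z i x| <= 4 / 3.
Proof.
have [_ hv] := zv_bmeas z i; rewrite (le_trans (ler_normD _ _))// normr1.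
have := hv x; lra.
Qed.

Let YX j r w : Y j r w - Xs r w = pint (a j) r w - A r w.
Proof. by rewrite /Y /drifted /Xs opprD addrACA subrr add0r opprD addrACA subrr add0r. Qed.

(* The densities [a i] are only bounded in [L^1] along the weight, while their
   primitives converge uniformly: [step_pairing] applies with the cadlag path of
   [1 + zv] composed with the limit process. *)
Lemma defect1 tm B theta : 0 <= tm -> 0 <= B -> 0 < theta -> exists I, forall i j,
  (I <= i)%N -> (I <= j)%N -> forall c dc, test_weight tm B i j c dc ->
  `|ET P tm (fun r w => E r * (c r w * ((1 + zv z (p i) (Y j r w)) * (a j r w - a i r w))))| <= theta.
Proof.
(* By contradiction, so that a sequence of bad indices and weights can be extracted: for a sequence,
   convergence path by path and boundedness suffice, although the weights vary with it. *)
move=> tm0 B0 t0; apply: contrapT => hn.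
have hI (n : nat) : exists q : (nat * nat) * ((R -> T -> R) * (R -> T -> R)),
    [/\ (n <= q.1.1)%N, (n <= q.1.2)%N, test_weight tm B q.1.1 q.1.2 q.2.1 q.2.2 &
    theta < `|ET P tm (fun r w => E r * (q.2.1 r w * ((1 + zv z (p q.1.1) (Y q.1.2 r w)) * (a q.1.2 r w - a q.1.1 r w))))|].
  apply: contrapT => hh; apply: hn; exists n => i j ni nj c dc tw.
  by rewrite leNgt; apply/negP => q; apply: hh; exists ((i, j), (c, dc)).
have [q hq] := choice hI.
pose ii n := (q n).1.1; pose jj n := (q n).1.2; pose c n := (q n).2.1; pose dc n := (q n).2.2.
pose g n r w := a (jj n) r w - a (ii n) r w.
pose f n r w := E r * (c n r w * ((1 + zv z (p (ii n)) (Y (jj n) r w)) * g n r w)).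
have tw n : test_weight tm B (ii n) (jj n) (c n) (dc n) by have [] := hq n.
have ec n : ebd tm (c n).
  have [hc c01 _ _] := tw n; have [pc _ _ _] := hc.
  by apply: (prog_ebd hL) => //; exists 1 => r w; have /andP[q0 q1] := c01 r w; rewrite ger0_norm.
have eg n : ebd tm (g n) by exact: ebdB.
have ef n : ebd tm (f n).
  by apply: ebdM => //; apply: ebdM => //; exact: (ebdM (ev tm (ii n) (jj n)) (eg n)).
have ecg n : ebd tm (fun r w => c n r w * `|g n r w|) by apply: ebdM => //; exact: ebd_norm.
have cg1 n w : \int[leb]_(r in `[0, tm]) (c n r w * `|g n r w|) <= 1.
  have [_ c01 _ hcg] := tw n; apply: le_trans (hcg w); apply: int_le => //.
  - exact: (ebd_path w tm0 (ecg n)).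
  - apply: (ebd_path w tm0 (f := fun r w => c n r w * (`|a (ii n) r w| + `|a (jj n) r w|))).
    by apply: ebdM => //; apply: ebdD; exact: ebd_norm.
  - by move=> r _; have /andP[q0 q1] := c01 r w; rewrite ler_wpM2l// addrC ler_normB.
pose Z n w := \int[leb]_(r in `[0, tm]) f n r w.
have Zb n (f' : R -> T -> R) (K : R) w : 0 <= K -> ebd tm (fun r w => E r * (c n r w * (f' r w * g n r w))) ->
    (forall r, 0 <= r <= tm -> `|f' r w| <= K) ->
    `|\int[leb]_(r in `[0, tm]) (E r * (c n r w * (f' r w * g n r w)))| <= K.
  move=> K0 ef' f'K; rewrite -[leRHS]mulr1; apply: le_trans (ler_wpM2l K0 (cg1 n w)).
  rewrite -RintegralZl//; last exact: (ebd_path w tm0 (ecg n)).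
  have [_ c01 _ _] := tw n.
  apply: int_dom => //; first exact: itg_meas (ebd_path w tm0 ef').
    by apply: itgZ => //; exact: (ebd_path w tm0 (ecg n)).
  move=> r /=; rewrite in_itv/= => hr; have /andP[r0 rt] := hr; have /andP[x1 x2] := E1 r0.
  have /andP[q0 q1] := c01 r w.
  rewrite normrM (ger0_norm x1) (le_trans (ler_piMl _ x2))//.
  by rewrite normrM (ger0_norm q0) normrM mulrCA ler_wpM2r ?mulr_ge0 ?f'K.
have Zc w : ~ N0 w -> Z n w @[n --> \oo] --> 0.
  move=> nw; apply/cvgrPdist_le => eta eta0.
  have e4 : 0 < eta / 4 by rewrite divr_gt0.
  (* One index [N] replaces the varying levels of [zv] at a cost of [eta / 4]; composed with the
     path of the solution it gives a single cadlag function to which [step_pairing] applies. *)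
  have [N hN] : exists N, forall n, (N <= n)%N -> zCv z * zdel z n <= eta / 4.
    apply: cvg0_le e4; rewrite -[X in _ --> X](mulr0 (zCv z)).
    by apply: cvgM; [exact: cvg_cst|exact: zdelc].
  have [K K0 hK] := zv_lip z N; have [mv hv] := zv_bmeas z N.
  have vc : continuous (zv z N) by exact: lip_continuous hK.
  pose pf r := 1 + zv z N (Xs r w).
  have mpf : measurable_fun setT pf.
    by apply: mrD; [exact: mrcst|exact: (prog_path hF w (prog_comp mv pX))].
  have BV0 : 0 <= B + lam * tm by rewrite addr_ge0// mulr_ge0 ?zlam0.
  have pfr t : 0 <= t -> pf s @[s --> t^'+] --> pf t.
    move=> tt; have cAr : A s w @[s --> t^'+] --> A t w := cvg_at_right_filter (@cA w t).
     apply: cvgD; first exact: cvg_cst.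
    suff H : Xs s w @[s --> t^'+] --> Xs t w by exact: (@cvg_comp _ _ _ (fun s => Xs s w) (zv z N) _ _ _ H (vc _)).
    apply: cvgD; first exact: L_right.
    by apply: cvgD; [exact: cvg_cst|exact: cAr].
  have pfl t : 0 < t -> cvg (pf s @[s --> t^'-]).
    move=> tt; have cAl : A s w @[s --> t^'-] --> A t w := cvg_at_left_filter (@cA w t).
    have cl := @L_left w t tt; set l := lim _ in cl.
    apply/cvg_ex; exists (1 + zv z N (l + (x0 + A t w))).
    apply: cvgD; first exact: cvg_cst.
    suff H : Xs s w @[s --> t^'-] --> l + (x0 + A t w) by exact: (@cvg_comp _ _ _ (fun s => Xs s w) (zv z N) _ _ _ H (vc _)).
    apply: cvgD; first exact: cl.
    by apply: cvgD; [exact: cvg_cst|exact: cAl].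
  have [C C0 hC] := step_pairing tm0 mpf (fun r => v1 N (Xs r w)) pfr pfl e4 BV0.
  (* The first bound pays for replacing [Y j] by the solution inside [zv z N]; the second for the
     constant [C], with [2 * gam] because the primitive of [g] is a difference of two approximations
     of [A]. *)
  pose gam := Num.min (eta / (4 * (K + 1))) (eta / (8 * (C + 1))).
  have gam0 : 0 < gam.
    by rewrite lt_min !divr_gt0// mulr_gt0// ltr_wpDl.
  have gK : K * gam <= eta / 4.
    rewrite (le_trans (ler_wpM2l K0 (_ : gam <= eta / (4 * (K + 1)))))//; first by rewrite ge_min lexx.
    rewrite (_ : K * _ = K / (K + 1) * (eta / 4)); last by field; rewrite gt_eqF// ltr_wpDl.
    by rewrite ler_piMl ?(ltW e4)// ler_pdivrMr ?ltr_wpDl// mul1r lerDl.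
  have gC : C * (2 * gam) <= eta / 4.
    rewrite mulrCA (le_trans (ler_wpM2l _ (ler_wpM2l C0 (_ : gam <= eta / (8 * (C + 1))))))//; first by rewrite ge_min lexx orbT.
    rewrite (_ : 2 * (C * _) = C / (C + 1) * (eta / 4)); last by field; rewrite gt_eqF// ltr_wpDl.
    by rewrite ler_piMl ?(ltW e4)// ler_pdivrMr ?ltr_wpDl// mul1r lerDl.
  have [I hIu] := unif nw tm gam0.
  exists (maxn I N) => // n /=; rewrite geq_max => /andP[nI nN]; rewrite sub0r normrN.
  have [n1 n2 _ _] := hq n.
  have iI : (I <= ii n)%N by exact: leq_trans nI n1.
  have jI : (I <= jj n)%N by exact: leq_trans nI n2.
  have iN : (N <= ii n)%N by exact: leq_trans nN n1.
  have [hc c01 dcB _] := tw n; have [_ _ _ pc] := hc.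
  pose f1 r w := E r * (c n r w * ((1 + zv z N (Xs r w)) * g n r w)).
  have ev1 : ebd tm (fun r w => 1 + zv z N (Xs r w)).
    by apply: ebdD; [exact: ebd_cst|exact: (comp_ebd hL tm mv hv)].
  have ef1 : ebd tm f1 by apply: ebdM => //; apply: ebdM => //; exact: (ebdM ev1 (eg n)).
  pose dv r w := zv z (p (ii n)) (Y (jj n) r w) - zv z N (Xs r w).
  have ef2 : ebd tm (fun r w => E r * (c n r w * (dv r w * g n r w))).
    have edv : ebd tm dv.
      have [mv' hv'] := zv_bmeas z (p (ii n)).
      by apply: ebdB; [exact: (comp_ebd hL tm mv' hv')|exact: (comp_ebd hL tm mv hv)].
    by apply: ebdM => //; apply: ebdM => //; exact: ebdM.
  have ZE : Z n w = \int[leb]_(r in `[0, tm]) f1 r w +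
      \int[leb]_(r in `[0, tm]) (E r * (c n r w * (dv r w * g n r w))).
    rewrite -RintegralD//; [|exact: (ebd_path w tm0 ef1)|exact: (ebd_path w tm0 ef2)].
    apply: int_eq => r _; rewrite /f /f1 /dv -mulrDr -mulrDr -mulrDl.
    have key (u v y : R) : u + v = u + y + (v - y) by ring.
    by rewrite -key.
  have B2 : `|\int[leb]_(r in `[0, tm]) (E r * (c n r w * (dv r w * g n r w)))| <= eta / 4 + eta / 4.
    apply: Zb => //; first by rewrite addr_ge0// ltW.
    move=> r hr; rewrite /dv (le_trans (ler_distD (zv z N (Y (jj n) r w)) _ _))// lerD//.
      apply: le_trans (hN N (leqnn N)); apply: zv_del => //.
      exact: leq_trans iN (p_ge _).
    rewrite (le_trans (hK _ _))// YX (le_trans _ gK)// ler_wpM2l//.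
    exact: hIu jI _ hr.
  have B1 : `|\int[leb]_(r in `[0, tm]) f1 r w| <= eta / 4 + eta / 4.
    have [_ _ _ pG] := pint_absc hF tm (admissibleB (ha (jj n)) (ha (ii n))).1 (admissibleB (ha (jj n)) (ha (ii n))).2.
    have pEc := primM (prim_expR tm (- lam)) (pc w).
    have := hC _ _ _ _ (2 * gam) pEc (pG w).
    have -> : \int[leb]_(r in `[0, tm]) (expR (- lam * r) * c n r w * pf r * (a (jj n) r w - a (ii n) r w)) =
       \int[leb]_(r in `[0, tm]) f1 r w.
      by apply: int_eq => r _; rewrite /f1 /g /pf /E mulNr -!mulrA.
    have iEcg : itg leb `[0, tm]%classic (fun r => expR (- lam * r) * c n r w * `|a (jj n) r w - a (ii n) r w|).
      apply: (ebd_path w tm0 (f := fun r w => expR (- lam * r) * c n r w * `|a (jj n) r w - a (ii n) r w|)).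
      apply: ebdM; last exact: ebd_norm (eg n).
      by apply: ebdM => //; have := eE tm; rewrite /E; under [X in ebd _ X]eq_fun do rewrite -mulNr.
    move=> H; apply: (le_trans (H _ _ _)).
    - move=> r /andP[r0 rt]; have /andP[x1 x2] := E1 r0; have /andP[q0 q1] := c01 r w.
      by rewrite mulNr mulr_ge0 ?expR_ge0// mulr_ile1 ?expR_ge0.
    - have edc : ebd tm (dc n) by have [_ pdc bdc _] := hc; exact: (prog_ebd hL).
      have i1 : itg leb `[0, tm]%classic (fun r => `|dc n r w|) by exact: (ebd_path w tm0 (ebd_norm edc)).
      apply: (@le_trans _ _ (\int[leb]_(r in `[0, tm]) (`|dc n r w| + lam))).
        apply: int_le => //.
        + have eEE : ebd tm (fun r (_ : T) => expR (- lam * r)).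
            by have := eE tm; rewrite /E; under [X in ebd _ X]eq_fun do rewrite -mulNr.
          apply: (ebd_path w tm0 (f := fun r w => `|expR (- lam * r) * dc n r w + c n r w * (- lam * expR (- lam * r))|)).
          apply: ebd_norm; apply: ebdD; first exact: ebdM.
          by apply: ebdM => //; exact: ebdZ.
        + by apply: itgD => //; apply/itg_cst/leb_cc_fin.
        move=> r /=; rewrite in_itv/= => /andP[r0 rt]; have /andP[x1 x2] := E1 r0; have /andP[q0 q1] := c01 r w.
        rewrite mulNr (le_trans (ler_normD _ _))// lerD//.
          by rewrite normrM (ger0_norm x1) ler_piMl.
        rewrite normrM (ger0_norm q0) normrM normrN (ger0_norm (zlam0 z)) (ger0_norm x1).
        by rewrite (le_trans (ler_piMl _ q1)) ?mulr_ge0 ?zlam0// ler_piMr ?zlam0.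
      rewrite RintegralD//; last exact/itg_cst/leb_cc_fin.
      by rewrite lerD ?dcB// Rintegral_cst// leb_ccE// subr0.
    - move=> r hr; rewrite (pintB hL r w (ha (jj n)) (ha (ii n))).
      have u1 := hIu _ iI r hr; have u2 := hIu _ jI r hr.
      rewrite (le_trans (ler_distD (A r w) _ _))// mulrDl mul1r lerD//.
      rewrite (distrC (A r w)); exact: u1.
    rewrite lerD// ler_piMr ?(ltW e4)//; apply: le_trans (cg1 n w); apply: int_le => //.
      exact: (ebd_path w tm0 (ecg n)).
    move=> r /=; rewrite in_itv/= => /andP[r0 rt]; have /andP[x1 x2] := E1 r0; have /andP[q0 q1] := c01 r w.
    by rewrite mulNr -mulrA ler_piMl ?mulr_ge0.
  rewrite ZE (le_trans (ler_normD _ _))// (le_trans (lerD B1 B2))//.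
  by rewrite le_eqVlt; apply/orP; left; apply/eqP; field.
have v0 : 0 <= 4 / 3 :> R by rewrite divr_ge0.
have cZ := int_bounded_cvg0 mN0 PN0 (f := Z) (K := 4 / 3) (fun n => itg_meas (ebd_iter_itg P (ef n)))
  (fun n w => Zb n (fun r w => 1 + zv z (p (ii n)) (Y (jj n) r w)) (4 / 3) w v0 (ef n) (fun r _ => v1 _ _)) Zc.
have /cvgrPdist_lt /(_ _ t0) [n _ /(_ n (leqnn n))] := cZ.
rewrite sub0r normrN -ebd_iter//; have [_ _ _ h1] := hq n => h2.
by have := lt_trans h1 h2; rewrite ltxx.
Qed.

(** For a fixed [i] the mollified density is bounded and Lipschitz, so uniform convergence of [Y j]
    to the solution is enough, without any weight. *)
Lemma defect2 tm i theta : 0 <= tm -> 0 < theta -> exists J, forall j, (J <= j)%N ->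
  ET P tm (fun r w => `|a i r w - zmu z (p i) (Y j r w)|) <= theta.
Proof.
move=> tm0 t0.
have [B B0 hB] := zM_bnd z (p i) (zh z); have [K K0 hK] := zM_lip z (p i) (zh z).
pose f j r w := `|a i r w - zmu z (p i) (Y j r w)|.
have em j : ebd tm (fun r w => zmu z (p i) (Y j r w)).
  exact: (comp_ebd hL tm (zM_meas z (p i) (zh z)) hB (pY j)).
have ef j : ebd tm (f j) by apply: ebd_norm; apply: ebdB.
pose Z j w := \int[leb]_(r in `[0, tm]) f j r w.
have fB j r w : `|f j r w| <= 2 * B.
  by rewrite /f normr_id (le_trans (ler_normB _ _))// mulrDl mul1r lerD// hB.
have Zb j w : `|Z j w| <= 2 * B * tm.
  rewrite -[X in _ * X](subr0 tm) -leb_ccE//; apply: int_bnd => //; first exact: leb_cc_fin.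
  exact: itg_meas (ebd_path w tm0 (ef j)).
have Zc w : ~ N0 w -> Z n w @[n --> \oo] --> 0.
  move=> nw; apply/cvgrPdist_le => eta eta0.
  have q0 : 0 < eta / (K * tm + 1) by rewrite divr_gt0// ltr_wpDl// mulr_ge0.
  have [I hI] := unif nw tm q0; exists I => // j /= Ij; rewrite sub0r normrN.
  apply: (@le_trans _ _ (K * (eta / (K * tm + 1)) * fine (leb `[0, tm]%classic))).
    apply: int_bnd => //; first exact: leb_cc_fin.
      exact: itg_meas (ebd_path w tm0 (ef j)).
    move=> r /=; rewrite in_itv/= => hr; rewrite /f normr_id (le_trans (hK _ _))//.
    by rewrite ler_wpM2l// distrC YX; exact: hI.
  rewrite leb_ccE// subr0.
  rewrite (_ : K * _ * tm = K * tm / (K * tm + 1) * eta); last by move: (_ + 1)^-1 => y; ring.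
  by rewrite ler_piMl ?(ltW eta0)// ler_pdivrMr ?mul1r ?lerDl// ltr_wpDl// mulr_ge0.
have cZ := int_bounded_cvg0 mN0 PN0 (f := Z) (fun n => itg_meas (ebd_iter_itg P (ef n))) Zb Zc.
have [J hJ] := cvg0_le cZ t0; exists J => j Jj.
by rewrite (ebd_iter P (ef j)); exact: hJ.
Qed.

(** The defect splits into the change of density from [a i] to [a j], the change of argument from
    the solution to [Y j] at level [p i], and the commutator of [zk_osc]. The last is estimated by
    [krylov], where the drift term is bounded by one thanks to the killed weight. The second part
    forces [j] to be chosen after [i]. *)
Lemma defect_small tm B theta : 0 <= tm -> 0 <= B -> 0 < theta -> exists I, forall i, (I <= i)%N ->
  exists J, forall j, (J <= j)%N -> forall c dc, test_weight tm B i j c dc ->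
  `|ET P tm (fun r w => E r * (c r w * defect i j r w))| <= theta.
Proof.
move=> tm0 B0 t0; have t3 : 0 < theta / 3 by rewrite divr_gt0.
have [om [om0 omc homk]] := zk_osc z; have G0 := zGk0 z.
have [I1 h1] := defect1 tm0 B0 t3.
set K3 := 2 * zGk z + zGk z * B + 4^-1.
have [I2 h2] : exists N, forall n, (N <= n)%N -> K3 * om n <= theta / 3.
  apply: cvg0_le t3; rewrite -[X in _ --> X](mulr0 K3).
  by apply: cvgM; [exact: cvg_cst|].
exists (maxn I1 I2) => i; rewrite geq_max => /andP[i1 i2].
have t4 : 0 < theta / 3 / (4 / 3) by rewrite divr_gt0// divr_gt0.
have [J hJ] := defect2 i tm0 t4.
exists (maxn I1 J) => j; rewrite geq_max => /andP[j1 j2] c dc tw.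
have H2 := hJ j j2.
have [hc c01 dcB cle] := tw.
have bc : bdd c by exists 1 => r w; have /andP[q0 q1] := c01 r w; rewrite ger0_norm.
have [ec edc] := absc_ebd hL hc bc.
have [B1 B10 hB1] := zM_bnd z (p i) (zh z); have [B2 B20 hB2] := zM_bnd z (p i) (zf_bmeas z (p i)).
have b1 := @bmeas1 R; have [B3 B30 hB3] := zM_bnd z (p i) b1.
have em : ebd tm (fun r w => zmu z (p i) (Y j r w)) := comp_ebd hL tm (zM_meas z (p i) (zh z)) hB1 (pY j).
have ek : ebd tm (fun r w => zk z (p i) (Y j r w)) := comp_ebd hL tm (zM_meas z (p i) (zf_bmeas z (p i))) hB2 (pY j).
have e1 : ebd tm (fun r w => zam z (p i) (Y j r w)) := comp_ebd hL tm (zM_meas z (p i) b1) hB3 (pY j).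
pose g1 r w := (1 + zv z (p i) (Y j r w)) * (a j r w - a i r w).
pose g2 r w := (1 + zv z (p i) (Y j r w)) * (a i r w - zmu z (p i) (Y j r w)).
pose g3 r w := zk z (p i) (Y j r w) - (1 + zv z (p i) (Y j r w)) * zmu z (p i) (Y j r w).
have H1 : `|ET P tm (fun r w => E r * (c r w * g1 r w))| <= theta / 3 := h1 i j i1 j1 c dc tw.
have wE g : ebd tm g -> ebd tm (fun r w => E r * (c r w * g r w)).
  by move=> eg; apply: ebdM => //; exact: ebdM.
have eg1 : ebd tm g1 by apply: ebdM; [exact: ev|exact: ebdB].
have eg2 : ebd tm g2 by apply: ebdM; [exact: ev|exact: ebdB].
have eg3 : ebd tm g3 by apply: ebdB => //; apply: ebdM => //; exact: ev.
have -> : ET P tm (fun r w => E r * (c r w * defect i j r w)) =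
  ET P tm (fun r w => E r * (c r w * g1 r w)) + ET P tm (fun r w => E r * (c r w * g2 r w)) -
  ET P tm (fun r w => E r * (c r w * g3 r w)).
  rewrite -ETD; [|exact: wE..]; rewrite -ETB; [|by apply: ebdD; exact: wE|exact: wE].
  apply: ET_eq => r w _; rewrite -mulrDr -mulrDr -mulrBr -mulrBr; congr (_ * (_ * _)).
  rewrite /defect /g1 /g2 /g3.
  have key (v aj ai m k : R) : v * aj - k = v * (aj - ai) + v * (ai - m) - (k - v * m) by ring.
  exact: key.
have absET g : ebd tm g -> `|ET P tm (fun r w => E r * (c r w * g r w))| <= ET P tm (fun r w => E r * (c r w * `|g r w|)).
  move=> eg; have q1 := wE _ eg; have q2 := wE _ (ebd_norm eg).
  rewrite ler_norml -mulN1r -ETZ//; apply/andP; split.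
    apply: ET_le => //; first exact: ebdZ.
    move=> r w /andP[r0 rt]; have /andP[x1 x2] := E1 r0; have /andP[y1 y2] := c01 r w.
    rewrite mulN1r -mulrN -mulrN ler_wpM2l// ler_wpM2l// lerNl -normrN; exact: ler_norm.
  apply: ET_le => // r w /andP[r0 rt]; have /andP[x1 x2] := E1 r0; have /andP[y1 y2] := c01 r w.
  by rewrite ler_wpM2l// ler_wpM2l// ler_norm.
have T2 : `|ET P tm (fun r w => E r * (c r w * g2 r w))| <= theta / 3.
  apply: (le_trans (absET _ eg2)).
  apply: (@le_trans _ _ (4 / 3 * ET P tm (fun r w => `|a i r w - zmu z (p i) (Y j r w)|))).
    have ed : ebd tm (fun r w => `|a i r w - zmu z (p i) (Y j r w)|) by apply: ebd_norm; exact: ebdB.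
    rewrite -ETZ//; apply: ET_le; [by apply: wE; exact: ebd_norm|exact: ebdZ|].
    move=> r w /andP[r0 rt]; have /andP[x1 x2] := E1 r0; have /andP[y1 y2] := c01 r w.
    rewrite (le_trans (ler_piMl _ x2)) ?mulr_ge0// (le_trans (ler_piMl _ y2))//.
    by rewrite /g2 normrM ler_wpM2r.
  by rewrite mulrC -ler_pdivlMr// divr_gt0.
have T3 : `|ET P tm (fun r w => E r * (c r w * g3 r w))| <= theta / 3.
  apply: (le_trans (absET _ eg3)); apply: le_trans (h2 (p i) (leq_trans i2 (p_ge i))).
  apply: (@le_trans _ _ (om (p i) * ET P tm (fun r w => E r * (c r w * zam z (p i) (Y j r w))))).
    rewrite -ETZ; last exact: wE.
    apply: ET_le; [by apply: wE; exact: ebd_norm|by apply: ebdZ; exact: wE|].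
    move=> r w /andP[r0 rt]; have /andP[x1 x2] := E1 r0; have /andP[y1 y2] := c01 r w.
    rewrite [leRHS]mulrCA ler_wpM2l// [leRHS]mulrCA ler_wpM2l//; exact: homk.
  rewrite mulrC ler_wpM2r//; apply: (le_trans (krylov hL z x0 (p i) (ha j) tm0 hc c01)).
  apply: lerD; first apply: lerD => //.
    rewrite ler_wpM2l//; apply: ET_path_le => //; exact: ebd_norm.
  rewrite -[leRHS]mulr1 ler_wpM2l//.
  have eaj := ebd_norm (ea tm j); have eai := ebd_norm (ea tm i).
  apply: ET_path_le => //; first exact: wE.
  move=> w; apply: le_trans (cle w); apply: int_le => //.
  - exact: (ebd_path w tm0 (wE _ eaj)).
  - by apply: (ebd_path w tm0 (f := fun r w => c r w * (`|a i r w| + `|a j r w|))); apply: ebdM => //; exact: ebdD.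
  move=> r /=; rewrite in_itv/= => /andP[r0 rt]; have /andP[x1 x2] := E1 r0; have /andP[y1 y2] := c01 r w.
  by rewrite (le_trans (ler_piMl _ x2)) ?mulr_ge0// ler_wpM2l// lerDr.
exact: (norm_third H1 T2 T3).
Qed.

End one_solution.

Lemma norm_half (R : realFieldType) (x y t : R) : `|x| <= t / 2 -> `|y| <= t / 2 -> x - y <= t.
Proof. by rewrite !ler_norml => /andP[? ?] /andP[? ?]; lra. Qed.

Lemma gap_quarter (R : realFieldType) (eta x y b b' : R) :
  `|x - b| < eta / 4 -> `|y - b'| < eta / 4 -> eta <= b - b' -> 2 * (eta / 4) <= x - y.
Proof. by rewrite !ltr_norml => /andP[? ?] /andP[? ?] ?; lra. Qed.

(** * Comparison of two solutions *)

Section two_solutions.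
Context {R : realType} {d} {T : measurableType d} {P : probability T R}.
Context {F : R -> set (set T)} {alpha : R} {L : R -> T -> R} (hL : driver P F alpha L).
Context {phi h : R -> R} {kap : {finite_measure set (measurableTypeR R) -> \bar R}}.
Context (z : zvonkin_data alpha phi h kap) (x0 : R).
Notation leb := (@lebesgue_measure R).
Notation lam := (zlam z).
Notation Xa := (drifted (L := L) x0).
Let hF : filtration F := drF hL.
Hypothesis L_right : forall w t, 0 <= t -> L s w @[s --> t^'+] --> L t w.
Hypothesis L_left : forall w t, 0 < t -> cvg (L s w @[s --> t^'-]).

(** A working form along chosen levels [p]. Pathwise convergence feeds the defect estimates;
    convergence in probability transfers the final bound from the approximations back to [A]. *)
Definition solves (A : R -> T -> R) (p : nat -> nat) (N0 : set T) :=
  let a i r w := drift (L := L) z x0 A p i r w in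
  [/\ prog F A /\ (forall w, continuous (A ^~ w)), forall i, (i <= p i)%N, measurable N0 /\ P N0 = 0%E,
    (forall w, ~ N0 w -> forall tm eta : R, 0 < eta -> exists I, forall i, (I <= i)%N ->
      forall t, 0 <= t <= tm -> `|pint (a i) t w - A t w| <= eta) /\
    (forall tm eta rho : R, 0 <= tm -> 0 < eta -> 0 < rho -> exists I, forall i, (I <= i)%N ->
      small P (exceed tm eta (gap (pint (a i)) A)) rho) &
    forall w, ~ N0 w -> forall tm : R, 0 <= tm -> exists M : R, forall i, pint (fun r w => `|a i r w|) tm w <= M].

(** The weights are killed by [kk], the sum of the absolute values of the four densities in play,
    which makes all time integrals bounded without moments. Outside an event of small probability
    the killing is bounded below, so that the weighted estimate still controls the unweighted
    event. *)
Lemma solves_le (A A' : R -> T -> R) (p p' : nat -> nat) (N0 N0' : set T) tm eta rho :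
  solves A p N0 -> solves A' p' N0' -> 0 <= tm -> 0 < eta -> 0 < rho ->
  small P (exceed tm eta (fun t w => A t w - A' t w)) rho.
Proof.
move=> [[pA cA] pg [mN PN] [uni ucp] bnd] [[pA' cA'] pg' [mN' PN'] [uni' ucp'] bnd'] tm0 e0 r0.
set a := fun i => drift (L := L) z x0 A p i in uni ucp bnd.
set a' := fun i => drift (L := L) z x0 A' p' i in uni' ucp' bnd'.
have ha i : admissible (F := F) (a i) := drift_admissible hL z x0 p pA i.
have ha' i : admissible (F := F) (a' i) := drift_admissible hL z x0 p' pA' i.
have hn (b : R -> T -> R) : admissible (F := F) b -> admissible (F := F) (fun r w => `|b r w|).
  move=> [pb [M hM]]; split; last by exists M => r w; rewrite normr_id.
  by apply: (prog_comp (h := Num.norm)) => //; mr.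
have hD (b c : R -> T -> R) : admissible (F := F) b -> admissible (F := F) c -> admissible (F := F) (fun r w => b r w + c r w).
  move=> [pb [M hM]] [pc [M' hM']]; split; first exact: progD.
  by exists (M + M') => r w; rewrite (le_trans (ler_normD _ _))// lerD.
have pintD (b c : R -> T -> R) t w : admissible (F := F) b -> admissible (F := F) c ->
    pint (fun r w => b r w + c r w) t w = pint b t w + pint c t w.
  by move=> hb hc; rewrite /pint RintegralD//; exact: (admissible_itg hL).
pose m i := pint (fun r w => `|a i r w|) tm; pose m' i := pint (fun r w => `|a' i r w|) tm.
have mm i : measurable_fun setT (m i) := prog_meas hF (pint_prog hL (hn _ (ha i))) tm0.
have mm' i : measurable_fun setT (m' i) := prog_meas hF (pint_prog hL (hn _ (ha' i))) tm0.
(* The union over all levels makes the threshold [n] independent of the indices selected later;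
   these events decrease to a null set by the pathwise bounds. *)
pose H n := \bigcup_i [set w | n%:R < m i w + m' i w].
have mH n : measurable (H n).
  apply: bigcupT_measurable => i.
  rewrite (_ : [set w | _] = (fun w => m i w + m' i w) @^-1` `]n%:R, +oo[); last first.
    by apply/seteqP; split => w /=; rewrite in_itv/= andbT.
  by rewrite -[X in measurable X]setTI; exact: (mrD (mm i) (mm' i)).
have dH n : H n.+1 `<=` H n.
  move=> w [i _ /= hi]; exists i => //=; apply: le_lt_trans hi; by rewrite ler_nat.
have r4 : 0 < rho / 4 by rewrite divr_gt0.
have [n hHn] : exists n, (P (H n) <= (rho / 4)%:E)%E.
  have nN : P.-negligible N0 by exists N0; split.
  have nN' : P.-negligible N0' by exists N0'; split.
  apply: small_decr => //; apply: negligibleS (negligibleU nN nN').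
  move=> w hw; apply: contrapT => /not_orP[n1 n2].
  have [M hM] := bnd w n1 tm tm0; have [M' hM'] := bnd' w n2 tm tm0.
  have [k hk] := nat_ge (M + M').
  have [i _ /=] := hw k I; rewrite ltNge => /negP; apply.
  by apply: (le_trans _ (hk k (leqnn k))); exact: lerD (hM i) (hM' i).
have e4 : 0 < eta / 4 by rewrite divr_gt0.
(* Off [H n] the densities with index [i] contribute at most [n] to the accumulated rate, and so do
   those with index [j]. *)
have [s [theta [s01 t0 hs]]] := main_choice (n%:R + n%:R) tm0 (zlam0 z) e4 r4 (ler01 : 0 <= 1 :> R).
pose kp := (s * ramp_scale s)^-1; have k0 : 0 <= kp.
  have /andP[q0 q1] := s01.
  by rewrite invr_ge0 mulr_ge0 ?(ltW q0)// ltW// ramp_scale_gt0.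
have B0 : 0 <= 1 + kp by rewrite addr_ge0.
have t2 : 0 < theta / 2 by rewrite divr_gt0.
have [I1 h1] := @defect_small _ _ _ _ _ _ _ hL _ _ _ z x0 L_right L_left A p N0 pA cA pg mN PN uni tm _ _ tm0 B0 t2.
have [I2 h2] := @defect_small _ _ _ _ _ _ _ hL _ _ _ z x0 L_right L_left A' p' N0' pA' cA' pg' mN' PN' uni' tm _ _ tm0 B0 t2.
have [I3 h3] : exists N, forall n, (N <= n)%N -> zCu z * zdel z n <= theta.
  apply: cvg0_le t0; rewrite -[X in _ --> X](mulr0 (zCu z)).
  by apply: cvgM; [exact: cvg_cst|exact: zdelc].
(* The level of the transform is fixed first; the index [j] of the approximating processes depends
   on it. *)
pose i := maxn I1 (maxn I2 I3).
have i1 : (I1 <= i)%N by rewrite leq_maxl.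
have i2 : (I2 <= i)%N by rewrite /i !leq_max leqnn orbT.
have i3 : (I3 <= i)%N by rewrite /i !leq_max leqnn !orbT.
have [J1 j1] := h1 i i1; have [J2 j2] := h2 i i2.
have [J3 j3] := ucp tm (eta / 4) (rho / 4) tm0 e4 r4.
have [J4 j4] := ucp' tm (eta / 4) (rho / 4) tm0 e4 r4.
pose j := maxn (maxn J1 J2) (maxn J3 J4).
have {j1} w1 := j1 j _; have {j2} w2 := j2 j _; have {j3} s3 := j3 j _; have {j4} s4 := j4 j _.
have {}w1 := w1 (leq_trans (leq_maxl J1 J2) (leq_maxl _ _)).
have {}w2 := w2 (leq_trans (leq_maxr J1 J2) (leq_maxl _ _)).
have {}s3 := s3 (leq_trans (leq_maxl J3 J4) (leq_maxr _ _)).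
have {}s4 := s4 (leq_trans (leq_maxr J3 J4) (leq_maxr _ _)).
pose Y := Xa (a j); pose Y' := Xa (a' j).
pose e r w := defect (L := L) z x0 A p i j r w; pose e' r w := defect (L := L) z x0 A' p' i j r w.
pose k1 r w := `|a i r w| + `|a j r w|; pose k2 r w := `|a' i r w| + `|a' j r w|.
pose kk r w := k1 r w + k2 r w.
have hk1 : admissible (F := F) k1 by apply: hD; apply: hn.
have hk2 : admissible (F := F) k2 by apply: hD; apply: hn.
have [pk bk] : admissible (F := F) kk by exact: hD.
have kk0 r w : 0 <= kk r w by rewrite !addr_ge0.
pose Dd r w := a j r w - a' j r w.
have hDd : admissible (F := F) Dd by exact: admissibleB.
have [pDd bDd] := hDd.
have DdE t w : pint Dd t w = Y t w - Y' t w by rewrite (pintB hL t w (ha j) (ha' j)) -(driftedB (L := L) x0).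
have pY : prog F Y := drifted_prog hL x0 (ha j); have pY' : prog F Y' := drifted_prog hL x0 (ha' j).
have edf (q : nat -> nat) (b : nat -> R -> T -> R) : admissible (F := F) (b j) ->
   admissible (F := F) (fun r w => (1 + zv z (q i) (Xa (b j) r w)) * b j r w - zk z (q i) (Xa (b j) r w)).
  move=> hb; have pX := drifted_prog hL x0 hb; have [mv hv] := zv_bmeas z (q i).
  have [C C0 hC] := zM_bnd z (q i) (zf_bmeas z (q i)).
  apply: (admissibleB _ (comp_admissible (zM_meas z (q i) (zf_bmeas z (q i))) hC pX)).
  have [pb [M hM]] := hb; split.
    by apply: progM => //; apply: progD; [exact: prog_cst|exact: prog_comp].
  exists ((1 + 3^-1) * M) => r w; rewrite normrM ler_pM//.
  by rewrite (le_trans (ler_normD _ _))// normr1 lerD2l.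
have he : admissible (F := F) e := edf p a (ha j); have he' : admissible (F := F) e' := edf p' a' (ha' j).
have [pee bee] := admissibleB he he'.
have hJ w : \int[leb]_(r in `[0, tm]) (expR (- pint kk r w) * kk r w) <= 1.
  have [_ _ _ pJ] := pint_absc hF tm pk bk.
  rewrite (prim_exp_int tm0 (pJ w)); last 2 first.
  - by move=> t _; exact: pint_ge0.
  - exact: pint0.
  by rewrite gerBl expR_ge0.
have ekk := prog_ebd hL tm pk bk; have eDd := prog_ebd hL tm pDd bDd.
have eexp : ebd tm (fun r w => expR (- pint kk r w)).
  apply: (prog_ebd hL).
    by apply: (prog_comp (h := fun x => expR (- x))); [mr|exact: (pint_prog hL (conj pk bk))].
  by exists 1 => r w; rewrite ger0_norm ?expR_ge0// -expR0 ler_expR oppr_le0 pint_ge0.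
have eJD : ebd tm (fun r w => expR (- pint kk r w) * `|Dd r w|) by apply: ebdM => //; exact: ebd_norm.
have eJk : ebd tm (fun r w => expR (- pint kk r w) * kk r w) by exact: ebdM.
have Ddk r w : `|Dd r w| <= kk r w.
  rewrite /Dd /kk /k1 /k2 (le_trans (ler_normB _ _))// lerD// lerDr//.
have hJD w : \int[leb]_(r in `[0, tm]) (expR (- pint kk r w) * `|Dd r w|) <= 1.
  apply: le_trans (hJ w); apply: int_le => //.
  - exact: (ebd_path w tm0 eJD).
  - exact: (ebd_path w tm0 eJk).
  by move=> r _; rewrite ler_wpM2l ?expR_ge0.
have tw c dc : weight (F := F) tm s kk Dd c dc ->
    test_weight (F := F) (L := L) z x0 A p tm (1 + kp) i j c dc /\ test_weight (F := F) (L := L) z x0 A' p' tm (1 + kp) i j c dc.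
  move=> [hc c01 hdc].
  have c1 r w : 0 <= c r w <= 1.
    have /andP[-> q] := c01 r w; rewrite (le_trans q)// -expR0 ler_expR oppr_le0 pint_ge0//.
  have dcB w : \int[leb]_(r in `[0, tm]) `|dc r w| <= 1 + kp.
    by apply: le_trans (hdc w) _; rewrite lerD2l ler_piMr.
  have ec : ebd tm c.
    by have [pc _ _ _] := hc; apply: (prog_ebd hL) => //; exists 1 => r w; have /andP[q0 q1] := c1 r w; rewrite ger0_norm.
  have ck (k : R -> T -> R) w : admissible (F := F) k -> (forall r, 0 <= k r w <= kk r w) ->
      \int[leb]_(r in `[0, tm]) (c r w * k r w) <= 1.
    move=> [p0 b0] kle; apply: le_trans (hJ w).
    have ek := prog_ebd hL tm p0 b0.
    apply: int_le => //.
    - by apply: (ebd_path w tm0 (f := fun r w => c r w * k r w)); exact: ebdM.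
    - exact: (ebd_path w tm0 eJk).
    move=> r _; have /andP[q0 q1] := c01 r w; have /andP[q2 q3] := kle r.
    by rewrite ler_pM.
  split; split => // w.
    by apply: (ck k1) => // r; rewrite addr_ge0//= lerDl addr_ge0.
  by apply: (ck k2) => // r; rewrite addr_ge0//= lerDr addr_ge0.
have SM : small P [set w | pint kk tm w <= n%:R + n%:R /\ exists2 t, 0 <= t <= tm & 2 * (eta / 4) <= pint Dd t w] (rho / 4).
  apply: (hs d T P F hF (pint Dd) Dd (fun r w => zu z (p i) (Y r w) - zu z (p' i) (Y' r w))
     (fun r w => e r w - e' r w) kk (zCu z * zdel z i)).
  - by rewrite mulr_ge0 ?zCu0 ?zdel0.
  - exact: h3.
  - exact: pint_absc.
  - exact: bDd.
  - by move=> w; exact: pint0.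
  - exact: pk.
  - exact: bk.
  - exact: kk0.
  - exact: pee.
  - exact: bee.
  - exact: progB (prog_comp (zU_meas z (p i) (zf_bmeas z (p i))) pY) (prog_comp (zU_meas z (p' i) (zf_bmeas z (p' i))) pY').
  - move=> r w hr; rewrite DdE.
    apply: (le_trans (ler_distD (zu z (p i) (Y' r w)) _ _)); apply: lerD; first exact: zu_lip.
    by apply: zu_del; [exact: pg|exact: pg'].
  - move=> c dc hc bc.
    rewrite (ito_diff hL z x0 (p i) (p' i) (ha j) (ha' j) (zf_bmeas z (p i)) (zf_bmeas z (p' i)) tm0 hc bc).
    apply: ET_eq => r w _; congr (_ * (_ + _ * _)); rewrite -!zvE /e /e' /defect !zkE /Dd.
    have key (v b k v' b' k' : R) : v * b - k - (v' * b' - k') = (1 + v) * b - k - ((1 + v') * b' - k') - (b - b') by ring.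
    exact: key.
  - exact: ET_path_le.
  - move=> c dc hw; have [tw1 tw2] := tw c dc hw.
    have q1 := w1 c dc tw1; have q2 := w2 c dc tw2.
    have [hc c01 _] := hw.
    have ec : ebd tm c.
      have [pc _ _ _] := hc; apply: (prog_ebd hL) => //; exists 1 => r w.
      by have [_ c1 _ _] := tw1; have /andP[y0 y1] := c1 r w; rewrite ger0_norm.
    have eE := exp_ebd (T := T) z tm.
    have eg1 := prog_ebd hL tm he.1 he.2; have eg2 := prog_ebd hL tm he'.1 he'.2.
    rewrite (@ET_eq _ _ _ P tm _ (fun r w => expR (- (lam * r)) * (c r w * e r w) - expR (- (lam * r)) * (c r w * e' r w))); last first.
      by move=> r w _; rewrite -mulrBr -mulrBr.
    rewrite ETB; [|by apply: ebdM => //; exact: ebdM..].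
    exact: (norm_half q1 q2).
have sH : small P (H n) (rho / 4) by exists (H n); split.
have SS := smallU (smallU SM sH) (smallU s3 s4).
rewrite (_ : rho = rho / 4 + rho / 4 + (rho / 4 + rho / 4)); last by field.
apply: (small_sub SS) => w [t ht hAt].
have [g1|g1] := leP (eta / 4) (gap (pint (a j)) A t w); first by right; left; exists t.
have [g2|g2] := leP (eta / 4) (gap (pint (a' j)) A' t w); first by right; right; exists t.
left; have [hw|hw] := pselect (H n w); [by right|left]; split.
  have le_n l : m l w + m' l w <= n%:R.
    by rewrite leNgt; apply/negP => q; apply: hw; exists l.
  rewrite /kk (pintD _ _ tm w hk1 hk2) (pintD _ _ tm w (hn _ (ha i)) (hn _ (ha j))) (pintD _ _ tm w (hn _ (ha' i)) (hn _ (ha' j))).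
  by rewrite addrACA lerD// ?le_n.
exists t => //; rewrite (pintB hL t w (ha j) (ha' j)).
move: g1 g2 hAt; rewrite /gap.
exact: gap_quarter.
Qed.

Definition driven_solution (A : R -> T -> R) := [/\ prog F A, forall w, continuous (A ^~ w),
  forall tm eta rho : R, 0 <= tm -> 0 < eta -> 0 < rho -> exists N, forall k, (N <= k)%N ->
    small P (exceed tm eta (gap (pint (fun r w => zmu z k (Xs (L := L) x0 A r w))) A)) rho &
  exists2 nk : nat -> nat, {homo nk : i j / (i < j)%N} &
    P.-negligible [set w | ~ forall t : R, 0 <= t -> exists M : R, forall k,
      pint (fun r w => `|zmu z (nk k) (Xs (L := L) x0 A r w)|) t w <= M]].

(** The levels form a subsequence of [nk], along which the variations are bounded, sparse enough for
    Borel-Cantelli to give uniform convergence path by path. *)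
Lemma driven_solves A : driven_solution A -> exists p N0, solves A p N0.
Proof.
move=> [pA cA ucp [nk nk_lt [N2 [mN2 PN2 hN2]]]].
have nk_ge i : (i <= nk i)%N.
  by elim: i => // i IH; exact: leq_ltn_trans IH (nk_lt _ _ (ltnSn i)).
have hi (i : nat) := ucp i%:R (2^-1 ^+ i) (2^-1 ^+ i) (ler0n R i) (exprn_gt0 i _) (exprn_gt0 i _).
have i2 : 0 < 2^-1 :> R by rewrite invr_gt0.
have {}hi := hi i2 i2.
have [Nf hNf] := choice hi.
have [q [q_lt q_ge]] := fast_seq Nf.
pose p i := nk (q i).
have p_ge i : (i <= p i)%N.
  by have [_ h2] := q_ge i; exact: leq_trans h2 (nk_ge _).
pose Ev i := exceed i%:R (2^-1 ^+ i) (gap (pint (fun r w => zmu z (p i) (Xs (L := L) x0 A r w))) A).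
have smE i : small P (Ev i) (2^-1 ^+ i).
  by have [h1 _] := q_ge i; apply: hNf; exact: leq_trans h1 (nk_ge _).
have [N1 [mN1 PN1 hN1]] := borel_cantelli smE.
exists p, (N1 `|` N2); split; [by split|exact: p_ge| | |].
- split; first exact: measurableU.
  have nn : P.-negligible (N1 `|` N2) by apply: negligibleU; [exists N1; split|exists N2; split].
  have mU : measurable (N1 `|` N2) by exact: measurableU.
  exact/negligibleP.
- split.
    move=> w /not_orP[n1 n2] tm eta e0.
    have [m hm] := hN1 w n1; have [k hk] := nat_ge tm.
    have c : (2^-1 ^+ n : R) @[n --> \oo] --> 0.
      by apply: cvg_expr; rewrite ger0_norm// invf_lt1// ltr1n.
    have [I hI] := cvg0_le c e0.
    exists (maxn m (maxn k I)) => i; rewrite !geq_max => /and3P[i1 i3 i4] t /andP[t0 tt].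
    apply: le_trans (hI i i4); rewrite leNgt; apply/negP => hh; apply: (hm i i1).
    by exists t; [rewrite t0 (le_trans tt)// hk|exact: ltW].
  move=> tm eta rho tm0 e0 r0; have [I hI] := ucp tm eta rho tm0 e0 r0.
  by exists I => i Ii; apply: hI; exact: leq_trans Ii (p_ge i).
move=> w /not_orP[n1 n2] tm tm0; have : ~ ~ (forall t : R, 0 <= t -> exists M : R, forall k,
      pint (fun r w => `|zmu z (nk k) (Xs (L := L) x0 A r w)|) t w <= M).
  by move=> hh; apply: n2; exact: hN2.
by move=> /contrapT /(_ tm tm0)[M hM]; exists M => i; exact: hM.
Qed.

(** The estimate is one-sided and is therefore used in both orders. Horizon [i] and threshold [2^-i]
    are coupled, so that countably many null events cover every separation of the paths. *)
Lemma driven_unique A A' : driven_solution A -> driven_solution A' ->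
  P.-negligible [set w | exists2 t, 0 <= t & A t w != A' t w].
Proof.
move=> /driven_solves[p [N0 h1]] /driven_solves[p' [N0' h2]].
have i2 i : 0 < 2^-1 ^+ i :> R by rewrite exprn_gt0.
pose G (B B' : R -> T -> R) (i : nat) := exceed i%:R (2^-1 ^+ i) (fun t w => B t w - B' t w).
have n1 i : P.-negligible (G A A' i).
  by apply: small_negligible => rho r0; exact: solves_le h1 h2 (ler0n _ _) (i2 i) r0.
have n2 i : P.-negligible (G A' A i).
  by apply: small_negligible => rho r0; exact: solves_le h2 h1 (ler0n _ _) (i2 i) r0.
apply: (negligibleS (A := \bigcup_i (G A A' i `|` G A' A i))); last first.
  by apply: negligible_bigcup => i; exact: negligibleU.
move=> w [t t0 /eqP tA].
have c : (2^-1 ^+ n : R) @[n --> \oo] --> 0.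
  by apply: cvg_expr; rewrite ger0_norm// invf_lt1// ltr1n.
have d0 : 0 < `|A t w - A' t w| by rewrite normr_gt0 subr_eq0; apply/eqP.
have [I hI] := cvg0_le c d0; have [k hk] := nat_ge t.
exists (maxn I k) => //.
have a1 := hI (maxn I k) (leq_maxl _ _); have a2 := hk (maxn I k) (leq_maxr _ _).
have [hd|hd] := leP 0 (A t w - A' t w); [left|right]; (exists t; first by rewrite t0).
  by rewrite ger0_norm in a1.
by rewrite ltr0_norm// opprB in a1.
Qed.

End two_solutions.

(** * From charges and Levy processes to the data above *)

Section variation.
Context (R : realType) (mu : finite_signed_measure R).
Notation mT := (measurableTypeR R).
Notation pos := (jordan_pos (hahn_posnegP mu)).
Notation neg := (jordan_neg (hahn_posnegP mu)).

Let tv_fin : fin_num_fun (Defs.total_variation mu).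
Proof. by move=> A mA; rewrite /Defs.total_variation /charge_variation fin_numD !fin_num_measure. Qed.

HB.instance Definition _ := @Measure_isFinite.Build _ _ _ (Defs.total_variation mu) tv_fin.

Definition hahn_sign (y : R) : R := 2 * \1_(hahn_pos mu) y - 1.

Lemma hahn_sign_bmeas : bmeas hahn_sign 1.
Proof.
split.
  apply: mrB; last exact: mrcst.
  apply: mrM; first exact: mrcst.
  by apply: measurable_indic; have [[]] := hahn_posnegP mu.
move=> y; rewrite /hahn_sign indicE; case: (_ \in _) => /=.
  by rewrite mulr1 ger0_norm; lra.
by rewrite mulr0 sub0r normrN1.
Qed.

Let bnd_itg (m : {finite_measure set mT -> \bar R}) (f : R -> R) M : bmeas f M -> itg m setT (f : mT -> R).
Proof.
move=> [mf fM]; apply: (itg_bnd _ (M := M)) => //.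
by rewrite ltey_eq fin_num_measure.
Qed.

Let int_tv (f : R -> R) M : bmeas f M ->
  \int[Defs.total_variation mu]_y f y = \int[pos]_y f y + \int[neg]_y f y.
Proof.
move=> bf; have i1 := bnd_itg pos bf; have i2 := bnd_itg neg bf.
rewrite /Rintegral -fineD; [|exact: integrable_fin_num|exact: integrable_fin_num].
congr fine; rewrite -integral_measure_add//.
by apply: eq_measure_integral => A mA _; exact/esym/measure_addE.
Qed.

Let int_null (m : {finite_measure set mT -> \bar R}) (B : set mT) (f : R -> R) M : measurable B -> m B = 0%E ->
  bmeas f M -> \int[m]_y (f y * \1_B y) = 0.
Proof.
move=> mB m0 [mf fM]; have b1 : bmeas (\1_B : R -> R) 1.
  split; first exact: measurable_indic.
  by move=> y; rewrite indicE; case: (_ \in _); rewrite ?normr1 ?normr0.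
apply/eqP; rewrite -normr_le0.
apply: (@le_trans _ _ (\int[m]_y (M * \1_B y))).
  apply: int_dom => //; first by apply: mrM => //; have [] := b1.
    by apply: itgZ => //; exact: bnd_itg b1.
  move=> y _; rewrite normrM [X in _ * X]ger0_norm ?indicE//.
  by rewrite ler_wpM2r.
rewrite RintegralZl//; last exact: bnd_itg b1.
suff -> : \int[m]_y (\1_B y : R) = 0 by rewrite mulr0.
by rewrite /Rintegral integral_indic// setIT; exact: (congr1 fine m0).
Qed.

(** The positive Jordan part does not charge the complement of the positive set, nor the negative
    part the positive set; adding null integrals with factors [-2] and [2] replaces the constant
    sign by [hahn_sign]. *)
Lemma signed_integralE (f : R -> R) M : bmeas f M ->
  signed_integral mu f = \int[Defs.total_variation mu]_y (f y * hahn_sign y).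
Proof.
move=> bf; have [mf fM] := bf; have [mh hh] := hahn_sign_bmeas.
have [[mP _] [mN _] PN PN0] := hahn_posnegP mu.
have bfh : bmeas (fun y => f y * hahn_sign y) (M * 1).
  by split; [exact: mrM|move=> y; rewrite normrM ler_pM].
have b2f (c : R) : bmeas (fun y => c * f y) (`|c| * M).
  by split; [apply: mrM => //; exact: mrcst|move=> y; rewrite normrM ler_wpM2l].
have b1 (B : set mT) : measurable B -> bmeas (\1_B : R -> R) 1.
  move=> mB; split; first exact: measurable_indic.
  by move=> y; rewrite indicE; case: (_ \in _); rewrite ?normr1 ?normr0.
have bfi (c : R) (B : set mT) : measurable B -> bmeas (fun y => c * f y * \1_B y) (`|c| * M * 1).
  move=> mB; have [m1 h1] := b2f c; have [m2 h2] := b1 B mB.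
  by split; [exact: mrM|move=> y; rewrite normrM ler_pM].
have npos : pos (~` hahn_pos mu) = 0%E.
  rewrite jordan_posE cjordan_posE /crestr0 mem_set; last exact: measurableC.
  by rewrite /crestr setICl charge0.
have nneg : neg (hahn_pos mu) = 0%E.
  by rewrite jordan_negE cjordan_negE /crestr0 mem_set// /crestr PN0 charge0 oppe0.
rewrite (int_tv bfh) /signed_integral; congr (_ + _).
  rewrite -[LHS]addr0 -(int_null (measurableC mP) npos (b2f (-2))) -RintegralD//.
  - apply: int_eq => y _; rewrite /hahn_sign !indicE in_setC.
    by case: (_ \in _) => /=; ring.
  - exact: bnd_itg bf.
  - exact: bnd_itg (bfi (-2) _ (measurableC mP)).
rewrite -[LHS]addr0 -(int_null mP nneg (b2f 2)) -mulN1r -RintegralZl//; last exact: bnd_itg bf.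
rewrite -RintegralD//.
- by apply: int_eq => y _; rewrite /hahn_sign; ring.
- by apply: itgZ => //; exact: bnd_itg bf.
- exact: bnd_itg (bfi 2 _ mP).
Qed.

(** A radius [r] with Kato modulus at most one bounds the near part, and finiteness of the measure
    the far part, where the kernel is at most [r^(eta - 1)]. On the diagonal [sing] takes the value
    0 and the kernel of the modulus [+oo], so the comparison is valid there too. *)
Lemma kato_sing eta : 0 < eta < 1 -> mu \in kato_class_finite eta -> exists N : R,
  forall x : R, itg (Defs.total_variation mu) setT (fun y : mT => sing eta (x - y)) /\
    \int[Defs.total_variation mu]_y sing eta (x - y) <= N.
Proof.
move=> /andP[e0 e1] /set_mem hk.
have [r [r0 [rf r1]]] : exists r : R, 0 < r /\ (kato_modulus eta mu r \is a fin_num /\ fine (kato_modulus eta mu r) <= 1).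
  have /fine_cvgP[h1 h2] := hk.
  have h3 : \forall r \near 0^'+, fine (kato_modulus eta mu r) <= 1.
    have /cvgrPdist_le /(_ 1 ltr01) := h2; apply: filterS => r /=.
    by rewrite sub0r normrN; apply: le_trans; exact: ler_norm.
  have h4 : \forall r \near 0^'+, 0 < r :> R by exact: nbhs_right_gt.
  near (0 : R)^'+ => r; exists r; split; first by near: r.
  by split; near: r.
set tv := Defs.total_variation mu.
have tvf : (tv setT < +oo)%E by rewrite ltey_eq fin_num_measure.
exists (1 + r `^ (eta - 1) * fine (tv setT)) => x.
pose f (y : mT) := sing eta (x - y).
have mf : measurable_fun setT f.
  apply: (mrcomp (h := fun u => u `^ (eta - 1))); first exact: measurable_powR.
  by apply: mrnorm; apply: mrB; [exact: mrcst|exact: measurable_id].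
have f0 y : 0 <= f y by exact: powR_ge0.
have mB : measurable (ball x r : set mT).
  by rewrite ball_itv; exact: measurable_itv.
have I1 : (\int[tv]_(y in (ball x r : set mT)) (f y)%:E <= 1%:E)%E.
  apply: (@le_trans _ _ (kato_modulus eta mu r)); last by rewrite -(fineK rf) lee_fin.
  apply: (@le_trans _ _ (\int[tv]_(y in (ball x r : set mT)) (((`|x - y| `^ (1 - eta))%:E)^-1))%E); last first.
    by apply: ereal_sup_ubound; exists x.
  apply: ge0_le_integral => //.
  - by move=> y _; rewrite lee_fin.
  - by apply/measurable_EFinP; exact: measurable_funTS.
  - under eq_fun do rewrite inver.
    have mp : measurable_fun setT (fun y : mT => `|x - y| `^ (1 - eta)).
      apply: (mrcomp (h := fun u => u `^ (1 - eta))); first exact: measurable_powR.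
      by apply: mrnorm; apply: mrB; [exact: mrcst|exact: measurable_id].
    apply: measurable_funTS; apply: measurable_fun_ifT.
    + by apply: measurable_fun_eqr => //; exact: mrcst.
    + exact: measurable_cst.
    + apply/measurable_EFinP; under eq_fun do rewrite -powR_inv1 ?powR_ge0//.
      exact: (measurableT_comp (measurable_powR _) mp).
  move=> y _; rewrite inver; case: eqP => [_|/eqP p0]; first by rewrite leey.
  rewrite lee_fin /f /sing -powRN opprB//.
have I2 : (\int[tv]_(y in ~` (ball x r : set mT)) (f y)%:E <= (r `^ (eta - 1) * fine (tv setT))%:E)%E.
  apply: (@le_trans _ _ (\int[tv]_(y in ~` (ball x r : set mT)) (r `^ (eta - 1))%:E)%E).
    apply: ge0_le_integral => //.
    - exact: measurableC.
    - by move=> y _; rewrite lee_fin.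
    - by apply/measurable_EFinP; exact: measurable_funTS.
    move=> y /= /negP; rewrite /ball/= -leNgt => ry; rewrite lee_fin /f /sing.
    have -> : eta - 1 = - (1 - eta) by rewrite opprB.
    rewrite !powRN lef_pV2 ?posrE ?powR_gt0//; last by rewrite (lt_le_trans r0).
    by rewrite ge0_ler_powR ?nnegrE// ?subr_ge0 ltW.
  rewrite integral_cst; last exact: measurableC.
  rewrite EFinM lee_wpmul2l ?lee_fin ?powR_ge0// fineK ?fin_num_measure//.
  by apply: le_measure; rewrite ?inE//; exact: measurableC.
have I : (\int[tv]_y (f y)%:E <= (1 + r `^ (eta - 1) * fine (tv setT))%:E)%E.
  move: I2; set Q := r `^ _ * _ => I2.
  rewrite -(setUv (ball x r : set mT)) ge0_integral_setU//.
  - by rewrite EFinD leeD.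
  - exact: measurableC.
  - by rewrite setUv; exact/measurable_EFinP.
  - by move=> y _; rewrite lee_fin.
  - by apply/disj_setPCl.
have itf : itg tv setT f.
  apply/integrableP; split; first exact/measurable_EFinP.
  under eq_integral do rewrite /= ger0_norm//.
  by rewrite (le_lt_trans I)// ltry.
split => //; rewrite -lee_fin /Rintegral fineK//; exact: integrable_fin_num.
Unshelve. all: by end_near.
Qed.

End variation.

(** * Modifications on null sets *)

Section off_null_set.
Context (R : realType) d (T : measurableType d) (P : probability T R) (N : set T).
Hypothesis mN : measurable N.
Hypothesis PN : P N = 0%E.

Lemma P_eq_off (A B : set T) : measurable A -> measurable B ->
  (forall w, ~ N w -> A w <-> B w) -> P A = P B.
Proof.
move=> mA mB AB.
have le (C D : set T) : measurable C -> measurable D -> (forall w, ~ N w -> C w -> D w) -> (P C <= P D)%E.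
  move=> mC mD CD; rewrite -[leRHS]adde0 -PN.
  apply: (le_trans _ (measureU2 P mD mN)); apply: le_measure; rewrite ?inE//.
    exact: measurableU.
  by move=> w Cw; have [nw|nw] := pselect (N w); [right|left; exact: CD].
by apply/eqP; rewrite eq_le !le// => w nw; have [] := AB w nw.
Qed.

Lemma int_eq_off (f g : T -> R) (K : R) : measurable_fun setT f -> measurable_fun setT g ->
  (forall w, `|f w| <= K) -> (forall w, `|g w| <= K) -> (forall w, ~ N w -> f w = g w) ->
  \int[P]_w f w = \int[P]_w g w.
Proof.
move=> mf mg fK gK fg; have Pf := P_lty P.
have i1 : itg P setT f by apply: (itg_bnd _ (M := K)).
have i2 : itg P setT g by apply: (itg_bnd _ (M := K)).
have c := @int_bounded_cvg0 R d T P (fun _ w => f w - g w) (K + K) N mN PN.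
have {}c : (fun _ : nat => \int[P]_w (f w - g w)) n @[n --> \oo] --> (0 : R).
  apply: c => [_|_ w|w nw]; first exact: mrB.
    by rewrite (le_trans (ler_normB _ _))// lerD.
  by rewrite fg// subrr; exact: cvg_cst.
apply/eqP; rewrite -subr_eq0 -RintegralB//; apply/eqP.
exact: (cvg_unique (@Rhausdorff R) (@cvg_cst _ _ _ _ _) c).
Qed.

End off_null_set.

(** * A regular version of the noise *)

Section noise.
Context {R : realType} {d} {T : measurableType d} {P : probability T R}.
Context {alpha : R} {L : R -> T -> R}.
Notation F := (generated_filtration P L).
Hypothesis hS : symmetric_stable_process P alpha F L.

Lemma generated_null N t : 0 <= t -> measurable N -> P N = 0%E -> F t N.
Proof. by move=> t0 mN PN; apply: sub_gen_smallest; right. Qed.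

Let hF : filtration F. Proof. by have [[[]]] := hS. Qed.

(* [F] contains the null events, so this modification is still adapted. *)
Definition noise_version (N : set T) r w := if pselect (N w) then 0 else L (Num.max r 0) w.

Context (N : set T).
Hypothesis mN : measurable N.
Hypothesis PN : P N = 0%E.
Hypothesis Ncad : forall w, ~ N w -> cadlag (L ^~ w).
Let L0 := noise_version N.

Let noise_in r w : N w -> L0 r w = 0.
Proof. by move=> nw; rewrite /L0 /noise_version; case: pselect. Qed.

Let noise_out r w : ~ N w -> L0 r w = L (Num.max r 0) w.
Proof. by move=> nw; rewrite /L0 /noise_version; case: pselect. Qed.

Lemma noise_off t w : ~ N w -> 0 <= t -> L0 t w = L t w.
Proof. by move=> nw t0; rewrite noise_out// max_l. Qed.

Lemma noise_cadlag w : (forall t, 0 <= t -> L0 s w @[s --> t^'+] --> L0 t w) /\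
  (forall t, 0 < t -> cvg (L0 s w @[s --> t^'-])).
Proof.
have [nw|nw] := pselect (N w).
  have -> : L0 ^~ w = fun=> 0 by apply/funext => r; exact: noise_in.
  split=> t _; first by rewrite (noise_in t nw); exact: cvg_cst.
  by apply/cvg_ex; exists 0; exact: cvg_cst.
have [rc ll] := Ncad nw; split => t t0.
  rewrite (noise_off nw t0); apply: cvg_trans (rc t t0); apply: near_eq_cvg.
  near=> s; apply: esym; apply: noise_off => //; apply: (le_trans t0).
  by near: s; exact: nbhs_right_ge.
apply/cvg_ex; exists (lim (L s w @[s --> t^'-])); apply: cvg_trans (ll t t0); apply: near_eq_cvg.
near=> s; apply: esym; apply: noise_off => //.
by near: s; exact: nbhs_left_ge.
Unshelve. all: by end_near.
Qed.

Let adL t : 0 <= t -> Fmeas F t (L t).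
Proof.
move=> t0 _ B mB; rewrite setTI (Ft_measE hF)//.
by have [[[_ ad] _ _ _ _] _] := hS; exact: ad.
Qed.

Let adL0 t : 0 <= t -> Fmeas F t (L0 t).
Proof.
move=> t0.
have mC : measurable (~` N : set (g_sigma_algebraType (F t))).
  by apply: measurableC; rewrite (Ft_measE hF)//; exact: generated_null.
rewrite /Fmeas (_ : L0 t = fun w : g_sigma_algebraType (F t) => L t w * \1_(~` N) w).
  by apply: mrM; [exact: adL|exact: measurable_indic].
apply/funext => w; rewrite indicE; have [nw|nw] := pselect (N w).
  have -> : (w \in ~` N) = false by apply: memNset => q; exact: q nw.
  by rewrite mulr0 noise_in.
have -> : (w \in ~` N) = true by exact: mem_set.
by rewrite mulr1 noise_off.
Qed.

Lemma noise_prog : prog F L0.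
Proof.
apply: (prog_rc hF) => [r w|t t0|w t t0]; last by have [h _] := noise_cadlag w; exact: h.
  have [nw|nw] := pselect (N w); first by rewrite !noise_in.
  by rewrite !noise_out// [in RHS]max_l// le_max lexx orbT.
exact: adL0.
Qed.

Let mL t : 0 <= t -> measurable_fun setT (L t). Proof. by move=> t0; exact: (Fmeas_meas hF t0 (adL t0)). Qed.
Let mL0 t : 0 <= t -> measurable_fun setT (L0 t). Proof. by move=> t0; exact: (Fmeas_meas hF t0 (adL0 t0)). Qed.

Let mpre (f : T -> R) C : measurable_fun setT f -> measurable C -> measurable (f @^-1` C).
Proof. by move=> mf mC; rewrite -[X in measurable X]setTI; exact: mf. Qed.

(** Removing the null set and using stationarity reduces an increment to [L (t - s)], whose
    characteristic function is prescribed. *)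
Let int_incr s t (g : R -> R) : 0 <= s -> s <= t -> measurable_fun setT g -> (forall x, `|g x| <= 1) ->
  \int[P]_w g (increment L0 s t w) = \int[P]_w g (L (t - s) w).
Proof.
move=> s0 st mg g1; have t0 : 0 <= t by exact: le_trans st.
have ts : 0 <= t - s by rewrite subr_ge0.
have mI : measurable_fun setT (increment L s t) by apply: mrB; exact: mL.
have mI0 : measurable_fun setT (increment L0 s t) by apply: mrB; exact: mL0.
rewrite (int_eq_off mN PN (f := fun w => g (increment L0 s t w)) (g := fun w => g (increment L s t w)) (K := 1))//.
- have ig (f : T -> R) : measurable_fun setT f -> itg P setT (g \o f).
    move=> mf; apply: (itg_bnd _ (M := 1)) => //; first exact: P_lty.
      exact: (measurableT_comp mg mf).
    by move=> w _; exact: g1.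
  rewrite -(int_pushm mI mg (ig _ mI)) -(int_pushm (mL ts) mg (ig _ (mL ts))).
  rewrite /Rintegral; congr fine; apply: eq_measure_integral => A mA _.
  by have [[_ _ _ _ st'] _] := hS; exact: st'.
- exact: (measurableT_comp mg mI0).
- exact: (measurableT_comp mg mI).
- by move=> w nw; rewrite /increment !noise_off.
Qed.

Lemma noise_driver : driver P F alpha L0.
Proof.
have [[_ _ _ ind _] ch] := hS.
split.
- exact: hF.
- exact: noise_prog.
- move=> s t s0 st B C FB mC; have t0 : 0 <= t by exact: le_trans st.
  have mI : measurable_fun setT (increment L s t) by apply: mrB; exact: mL.
  have mI0 : measurable_fun setT (increment L0 s t) by apply: mrB; exact: mL0.
  have mB : measurable B by have [_ FM _] := hF; exact: FM FB.
  have E w : ~ N w -> increment L0 s t w = increment L s t w.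
    by move=> nw; rewrite /increment !noise_off.
  rewrite (P_eq_off mN PN (B := B `&` increment L s t @^-1` C)).
  + rewrite (P_eq_off mN PN (A := increment L0 s t @^-1` C) (B := increment L s t @^-1` C)).
    * exact: ind.
    * exact: mpre.
    * exact: mpre.
    * by move=> w nw; rewrite /preimage/= E.
  + by apply: measurableI => //; exact: mpre.
  + by apply: measurableI => //; exact: mpre.
  + by move=> w nw; rewrite /preimage/= E.
- move=> s t xi s0 st; have ts : 0 <= t - s by rewrite subr_ge0.
  rewrite (int_incr (g := fun x => cos (xi * x)) s0 st).
  + by have := ch (t - s) xi ts; rewrite /char_fun => -[].
  + by mr.
  + by move=> x; exact: cos_max.
- move=> s t xi s0 st; have ts : 0 <= t - s by rewrite subr_ge0.
  rewrite (int_incr (g := fun x => sin (xi * x)) s0 st).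
  + by have := ch (t - s) xi ts; rewrite /char_fun => -[].
  + by mr.
  + by move=> x; exact: sin_max.
Qed.

End noise.

Section half_line.
Context (R : realType).

Lemma within_half_line (f : R -> R) : {within `[0, +oo[, continuous f} ->
  continuous (fun r : R => f (Num.max r 0)).
Proof.
move=> hf r; apply/cvgrPdist_le => e e0.
have m0 (x : R) : 0 <= Num.max x 0 by rewrite le_max lexx orbT.
have ir : `[0, +oo[%classic (Num.max r 0) by rewrite /= in_itv/= m0.
have /subspace_continuousP/(_ _ ir) := hf.
move=> /cvgrPdist_le /(_ e e0); rewrite near_withinE => /nbhs_ballP[dl /= dl0 hd].
apply/nbhs_ballP; exists dl => //= s rs; apply: hd; last by rewrite /= in_itv/= m0.
by apply: le_lt_trans rs; exact: pospart_lip.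
Qed.

End half_line.

(** * Uniform convergence in probability *)

Section running_supremum.
Context {R : realType} {d} {T : measurableType d} (P : probability T R).
Implicit Types Y A : R -> T -> R.

Lemma running_sup_exceed Y t (eta : R) w : 0 < eta -> exceed t eta (fun s w => `|Y s w|) w ->
  ((eta / 2)%:E < running_sup Y t w)%E.
Proof.
move=> e0 [s hs hw]; apply: (@lt_le_trans _ _ `|Y s w|%:E).
  by rewrite lte_fin (lt_le_trans _ hw)// ltr_pdivrMr// ltr_pMr// ltr1n.
by apply: ereal_sup_ubound; exists s => //; rewrite /= in_itv.
Qed.

Lemma exceed_running_sup Y t (eta : R) w : (eta%:E < running_sup Y t w)%E ->
  exists2 s, 0 <= s <= t & eta < `|Y s w|.
Proof.
move=> /ereal_sup_gt[_ [s /= + <-]]; rewrite in_itv/= lte_fin => hs h.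
by exists s.
Qed.

(** For continuous paths a strict inequality persists at some time of a grid [t * k / n.+1], which
    reduces the supremum to countably many times. *)
Lemma running_sup_meas Y t (eta : R) : 0 <= t -> (forall s, 0 <= s -> measurable_fun setT (Y s)) ->
  (forall w, continuous (fun r : R => Y (Num.max r 0) w)) ->
  measurable [set w | (eta%:E < running_sup Y t w)%E].
Proof.
move=> t0 mY cY.
pose q (n k : nat) := t * k%:R / n.+1%:R.
have q0 n k : 0 <= q n k by rewrite /q divr_ge0// mulr_ge0.
have -> : [set w | (eta%:E < running_sup Y t w)%E] =
    \bigcup_n \bigcup_(k in [set k | (k <= n.+1)%N]) (Y (q n k) @^-1` [set x | eta < `|x|]).
  apply/seteqP; split => w /=.
    move=> /exceed_running_sup[s /andP[s0 st] hs].
    have c := cY w s; have e0 : 0 < `|Y s w| - eta by rewrite subr_gt0.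
    move: c => /cvgrPdist_lt /(_ _ e0) /nbhs_ballP[dl /= dl0 hd].
    have [n hn] := nat_ge (t / dl).
    have [tz|tp] := eqVneq t 0.
      exists 0%N => //; exists 0%N => //=.
      have -> : q 0%N 0%N = s by rewrite /q mulr0 mul0r; apply/eqP; rewrite eq_le s0/= -tz st.
      exact: hs.
    have tp0 : 0 < t by rewrite lt_neqAle eq_sym tp.
    have sn0 : 0 <= s * n.+1%:R / t by rewrite divr_ge0// mulr_ge0.
    have /andP[k1 k2] := truncn_itv sn0.
    set k := Num.truncn _ in k1 k2.
    exists n => //; exists k => /=.
      rewrite -(ler_nat R) (le_trans k1)// ler_pdivrMr// mulrC ler_wpM2l//.
    have d1 : `|s - q n k| < dl.
      have n0 : 0 < n.+1%:R :> R by rewrite ltr0n.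
      have h1 : q n k <= s by rewrite /q ler_pdivrMr// mulrC -ler_pdivlMr.
      have h2 : s < q n k + t / n.+1%:R.
        rewrite /q -mulrDl -[X in _ + X]mulr1 -mulrDr ltr_pdivlMr// mulrC [ltRHS]mulrC -ltr_pdivrMr// mulrC.
        by rewrite natr1.
      have h3 : t / n.+1%:R < dl.
        rewrite ltr_pdivrMr// mulrC -ltr_pdivrMr//; apply: (le_lt_trans (hn n (leqnn n))).
        by rewrite ltr_nat.
      by rewrite ger0_norm ?subr_ge0// ltrBlDl (lt_trans h2)// ltrD2l.
    have := hd (q n k) d1; rewrite max_l// max_l// => h.
    have := ler_distD 0 (Y s w) (Y (q n k) w).
    have := lerB_dist (Y s w) (Y (q n k) w); lra.
  move=> [n _ [k /= kn hw]]; apply: (@lt_le_trans _ _ `|Y (q n k) w|%:E).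
    by rewrite lte_fin.
  apply: ereal_sup_ubound; exists (q n k) => //=; rewrite in_itv/= q0/=.
  by rewrite /q ler_pdivrMr ?ltr0n// ler_wpM2l// ler_nat.
apply: bigcupT_measurable => n; apply: bigcup_measurable => k _.
rewrite (_ : _ @^-1` _ = (fun w => `|Y (q n k) w|) @^-1` `]eta, +oo[); last first.
  by apply/seteqP; split => w /=; rewrite in_itv/= andbT.
by rewrite -[X in measurable X]setTI; exact: (mrnorm (mY _ (q0 n k))).
Qed.

(** Measurability of the event for the running supremum allows its probability to be compared with
    that of the cover. *)
Lemma ucp_of_small (Y : nat -> R -> T -> R) A : (forall n s, 0 <= s -> measurable_fun setT (Y n s)) ->
  (forall s, 0 <= s -> measurable_fun setT (A s)) ->
  (forall n w, continuous (fun r : R => Y n (Num.max r 0) w)) ->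
  (forall w, continuous (fun r : R => A (Num.max r 0) w)) ->
  (forall tm eta rho : R, 0 <= tm -> 0 < eta -> 0 < rho -> exists N, forall k, (N <= k)%N ->
    small P (exceed tm eta (gap (Y k) A)) rho) -> ucp_cvg P Y A.
Proof.
move=> mY mA cY cA H t eps t0 e0.
pose E n := [set w | (eps%:E < running_sup (fun s w => (Y n s w - A s w)%R) t w)%E].
have mE n : measurable (E n).
  apply: running_sup_meas => // [s s0|w]; first by apply: mrB; [exact: mY|exact: mA].
  by move=> r; apply: cvgB; [exact: cY|exact: cA].
have PE n : P (E n) \is a fin_num by exact: fin_num_measure.
apply/fine_cvgP; split; first exact: nearW.
apply/cvgrPdist_le => rho r0; have [N hN] := H t eps rho t0 e0 r0.
exists N => // n /= Nn; rewrite sub0r normrN ger0_norm ?fine_ge0//.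
have [B [mB EB PB]] := hN n Nn.
have PEB : (P (E n) <= P B)%E.
  apply: le_measure; rewrite ?inE//.
  by move=> w /exceed_running_sup[s hs hw]; apply: EB; exists s => //; exact: ltW.
by have := le_trans PEB PB; rewrite -[X in (X <= _)%E]fineK// lee_fin.
Qed.

Lemma small_of_ucp (Y : nat -> R -> T -> R) A : (forall n s, 0 <= s -> measurable_fun setT (Y n s)) ->
  (forall s, 0 <= s -> measurable_fun setT (A s)) ->
  (forall n w, continuous (fun r : R => Y n (Num.max r 0) w)) ->
  (forall w, continuous (fun r : R => A (Num.max r 0) w)) -> ucp_cvg P Y A ->
  forall tm eta rho : R, 0 <= tm -> 0 < eta -> 0 < rho -> exists N, forall k, (N <= k)%N ->
    small P (exceed tm eta (gap (Y k) A)) rho.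
Proof.
move=> mY mA cY cA H tm eta rho tm0 e0 r0.
(* Half the threshold, since [exceed] has a weak inequality and [ucp_cvg] a strict one. *)
have e2 : 0 < eta / 2 by rewrite divr_gt0.
have /fine_cvgP[_ /cvgrPdist_le /(_ rho r0)[N _ hN]] := H tm (eta / 2) tm0 e2.
exists N => n Nn; exists [set w | ((eta / 2)%:E < running_sup (fun s w => (Y n s w - A s w)%R) tm w)%E].
have mE : measurable [set w | ((eta / 2)%:E < running_sup (fun s w => (Y n s w - A s w)%R) tm w)%E].
  apply: running_sup_meas => // [s s0|w]; first by apply: mrB; [exact: mY|exact: mA].
  by move=> r; apply: cvgB; [exact: cY|exact: cA].
split => //.
  by move=> w hw; exact: running_sup_exceed hw.
have := hN n Nn; rewrite /= sub0r normrN => /(le_trans (ler_norm _)) h.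
by rewrite -[X in (X <= _)%E]fineK ?fin_num_measure// lee_fin.
Qed.

End running_supremum.

Section cadlag_occupation.
Context (R : realType) d (T : measurableType d) (X : R -> T -> R) (g : R -> R) (M : R).
Hypothesis hX : cadlag_process X.
Hypothesis mg : measurable_fun setT g.
Hypothesis gM : forall x, `|g x| <= M.
Notation leb := (@lebesgue_measure R).

(** The constant filtration of all events makes the results on progressive processes available for
    plain joint measurability. *)
Let Ftop (_ : R) : set (set T) := measurable.
Let hFtop : filtration Ftop.
Proof. by split => [t _|t _|s t _ _] //; exact: sigma_algebra_measurable. Qed.

Let Xb r w := X (Num.max r 0) w.

Let m00 (r : R) : 0 <= Num.max r 0. Proof. by rewrite le_max lexx orbT. Qed.

Let pXb : prog Ftop Xb.
Proof.
have [mX cX] := hX.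
apply: (prog_rc hFtop) => [r w|t t0|w t t0].
- by rewrite /Xb [in RHS]max_l.
- move=> _ B mB; rewrite setTI (Ft_measE hFtop)// /Xb max_l//.
  by have := mX t t0 measurableT B mB; rewrite setTI.
rewrite {2}/Xb max_l//; have [rc _] := cX w; apply: cvg_trans (rc t t0).
apply: near_eq_cvg; near=> s; rewrite /Xb max_l//; apply: (le_trans t0).
by near: s; exact: nbhs_right_ge.
Unshelve. all: by end_near.
Qed.

Let pg : prog Ftop (fun r w => g (Xb r w)). Proof. exact: prog_comp. Qed.

Let bg (r : R) (w : T) : `|g (Xb r w)| <= M. Proof. exact: gM. Qed.

Lemma time_integralE t w : time_integral g X t w = pint (fun r w => g (Xb r w)) t w.
Proof. by apply: int_eq => r /=; rewrite in_itv/= => /andP[r0 _]; rewrite /Xb max_l. Qed.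

Lemma time_integral_meas t : 0 <= t -> measurable_fun setT (time_integral g X t).
Proof.
move=> t0; have -> : time_integral g X t = pint (fun r w => g (Xb r w)) t.
  by apply/funext => w; exact: time_integralE.
exact: (prog_meas hFtop (prog_int hFtop pg bg) t0).
Qed.

Lemma time_integral_cont w : continuous (fun r : R => time_integral g X (Num.max r 0) w).
Proof.
move=> r; apply/cvgrPdist_le => e e0.
have M0 : 0 <= M by exact: le_trans (normr_ge0 _) (gM 0).
have d0 : 0 < e / (M + 1) by rewrite divr_gt0// ltr_wpDl.
apply/nbhs_ballP; exists (e / (M + 1)) => //= s rs.
rewrite !time_integralE (le_trans (pint_lip hFtop w pg bg (m00 s) (m00 r)))//.
apply: (@le_trans _ _ (M * (e / (M + 1)))).
  by rewrite ler_wpM2l// (le_trans _ (ltW rs))//; exact: pospart_lip.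
by rewrite mulrA ler_pdivrMr ?ltr_wpDl// mulrDr mulr1 mulrC lerDl ltW.
Qed.

Lemma occupation_itg t w : itg leb `[0, t]%classic (fun r => g (X r w)).
Proof.
apply: (itg_bnd _ (M := M)) => //; first exact: leb_cc_fin.
apply: (eq_measurable_fun (fun r => g (Xb r w))).
  by move=> r; rewrite inE/= in_itv/= => /andP[r0 _]; rewrite /Xb max_l.
exact: measurable_funTS (prog_path hFtop w pg).
Qed.

End cadlag_occupation.

(** * Existence and uniqueness of strong solutions *)

Section strong_solutions.
Context {R : realType} {alpha x0 : R} {mu : finite_signed_measure R} {phi : R -> R}.
Context {d} {T : measurableType d} {P : probability T R} {L : R -> T -> R}.
Notation F := (generated_filtration P L).
Notation leb := (@lebesgue_measure R).
Notation kap := (Defs.total_variation mu).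
Context (z : zvonkin_data alpha phi (hahn_sign mu) kap).
Hypothesis hS : symmetric_stable_process P alpha F L.
Context (NL : set T).
Hypothesis mNL : measurable NL.
Hypothesis PNL : P NL = 0%E.
Hypothesis NLcad : forall w, ~ NL w -> cadlag (L ^~ w).
Notation L0 := (noise_version (L := L) NL).
Let hL : driver P F alpha L0 := noise_driver hS mNL PNL NLcad.
Let hF : filtration F := drF hL.

(** Writing the charge as its sign times its total variation identifies the mollified charge with a
    potential, to which the analytic part applies. *)
Lemma mollifyE n : mollify phi mu n = zmu z n.
Proof.
apply/funext => x; have [B B0 hB] := moll_bound (zphi z) n; have [K K0 hK] := moll_lip (zphi z) n.
have m : measurable_fun setT (mollifier_seq phi n) := continuous_measurable_fun (lip_continuous hK).
rewrite /mollify (@signed_integralE R mu (fun y => mollifier_seq phi n (x - y)) B)//.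
by split; [apply: (mrcomp m); apply: mrB; [exact: mrcst|exact: measurable_id]|move=> y; exact: hB].
Qed.

Let Xof (A : R -> T -> R) := Xs (L := L0) x0 A.

Lemma strong_existence : exists X, strong_solution P alpha phi mu x0 L X.
Proof.
have [A [[pA AM] cA ucp [nk nk_lt nbd]]] := driven_existence hL z x0 (fun N t => @generated_null _ _ _ _ _ N t).
have pX : prog F (Xof A).
  by apply: progD; [exact: drL hL|apply: progD => //; exact: prog_cst].
have mA t : 0 <= t -> measurable_fun setT (A t) by move=> t0; exact: (prog_meas hF pA t0).
have cX : cadlag_process (Xof A).
  split; first by move=> t t0; exact: (prog_meas hF pX t0).
  move=> w; have [rc ll] := noise_cadlag NLcad w; split => t t0.
    apply: cvgD; first exact: rc.
    by apply: cvgD; [exact: cvg_cst|exact: (cvg_at_right_filter (cA w t))].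
  apply/cvg_ex; exists (lim (L0 s w @[s --> t^'-]) + (x0 + A t w)).
  apply: cvgD; first exact: ll.
  by apply: cvgD; [exact: cvg_cst|exact: (cvg_at_left_filter (cA w t))].
exists (Xof A); split; last first.
  move=> t t0 B mB; rewrite -(Ft_measE hF)//.
  by have := prog_Fmeas pX t0 measurableT mB; rewrite setTI.
split => //; exists A; split.
- by split => // w; exact: continuous_subspaceT (cA w).
- exists NL; split => // w /= hw; apply: contrapT => nw; apply: hw => t t0.
  by rewrite /Xof /Xs (noise_off nw t0) addrCA addrA.
- have AE w : (fun r : R => A (Num.max r 0) w) = A ^~ w by apply/funext => r; rewrite -AM.
  apply: ucp_of_small => //.
  + move=> n s s0; rewrite mollifyE; have [B B0 hB] := zM_bnd z n (zh z).
    exact: (time_integral_meas cX (zM_meas z n (zh z)) hB).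
  + move=> n w; rewrite mollifyE; have [B B0 hB] := zM_bnd z n (zh z).
    exact: (time_integral_cont cX (zM_meas z n (zh z)) hB).
  + by move=> w; rewrite AE.
  + move=> tm eta rho tm0 e0 r0; have [N hN] := ucp tm eta rho tm0 e0 r0.
    by exists N => k Nk; have := hN k Nk; rewrite mollifyE.
(* The bound was obtained for the mollified total variation, which dominates the absolute value of
   the mollified charge. *)
- exists nk => // t t0; apply: negligibleS nbd => w /= hw hM; apply: hw.
  have [M hM'] := hM t (ltW t0).
  apply: (@le_lt_trans _ _ M%:E); last exact: ltry.
  apply: ge_ereal_sup => _ [k _ <-].
  have [B B0 hB] := zM_bnd z (nk k) (zh z).
  have i1 := occupation_itg cX (zM_meas z (nk k) (zh z)) hB t w.
  have b1 := @bmeas1 R; have [B' B0' hB'] := zM_bnd z (nk k) b1.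
  have i2 := occupation_itg cX (zM_meas z (nk k) b1) hB' t w.
  rewrite mollifyE -[X in (X <= _)%E]fineK; last exact: integrable_fin_num (itg_norm i1).
  rewrite lee_fin.
  apply: le_trans (hM' k); apply: int_le => //; first exact: itg_norm i1.
  by move=> r _; exact: zM_le (zh z).
- exact: hS.
Qed.

(** Nothing is said about adaptedness of the drift part, but off a null set it equals [X - x0 - L]
    and inherits adaptedness from the strong solution. The version [Ab] vanishes on the null set and
    is constant at negative times. *)
Lemma solution_driven X : strong_solution P alpha phi mu x0 L X ->
  exists A, driven_solution (P := P) (F := F) (L := L0) z x0 A /\
    P.-negligible [set w | exists2 t, 0 <= t & X t w != Xof A t w].
Proof.
move=> [[cX [A [[mA cA] [N1 [mN1 PN1 hN1]] ucp [nk nk_lt bd] _]]] adX].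
pose N := NL `|` N1.
have mN : measurable N by exact: measurableU.
have nN : P.-negligible N by apply: negligibleU; [exists NL|exists N1]; split.
have PN : P N = 0%E by exact/negligibleP.
pose Ab r w := if pselect (N w) then 0 else A (Num.max r 0) w.
have Ab_in r w : N w -> Ab r w = 0 by move=> nw; rewrite /Ab; case: pselect.
have Ab_out r w : ~ N w -> Ab r w = A (Num.max r 0) w by move=> nw; rewrite /Ab; case: pselect.
have m00 (r : R) : 0 <= Num.max r 0 by rewrite le_max lexx orbT.
have XE w t : ~ N w -> 0 <= t -> X t w = x0 + L t w + A t w.
  move=> nw t0; apply: contrapT => hh; apply: nw; right; apply: hN1 => /= H.
  by apply: hh; exact: H.
have XofE w t : ~ N w -> 0 <= t -> Xof Ab t w = X t w.
  move=> nw t0; rewrite (XE w t nw t0) /Xof /Xs Ab_out// max_l//.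
  rewrite noise_off//; first by rewrite addrCA addrA.
  by move=> h; apply: nw; left.
have cAb w : continuous (Ab ^~ w).
  have [nw|nw] := pselect (N w).
    rewrite (_ : Ab ^~ w = fun=> 0); last by apply/funext => r; exact: Ab_in.
    by move=> r; exact: cvg_cst.
  rewrite (_ : Ab ^~ w = fun r => A (Num.max r 0) w); last by apply/funext => r; exact: Ab_out.
  exact: within_half_line (cA w).
have adL t : 0 <= t -> Fmeas F t (L t).
  move=> t0 _ B mB; rewrite setTI (Ft_measE hF)//.
  by have [[[_ ad] _ _ _ _] _] := hS; exact: ad.
have adX' t : 0 <= t -> Fmeas F t (X t).
  by move=> t0 _ B mB; rewrite setTI (Ft_measE hF)//; exact: adX.
have pA : prog F Ab.
  apply: (prog_rc hF) => [r w|t t0|w t t0]; last exact: (cvg_at_right_filter (cAb w t)).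
    have [nw|nw] := pselect (N w); first by rewrite !Ab_in.
    by rewrite !Ab_out// [in RHS]max_l.
  have mC : measurable (~` N : set (g_sigma_algebraType (F t))).
    by apply: measurableC; rewrite (Ft_measE hF)//; exact: generated_null.
  rewrite /Fmeas (_ : Ab t = fun w : g_sigma_algebraType (F t) => (X t w - (x0 + L t w)) * \1_(~` N) w).
    apply: mrM; last exact: measurable_indic.
    by apply: mrB; [exact: adX'|apply: mrD; [exact: mrcst|exact: adL]].
  apply/funext => w; rewrite indicE; have [nw|nw] := pselect (N w).
    have -> : (w \in ~` N) = false by apply: memNset => q; exact: q nw.
    by rewrite mulr0 Ab_in.
  have -> : (w \in ~` N) = true by exact: mem_set.
  by rewrite mulr1 Ab_out// max_l// (XE w t nw t0) addrC addKr.
exists Ab; split; last first.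
  apply: negligibleS nN => w [t t0 /eqP hx]; apply: contrapT => nw; apply: hx.
  by rewrite XofE.
split => //.
- have H := @small_of_ucp R d T P (fun n => time_integral (mollify phi mu n) X) A.
  move=> tm eta rho tm0 e0 r0.
  have {}H := H _ _ _ _ ucp tm eta rho tm0 e0 r0.
  have {H} [I hI] : exists I, forall k, (I <= k)%N ->
      small P (exceed tm eta (gap (time_integral (mollify phi mu k) X) A)) rho.
    apply: H.
    + move=> n s s0; rewrite mollifyE; have [B B0 hB] := zM_bnd z n (zh z).
      exact: (time_integral_meas cX (zM_meas z n (zh z)) hB).
    + exact: mA.
    + move=> n w; rewrite mollifyE; have [B B0 hB] := zM_bnd z n (zh z).
      exact: (time_integral_cont cX (zM_meas z n (zh z)) hB).
    + by move=> w; exact: within_half_line (cA w).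
  exists I => k Ik; have sN : small P N 0 by exact: small_null.
  have H := smallU sN (hI k Ik); rewrite add0r in H; apply: (small_sub H) => w [t /andP[t0 tt] hw].
  have [nw|nw] := pselect (N w); [by left|right].
  exists t; first by rewrite t0.
  have E : pint (fun r w => zmu z k (Xs (L := L0) x0 Ab r w)) t w = time_integral (zmu z k) X t w.
    apply: int_eq => r /=; rewrite in_itv/= => /andP[r1 _]; congr (zmu z k _).
    exact: XofE.
  move: hw; rewrite /gap E (Ab_out t w nw) (max_l t0) mollifyE; exact: id.
- exists nk => //.
  (* The exceptional set of the boundedness condition depends on the time; integer times give one
     null set, and monotonicity covers the times between. *)
  have nb (n : nat) : P.-negligible [set w | ~ (ereal_sup (range (fun k => \int[leb]_(s in `[0%R, n.+1%:R])
           `|mollify phi mu (nk k) (X s w)|%:E)) < +oo)%E].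
    exact: bd (ltr0Sn R n).
  apply: negligibleS (negligibleU nN (negligible_bigcup nb)) => w /= hw.
  apply: contrapT => /not_orP[nw nn]; apply: hw => t t0.
  have [n hn] := nat_ge t.
  have hs : (ereal_sup (range (fun k => \int[leb]_(s in `[0%R, n.+1%:R])
           `|mollify phi mu (nk k) (X s w)|%:E)) < +oo)%E.
    by apply: contrapT => hh; apply: nn; exists n.
  set S := ereal_sup _ in hs.
  exists (fine S) => k.
  have [B B0 hB] := zM_bnd z (nk k) (zh z).
  have i1 t' := itg_norm (occupation_itg cX (zM_meas z (nk k) (zh z)) hB t' w).
  have le1 : ((\int[leb]_(s in `[0, n.+1%:R]) `|zmu z (nk k) (X s w)|)%:E <= S)%E.
    rewrite /Rintegral fineK; last exact: integrable_fin_num (i1 _).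
    by apply: ereal_sup_ubound; exists k => //; rewrite mollifyE.
  have S0 : (0 <= S)%E.
    by apply: le_trans le1; rewrite lee_fin; exact: int_ge0.
  have SE : (fine S)%:E = S by apply: fineK; rewrite ge0_fin_numE.
  have le2 : \int[leb]_(s in `[0, n.+1%:R]) `|zmu z (nk k) (X s w)| <= fine S.
    by rewrite -lee_fin SE; exact: le1.
  apply: (le_trans _ le2).
  have -> : pint (fun r w => `|zmu z (nk k) (Xs (L := L0) x0 Ab r w)|) t w =
      \int[leb]_(s in `[0, t]) `|zmu z (nk k) (X s w)|.
    apply: int_eq => r /=; rewrite in_itv/= => /andP[r1 _]; congr (`|zmu z (nk k) _|).
    exact: XofE.
  have tn : t <= n.+1%:R by exact: hn.
  rewrite -subr_ge0 (int_ccB (i1 n.+1%:R) t0 tn (lexx _)); exact: int_ge0.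
Qed.

Lemma strong_uniqueness X X' : strong_solution P alpha phi mu x0 L X ->
  strong_solution P alpha phi mu x0 L X' -> indistinguishable P X X'.
Proof.
move=> /solution_driven[A [hA nA]] /solution_driven[A' [hA' nA']].
have Lr w : forall t, 0 <= t -> L0 s w @[s --> t^'+] --> L0 t w by have [] := noise_cadlag NLcad w.
have Ll w : forall t, 0 < t -> cvg (L0 s w @[s --> t^'-]) by have [] := noise_cadlag NLcad w.
have nU := driven_unique hL Lr Ll hA hA'.
apply: negligibleS (negligibleU nU (negligibleU nA nA')) => w /= hw.
apply: contrapT => /not_orP[n1 /not_orP[n2 n3]]; apply: hw => t t0.
have e1 : X t w = Xof A t w by apply/eqP; apply: contrapT => /negP q; apply: n2; exists t.
have e2 : X' t w = Xof A' t w by apply/eqP; apply: contrapT => /negP q; apply: n3; exists t.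
have e3 : A t w = A' t w by apply/eqP; apply: contrapT => /negP q; apply: n1; exists t.
by rewrite e1 e2 /Xof /Xs e3.
Qed.

End strong_solutions.

Theorem theorem3p4 (R : realType) (alpha eta x0 : R)
    (mu : finite_signed_measure R) (phi : R -> R)
    (d : measure_display) (T : measurableType d) (P : probability T R)
    (L : R -> T -> R) :
  1 < alpha < 2 ->
  0 < eta < alpha - 1 ->
  mu \in kato_class_finite eta ->
  mollifier phi ->
  symmetric_stable_process P alpha (generated_filtration P L) L ->
  (exists X, strong_solution P alpha phi mu x0 L X) /\
  (forall X X', strong_solution P alpha phi mu x0 L X ->
     strong_solution P alpha phi mu x0 L X' -> indistinguishable P X X').
Proof.
move=> ha he hmu hphi hS.
have e01 : 0 < eta < 1 by move: ha he => /andP[a1 a2] /andP[e0 e1]; rewrite e0/=; lra.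
have [N hN] := kato_sing e01 hmu.
have [z _] := zvonkin_data_exists ha he hphi (hahn_sign_bmeas mu) hN.
have [[_ _ [NL [mNL PNL hNL]] _ _] _] := hS.
have cad w : ~ NL w -> cadlag (L ^~ w).
  by move=> nw; apply: contrapT => hc; apply: nw; exact: hNL.
split; first exact: (strong_existence z hS mNL PNL cad).
by move=> X X'; exact: (strong_uniqueness z hS mNL PNL cad).
Qed.
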